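(* For every $s\in(0,1]$ there exist constants $0<c_s\le C_s<\infty$ depending only on $s$ such that the following holds. Let $\pi\propto e^{-V}$ be a probability measure on $\mathbb{R}^d$ satisfying a weak Poincaré inequality with some weight $\beta_{\mathsf{WPI}}$ and $\Phi(\cdot)=\operatorname{Osc}(\cdot)^2$. Suppose $\nabla V$ is $s$-Hölder continuous with constant $L$, i.e. $\|\nabla V(x)-\nabla V(y)\|\le L\|x-y\|^s$ for all $x,y\in\mathbb{R}^d$, and $\nabla V(0)=0$. Let $q\in[2,\infty)$, $q'\in(2q-1,\infty]$ and let $\mu_0$ be a probability measure with $R_{q'}(\mu_0\,\|\,\pi)<\infty$. Define $\delta_0:=\exp\big((2q-1)R_{q'}(\mu_0\,\|\,\pi)\big)$, $m:=\frac12\inf\{R:\pi(\|x\|\ge R)\le\frac12\}$ and, for $0<\varepsilon\le q^{-1}$, $$T:=(2q-1)\Big\{\beta\Big(\frac1{4\delta_0}\Big)R_{2q-1}(\mu_0\,\|\,\pi)+\beta\Big(\frac{\varepsilon}{8\delta_0}\Big)\ln\Big(\frac2\varepsilon\Big)\Big\},$$ where $$\beta(r):=\begin{cases}\beta_{\mathsf{WPI}}(r) & \text{if } q'=\infty,\\ \beta_{\mathsf{WPI}}\Big((r/5)^{\frac{q'}{q'-(2q-1)}}\Big)\ln\Big((5/r)^{\frac{q'}{q'-(2q-1)}}\vee1\Big) & \text{if } q'<\infty.\end{cases}$$ Let $\hat\pi$ be the probability measure $$\hat\pi(x)\propto\exp\Big(-V(x)-\frac{1}{6144\,T}\max\{\|x\|-2m,0\}^2\Big),$$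 and assume that $\varepsilon^{-1},m,L,T,R_2(\mu_0\,\|\,\hat\pi)\ge1$. Then, for a suitable sufficiently small step size $h>0$, the LMC iterates with step size $h$ and initial law $\mu_0$ satisfy $R_q(\mu_N\,\|\,\pi)\le\varepsilon$ after a number $N$ of iterations with $c_s\,A\le N\le C_s\,A$, where $$A:=\frac{T^{1+1/s}\,d\,q^{1/s}L^{2/s}}{\varepsilon^{1/s}}\max\left\{1,\ \frac{\varepsilon^{1/(2s)}m^s}{L^{1/s-1}T^{1/(2s)}d},\ \frac{\varepsilon^{1/(2s)}R_2(\mu_0\,\|\,\hat\pi)^{s/2}}{L^{1/s-1}T^{(1-s^2)/(2s)}d}\,\ln\Big(\frac{qTL\,R_2(\mu_0\,\|\,\hat\pi)}{\varepsilon}\Big)^{s/2}\right\}.$$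
   Context: Langevin Monte Carlo (LMC) with step size $h>0$: $x_{k+1}=x_k-h\nabla V(x_k)+\sqrt{2h}\,\xi_k$, where $(\xi_k)$ are i.i.d. standard Gaussian vectors in $\mathbb{R}^d$, independent of $x_0\sim\mu_0$; $\mu_k$ denotes the law of $x_k$. Weak Poincaré inequality (WPI): a probability measure $\pi$ on $\mathbb{R}^d$ satisfies a WPI with weight $\beta_{\mathsf{WPI}}$ and functional $\Phi$ if $\beta_{\mathsf{WPI}}:(0,\infty)\to\mathbb{R}_+$ is non-increasing, $\Phi:L^2(\pi)\to[0,\infty]$ satisfies $\Phi(cf+a)=c^2\Phi(f)$ for all $a,c\in\mathbb{R}$, $f\in L^2(\pi)$, and for every $f\in\mathcal{C}^\infty(\mathbb{R}^d)$, $\operatorname{Var}_\pi(f)\le\beta_{\mathsf{WPI}}(r)\,\mathbb{E}_\pi[\|\nabla f\|^2]+r\,\Phi(f)$ for all $r>0$. Here $\operatorname{Osc}(f)=\sup f-\inf f$. Rényi divergence: for $1<q<\infty$, $R_q(\rho\,\|\,\pi)=\frac1{q-1}\ln\big\|\frac{\mathrm{d}\rho}{\mathrm{d}\pi}\big\|_{L^q(\pi)}^q$ if $\rho\ll\pi$ and $+\infty$ otherwise; $R_\infty(\rho\,\|\,\pi)=\ln\|\mathrm{d}\rho/\mathrm{d}\pi\|_{L^\infty(\pi)}$. All probability measures are assumed to have Lebesgue densities. Standing assumption: $\mathcal{C}^\infty(\mathbb{R}^d)$ forms a core for the domain of the generator of the Langevin diffusion $\mathrm{d}X_t=-\nabla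 V(X_t)\,\mathrm{d}t+\sqrt2\,\mathrm{d}B_t$. $a\vee b=\max(a,b)$. *)

(* Defs.v *)
From HB Require Import structures.
From mathcomp Require Import all_boot all_order all_algebra.
From mathcomp Require Import finmap.
From mathcomp Require Import all_classical all_reals all_analysis.

Set Implicit Arguments.
Unset Strict Implicit.
Unset Printing Implicit Defensive.

Import Order.TTheory GRing.Theory Num.Theory.
Import numFieldNormedType.Exports.

Local Open Scope classical_set_scope.
Local Open Scope charge_scope.
Local Open Scope ring_scope.

(* R^n is 'rV[R]_n with the sigma-algebra generated by the coordinates, which is
   its Borel sigma-algebra. *)
Section rV_measurable.
Context (R : realType) (n : nat).

Let coors : 'I_n -> 'rV[R]_n -> R := fun i x => x ord0 i.

Let rV_set0 : g_sigma_preimage coors set0.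
Proof. exact: sigma_algebra0. Qed.

Let rV_setC A : g_sigma_preimage coors A -> g_sigma_preimage coors (~` A).
Proof. exact: sigma_algebraC. Qed.

Let rV_bigcup (F : _^nat) : (forall i, g_sigma_preimage coors (F i)) ->
  g_sigma_preimage coors (\bigcup_i (F i)).
Proof. exact: sigma_algebra_bigcup. Qed.

HB.instance Definition _ := @isMeasurable.Build default_measure_display
  'rV[R]_n (g_sigma_preimage coors) rV_set0 rV_setC rV_bigcup.

End rV_measurable.

Lemma measurable_coord (R : realType) n (i : 'I_n) :
  measurable_fun [set: 'rV[R]_n] (fun x : 'rV[R]_n => x ord0 i).
Proof.
move=> _ Y mY; rewrite setTI; apply: sub_sigma_algebra => /=.
rewrite -bigcup_seq/=; exists i => /=; first by rewrite mem_index_enum.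
by exists Y => //; rewrite setTI.
Qed.

Lemma measurable_fun_rV d (T : measurableType d) (R : realType) n
    (f : T -> 'rV[R]_n) :
  (forall i, measurable_fun [set: T] (fun t => f t ord0 i)) ->
  measurable_fun [set: T] f.
Proof.
move=> mf.
suff prefS : g_sigma_preimage (fun i t => f t ord0 i) `<=` measurable.
  move=> _ A mA; apply: prefS.
  by rewrite (g_sigma_preimage_comp (fun i (x : 'rV[R]_n) => x ord0 i) f); exists A.
apply: smallest_sub; first exact: sigma_algebra_measurable.
rewrite -bigcup_seq/= => A [i _] [B mB <-]; exact: mf.
Qed.

Definition rV_cons (R : realType) n (x : measurableTypeR R * 'rV[R]_n) : 'rV[R]_n.+1 :=
  \row_(i < n.+1) oapp (x.2 ord0) x.1 (unlift ord0 i).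

Lemma measurable_rV_cons (R : realType) n :
  measurable_fun [set: measurableTypeR R * 'rV[R]_n] (@rV_cons R n).
Proof.
apply: measurable_fun_rV => i; under eq_fun do rewrite mxE.
case: unliftP => [j|] _ /=; last exact: measurable_fst.
apply: (measurableT_comp (@measurable_coord R n j)); exact: measurable_snd.
Qed.

Section lebesgue_rV_step.
Context (R : realType) (n : nat).
Variable mu : {sigma_finite_measure set 'rV[R]_n -> \bar R}.

Definition lebesgue_rV_step : set 'rV[R]_n.+1 -> \bar R :=
  pushforward (lebesgue_measure \x mu)%E (@rV_cons R n).

Let preimage_measurable (A : set 'rV[R]_n.+1) :
  measurable A -> measurable (@rV_cons R n @^-1` A).
Proof.
by move=> mA; rewrite -[_ @^-1` _]setTI; exact: measurable_rV_cons.
Qed.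

Let step0 : lebesgue_rV_step set0 = 0%E.
Proof. by rewrite /lebesgue_rV_step /pushforward preimage_set0 measure0. Qed.

Let step_ge0 A : (0 <= lebesgue_rV_step A)%E.
Proof. by rewrite /lebesgue_rV_step /pushforward; exact: measure_ge0. Qed.

Let step_sigma_additive : semi_sigma_additive lebesgue_rV_step.
Proof.
move=> F mF tF mUF; rewrite /lebesgue_rV_step /pushforward preimage_bigcup.
apply: measure_semi_sigma_additive.
- by move=> i; exact: preimage_measurable.
- apply/trivIsetP => /= i j _ _ ij; rewrite -preimage_setI.
  by move/trivIsetP : tF => /(_ _ _ _ _ ij) ->//; rewrite preimage_set0.
- by rewrite -preimage_bigcup; exact: preimage_measurable.
Qed.

HB.instance Definition _ := isMeasure.Build _ _ _ lebesgue_rV_step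
  step0 step_ge0 step_sigma_additive.

Let sigma_finite_step : sigma_finite setT lebesgue_rV_step.
Proof.
have [F TF mF] : sigma_finite setT (lebesgue_measure \x mu)%E.
  have /sigma_finiteP[F [TF ndF Foo]] := sigma_finiteT (@lebesgue_measure R).
  have /sigma_finiteP[G [TG ndG Goo]] := sigma_finiteT mu.
  exists (fun n => F n `*` G n).
    rewrite -setXTT TF TG predeqE => -[x y]; split.
      move=> [/= [k _ Fkx] [l _ Gly]]; exists (maxn k l) => //; split.
      - by move: x Fkx; exact/subsetPset/ndF/leq_maxl.
      - by move: y Gly; exact/subsetPset/ndG/leq_maxr.
    by move=> [k _ []/= ? ?]; split; exists k.
  move=> k; have [? ?] := Foo k; have [? ?] := Goo k.
  split; first exact: measurableX.
  by rewrite product_measure1E// lte_mul_pinfty// ge0_fin_numE.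
pose g (y : 'rV[R]_n.+1) : measurableTypeR R * 'rV[R]_n :=
  (y ord0 ord0, \row_j y ord0 (lift ord0 j)).
have mg : measurable_fun setT g.
  apply/measurable_fun_pairP; split; first exact: measurable_coord.
  apply: measurable_fun_rV => j; under eq_fun do rewrite /= mxE.
  exact: measurable_coord.
have gK : cancel (@rV_cons R n) g.
  case=> a x; rewrite /g /rV_cons; congr pair.
    by rewrite mxE unlift_none.
  by apply/rowP => j; rewrite !mxE liftK.
exists (fun i => g @^-1` F i).
  by rewrite -preimage_bigcup -TF preimage_setT.
move=> i; have [mFi Fioo] := mF i; split.
  by rewrite -[_ @^-1` _]setTI; exact: mg.
rewrite /lebesgue_rV_step /pushforward -comp_preimage.
by rewrite (_ : g \o _ = id) //; apply/funext => x /=; rewrite gK.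
Qed.

HB.instance Definition _ := Measure_isSigmaFinite.Build _ _ _
  lebesgue_rV_step sigma_finite_step.

End lebesgue_rV_step.

Fixpoint lebesgue_rV (R : realType) n :
    {sigma_finite_measure set 'rV[R]_n -> \bar R} :=
  if n is n'.+1 then lebesgue_rV_step (lebesgue_rV R n') else \d_(0 : 'rV[R]_0).

Definition box (R : realType) n (A : 'I_n -> set R) : set 'rV[R]_n :=
  [set x | forall i, A i (x ord0 i)].

Lemma measurable_box (R : realType) n (A : 'I_n -> set R) :
  (forall i, measurable (A i)) -> measurable (box A).
Proof.
move=> mA; rewrite (_ : box A = \bigcap_(i in [set: 'I_n])
    ((fun x : 'rV[R]_n => x ord0 i) @^-1` A i)); last first.
  by apply/seteqP; split => [x Ax i _|x Ax i]; [exact: Ax|exact: (Ax i)].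
apply: fin_bigcap_measurable => // i _.
by rewrite -[_ @^-1` _]setTI; exact: measurable_coord.
Qed.

Lemma lebesgue_rV_box (R : realType) n (A : 'I_n -> set R) :
  (forall i, measurable (A i)) ->
  lebesgue_rV R n (box A) = (\prod_(i < n) lebesgue_measure (A i))%E.
Proof.
elim: n A => [|n IH] A mA.
  by rewrite big_ord0 /= diracE mem_set//= => -[].
rewrite big_ord_recl -(IH (fun i => A (lift ord0 i)))//.
rewrite -product_measure1E; try exact: mA; try exact: measurable_box.
rewrite /= /lebesgue_rV_step /pushforward; congr (_ _).
apply/seteqP; split => -[a x]; rewrite /box /rV_cons /=.
  move=> Ax; split => [|i]; first by have := Ax ord0; rewrite mxE unlift_none.
  by have := Ax (lift ord0 i); rewrite mxE liftK.
move=> [Aa Ax] i; rewrite mxE; case: unliftP => [j ->|->] //=; exact: Ax.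
Qed.
(* The library norm `|x| on 'rV[R]_n is the sup norm. *)
Definition enorm (R : realType) n (x : 'rV[R]_n) : R :=
  Num.sqrt (\sum_(i < n) x ord0 i ^+ 2).

Definition partial (R : realType) n (i : 'I_n) (f : 'rV[R]_n -> R)
    (x : 'rV[R]_n) : R := 'D_(delta_mx ord0 i) f x.

Definition grad (R : realType) n (f : 'rV[R]_n -> R) (x : 'rV[R]_n) :
    'rV[R]_n := \row_(i < n) partial i f x.

Fixpoint Ck (R : realType) n (k : nat) (f : 'rV[R]_n -> R) : Prop :=
  continuous f /\
  (if k is k'.+1 then
     forall i : 'I_n, (forall x, derivable f x (delta_mx ord0 i)) /\
                      Ck k' (partial i f)
   else True).

Definition smooth (R : realType) n (f : 'rV[R]_n -> R) : Prop :=
  forall k, Ck k f.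

Definition holder_grad (R : realType) n (V : 'rV[R]_n -> R) (L s : R) : Prop :=
  forall x y, enorm (grad V x - grad V y) <= L * enorm (x - y) `^ s.

(* pi is proportional to e^{-W}: since pi is a probability measure, Z is
   necessarily the normalizing constant, the integral of e^{-W}. *)
Definition gibbs (R : realType) n (W : 'rV[R]_n -> R)
    (pi : probability 'rV[R]_n R) : Prop :=
  exists2 Z : R, 0 < Z & forall A, measurable A ->
    pi A = (\int[lebesgue_rV R n]_(x in A) (expR (- W x) / Z)%:E)%E.

Definition osc (R : realType) n (f : 'rV[R]_n -> R) : \bar R :=
  (ereal_sup (range (EFin \o f)) - ereal_inf (range (EFin \o f)))%E.

Record weak_poincare (R : realType) n (pi : probability 'rV[R]_n R)
    (beta : R -> R) (Phi : ('rV[R]_n -> R) -> \bar R) : Prop := WeakPoincare {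
  wpi_weight_ge0 : forall r, 0 < r -> 0 <= beta r ;
  wpi_weight_nonincreasing :
    forall r1 r2, 0 < r1 -> r1 <= r2 -> beta r2 <= beta r1 ;
  wpi_functional_ge0 : forall f, f \in Lfun pi 2%:E -> (0 <= Phi f)%E ;
  wpi_functional_quadratic : forall (a c : R) f, f \in Lfun pi 2%:E ->
    Phi (fun x => c * f x + a) = ((c ^+ 2)%:E * Phi f)%E ;
  wpi_inequality : forall f, smooth f -> forall r, 0 < r ->
    ('V_pi[f] <= (beta r)%:E * \int[pi]_x (enorm (grad f x) ^+ 2)%:E
                 + r%:E * Phi f)%E }.

(* Only used at orders q > 1, so the value at q = -oo is irrelevant. *)
Definition renyi (R : realType) d (T : measurableType d) (q : \bar R)
    (rho pi : probability T R) : \bar R :=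
  if `[< rho `<< pi >] then
    let f := ('d (charge_of_finite_measure rho) '/d pi) in
    match q with
    | r%:E => ((r - 1)^-1)%:E * lne ('N[pi]_r%:E[f] `^ r)
    | +oo => lne 'N[pi]_+oo[f]
    | -oo => 0
    end%E
  else +oo%E.

(* N(0, v I_n) *)
Definition gaussian_law (R : realType) n (v : R) (A : set 'rV[R]_n) : \bar R :=
  (\int[lebesgue_rV R n]_(y in A)
     (\prod_(i < n) normal_pdf 0 (Num.sqrt v) (y ord0 i))%:E)%E.

Definition mutually_independent (R : realType) d (Omega : measurableType d)
    (P : probability Omega R) d' (T : measurableType d') (I : choiceType)
    (X : I -> {RV P >-> T}) : Prop :=
  forall (J : {fset I}) (A : I -> set T), (forall i, measurable (A i)) ->
    P (\bigcap_(i in [set` J]) (X i @^-1` A i)) =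
    (\prod_(i <- J) P (X i @^-1` A i))%E.

Record LMC (R : realType) n (V : 'rV[R]_n -> R) (h : R)
    (mu0 : probability 'rV[R]_n R) d (Omega : measurableType d)
    (P : probability Omega R) (x xi : nat -> {RV P >-> 'rV[R]_n}) : Prop :=
  mkLMC {
  LMC_init : forall A, measurable A -> distribution P (x 0%N) A = mu0 A ;
  LMC_noise : forall k A, measurable A ->
    distribution P (xi k) A = gaussian_law 1 A ;
  LMC_independent :
    mutually_independent (fun k => if k is k'.+1 then xi k' else x 0%N) ;
  LMC_step : forall k w,
    x k.+1 w = x k w - h *: grad V (x k w) + Num.sqrt (2 * h) *: xi k w }.

(* Events generated by X and B up to time t. *)
Definition past (R : realType) n d (Omega : measurableType d)
    (X B : R -> Omega -> 'rV[R]_n) (t : R) : set (set Omega) :=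
  <<s [set E | exists u A, [/\ 0 <= u, u <= t, measurable A &
                              E = X u @^-1` A \/ E = B u @^-1` A] ] >>.

(* Weak solution of dX = - grad V(X) dt + sqrt 2 dB with X_0 = x. As the noise is
   additive, the equation holds pathwise and no stochastic integral is needed.
   Only times t >= 0 matter. *)
Record langevin_solution (R : realType) n (V : 'rV[R]_n -> R) (x : 'rV[R]_n) d
    (Omega : measurableType d) (P : probability Omega R)
    (X B : R -> {RV P >-> 'rV[R]_n}) : Prop := LangevinSolution {
  langevin_continuous : forall w,
    {within `[0, +oo[, continuous (fun t : R => X t w : 'rV[R]_n)} ;
  brownian_continuous : forall w,
    {within `[0, +oo[, continuous (fun t : R => B t w : 'rV[R]_n)} ;
  brownian_start : forall w, B 0 w = 0 ;
  brownian_gaussian : forall (u t : R) (A : set 'rV[R]_n),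
    0 <= u -> u < t -> measurable A ->
    P [set w | A (B t w - B u w : 'rV[R]_n)] = gaussian_law (t - u) A ;
  brownian_independent : forall (u t : R) (E : set Omega) (A : set 'rV[R]_n),
    0 <= u -> u < t ->
    past X B u E -> measurable A ->
    P (E `&` [set w | A (B t w - B u w : 'rV[R]_n)]) =
    (P E * P [set w | A (B t w - B u w : 'rV[R]_n)%R])%E ;
  langevin_equation : forall w (t : R) i, 0 <= t ->
    X t w ord0 i =
    x ord0 i - (\int[lebesgue_measure]_(r in `[0, t]) grad V (X r w) ord0 i)
    + Num.sqrt 2 * B t w ord0 i }.

Definition langevin_kernel (R : realType) n (V : 'rV[R]_n -> R)
    (K : R -> R.-pker 'rV[R]_n ~> 'rV[R]_n) : Prop :=
  forall x, exists d (Omega : measurableType d) (P : probability Omega R)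
    (X B : R -> {RV P >-> 'rV[R]_n}),
    langevin_solution V x X B /\
    forall t A, 0 <= t -> measurable A -> K t x A = distribution P (X t) A.

Definition semigroup (R : realType) n (K : R -> R.-pker 'rV[R]_n ~> 'rV[R]_n)
    (t : R) (f : 'rV[R]_n -> R) (x : 'rV[R]_n) : R := \int[K t x]_y f y.

(* (f, g) is in the graph of the L^2(pi)-generator: (P_t f - f) / t converges to
   g in L^2(pi) as t decreases to 0. *)
Definition generator (R : realType) n (pi : probability 'rV[R]_n R)
    (K : R -> R.-pker 'rV[R]_n ~> 'rV[R]_n) (f g : 'rV[R]_n -> R) : Prop :=
  [/\ f \in Lfun pi 2%:E, g \in Lfun pi 2%:E &
    ('N[pi]_2%:E[EFin \o (fun x => t^-1 * (semigroup K t f x - f x) - g x)%R])%E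
      @[t --> 0^'+] --> 0%E].

(* The smooth functions in the domain of the generator of the Langevin diffusion
   are dense in that domain for the graph norm. *)
Definition smooth_core (R : realType) n (V : 'rV[R]_n -> R)
    (pi : probability 'rV[R]_n R) : Prop :=
  exists2 K : R -> R.-pker 'rV[R]_n ~> 'rV[R]_n, langevin_kernel V K &
    forall f g, generator pi K f g -> forall e : R, 0 < e ->
      exists f' g', [/\ smooth f', generator pi K f' g',
        ('N[pi]_2%:E[EFin \o (f \- f')%R] < e%:E)%E &
        ('N[pi]_2%:E[EFin \o (g \- g')%R] < e%:E)%E].

Definition half_median_radius (R : realType) n (pi : probability 'rV[R]_n R) : R :=
  2^-1 * inf [set r : R | (pi [set x | r <= enorm x]%R <= (2^-1)%:E)%E].

(* q' > 2q - 1, so that q' = -oo does not occur. *)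
Definition rate (R : realType) (beta : R -> R) (q : R) (q' : \bar R) (r : R) : R :=
  match q' with
  | p%:E => let a := p / (p - (2 * q - 1)) in
            beta ((r / 5) `^ a) * ln (Num.max ((5 / r) `^ a) 1)
  | +oo%E => beta r
  | -oo%E => 0
  end.

Definition tilted_potential (R : realType) n (V : 'rV[R]_n -> R) (m T : R)
    (x : 'rV[R]_n) : R :=
  V x + (6144 * T)^-1 * Num.max (enorm x - 2 * m) 0 ^+ 2.

Definition mixing_time (R : realType) n (beta : R -> R) (q : R) (q' : \bar R)
    (eps : R) (mu0 pi : probability 'rV[R]_n R) : R :=
  let delta0 := expR ((2 * q - 1) * fine (renyi q' mu0 pi)) in
  (2 * q - 1) *
    (rate beta q q' (1 / (4 * delta0)) * fine (renyi (2 * q - 1)%:E mu0 pi)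
     + rate beta q q' (eps / (8 * delta0)) * ln (2 / eps)).

Definition iteration_bound (R : realType) (n : nat) (s q L m T eps r2 : R) : R :=
  T `^ (1 + 1 / s) * n%:R * q `^ (1 / s) * L `^ (2 / s) / eps `^ (1 / s) *
  Num.max 1 (Num.max
    (eps `^ (1 / (2 * s)) * m `^ s /
       (L `^ (1 / s - 1) * T `^ (1 / (2 * s)) * n%:R))
    (eps `^ (1 / (2 * s)) * r2 `^ (s / 2) /
       (L `^ (1 / s - 1) * T `^ ((1 - s ^+ 2) / (2 * s)) * n%:R) *
     ln (q * T * L * r2 / eps) `^ (s / 2))).

(* Main.v *)
(** An LMC step is split into two Gaussian half steps, x -> y ~ N(x, h) and
    y -> z ~ N(y - h grad V(x), h), and is compared with a step of the proximal
    sampler, x -> y ~ N(x, h) followed by a draw from the posterior of x given y,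
    which leaves pi invariant.

    Proximal sampler: by Bessel's inequality the squared gradient of a Gaussian
    convolution is at most 2/h times the variance lost by the convolution. The
    weak Poincare inequality applied to the convolution of a truncated density
    therefore gives a recursion for the moment of order 2q - 1, which brings the
    Renyi divergence below eps/2 after about T/h steps. Testing the inequality
    with sines and cosines of frequency h^(-1/2) shows that its weight is at least
    h, so that the weight dominates the loss of one step.

    Comparison: Hoelder's inequality bounds the moment of order q of the LMC
    density by the square root of the moment of order 2q - 1 of the proximal one
    times a moment of the product of the likelihood ratios. The Maurey-Pisier
    inequality and the Hoelder continuity of grad V bound the moments of a single
    ratio by exp(c0 + c1 |x|^2). The resulting Feynman-Kac functional is bounded in
    L^2 of the weight exp(-a |x|^2) pi, and the divergence of order 2 from the
    tilted target transfers this bound to the initial law. *)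

From HB Require Import structures.
From mathcomp Require Import all_boot all_order all_algebra.
From mathcomp Require Import finmap ring lra.
From mathcomp Require Import all_classical all_reals all_analysis measurable_realfun.
Require Import Defs.

Set Implicit Arguments.
Unset Strict Implicit.
Unset Printing Implicit Defensive.

Import Order.TTheory GRing.Theory Num.Theory.
Import numFieldNormedType.Exports.

Local Open Scope classical_set_scope.
Local Open Scope ring_scope.

(** The proof stays in discrete time: every kernel has a density, so a change of measure is a
    product of pointwise likelihood ratios. The main obstacle is that the bound exp(c0 + c1 |x|^2)
    on one ratio is unbounded while pi may have heavy tails, so the Feynman-Kac functional need not
    be integrable for pi. A Gaussian weight repairs this: its coefficient starts at 0 and each step
    raises it just enough to absorb c1, but it has to stay below half the coefficient of the
    quadratic penalty in the tilted target. Passing from pi to the initial law then has a cost of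
    order S = 1 + m^2/T + d + r2, with r2 the divergence of order 2 from the tilted target, and no
    step size makes it small. The functional is therefore estimated at a large power, of order S/(q
    eps), and Jensen's inequality divides the cost by that power. The recursion for the proximal
    moments is run with the error 1/4 while the divergence exceeds 1 and with the error eps/8
    afterwards; this produces the two arguments 1/(4 delta0) and eps/(8 delta0) of beta in T. *)

(** * Hoelder's inequality and change of density *)

Lemma ae_zero_of_integral d (T : measurableType d) (R : realType)
    (mu : {measure set T -> \bar R}) (u v : T -> \bar R) :
  measurable_fun [set: T] u -> measurable_fun [set: T] v ->
  (forall x, 0 <= u x)%E -> (forall x, 0 <= v x)%E ->
  (forall x, u x = 0 -> v x = 0)%E ->
  (\int[mu]_x u x = 0)%E -> (\int[mu]_x v x = 0)%E.
Proof.
move=> mu_ mv u0 v0 uv iu.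
rewrite (@ge0_ae_eq_integral _ _ _ mu setT v (cst 0%E)) ?integral0//.
have /ae_eq_integral_abs : (\int[mu]_(x in setT) `|u x| = 0)%E.
  by under eq_integral do rewrite gee0_abs//.
move=> /(_ measurableT mu_); apply: filterS => x /= ux _; exact/uv/ux.
Qed.

(** Young's inequality for a/c and b/e, scaled back. The free scales [c] and [e] become the two
    integrals in Hoelder's inequality. *)
Lemma poweR_prod_le (R : realType) (a b c e t : R) :
  0 < t < 1 -> 0 <= a -> 0 <= b -> 0 < c -> 0 < e ->
  a `^ t * b `^ (1 - t) <=
  c `^ t * e `^ (1 - t) * (t / c * a + (1 - t) / e * b).
Proof.
move=> /andP[t0 t1] a0 b0 c0 e0.
have t1' : 0 < 1 - t by rewrite subr_gt0.
have ac0 : 0 <= a / c by rewrite divr_ge0 // ltW.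
have be0 : 0 <= b / e by rewrite divr_ge0 // ltW.
have := @conjugate_powR R ((a / c) `^ t) ((b / e) `^ (1 - t)) t^-1 (1 - t)^-1
  (powR_ge0 _ _) (powR_ge0 _ _).
rewrite !invr_gt0 t0 t1' !invrK addrC subrK => /(_ isT isT erefl).
rewrite -!powRrM !mulfV ?gt_eqF// !powRr1// => H.
have -> : a `^ t * b `^ (1 - t) =
    c `^ t * e `^ (1 - t) * ((a / c) `^ t * (b / e) `^ (1 - t)).
  rewrite {1}(_ : a = c * (a / c)); last by rewrite mulrC divfK// gt_eqF.
  rewrite {1}(_ : b = e * (b / e)); last by rewrite mulrC divfK// gt_eqF.
  by rewrite (powRM _ (ltW c0) ac0) (powRM _ (ltW e0) be0) mulrACA.
rewrite ler_pM2l ?mulr_gt0 ?powR_gt0//; apply: le_trans H _.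
by rewrite le_eqVlt; apply/orP; left; apply/eqP; field; rewrite !gt_eqF.
Qed.

(** Hoelder's inequality with weights t and 1 - t in place of conjugate exponents. The functions
    take values in [0, +oo], since iterated kernel operators may be infinite and no integrability
    can be assumed. *)
Lemma hoelder_geo d (T : measurableType d) (R : realType)
    (mu : {measure set T -> \bar R}) (u v : T -> \bar R) (t : R) :
  0 < t < 1 ->
  measurable_fun [set: T] u -> measurable_fun [set: T] v ->
  (forall x, 0 <= u x)%E -> (forall x, 0 <= v x)%E ->
  (\int[mu]_x (u x `^ t * v x `^ (1 - t)) <=
   (\int[mu]_x u x) `^ t * (\int[mu]_x v x) `^ (1 - t))%E.
Proof.
move=> t01 mu_ mv u0 v0; have /andP[t0 t1] := t01.
have t1' : 0 < 1 - t by rewrite subr_gt0.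
have mp : measurable_fun [set: T] (fun x => u x `^ t * v x `^ (1 - t))%E.
  by apply: emeasurable_funM; apply: (measurableT_comp (measurable_poweR _)).
have p0 x : (0 <= u x `^ t * v x `^ (1 - t))%E by rewrite mule_ge0 ?poweR_ge0.
have [U0|U0] := eqVneq (\int[mu]_x u x)%E 0%E.
  rewrite (ae_zero_of_integral mu_ mp u0 p0 _ U0) ?mule_ge0 ?poweR_ge0//.
  by move=> x ->; rewrite poweR0r ?mul0e// gt_eqF.
have [V0|V0] := eqVneq (\int[mu]_x v x)%E 0%E.
  rewrite (ae_zero_of_integral mv mp v0 p0 _ V0) ?mule_ge0 ?poweR_ge0//.
  by move=> x ->; rewrite poweR0r ?mule0// gt_eqF.
have Ug : (0 < \int[mu]_x u x)%E by rewrite lt0e U0 integral_ge0.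
have Vg : (0 < \int[mu]_x v x)%E by rewrite lt0e V0 integral_ge0.
have [->|Uoo] := eqVneq (\int[mu]_x u x)%E +oo%E.
  by rewrite poweRyr ?gt_eqF// gt0_mulye ?leey// poweR_gt0.
have [->|Voo] := eqVneq (\int[mu]_x v x)%E +oo%E.
  by rewrite poweRyr ?gt_eqF// gt0_muley ?leey// poweR_gt0.
have Uf : (\int[mu]_x u x)%E \is a fin_num by rewrite ge0_fin_numE ?ltW// lt_neqAle Uoo leey.
have Vf : (\int[mu]_x v x)%E \is a fin_num by rewrite ge0_fin_numE ?ltW// lt_neqAle Voo leey.
set U := (\int[mu]_x u x)%E in Uf Ug *; set V := (\int[mu]_x v x)%E in Vf Vg *.
have fU0 : 0 < fine U by rewrite fine_gt0// Ug ltey_eq Uf.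
have fV0 : 0 < fine V by rewrite fine_gt0// Vg ltey_eq Vf.
(* Both integrals are now positive and finite. Normalising by them makes the affine majorant of
   Young's inequality integrate to [k]. *)
pose k := fine U `^ t * fine V `^ (1 - t).
have k0 : 0 < k by rewrite mulr_gt0 ?powR_gt0.
have -> : (U `^ t * V `^ (1 - t) = k%:E)%E.
  by rewrite -(fineK Uf) -(fineK Vf) !poweR_EFin -EFinM.
apply: (@le_trans _ _ (\int[mu]_x (k%:E * ((t / fine U)%:E * u x + ((1 - t) / fine V)%:E * v x)))%E).
  apply: ge0_le_integral => //.
    apply: emeasurable_funM => //; apply: emeasurable_funD; exact: emeasurable_funM.
  move=> x _.
  have [ux|ux] := eqVneq (u x) +oo%E.
    rewrite ux gt0_muley ?lte_fin ?divr_gt0// addye ?gt0_muley ?lte_fin ?leey//.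
    by rewrite -ltNye (lt_le_trans (ltNye 0)) ?mule_ge0// lee_fin divr_ge0 ?ltW.
  have [vx|vx] := eqVneq (v x) +oo%E.
    rewrite vx (gt0_muley (_ : 0 < ((1 - t) / fine V)%:E)%E) ?lte_fin ?divr_gt0//.
    rewrite addey ?gt0_muley ?lte_fin ?leey//.
    by rewrite -ltNye (lt_le_trans (ltNye 0)) ?mule_ge0// lee_fin divr_ge0 ?ltW.
  case: (u x) (u0 x) ux => // a a0 _; case: (v x) (v0 x) vx => // b b0 _.
  rewrite !poweR_EFin -!EFinM lee_fin.
  exact: poweR_prod_le.
rewrite ge0_integralZl//; last 3 first.
- apply: emeasurable_funD; exact: emeasurable_funM.
- by move=> x _; rewrite adde_ge0 ?mule_ge0// lee_fin divr_ge0 ?ltW.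
- by rewrite lee_fin ltW.
rewrite ge0_integralD//; last 4 first.
- by move=> x _; rewrite mule_ge0// lee_fin divr_ge0 ?ltW.
- exact: emeasurable_funM.
- by move=> x _; rewrite mule_ge0// lee_fin divr_ge0 ?ltW.
- exact: emeasurable_funM.
have tU : 0 <= t / fine U by rewrite divr_ge0 ?ltW.
have tV : 0 <= (1 - t) / fine V by rewrite divr_ge0 ?ltW.
rewrite !ge0_integralZl ?lee_fin// -/U -/V.
rewrite -(fineK Uf) -(fineK Vf) /= -!EFinM lee_fin.
by rewrite !divfK ?gt_eqF// addrCA subrr addr0 mulr1.
Qed.

Import HBNNSimple.

(** [nu] is known only through its values on sets, so the identity passes from indicators to simple
    functions and then to the limit by monotone convergence. *)
Lemma integral_density d (T : measurableType d) (R : realType)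
    (mu nu : {measure set T -> \bar R}) (g : T -> R) (f : T -> \bar R) :
  measurable_fun [set: T] g -> (forall x, 0 <= g x) ->
  (forall A, measurable A -> nu A = \int[mu]_(x in A) (g x)%:E)%E ->
  measurable_fun [set: T] f -> (forall x, 0 <= f x)%E ->
  (\int[nu]_x f x = \int[mu]_x (f x * (g x)%:E))%E.
Proof.
move=> mg0 g0 nuE mf f0.
have mg : measurable_fun [set: T] (EFin \o g) by exact/measurable_EFinP.
pose h := nnsfun_approx measurableT mf.
have hcvg x : (EFin \o h n) x @[n --> \oo] --> f x.
  by apply: cvg_nnsfun_approx.
have hnd x a b : (a <= b)%N -> ((EFin \o h a) x <= (EFin \o h b) x)%E.
  by move=> ab; rewrite lee_fin; exact/lefP/nd_nnsfun_approx.
have -> : (\int[nu]_x f x = lim (\int[nu]_x (EFin \o h n) x @[n --> \oo]))%E.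
  rewrite -monotone_convergence//.
  - by apply: eq_integral => x _; apply/esym/cvg_lim.
  - by move=> n; apply/measurable_EFinP.
  - by move=> n x _; rewrite lee_fin.
  - by move=> x _ a b; exact: hnd.
have -> : (\int[mu]_x (f x * (g x)%:E) = lim (\int[mu]_x ((EFin \o h n) x * (g x)%:E) @[n --> \oo]))%E.
  rewrite -monotone_convergence//.
  - apply: eq_integral => x _; apply/esym/cvg_lim => //.
    exact: cvgeZr.
  - by move=> n; apply: emeasurable_funM => //; apply/measurable_EFinP.
  - by move=> n x _; rewrite mule_ge0// lee_fin.
  - by move=> x _ a b ab; apply: lee_wpmul2r; [rewrite lee_fin|exact: hnd].
congr (limn _); apply/funext => n.
transitivity (\int[nu]_x (\sum_(y \in range (h n)) (y * \1_(h n @^-1` [set y]) x)%:E))%E.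
  by apply: eq_integral => t tE; rewrite /= fimfunE -fsumEFin.
rewrite ge0_integral_fsum//; last 2 first.
  by move=> r; apply/measurable_EFinP; exact: measurable_funM.
  by move=> m y Ey; exact: nnfun_muleindic_ge0.
transitivity (\int[mu]_x (\sum_(y \in range (h n))
    (y * \1_(h n @^-1` [set y]) x)%:E * (g x)%:E))%E; last first.
  apply: eq_integral => x _.
  rewrite -ge0_mule_fsuml => [|y]; last exact: nnfun_muleindic_ge0.
  by rewrite fsumEFin // -(fimfunE _ x).
rewrite ge0_integral_fsum//; last 2 first.
  - by move=> y; apply: emeasurable_funM => //; apply/measurable_EFinP; exact: measurable_funM.
  - by move=> m y Ey; rewrite mule_ge0 ?lee_fin ?g0//; exact: nnfun_muleindic_ge0.
apply: eq_fsbigr => r rhn.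
under eq_integral do rewrite EFinM.
rewrite integralZl_indic_nnsfun //.
under [RHS]eq_integral do rewrite EFinM -muleA.
rewrite ge0_integralZl//.
- under [in RHS]eq_integral do rewrite muleC.
  rewrite [in RHS](eq_integral ((EFin \o g) \_ (h n @^-1` [set r]))); last first.
    by move=> x xE; rewrite epatch_indic.
  by rewrite -integral_mkcond -nuE// integral_indic// setIT.
- by apply: emeasurable_funM => //; exact/measurable_EFinP.
- by move=> t Et; rewrite mule_ge0 ?lee_fin ?g0.
- by move: rhn; rewrite inE => -[t _ <-]; rewrite lee_fin.
Qed.

(** * Lebesgue measure on row vectors *)

(** The sigma-algebra is generated by the coordinates, so an open set has to be exhibited as a
    countable union of boxes: those with rational centre and radius 1/(k + 1) that lie in [U]. *)
Lemma open_measurable_rV (R : realType) n (U : set 'rV[R]_n) :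
  open U -> measurable U.
Proof.
move=> oU.
pose D : set ('rV[rat]_n * nat) := [set qk : 'rV[rat]_n * nat | forall y : 'rV[R]_n,
  (forall i, `|ratr (qk.1 ord0 i) - y ord0 i| < qk.2.+1%:R^-1) -> U y].
have -> : U = \bigcup_qk (if `[< D qk >] then
    box (fun i => ball (ratr (qk.1 ord0 i) : R) qk.2.+1%:R^-1) else set0).
  apply/seteqP; split => [x Ux|x [qk _]]; last first.
    by case: asboolP => // Dqk; exact: Dqk.
  have [e /= e0 eU] : nbhs_ball x U by rewrite nbhs_ballE; exact: oU.
  (* The radius is below e/2, so a box that contains x lies in the ball of radius e around x. *)
  pose k := Num.truncn (2 / e).
  have ke : 2 * k.+1%:R^-1 < e.
    rewrite ltr_pdivrMr// mulrC -ltr_pdivrMr//; exact: truncnS_gt.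
  have H i : exists q : rat, `|ratr q - x ord0 i| < k.+1%:R^-1.
    have [q] := @rat_in_itvoo R (x ord0 i - k.+1%:R^-1) (x ord0 i + k.+1%:R^-1)
      ltac:(by rewrite ltrD2l gtrN// invr_gt0).
    rewrite in_itv/= => /andP[q1 q2]; exists q.
    by move: q1 q2; set e' := _.+1%:R^-1 => q1 q2; rewrite ltr_norml; apply/andP; split; lra.
  have [q qE] := choice H.
  exists (\row_i q i, k) => //=.
  rewrite ifT; first by move=> i; rewrite /ball/= mxE; exact: qE.
  apply/asboolP => y /= Hy; apply: eU; split => // i j; rewrite /ball/=.
    rewrite ord1; have := qE j; have := Hy j; rewrite mxE => h1 h2.
    have -> : x ord0 j - y ord0 j = (ratr (q j) - y ord0 j) - (ratr (q j) - x ord0 j) by ring.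
    rewrite (le_lt_trans (ler_normB _ _))// (lt_trans _ ke)//.
    by rewrite [ltRHS]mulr_natl mulr2n ltrD.
apply: countable_bigcupT_measurable => // -[q k].
case: ifP => // _; apply: measurable_box => i; exact: measurable_ball.
Qed.

Lemma measurable_fun_continuous_rV (R : realType) n (f : 'rV[R]_n -> R) :
  continuous f -> measurable_fun [set: 'rV[R]_n] f.
Proof.
move=> /continuousP cf; apply: (measurability _ (RGenOpens.measurableE R)).
move=> _ [_ [a [b ->] <-]]; rewrite setTI; apply: open_measurable_rV.
exact/cf/interval_open.
Qed.

(** The image of Lebesgue measure under the affine map, multiplied by c, agrees with Lebesgue
    measure on half-open intervals, hence everywhere. *)
Lemma lebesgue_affine (R : realType) (c v : R) (f : R -> \bar R) :
  0 < c -> measurable_fun [set: measurableTypeR R] f -> (forall x, 0 <= f x)%E ->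
  (\int[lebesgue_measure]_x f (c * x + v)%R =
   (c^-1)%:E * \int[lebesgue_measure]_x f x)%E.
Proof.
move=> c0 mf f0.
pose g (x : measurableTypeR R) : measurableTypeR R := c * x + v.
have mg : measurable_fun [set: measurableTypeR R] g.
  by apply: measurable_funD => //; exact: measurable_funM.
have -> : (\int[lebesgue_measure]_x f x =
    \int[mscale (NngNum (ltW c0)) (pushforward lebesgue_measure g)]_x f x)%E.
  move=> mg'.
  apply: eq_measure_integral => A mA _.
  apply: lebesgue_measure_unique => // X [[a b] /= ab <-].
  rewrite /mscale/= /pushforward.
  have -> : g @^-1` `]a, b] = `](a - v) / c, (b - v) / c]%classic.
    apply/seteqP; split => x /=; rewrite !in_itv/= ltr_pdivrMr// ler_pdivlMr//;
      by rewrite ltrBlDr lerBrDr mulrC.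
  rewrite !lebesgue_measure_itv/= !lte_fin ltr_pM2r ?invr_gt0// ltrD2r.
  case: ifP => _; last by rewrite mule0.
  rewrite -!EFinM; congr EFin; field; exact: lt0r_neq0.
rewrite ge0_integral_mscale// ge0_integral_pushforward//= preimage_setT muleA.
by rewrite -EFinM mulVf ?gt_eqF// mul1e.
Qed.

Lemma lebesgue_rV_recl (R : realType) n (f : 'rV[R]_n.+1 -> \bar R) :
  measurable_fun [set: 'rV[R]_n.+1] f -> (forall x, 0 <= f x)%E ->
  (\int[lebesgue_rV R n.+1]_x f x =
   \int[lebesgue_measure]_a \int[lebesgue_rV R n]_x f (rV_cons (a, x)))%E.
Proof.
move=> mf f0.
rewrite ge0_integral_pushforward//; last exact: measurable_rV_cons.
rewrite preimage_setT fubini_tonelli1//; last by move=> x; exact: f0.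
exact: (measurableT_comp mf (@measurable_rV_cons R n)).
Qed.

Lemma rV_consD (R : realType) n (a b : R) (x y : 'rV[R]_n) (c : R) :
  rV_cons (c * a + b, c *: x + y) = c *: rV_cons (a, x) + rV_cons (b, y).
Proof.
by apply/rowP => i; rewrite !mxE; case: unliftP => [j|] _ /=; rewrite ?mxE.
Qed.

Lemma rV_consE (R : realType) n (x : 'rV[R]_n.+1) :
  rV_cons (x ord0 ord0, \row_j x ord0 (lift ord0 j)) = x.
Proof.
by apply/rowP => i; rewrite !mxE; case: unliftP => [j|] -> /=; rewrite ?mxE.
Qed.

Lemma measurable_rV_affine (R : realType) n (c : R) (v : 'rV[R]_n) :
  measurable_fun [set: 'rV[R]_n] (fun x : 'rV[R]_n => c *: x + v).
Proof.
apply: measurable_fun_rV => i; under eq_fun do rewrite !mxE.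
by apply: measurable_funD => //; apply: measurable_funM => //; exact: measurable_coord.
Qed.

(** Induction on the dimension: each coordinate contributes one factor 1/c. *)
Lemma lebesgue_rV_affine (R : realType) n (c : R) (v : 'rV[R]_n)
    (f : 'rV[R]_n -> \bar R) :
  0 < c -> measurable_fun [set: 'rV[R]_n] f -> (forall x, 0 <= f x)%E ->
  (\int[lebesgue_rV R n]_x f (c *: x + v)%R =
   (c ^- n)%:E * \int[lebesgue_rV R n]_x f x)%E.
Proof.
move=> c0; elim: n v f => [|n IH] v f mf f0.
  rewrite expr0 invr1 mul1e; apply: eq_integral => x _; congr f.
  by apply/rowP => -[].
have mfa := measurableT_comp mf (measurable_rV_affine c v).
have f0a x : (0 <= f (c *: x + v)%R)%E by exact: f0.
rewrite (lebesgue_rV_recl mfa f0a) (lebesgue_rV_recl mf f0).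
have mfc := measurableT_comp mf (@measurable_rV_cons R n).
pose v' : 'rV[R]_n := \row_j v ord0 (lift ord0 j).
have mfa1 a : measurable_fun [set: 'rV[R]_n] (fun x => f (rV_cons (a, x))).
  by apply: (measurableT_comp mfc (pair1_measurable _)).
transitivity (\int[lebesgue_measure]_a
    ((c ^- n)%:E * \int[lebesgue_rV R n]_x f (rV_cons ((c * a + v ord0 ord0)%R, x))))%E.
  apply: eq_integral => a _; rewrite -(IH v')//.
  by apply: eq_integral => x _; rewrite /= -{1}(rV_consE v) -rV_consD.
have mF : measurable_fun [set: measurableTypeR R]
    (fun a : R => \int[lebesgue_rV R n]_x f (rV_cons (a, x)))%E.
  exact: (@measurable_fun_fubini_tonelli_F _ _ (measurableTypeR R) _ _ (lebesgue_rV R n) _ mfc (fun x => f0 _)).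
have mFa : measurable_fun [set: measurableTypeR R] (fun a : R =>
    \int[lebesgue_rV R n]_x f (rV_cons ((c * a + v ord0 ord0)%R, x)))%E.
  have := @measurableT_comp _ _ _ (measurableTypeR R) (measurableTypeR R) _ _ _ (fun a => c * a + v ord0 ord0) mF.
  by apply; apply: measurable_funD => //; exact: measurable_funM.
have cn0 : (0 <= (c ^- n)%:E :> \bar R)%E by rewrite lee_fin invr_ge0 exprn_ge0 // ltW.
transitivity ((c ^- n)%:E * \int[lebesgue_measure]_a
    \int[lebesgue_rV R n]_x f (rV_cons ((c * a + v ord0 ord0)%R, x)))%E.
  apply: (ge0_integralZl _ measurableT mFa) => //.
  by move=> a _; exact: integral_ge0.
rewrite (lebesgue_affine _ c0 mF); last by move=> a; exact: integral_ge0.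
by rewrite muleA -EFinM exprS invfM mulrC.
Qed.

(** * Gaussian densities *)

Definition dotv (R : realType) n (x y : 'rV[R]_n) : R :=
  \sum_(i < n) x ord0 i * y ord0 i.

Section dotv.
Context (R : realType) (n : nat).
Implicit Types x y z : 'rV[R]_n.

Lemma dotvC x y : dotv x y = dotv y x.
Proof. by apply: eq_bigr => i _; rewrite mulrC. Qed.

Lemma dotvDl x y z : dotv (x + y) z = dotv x z + dotv y z.
Proof. by rewrite -big_split; apply: eq_bigr => i _; rewrite mxE mulrDl. Qed.

Lemma dotvZl a x y : dotv (a *: x) y = a * dotv x y.
Proof. by rewrite /dotv mulr_sumr; apply: eq_bigr => i _; rewrite mxE mulrA. Qed.

Lemma dotvDr x y z : dotv x (y + z) = dotv x y + dotv x z.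
Proof. by rewrite dotvC dotvDl !(dotvC x). Qed.

Lemma dotvZr a x y : dotv x (a *: y) = a * dotv x y.
Proof. by rewrite dotvC dotvZl dotvC. Qed.

Lemma dotvNl x y : dotv (- x) y = - dotv x y.
Proof. by rewrite -scaleN1r dotvZl mulN1r. Qed.

Lemma dotvNr x y : dotv x (- y) = - dotv x y.
Proof. by rewrite dotvC dotvNl dotvC. Qed.

Definition dotvE := (dotvDl, dotvDr, dotvNl, dotvNr, dotvZl, dotvZr).

Lemma dot0v x : dotv 0 x = 0.
Proof. by rewrite -(scale0r x) dotvZl mul0r. Qed.

Lemma dotv_ge0 x : 0 <= dotv x x.
Proof. by apply: sumr_ge0 => i _; rewrite -expr2 sqr_ge0. Qed.

Lemma dotv_delta x i : dotv x (delta_mx ord0 i) = x ord0 i.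
Proof.
rewrite /dotv (bigD1 i)//= mxE !eqxx mulr1 big1 ?addr0// => j ji.
by rewrite mxE eqxx (negbTE ji) mulr0.
Qed.

Lemma enormE x : enorm x = Num.sqrt (dotv x x).
Proof. by congr Num.sqrt; apply: eq_bigr => i _; rewrite expr2. Qed.

Lemma enorm_ge0 x : 0 <= enorm x. Proof. exact: sqrtr_ge0. Qed.

Lemma enorm_sqr x : enorm x ^+ 2 = dotv x x.
Proof. by rewrite enormE sqr_sqrtr// dotv_ge0. Qed.

Lemma dotv_eq0 x y : dotv x x = 0 -> dotv x y = 0.
Proof.
move=> /eqP; rewrite psumr_eq0; last by move=> i _; rewrite -expr2 sqr_ge0.
move=> /allP x0; rewrite /dotv big1// => i _.
have := x0 i (mem_index_enum i); rewrite -expr2 sqrf_eq0 => /eqP ->.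
by rewrite mul0r.
Qed.

(** Cauchy-Schwarz, from the positivity of the squared norm of |x|^2 y - <x, y> x. *)
Lemma dotv_sqr_le x y : dotv x y ^+ 2 <= dotv x x * dotv y y.
Proof.
have [x0|x0] := eqVneq (dotv x x) 0.
  by rewrite dotv_eq0// x0 mul0r expr0n.
have xp : 0 < dotv x x by rewrite lt_neqAle eq_sym x0 dotv_ge0.
have := dotv_ge0 (dotv x x *: y - dotv x y *: x).
rewrite !dotvE (dotvC y x) => H.
have : 0 <= dotv x x * (dotv x x * dotv y y - dotv x y ^+ 2) by nra.
by rewrite pmulr_rge0// subr_ge0.
Qed.

Lemma dotv_le_enorm x y : dotv x y <= enorm x * enorm y.
Proof.
apply: le_trans (ler_norm _) _.
rewrite !enormE -sqrtrM ?dotv_ge0// -sqrtr_sqr ler_sqrt ?dotv_sqr_le//.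
by rewrite mulr_ge0 ?dotv_ge0.
Qed.

Lemma enormZ a x : enorm (a *: x) = `|a| * enorm x.
Proof. by rewrite !enormE !dotvE mulrA -expr2 sqrtrM ?sqr_ge0// sqrtr_sqr. Qed.

Lemma enormN x : enorm (- x) = enorm x.
Proof. by rewrite -scaleN1r enormZ normrN1 mul1r. Qed.

Lemma enormD x y : enorm (x + y) <= enorm x + enorm y.
Proof.
rewrite -(@ler_pXn2r _ 2)// ?nnegrE ?addr_ge0 ?enorm_ge0//.
rewrite sqrrD !enorm_sqr !dotvE (dotvC y x).
have := dotv_le_enorm x y; lra.
Qed.

Lemma dotv_addC_le x y : dotv (x + y) (x + y) <= 2 * dotv x x + 2 * dotv y y.
Proof. by have := dotv_ge0 (x - y); rewrite !dotvE (dotvC y x); lra. Qed.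

End dotv.

Lemma measurable_dotv d (T : measurableType d) (R : realType) n
    (f g : T -> 'rV[R]_n) :
  measurable_fun [set: T] f -> measurable_fun [set: T] g ->
  measurable_fun [set: T] (fun t => dotv (f t) (g t)).
Proof.
move=> mf mg; apply: measurable_sum => i; apply: measurable_funM.
  exact: (measurableT_comp (@measurable_coord R n i) mf).
exact: (measurableT_comp (@measurable_coord R n i) mg).
Qed.

Lemma measurable_enorm d (T : measurableType d) (R : realType) n
    (f : T -> 'rV[R]_n) :
  measurable_fun [set: T] f -> measurable_fun [set: T] (fun t => enorm (f t)).
Proof.
move=> mf; under eq_fun do rewrite enormE.
by apply: (measurableT_comp (continuous_measurable_fun (@sqrt_continuous R))); exact: measurable_dotv.
Qed.

Lemma measurable_rVD d (T : measurableType d) (R : realType) n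
    (f g : T -> 'rV[R]_n) :
  measurable_fun [set: T] f -> measurable_fun [set: T] g ->
  measurable_fun [set: T] (fun t => f t + g t).
Proof.
move=> mf mg; apply: measurable_fun_rV => i; under eq_fun do rewrite mxE.
apply: measurable_funD.
  exact: (measurableT_comp (@measurable_coord R n i) mf).
exact: (measurableT_comp (@measurable_coord R n i) mg).
Qed.

Lemma measurable_rVZ d (T : measurableType d) (R : realType) n
    (a : R) (f : T -> 'rV[R]_n) :
  measurable_fun [set: T] f -> measurable_fun [set: T] (fun t => a *: f t).
Proof.
move=> mf; apply: measurable_fun_rV => i; under eq_fun do rewrite mxE.
apply: measurable_funM => //.
exact: (measurableT_comp (@measurable_coord R n i) mf).
Qed.

Lemma measurable_rVN d (T : measurableType d) (R : realType) n
    (f : T -> 'rV[R]_n) :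
  measurable_fun [set: T] f -> measurable_fun [set: T] (fun t => - f t).
Proof.
by move=> mf; under eq_fun do rewrite -scaleN1r; exact: measurable_rVZ.
Qed.

(** The product form is that of [gaussian_law], so the noise law in [LMC] unfolds to it. *)
Definition gausspdf (R : realType) n (v : R) (x : 'rV[R]_n) : R :=
  \prod_(i < n) normal_pdf 0 (Num.sqrt v) (x ord0 i).

Section gausspdf.
Context (R : realType) (n : nat).
Implicit Types x y z : 'rV[R]_n.

Lemma gausspdfE v x : 0 < v ->
  gausspdf v x = normal_peak (Num.sqrt v) ^+ n * expR (- dotv x x / (2 * v)).
Proof.
move=> v0; rewrite /gausspdf.
have sv : Num.sqrt v != 0 by rewrite gt_eqF// sqrtr_gt0.
under eq_bigr do rewrite normal_pdfE//.
rewrite big_split/= prodr_const card_ord; congr (_ * _).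
rewrite /normal_fun -expR_sum; congr expR.
rewrite -mulr_suml sumrN; congr (- _ / _).
  by apply: eq_bigr => i _; rewrite subr0 expr2.
by rewrite sqr_sqrtr ?ltW// mulr_natl.
Qed.

Lemma gausspdf_gt0 v x : 0 < v -> 0 < gausspdf v x.
Proof.
move=> v0; rewrite gausspdfE// mulr_gt0 ?expR_gt0// exprn_gt0//.
by rewrite normal_peak_gt0// gt_eqF// sqrtr_gt0.
Qed.

Lemma gausspdf_ge0 v x : 0 <= gausspdf v x.
Proof. by apply: prodr_ge0 => i _; exact: normal_pdf_ge0. Qed.

Lemma gausspdf_le v x : 0 < v -> gausspdf v x <= normal_peak (Num.sqrt v) ^+ n.
Proof.
move=> v0; rewrite gausspdfE// ler_piMr ?exprn_ge0 ?normal_peak_ge0//.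
by rewrite expR_le1 mulNr oppr_le0 divr_ge0 ?dotv_ge0// mulr_ge0 ?ltW.
Qed.

Lemma measurable_gausspdf d (T : measurableType d) (v : R) (f : T -> 'rV[R]_n) :
  measurable_fun [set: T] f -> measurable_fun [set: T] (fun t => gausspdf v (f t)).
Proof.
move=> mf; apply: measurable_prod => i _.
apply: (measurableT_comp (measurable_normal_pdf _ _)).
exact: (measurableT_comp (@measurable_coord R n i) mf).
Qed.

End gausspdf.

Lemma integral_gausspdf (R : realType) n (v : R) : 0 < v ->
  (\int[lebesgue_rV R n]_x (gausspdf v x)%:E = 1)%E.
Proof.
move=> v0; elim: n => [|n IH].
  rewrite /gausspdf.
  under eq_integral do rewrite big_ord0.
  by rewrite integral_cst//= mul1e diracE mem_set.
rewrite lebesgue_rV_recl; last 2 first.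
  by apply/measurable_EFinP; exact: measurable_gausspdf.
  by move=> x; rewrite lee_fin gausspdf_ge0.
transitivity (\int[@lebesgue_measure R]_a (normal_pdf 0 (Num.sqrt v) a)%:E)%E; last first.
  by apply: integral_normal_pdf; rewrite gt_eqF// sqrtr_gt0.
apply: eq_integral => a _.
transitivity (\int[lebesgue_rV R n]_x ((normal_pdf 0 (Num.sqrt v) a)%:E * (gausspdf v x)%:E))%E.
  apply: eq_integral => x _; rewrite /gausspdf big_ord_recl -EFinM /rV_cons mxE unlift_none.
  by congr (_ * _)%:E; apply: eq_bigr => i _; rewrite mxE liftK.
rewrite ge0_integralZl//.
- by rewrite IH mule1.
- by apply/measurable_EFinP; exact: measurable_gausspdf.
- by move=> x _; rewrite lee_fin gausspdf_ge0.
- by rewrite lee_fin normal_pdf_ge0.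
Qed.

Section gaussian_integrals.
Context (R : realType) (n : nat).
Implicit Types (x y z w : 'rV[R]_n) (h a c v : R).
Local Notation lam := (lebesgue_rV R n).

Lemma gausspdf_scale c v z : 0 < c -> 0 < v ->
  gausspdf (c ^+ 2 * v) (c *: z) = c ^- n * gausspdf v z.
Proof.
move=> c0 v0; rewrite !gausspdfE ?mulr_gt0 ?exprn_gt0// [RHS]mulrA; congr (_ * _).
  rewrite -exprVn -exprMn; congr (_ ^+ n).
  rewrite /normal_peak !sqr_sqrtr ?mulr_ge0 ?exprn_ge0 ?(ltW c0) ?(ltW v0)//.
  rewrite -mulrA -mulrnAr sqrtrM ?exprn_ge0 ?(ltW c0)// sqrtr_sqr gtr0_norm//.
  by rewrite invfM.
congr expR; rewrite !dotvE; field.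
by rewrite !gt_eqF.
Qed.

Lemma measurable_gausspdf_shift h x :
  measurable_fun [set: 'rV[R]_n] (fun y => gausspdf h (y - x)).
Proof.
by apply: measurable_gausspdf; apply: measurable_rVD.
Qed.

(** The substitution y = sqrt h z + x reduces Gaussian integrals to the standard Gaussian, the form
    in which rotations act. *)
Lemma integral_gausspdf_shift h x (u : 'rV[R]_n -> \bar R) :
  0 < h -> measurable_fun [set: 'rV[R]_n] u -> (forall y, 0 <= u y)%E ->
  (\int[lam]_y (u y * (gausspdf h (y - x))%:E) =
   \int[lam]_z (u (Num.sqrt h *: z + x)%R * (gausspdf 1 z)%:E))%E.
Proof.
move=> h0 mu_ u0; have sh : 0 < Num.sqrt h by rewrite sqrtr_gt0.
pose f y := (u y * (gausspdf h (y - x))%:E)%E.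
have mf : measurable_fun [set: 'rV[R]_n] f.
  by apply: emeasurable_funM => //; apply/measurable_EFinP; exact: measurable_gausspdf_shift.
have f0 y : (0 <= f y)%E by rewrite mule_ge0// lee_fin gausspdf_ge0.
have H := lebesgue_rV_affine x sh mf f0.
have -> : (\int[lam]_y (u y * (gausspdf h (y - x))%:E) =
   (Num.sqrt h ^+ n)%:E * \int[lam]_z f (Num.sqrt h *: z + x)%R)%E.
  by rewrite H muleA -EFinM mulfV ?mul1e// gt_eqF// exprn_gt0.
rewrite -ge0_integralZl//; last first.
  exact: (measurableT_comp mf (measurable_rV_affine _ _)).
apply: eq_integral => z _; rewrite /f addrK.
have := gausspdf_scale z sh ltr01; rewrite mulr1 sqr_sqrtr ?(ltW h0)// => ->.
rewrite EFinM muleCA (muleA (_ ^+ n)%:E) -EFinM mulfV ?mul1r//.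
by rewrite gt_eqF// exprn_gt0.
Qed.

Lemma integral_gausspdf_shift1 h x : 0 < h ->
  (\int[lam]_y (gausspdf h (y - x))%:E = 1)%E.
Proof.
move=> h0; have := @integral_gausspdf_shift h x (cst 1%E) h0.
under eq_integral do rewrite mul1e; move=> -> //.
by under eq_integral do rewrite mul1e; exact: integral_gausspdf.
Qed.

(** Completing the square: the exponential factor moves the centre from x to x + h w. *)
Lemma gauss_mgf h x w : 0 < h ->
  (\int[lam]_y (gausspdf h (y - x) * expR (dotv w y))%:E =
   (expR (dotv w x + h / 2 * dotv w w))%:E)%E.
Proof.
move=> h0.
transitivity (\int[lam]_y ((expR (dotv w x + h / 2 * dotv w w))%:E *
   (gausspdf h (y - (x + h *: w)))%:E))%E.
  apply: eq_integral => y _; rewrite -EFinM; congr EFin.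
  rewrite !gausspdfE// -[LHS]mulrA [RHS]mulrCA; congr (_ * _).
  rewrite -!expRD; congr expR; rewrite !(dotvE, dotvDl, opprD).
  rewrite (dotvC y x) (dotvC y w) (dotvC x w); field; exact: lt0r_neq0.
rewrite ge0_integralZl//.
- by rewrite integral_gausspdf_shift1// mule1.
- by apply/measurable_EFinP; exact: measurable_gausspdf_shift.
- by move=> y _; rewrite lee_fin gausspdf_ge0.
Qed.

(** With c^2 = 1 - 2 a h the integrand is a constant times the Gaussian density at c y - x/c. The
    sign of [a] is free: negative values serve for Gaussian weights, positive ones for their
    inverses. *)
Lemma gauss_quad h a x : 0 < h -> 2 * a * h < 1 ->
  (\int[lam]_y (gausspdf h (y - x) * expR (a * dotv y y))%:E =
   (Num.sqrt (1 - 2 * a * h) ^- n *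
    expR (a / (1 - 2 * a * h) * dotv x x))%:E)%E.
Proof.
move=> h0 ah; set c2 := 1 - 2 * a * h.
have c20 : 0 < c2 by rewrite subr_gt0.
set c := Num.sqrt c2; have c0 : 0 < c by rewrite sqrtr_gt0.
have cc : c ^+ 2 = c2 by rewrite sqr_sqrtr ?ltW.
have mg : measurable_fun [set: 'rV[R]_n] (EFin \o @gausspdf R n h).
  by apply/measurable_EFinP; exact: measurable_gausspdf.
have g0 y : (0 <= (EFin \o @gausspdf R n h) y)%E by rewrite lee_fin gausspdf_ge0.
have := lebesgue_rV_affine (- (c^-1 *: x)) c0 mg g0.
rewrite integral_gausspdf// mule1 => H.
rewrite EFinM -H muleC -ge0_integralZl//; last first.
  exact: (measurableT_comp mg (measurable_rV_affine _ _)).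
apply: eq_integral => y _; rewrite -EFinM; congr EFin.
rewrite !gausspdfE// -[LHS]mulrA [RHS]mulrCA; congr (_ * _).
rewrite -!expRD; congr expR; rewrite !dotvE.
have -> : c2 = c ^+ 2 by [].
have -> : a = (1 - c ^+ 2) / (2 * h) by rewrite cc /c2; field; exact: lt0r_neq0.
rewrite (dotvC x y); field; by rewrite !gt_eqF.
Qed.

End gaussian_integrals.

(** * Density kernels and comparison of two chains *)

Lemma poweR_split (R : realType) (k t : R) : 0 < t < 1 -> 0 <= k ->
  (k%:E `^ t * k%:E `^ (1 - t) = k%:E)%E.
Proof.
move=> /andP[t0 t1] k0; rewrite !poweR_EFin -EFinM; congr EFin.
have [->|kn] := eqVneq k 0; first by rewrite powR0 ?mul0r// gt_eqF.
by rewrite -powRD ?kn ?implybT// addrCA subrr addr0 powRr1.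
Qed.

Lemma poweRK (R : realType) (x : \bar R) (t : R) : t != 0 -> (0 <= x)%E ->
  ((x `^ t) `^ t^-1 = x)%E.
Proof. by move=> t0 x0; rewrite -poweRrM mulfV// poweRe1. Qed.

Lemma poweRVK (R : realType) (x : \bar R) (t : R) : t != 0 -> (0 <= x)%E ->
  ((x `^ t^-1) `^ t = x)%E.
Proof. by move=> t0 x0; rewrite -poweRrM mulVf// poweRe1. Qed.

Lemma lee_poweR (R : realType) (x y : \bar R) (t : R) : 0 <= t -> (0 <= x)%E ->
  (x <= y)%E -> (x `^ t <= y `^ t)%E.
Proof.
move=> t0 x0 xy; apply: gt0_ler_poweR => //; rewrite in_itv/= ?x0 ?leey//=.
by rewrite andbT (le_trans x0 xy).
Qed.

Section weighted_hoelder.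
Context d (T : measurableType d) (R : realType) (mu : {measure set T -> \bar R}).
Variable k : T -> R.
Hypotheses (mk : measurable_fun [set: T] k) (k0 : forall x, 0 <= k x).
Implicit Types u v : T -> \bar R.

Let mek : measurable_fun [set: T] (EFin \o k).
Proof. exact/measurable_EFinP. Qed.

Lemma measurable_poweR_fun u t : measurable_fun [set: T] u ->
  measurable_fun [set: T] (fun x => u x `^ t)%E.
Proof. by move=> h; exact: (measurableT_comp (measurable_poweR t) h). Qed.

(** The weight is split as k = k^t k^(1 - t) and distributed over the two factors. *)
Lemma hoelder_weight u v (t : R) : 0 < t < 1 ->
  measurable_fun [set: T] u -> measurable_fun [set: T] v ->
  (forall x, 0 <= u x)%E -> (forall x, 0 <= v x)%E ->
  (\int[mu]_x (u x `^ t * v x `^ (1 - t) * (k x)%:E) <=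
   (\int[mu]_x (u x * (k x)%:E)) `^ t * (\int[mu]_x (v x * (k x)%:E)) `^ (1 - t))%E.
Proof.
move=> t01 mu_ mv u0 v0; have /andP[t0 t1] := t01.
have mU : measurable_fun [set: T] (fun x => u x * (k x)%:E)%E by exact: emeasurable_funM.
have mV : measurable_fun [set: T] (fun x => v x * (k x)%:E)%E by exact: emeasurable_funM.
have U0 x : (0 <= u x * (k x)%:E)%E by rewrite mule_ge0 ?lee_fin.
have V0 x : (0 <= v x * (k x)%:E)%E by rewrite mule_ge0 ?lee_fin.
apply: le_trans (hoelder_geo mu t01 mU mV U0 V0).
rewrite le_eqVlt; apply/orP; left; apply/eqP; apply: eq_integral => x _.
by rewrite !poweRM ?lee_fin// muleACA poweR_split.
Qed.

(** Hoelder's inequality against the constant 1, whose weighted integral is 1. *)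
Lemma jensen_poweR u (p : R) : 1 <= p ->
  (\int[mu]_x (k x)%:E = 1)%E ->
  measurable_fun [set: T] u -> (forall x, 0 <= u x)%E ->
  ((\int[mu]_x (u x * (k x)%:E)) `^ p <= \int[mu]_x (u x `^ p * (k x)%:E))%E.
Proof.
rewrite le_eqVlt => /orP[/eqP <- _ mu_ u0|p1 k1 mu_ u0].
  rewrite poweRe1; last by apply: integral_ge0 => x _; rewrite mule_ge0 ?lee_fin.
  by under [leRHS]eq_integral do rewrite poweRe1//.
have p0 : 0 < p by rewrite (lt_trans ltr01).
have t01 : 0 < p^-1 < 1 by rewrite invr_gt0 p0 invf_lt1.
have mup := measurable_poweR_fun p mu_.
have := hoelder_weight t01 mup (@measurable_cst _ _ _ _ setT 1%E)
  (fun x => poweR_ge0 _ _) (fun=> lee01).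
under eq_integral do rewrite poweRK ?gt_eqF// poweR1r mule1.
under [X in (_ <= _ * X `^ _)%E -> _]eq_integral do rewrite mul1e.
rewrite k1 poweR1r mule1 => H.
rewrite -[leRHS](@poweRVK _ _ p) ?gt_eqF//; last first.
  by apply: integral_ge0 => x _; rewrite mule_ge0 ?lee_fin ?poweR_ge0.
apply: lee_poweR => //; first exact: ltW.
by apply: integral_ge0 => x _; rewrite mule_ge0 ?lee_fin.
Qed.

End weighted_hoelder.

Definition kop d (T : measurableType d) (R : realType)
    (mu : {measure set T -> \bar R}) (K : T -> T -> R) (u : T -> \bar R) (x : T) :=
  (\int[mu]_y (u y * (K x y)%:E))%E.

Section density_kernel.
Context d (T : measurableType d) (R : realType)
  (lam : {sigma_finite_measure set T -> \bar R}).
Variable K : T -> T -> R.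
Hypotheses (mK : measurable_fun [set: T * T] (fun z => K z.1 z.2))
  (K0 : forall x y, 0 <= K x y).
Implicit Types u v : T -> \bar R.
Local Notation kop := (kop lam K).

Lemma measurable_kernel1 x : measurable_fun [set: T] (K x).
Proof. exact: (measurableT_comp mK (pair1_measurable x)). Qed.

Lemma measurable_kernel2 y : measurable_fun [set: T] (K^~ y).
Proof. exact: (measurableT_comp mK (pair2_measurable y)). Qed.

Lemma kop_ge0 u x : (forall y, 0 <= u y)%E -> (0 <= kop u x)%E.
Proof. by move=> u0; apply: integral_ge0 => y _; rewrite mule_ge0 ?lee_fin. Qed.

Lemma measurable_kop u : measurable_fun [set: T] u -> (forall y, 0 <= u y)%E ->
  measurable_fun [set: T] (kop u).
Proof.
move=> mu_ u0.
apply: (@measurable_fun_fubini_tonelli_F _ _ _ _ _ lam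
  (fun z : T * T => u z.2 * (K z.1 z.2)%:E)%E).
  apply: emeasurable_funM; last exact/measurable_EFinP.
  exact: (measurableT_comp mu_ measurable_snd).
by move=> z; rewrite mule_ge0 ?lee_fin.
Qed.

Lemma le_kop u v x : measurable_fun [set: T] u -> measurable_fun [set: T] v ->
  (forall y, 0 <= u y)%E -> (forall y, u y <= v y)%E -> (kop u x <= kop v x)%E.
Proof.
move=> mu_ mv u0 uv; have mKx := measurable_kernel1 x.
apply: ge0_le_integral => //.
- by move=> y _; rewrite mule_ge0 ?lee_fin.
- by apply: emeasurable_funM => //; exact/measurable_EFinP.
- by apply: emeasurable_funM => //; exact/measurable_EFinP.
- by move=> y _; rewrite lee_wpmul2r ?lee_fin.
Qed.

Lemma kopZ u c x : measurable_fun [set: T] u -> (forall y, 0 <= u y)%E ->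
  (0 <= c)%E -> (kop (fun y => c * u y) x = c * kop u x)%E.
Proof.
move=> mu_ u0 c0; rewrite /kop -ge0_integralZl//.
- by apply: eq_integral => y _; rewrite muleA.
- by apply: emeasurable_funM => //; apply/measurable_EFinP; exact: measurable_kernel1.
- by move=> y _; rewrite mule_ge0 ?lee_fin.
Qed.

Hypothesis K1 : forall x, (\int[lam]_y (K x y)%:E = 1)%E.

Lemma kop_cst c x : (0 <= c)%E -> (kop (cst c) x = c)%E.
Proof.
move=> c0; rewrite /kop ge0_integralZl ?K1 ?mule1//.
- by apply/measurable_EFinP; exact: measurable_kernel1.
- by move=> y _; rewrite lee_fin.
Qed.

Lemma kop_jensen u p x : 1 <= p -> measurable_fun [set: T] u ->
  (forall y, 0 <= u y)%E -> (kop u x `^ p <= kop (fun y => u y `^ p) x)%E.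
Proof. by move=> p1 mu_ u0; apply: jensen_poweR => //; exact: measurable_kernel1. Qed.

Lemma kop_geo u v t x : 0 < t < 1 ->
  measurable_fun [set: T] u -> measurable_fun [set: T] v ->
  (forall y, 0 <= u y)%E -> (forall y, 0 <= v y)%E ->
  (kop (fun y => u y `^ t * v y `^ (1 - t)) x <= kop u x `^ t * kop v x `^ (1 - t))%E.
Proof. by move=> t01 mu_ mv u0 v0; apply: hoelder_weight => //; exact: measurable_kernel1. Qed.

End density_kernel.

(** Under the detailed balance relation between [a] and [b], Tonelli's theorem makes the operator of
    [S] the adjoint of the operator of [Q]. Hence [S] also transports densities relative to [a] into
    densities relative to [b]. *)
Lemma kop_duality d (T : measurableType d) (R : realType)
    (lam : {sigma_finite_measure set T -> \bar R}) (Q S : T -> T -> R)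
    (a b : T -> R) (u v : T -> \bar R) :
  measurable_fun [set: T * T] (fun z => Q z.1 z.2) ->
  measurable_fun [set: T] a -> measurable_fun [set: T] b ->
  (forall x y, 0 <= Q x y) -> (forall x y, 0 <= S x y) ->
  (forall x, 0 <= a x) -> (forall x, 0 <= b x) ->
  (forall x y, Q x y * a x = S y x * b y) ->
  measurable_fun [set: T * T] (fun z => S z.1 z.2) ->
  measurable_fun [set: T] u -> measurable_fun [set: T] v ->
  (forall x, 0 <= u x)%E -> (forall x, 0 <= v x)%E ->
  (\int[lam]_x (u x * kop lam Q v x * (a x)%:E) =
   \int[lam]_y (kop lam S u y * v y * (b y)%:E))%E.
Proof.
move=> mQ ma mb Q0 S0 a0 b0 QS mS mu_ mv u0 v0.
pose F (z : T * T) := (u z.1 * v z.2 * (Q z.1 z.2 * a z.1)%:E)%E.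
have F0 z : (0 <= F z)%E by rewrite !mule_ge0// lee_fin mulr_ge0.
have mF : measurable_fun [set: T * T] F.
  apply: emeasurable_funM.
    apply: emeasurable_funM; first exact: (measurableT_comp mu_ measurable_fst).
    exact: (measurableT_comp mv measurable_snd).
  apply/measurable_EFinP; apply: measurable_funM => //.
  exact: (measurableT_comp ma measurable_fst).
transitivity (\int[lam]_x \int[lam]_y F (x, y))%E.
  apply: eq_integral => x _; rewrite /kop /F/=.
  rewrite -muleA [X in (_ * X)%E]muleC muleA -ge0_integralZl//.
  - apply: eq_integral => y _; rewrite EFinM -!muleA; congr (_ * _)%E.
    by rewrite muleC -!muleA; congr (_ * _)%E.
  - apply: emeasurable_funM => //; apply/measurable_EFinP.
    exact: (measurableT_comp mQ (pair1_measurable x)).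
  - by move=> y _; rewrite mule_ge0 ?lee_fin.
  - by rewrite mule_ge0 ?lee_fin.
rewrite fubini_tonelli//; apply: eq_integral => y _; rewrite /kop /F/=.
rewrite -muleA [RHS]muleC -ge0_integralZl//.
- apply: eq_integral => x _; rewrite QS EFinM [in LHS](muleC (u x)) -!muleA.
  congr (_ * _)%E; rewrite [RHS]muleCA; congr (_ * _)%E; exact: muleC.
- apply: emeasurable_funM => //; apply/measurable_EFinP.
  exact: (measurableT_comp mS (pair1_measurable y)).
- by move=> x _; rewrite mule_ge0 ?lee_fin.
- by rewrite mule_ge0 ?lee_fin.
Qed.

Lemma le_integral_nneg d (T : measurableType d) (R : realType)
    (mu : {measure set T -> \bar R}) (u v : T -> \bar R) :
  measurable_fun [set: T] u -> measurable_fun [set: T] v ->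
  (forall x, 0 <= u x)%E -> (forall x, u x <= v x)%E ->
  (\int[mu]_x u x <= \int[mu]_x v x)%E.
Proof.
by move=> mu_ mv u0 uv; apply: ge0_le_integral => // x _.
Qed.

Lemma measurable_funV d (T : measurableType d) (R : realType) (f : T -> R) :
  (forall x, 0 <= f x) ->
  measurable_fun [set: T] f -> measurable_fun [set: T] (fun x => (f x)^-1).
Proof.
move=> f0 mf; under eq_fun do rewrite -powR_inv1//.
exact: (measurableT_comp (measurable_powR _) mf).
Qed.

Lemma measurable2_comp d d1 d2 d3 (T : measurableType d) (T1 : measurableType d1)
    (T2 : measurableType d2) (T3 : measurableType d3)
    (F : T1 -> T2 -> T3) (f : T -> T1) (g : T -> T2) :
  measurable_fun [set: T1 * T2] (fun z => F z.1 z.2) ->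
  measurable_fun [set: T] f -> measurable_fun [set: T] g ->
  measurable_fun [set: T] (fun t => F (f t) (g t)).
Proof.
by move=> mF mf mg; exact: (measurableT_comp mF (measurable_fun_pair mf mg)).
Qed.

Section tilted_operator.
Context d (T : measurableType d) (R : realType)
  (lam : {sigma_finite_measure set T -> \bar R}).
Variables (Q S : T -> T -> R).
Hypotheses (mQ : measurable_fun [set: T * T] (fun z => Q z.1 z.2))
  (mS : measurable_fun [set: T * T] (fun z => S z.1 z.2)).
Hypotheses (Q0 : forall x y, 0 <= Q x y) (S0 : forall x y, 0 <= S x y).
Implicit Types (u v : T -> \bar R) (k : T -> T -> T -> R).

Definition measurable3 k :=
  measurable_fun [set: (T * T) * T] (fun t => k t.1.1 t.1.2 t.2).

(* top k is the two-step transition Q then S reweighted by the ratio k. *)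
Definition tin k u (x y : T) : \bar R :=
  (\int[lam]_z (u z * (k x y z * S y z)%:E))%E.

Definition top k u (x : T) : \bar R := (\int[lam]_y (tin k u x y * (Q x y)%:E))%E.

Section one.
Variables (k : T -> T -> T -> R) (u : T -> \bar R).
Hypotheses (mk : measurable3 k) (k0 : forall x y z, 0 <= k x y z).
Hypotheses (mu : measurable_fun [set: T] u) (u0 : forall x, (0 <= u x)%E).

Lemma tin_ge0 x y : (0 <= tin k u x y)%E.
Proof. by apply: integral_ge0 => z _; rewrite mule_ge0 ?lee_fin ?mulr_ge0. Qed.

Lemma top_ge0 x : (0 <= top k u x)%E.
Proof. by apply: integral_ge0 => y _; rewrite mule_ge0 ?lee_fin ?tin_ge0. Qed.

Lemma measurable_tin : measurable_fun [set: T * T] (fun z => tin k u z.1 z.2).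
Proof.
apply: (@measurable_fun_fubini_tonelli_F _ _ (T * T)%type T R lam
  (fun t => u t.2 * (k t.1.1 t.1.2 t.2 * S t.1.2 t.2)%:E)%E).
  apply: emeasurable_funM; first exact: (measurableT_comp mu measurable_snd).
  apply/measurable_EFinP; apply: measurable_funM => //.
  apply: (measurable2_comp mS) => //.
  exact: (measurableT_comp measurable_snd measurable_fst).
by move=> t; rewrite mule_ge0 ?lee_fin ?mulr_ge0.
Qed.

Lemma measurable_tin1 x : measurable_fun [set: T] (tin k u x).
Proof. exact: (measurableT_comp measurable_tin (pair1_measurable x)). Qed.

Lemma measurable_top : measurable_fun [set: T] (top k u).
Proof.
apply: (@measurable_fun_fubini_tonelli_F _ _ _ _ _ lam
  (fun t : T * T => tin k u t.1 t.2 * (Q t.1 t.2)%:E)%E).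
  by apply: emeasurable_funM; [exact: measurable_tin|exact/measurable_EFinP].
by move=> t; rewrite mule_ge0 ?lee_fin ?tin_ge0.
Qed.

Lemma measurable_kS x y : measurable_fun [set: T] (fun z => k x y z * S y z).
Proof.
apply: measurable_funM; first exact: (measurableT_comp mk (pair1_measurable (x, y))).
exact: (measurableT_comp mS (pair1_measurable y)).
Qed.

End one.

Lemma top_cst1 u x : top (fun _ _ _ => 1) u x = kop lam Q (kop lam S u) x.
Proof.
rewrite /top /kop; apply: eq_integral => y _; congr (_ * _)%E.
by apply: eq_integral => z _; rewrite mul1r.
Qed.

Lemma le_top k u v x : measurable3 k -> (forall x y z, 0 <= k x y z) ->
  measurable_fun [set: T] u -> measurable_fun [set: T] v ->
  (forall z, 0 <= u z)%E -> (forall z, u z <= v z)%E ->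
  (top k u x <= top k v x)%E.
Proof.
move=> mk k0 mu mv u0 uv; have v0 z : (0 <= v z)%E by rewrite (le_trans (u0 z)).
have mQx : measurable_fun [set: T] (EFin \o Q x).
  by apply/measurable_EFinP; exact: (measurableT_comp mQ (pair1_measurable x)).
apply: le_integral_nneg.
- apply: emeasurable_funM => //; exact: measurable_tin1.
- apply: emeasurable_funM => //; exact: measurable_tin1.
- by move=> y; rewrite mule_ge0 ?lee_fin ?tin_ge0.
- move=> y; rewrite lee_wpmul2r ?lee_fin//; apply: le_integral_nneg.
  + by apply: emeasurable_funM => //; apply/measurable_EFinP; exact: measurable_kS.
  + by apply: emeasurable_funM => //; apply/measurable_EFinP; exact: measurable_kS.
  + by move=> z; rewrite mule_ge0 ?lee_fin ?mulr_ge0.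
  + by move=> z; rewrite lee_wpmul2r ?lee_fin ?mulr_ge0.
Qed.

(** Hoelder's inequality is applied at the end point z and then at the middle point y, interpolating
    the likelihood ratio together with the function. *)
Lemma top_hoelder k1 k2 u v x (t : R) : 0 < t < 1 ->
  measurable3 k1 -> measurable3 k2 ->
  (forall x y z, 0 <= k1 x y z) -> (forall x y z, 0 <= k2 x y z) ->
  measurable_fun [set: T] u -> measurable_fun [set: T] v ->
  (forall z, 0 <= u z)%E -> (forall z, 0 <= v z)%E ->
  (top (fun x y z => (k1 x y z `^ t * k2 x y z `^ (1 - t))%R)
       (fun z => u z `^ t * v z `^ (1 - t)) x <=
   top k1 u x `^ t * top k2 v x `^ (1 - t))%E.
Proof.
move=> t01 mk1 mk2 k10 k20 mu mv u0 v0; have /andP[t0 t1] := t01.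
have mQx : measurable_fun [set: T] (Q x).
  exact: (measurableT_comp mQ (pair1_measurable x)).
have mt1 := measurable_tin1 mk1 k10 mu u0 x.
have mt2 := measurable_tin1 mk2 k20 mv v0 x.
apply: le_trans (hoelder_weight lam mQx (Q0 x) t01 mt1 mt2 (tin_ge0 k10 u0 x) (tin_ge0 k20 v0 x)).
apply: le_integral_nneg.
- apply: emeasurable_funM; last exact/measurable_EFinP.
  apply: measurable_tin1.
  + apply: measurable_funM; first exact: (measurableT_comp (measurable_powR t) mk1).
    exact: (measurableT_comp (measurable_powR (1 - t)) mk2).
  + by move=> *; rewrite mulr_ge0 ?powR_ge0.
  + by apply: emeasurable_funM; exact: measurable_poweR_fun.
  + by move=> z; rewrite mule_ge0 ?poweR_ge0.
- apply: emeasurable_funM; last exact/measurable_EFinP.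
  by apply: emeasurable_funM; exact: measurable_poweR_fun.
- move=> y; rewrite mule_ge0 ?lee_fin ?tin_ge0// => *; rewrite ?mule_ge0 ?mulr_ge0 ?powR_ge0 ?poweR_ge0//.
- move=> y; rewrite lee_wpmul2r ?lee_fin//.
  have mSy : measurable_fun [set: T] (S y).
    exact: (measurableT_comp mS (pair1_measurable y)).
  have mk1e : measurable_fun [set: T] (fun z => u z * (k1 x y z)%:E)%E.
    apply: emeasurable_funM => //; apply/measurable_EFinP.
    exact: (measurableT_comp mk1 (pair1_measurable (x, y))).
  have mk2e : measurable_fun [set: T] (fun z => v z * (k2 x y z)%:E)%E.
    apply: emeasurable_funM => //; apply/measurable_EFinP.
    exact: (measurableT_comp mk2 (pair1_measurable (x, y))).
  have uk0 z : (0 <= u z * (k1 x y z)%:E)%E by rewrite mule_ge0 ?lee_fin.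
  have vk0 z : (0 <= v z * (k2 x y z)%:E)%E by rewrite mule_ge0 ?lee_fin.
  have := hoelder_weight lam mSy (S0 y) t01 mk1e mk2e uk0 vk0.
  rewrite /tin.
  under [X in (_ <= X `^ _ * _)%E -> _]eq_integral do rewrite -muleA -EFinM.
  under [X in (_ <= _ * X `^ _)%E -> _]eq_integral do rewrite -muleA -EFinM.
  apply: le_trans; rewrite le_eqVlt; apply/orP; left; apply/eqP.
  apply: eq_integral => z _.
  by rewrite !poweRM ?lee_fin// !poweR_EFin [X in _ = (X * _)%E]muleACA !EFinM !muleA.
Qed.

End tilted_operator.

(** Reversibility of the proximal step. After detailed balance both sides are integrals against S y
    x, S y z and b y, in which the two end points play the same role; only the ratio distinguishes
    them, and its arguments get reversed. *)
Lemma top_duality d (T : measurableType d) (R : realType)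
    (lam : {sigma_finite_measure set T -> \bar R}) (Q S : T -> T -> R)
    (w b : T -> R) (k : T -> T -> T -> R) (u v : T -> \bar R) :
  measurable_fun [set: T * T] (fun z => Q z.1 z.2) ->
  measurable_fun [set: T * T] (fun z => S z.1 z.2) ->
  measurable_fun [set: T] w ->
  (forall x y, 0 <= Q x y) -> (forall x y, 0 <= S x y) ->
  (forall x, 0 <= w x) -> (forall x, 0 <= b x) ->
  (forall x y, Q x y * w x = S y x * b y) ->
  measurable3 k -> (forall x y z, 0 <= k x y z) ->
  measurable_fun [set: T] u -> measurable_fun [set: T] v ->
  (forall x, 0 <= u x)%E -> (forall x, 0 <= v x)%E ->
  (\int[lam]_x (u x * top lam Q S k v x * (w x)%:E) =
   \int[lam]_z (v z * top lam Q S (fun z y x => k x y z) u z * (w z)%:E))%E.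
Proof.
move=> mQ mS mw Q0 S0 w0 b0 QS mk k0 mu mv u0 v0.
pose k' := fun z y x => k x y z.
have mk' : measurable3 k'.
  apply: (measurableT_comp mk (g := fun t => ((t.2, t.1.2), t.1.1))).
  apply: measurable_fun_pair; last exact: (measurableT_comp measurable_fst measurable_fst).
  apply: measurable_fun_pair => //; exact: (measurableT_comp measurable_snd measurable_fst).
have k'0 x y z : 0 <= k' x y z by exact: k0.
(* One use of detailed balance replaces [Q x y * w x] by [S y x * b y]. It is applied to both sides,
   the second time with the reversed ratio. *)
have half (k1 : T -> T -> T -> R) (u1 v1 : T -> \bar R) : measurable3 k1 ->
    (forall x y z, 0 <= k1 x y z) ->
    measurable_fun [set: T] u1 -> measurable_fun [set: T] v1 ->
    (forall x, 0 <= u1 x)%E -> (forall x, 0 <= v1 x)%E ->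
    (\int[lam]_x (u1 x * top lam Q S k1 v1 x * (w x)%:E) =
     \int[lam]_y \int[lam]_x (u1 x * tin lam S k1 v1 x y * (S y x * b y)%:E))%E.
  move=> mk1 k10 mu1 mv1 u10 v10.
  pose F (z : T * T) := (u1 z.1 * tin lam S k1 v1 z.1 z.2 * (Q z.1 z.2 * w z.1)%:E)%E.
  have F0 z : (0 <= F z)%E.
    by rewrite /F !mule_ge0 ?lee_fin ?mulr_ge0// tin_ge0.
  have mF : measurable_fun [set: T * T] F.
    apply: emeasurable_funM.
      apply: emeasurable_funM; first exact: (measurableT_comp mu1 measurable_fst).
      exact: (@measurable_tin _ _ _ lam S mS S0 k1 v1 mk1 k10 mv1 v10).
    apply/measurable_EFinP; apply: measurable_funM => //.
    exact: (measurableT_comp mw measurable_fst).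
  transitivity (\int[lam]_x \int[lam]_y F (x, y))%E.
    apply: eq_integral => x _; rewrite /top /F/=.
    rewrite -muleA [X in (_ * X)%E]muleC muleA -ge0_integralZl//.
    - apply: eq_integral => y _; rewrite EFinM -!muleA; congr (_ * _)%E.
      by rewrite muleC -!muleA; congr (_ * _)%E.
    - apply: emeasurable_funM; first exact: (@measurable_tin1 _ _ _ lam S mS S0 k1 v1 mk1 k10 mv1 v10).
      apply/measurable_EFinP; exact: (measurableT_comp mQ (pair1_measurable x)).
    - by move=> y _; rewrite mule_ge0 ?lee_fin ?tin_ge0.
    - by rewrite mule_ge0 ?lee_fin.
  rewrite (fubini_tonelli F mF F0); apply: eq_integral => y _.
  by apply: eq_integral => x _; rewrite /F/= QS.
rewrite (half k u v mk k0 mu mv u0 v0) (half k' v u mk' k'0 mv mu v0 u0); clear half; apply: eq_integral => y _.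
pose H (z : T * T) := (u z.1 * v z.2 * (k z.1 y z.2 * S y z.1 * S y z.2 * b y)%:E)%E.
have H0 z : (0 <= H z)%E by rewrite /H !mule_ge0 ?lee_fin ?mulr_ge0.
have mSy : measurable_fun [set: T] (S y) by exact: (measurableT_comp mS (pair1_measurable y)).
have mH : measurable_fun [set: T * T] H.
  apply: emeasurable_funM.
    apply: emeasurable_funM; first exact: (measurableT_comp mu measurable_fst).
    exact: (measurableT_comp mv measurable_snd).
  apply/measurable_EFinP; apply: measurable_funM => //.
  apply: measurable_funM; last exact: (measurableT_comp mSy measurable_snd).
  apply: measurable_funM; last exact: (measurableT_comp mSy measurable_fst).
  apply: (measurableT_comp mk (g := fun t : T * T => ((t.1, y), t.2))).
  by apply: measurable_fun_pair => //; apply: measurable_fun_pair.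
transitivity (\int[lam]_x \int[lam]_z H (x, z))%E.
  apply: eq_integral => x _; rewrite /tin /H/=.
  rewrite -muleA [X in (_ * X)%E]muleC muleA -ge0_integralZl//.
  - apply: eq_integral => z _; rewrite -!muleA; congr (_ * _)%E.
    rewrite muleCA; congr (_ * _)%E; rewrite -!EFinM; congr EFin; ring.
  - apply: emeasurable_funM => //; apply/measurable_EFinP; exact: measurable_kS.
  - by move=> z _; rewrite mule_ge0 ?lee_fin ?mulr_ge0.
  - by rewrite mule_ge0 ?lee_fin ?mulr_ge0.
rewrite (fubini_tonelli H mH H0); apply: eq_integral => z _; rewrite /tin /H/=.
rewrite -muleA [X in _ = (_ * X)%E]muleC muleA -ge0_integralZl//.
- apply: eq_integral => x _; rewrite [in LHS](muleC (u x)) -!muleA; congr (_ * _)%E.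
  rewrite [RHS]muleCA; congr (_ * _)%E; rewrite -!EFinM; congr EFin; rewrite /k'; ring.
- apply: emeasurable_funM => //; apply/measurable_EFinP; exact: measurable_kS.
- by move=> x _; rewrite mule_ge0 ?lee_fin ?mulr_ge0.
- by rewrite mule_ge0 ?lee_fin ?mulr_ge0.
Qed.

(** The pair of conditions under which extended real integrals can be exchanged and compared without
    integrability; it is stable under all the operators in use. *)
Definition nnmf d (T : measurableType d) (R : realType) (u : T -> \bar R) :=
  measurable_fun [set: T] u /\ (forall x, 0 <= u x)%E.

Section nnmf.
Context d (T : measurableType d) (R : realType).
Implicit Types u v : T -> \bar R.

Lemma nnmfM u v : nnmf u -> nnmf v -> nnmf (fun x => u x * v x)%E.
Proof.
by move=> [mu u0] [mv v0]; split=> [|x]; [exact: emeasurable_funM|rewrite mule_ge0].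
Qed.

Lemma nnmf_poweR u p : nnmf u -> nnmf (fun x => u x `^ p)%E.
Proof.
by move=> [mu u0]; split=> [|x]; [exact: measurable_poweR_fun|rewrite poweR_ge0].
Qed.

Lemma nnmf_EFin (f : T -> R) : measurable_fun [set: T] f -> (forall x, 0 <= f x) ->
  nnmf (fun x => (f x)%:E).
Proof. by move=> mf f0; split=> [|x]; [exact/measurable_EFinP|rewrite lee_fin]. Qed.

Lemma nnmf_cst (c : \bar R) : (0 <= c)%E -> nnmf (fun _ : T => c).
Proof. by move=> c0; split. Qed.

Lemma nnmf_kop (lam : {sigma_finite_measure set T -> \bar R}) (K : T -> T -> R) u :
  measurable_fun [set: T * T] (fun z => K z.1 z.2) -> (forall x y, 0 <= K x y) ->
  nnmf u -> nnmf (kop lam K u).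
Proof.
by move=> mK K0 [mu u0]; split=> [|x]; [exact: measurable_kop|exact: kop_ge0].
Qed.

Lemma nnmf_top (lam : {sigma_finite_measure set T -> \bar R}) (Q S : T -> T -> R) (k : T -> T -> T -> R) u :
  measurable_fun [set: T * T] (fun z => Q z.1 z.2) ->
  measurable_fun [set: T * T] (fun z => S z.1 z.2) ->
  (forall x y, 0 <= Q x y) -> (forall x y, 0 <= S x y) ->
  measurable3 k -> (forall x y z, 0 <= k x y z) ->
  nnmf u -> nnmf (top lam Q S k u).
Proof.
by move=> mQ mS Q0 S0 mk k0 [mu u0]; split=> [|x]; [exact: measurable_top|exact: top_ge0].
Qed.

End nnmf.

Lemma measurable3_rev d (T : measurableType d) (R : realType) (k : T -> T -> T -> R) :
  measurable3 k -> measurable3 (fun z y x => k x y z).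
Proof.
move=> mk; apply: (measurableT_comp mk (g := fun t => ((t.2, t.1.2), t.1.1))).
apply: measurable_fun_pair; last exact: (measurableT_comp measurable_fst measurable_fst).
apply: measurable_fun_pair => //; exact: (measurableT_comp measurable_snd measurable_fst).
Qed.

Lemma measurable3_powR d (T : measurableType d) (R : realType) (k : T -> T -> T -> R) p :
  measurable3 k -> measurable3 (fun x y z => k x y z `^ p).
Proof. by move=> mk; exact: (measurableT_comp (measurable_powR p) mk). Qed.

Lemma half01 (R : realType) : 0 < (2^-1 : R) < 1.
Proof. by rewrite invr_gt0 ltr0n invf_lt1 ?ltr1n. Qed.

Lemma onem_half (R : realType) : 1 - 2^-1 = 2^-1 :> R.
Proof. by field. Qed.

Section two_stage_chain.
Context d (T : measurableType d) (R : realType)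
  (lam : {sigma_finite_measure set T -> \bar R}).
Variables (Q S : T -> T -> R) (w b : T -> R).
Hypotheses (mQ : measurable_fun [set: T * T] (fun z => Q z.1 z.2))
  (mS : measurable_fun [set: T * T] (fun z => S z.1 z.2))
  (mw : measurable_fun [set: T] w) (mb : measurable_fun [set: T] b).
Hypotheses (Q0 : forall x y, 0 <= Q x y) (S0 : forall x y, 0 <= S x y)
  (w0 : forall x, 0 <= w x) (b0 : forall x, 0 <= b x).
Hypothesis (QS : forall x y, Q x y * w x = S y x * b y).
Hypotheses (Q1 : forall x, (\int[lam]_y (Q x y)%:E = 1)%E)
  (S1 : forall x, (\int[lam]_y (S x y)%:E = 1)%E).
Implicit Types (u v f g W : T -> \bar R) (p n : R).

Local Notation prox := (fun u => kop lam Q (kop lam S u)).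

Lemma nnmf_prox u : nnmf u -> nnmf (prox u).
Proof. by move=> hu; apply: nnmf_kop => //; exact: nnmf_kop. Qed.

Lemma nnmf_iter_prox u k : nnmf u -> nnmf (iter k prox u).
Proof. by move=> hu; elim: k => //= k IH; exact: nnmf_prox. Qed.

Lemma prox_le u v x : nnmf u -> nnmf v -> (forall x, u x <= v x)%E ->
  (prox u x <= prox v x)%E.
Proof.
move=> hu hv uv; have [mSu Su0] := nnmf_kop lam mS S0 hu.
have [mSv Sv0] := nnmf_kop lam mS S0 hv.
by apply: le_kop => // y; apply: le_kop => //; [case: hu|case: hv|case: hu].
Qed.

Lemma prox_jensen u p x : 1 <= p -> nnmf u ->
  (prox u x `^ p <= prox (fun x => u x `^ p)%E x)%E.
Proof.
move=> p1 hu; have [mSu Su0] := nnmf_kop lam mS S0 hu.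
have [mup up0] := nnmf_poweR p hu.
have [mSup Sup0] := nnmf_kop lam mS S0 (nnmf_poweR p hu).
apply: (@le_trans _ _ (kop lam Q (fun y => (kop lam S u y) `^ p)%E x)).
  exact: kop_jensen.
have [mSp Sp0] := nnmf_poweR p (nnmf_kop lam mS S0 hu).
apply: le_kop => // y; have [mu u0] := hu; exact: kop_jensen.
Qed.

Lemma kop_duality_QS u v : nnmf u -> nnmf v ->
  (\int[lam]_x (u x * kop lam Q v x * (w x)%:E) =
   \int[lam]_y (kop lam S u y * v y * (b y)%:E))%E.
Proof. by move=> [mu u0] [mv v0]; exact: (kop_duality lam mQ mw mb Q0 S0 w0 b0 QS mS). Qed.

Section comparison.
Variables (r : T -> T -> T -> R) (g0 : T -> R).
Hypotheses (mr : measurable3 r) (r0 : forall x y z, 0 <= r x y z)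
  (mg0 : measurable_fun [set: T] g0) (g00 : forall x, 0 <= g0 x).

Local Notation e0 := (fun x => (g0 x)%:E).
(** [fwd] transports densities relative to [w] along the reweighted chain, [bwd] acts on functions
    of the end point. They are dual to each other, hence the opposite orders of the arguments of
    [r]. *)
Local Notation fwd p := (top lam Q S (fun z y x => r x y z `^ p)).
Local Notation bwd p := (top lam Q S (fun x y z => r x y z `^ p)).

Let mrf p : measurable3 (fun z y x => r x y z `^ p).
Proof. exact: (measurable3_rev (measurable3_powR p mr)). Qed.

Let rf0 p (x y z : T) : 0 <= r x y z `^ p.
Proof. exact: powR_ge0. Qed.

Lemma nnmf_iter_fwd p k : nnmf (iter k (fwd p) e0).
Proof.
by elim: k => [|k IH]; [exact: nnmf_EFin|apply: nnmf_top => //; exact: mrf].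
Qed.

Lemma nnmf_iter_bwd p k u : nnmf u -> nnmf (iter k (bwd p) u).
Proof.
move=> hu; elim: k => [//|k IH]; apply: nnmf_top => //; exact: measurable3_powR.
Qed.

(** The chain reweighted by r interpolates, step by step, between the chain reweighted by r^p and
    the proximal chain, whose ratio is 1. Hoelder's inequality with weight 1/p carries the bound
    from one step to the next. *)
Lemma iter_fwd_le p k x : 1 < p ->
  (iter k (fwd 1) e0 x <=
   (iter k (fwd p) e0 x) `^ p^-1 * (iter k prox e0 x) `^ (1 - p^-1))%E.
Proof.
move=> p1; have p0 : 0 < p by rewrite (lt_trans ltr01).
have t01 : 0 < p^-1 < 1 by rewrite invr_gt0 p0 invf_lt1.
have hg : nnmf e0 by exact: nnmf_EFin.
elim: k x => [|k IH] x /=; first by rewrite poweR_split.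
have [mf f0] := nnmf_iter_fwd 1 k; have hW := nnmf_iter_fwd p k.
have hgk := nnmf_iter_prox k hg.
have [mB B0] := nnmfM (nnmf_poweR p^-1 hW) (nnmf_poweR (1 - p^-1) hgk).
apply: (@le_trans _ _ (fwd 1 (fun x => iter k (fwd p) e0 x `^ p^-1 * iter k prox e0 x `^ (1 - p^-1))%E x)).
  by apply: le_top => //; exact: mrf.
rewrite -top_cst1.
have -> : (fun z y x => r x y z `^ 1) = (fun z y x =>
    (r x y z `^ p) `^ p^-1 * (1 : R) `^ (1 - p^-1)).
  apply/funext => z; apply/funext => y; apply/funext => x'.
  by rewrite -powRrM mulfV ?gt_eqF// powR1 mulr1.
have [mW W0] := hW; have [mgk gk0] := hgk.
exact: (@top_hoelder _ _ _ lam Q S mQ mS Q0 S0 (fun z y x => r x y z `^ p) (fun _ _ _ => 1)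
  (iter k (fwd p) e0) (iter k prox e0) x p^-1 t01 (mrf p) (measurable_cst _)
  (fun x y z => powR_ge0 _ _) (fun _ _ _ => ler01) mW mgk W0 gk0).
Qed.

(** Duality moves the steps one at a time from the initial density to the test function. With u = 1,
    the total mass becomes a mean under the initial law of a backward functional. *)
Lemma iter_fwd_mass p k u : nnmf u ->
  (\int[lam]_x (iter k (fwd p) e0 x * u x * (w x)%:E) =
   \int[lam]_x (e0 x * iter k (bwd p) u x * (w x)%:E))%E.
Proof.
elim: k u => [//|k IH] u hu; rewrite [in RHS]iterSr -IH; last first.
  by apply: nnmf_top => //; exact: measurable3_powR.
rewrite iterS; have [mf f0] := nnmf_iter_fwd p k; have [mu u0] := hu.
rewrite (top_duality lam mQ mS mw Q0 S0 w0 b0 QS (measurable3_powR p mr) (fun x y z => powR_ge0 _ _) mf mu f0 u0).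
by apply: eq_integral => x _; congr (_ * _)%E; rewrite muleC.
Qed.

Variables (ec : T -> R) (p n : R).
Hypotheses (mec : measurable_fun [set: T] ec) (n1 : 1 <= n).
Hypothesis rate : forall x, (bwd (2 * p) (fun=> 1%E) x <= (ec x)%:E)%E.

(** One step of the proximal chain with potential n ln ec. The power n anticipates the use of
    Jensen's inequality in [mass_le]. *)
Definition feynman_kac u x := ((ec x `^ n)%:E * prox u x)%E.

Lemma nnmf_feynman_kac u : nnmf u -> nnmf (feynman_kac u).
Proof.
move=> hu; apply: nnmfM; last exact: nnmf_prox.
by apply: nnmf_EFin => [|x]; [exact: (measurableT_comp (measurable_powR n) mec)|exact: powR_ge0].
Qed.

Lemma nnmf_iter_fk k u : nnmf u -> nnmf (iter k feynman_kac u).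
Proof. by move=> hu; elim: k => //= k IH; exact: nnmf_feynman_kac. Qed.

(** Cauchy-Schwarz separates the ratio from u and leaves the ratio moment of order 2p and prox(u^2).
    After raising to the power 2n, Jensen's inequality replaces prox(u^2)^n by prox(u^(2n)), so the
    exponent 2n is reproduced and the bound can be iterated. *)
Lemma bwd_le u x : nnmf u ->
  (bwd p u x `^ (2 * n) <= feynman_kac (fun x => u x `^ (2 * n))%E x)%E.
Proof.
move=> hu; have n0 : 0 < n by rewrite (lt_le_trans ltr01).
have t01 := half01 R.
have [mu2 u20] := nnmf_poweR 2 hu; have [mu u0] := hu.
have H : (bwd p u x <= (bwd (2 * p) (fun=> 1%E) x) `^ 2^-1 *
    prox (fun x => u x `^ 2)%E x `^ 2^-1)%E.
  have := @top_hoelder _ _ _ lam Q S mQ mS Q0 S0 (fun x y z => r x y z `^ (2 * p))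
    (fun _ _ _ => 1) (fun=> 1%E) (fun x => u x `^ 2)%E x 2^-1 t01 (measurable3_powR _ mr)
    (measurable_cst _) (fun x y z => powR_ge0 _ _) (fun _ _ _ => ler01) (measurable_cst _)
    mu2 (fun=> lee01) u20.
  rewrite top_cst1 onem_half.
  have -> : (fun x y z => (r x y z `^ (2 * p)) `^ 2^-1 * (1 : R) `^ 2^-1) = (fun x y z => r x y z `^ p).
    apply/funext => a; apply/funext => c; apply/funext => e.
    by rewrite powR1 mulr1 -powRrM mulrAC mulfV ?mul1r.
  have -> : (fun z => 1 `^ 2^-1 * (u z `^ 2) `^ 2^-1)%E = u; last by [].
  by apply/funext => z; rewrite poweR1r mul1e poweRK.
have hA : nnmf (bwd p u) by apply: nnmf_top => //; exact: measurable3_powR.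
apply: (@le_trans _ _ (((ec x)%:E `^ 2^-1 * prox (fun x => u x `^ 2)%E x `^ 2^-1) `^ (2 * n))%E).
  apply: lee_poweR; [by rewrite mulr_ge0 ?ltW|by case: hA|].
  apply: le_trans H _; rewrite lee_wpmul2r ?poweR_ge0//.
  apply: lee_poweR => //; apply: top_ge0 => //; by move=> *; rewrite powR_ge0.
have hu2 := nnmf_poweR 2 hu; have [_ P20] := nnmf_prox hu2.
rewrite poweRM ?poweR_ge0// -!poweRrM mulrA mulVf ?mul1r// poweR_EFin.
rewrite /feynman_kac lee_wpmul2l ?lee_fin ?powR_ge0//.
apply: le_trans (prox_jensen x n1 hu2) _.
rewrite le_eqVlt; apply/orP; left; apply/eqP; congr (kop _ _ (kop _ _ _) x).
by apply/funext => z; rewrite -poweRrM.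
Qed.

Lemma fk_le u v x : nnmf u -> nnmf v -> (forall x, u x <= v x)%E ->
  (feynman_kac u x <= feynman_kac v x)%E.
Proof.
by move=> hu hv uv; rewrite lee_wpmul2l ?lee_fin ?powR_ge0//; exact: prox_le.
Qed.

Lemma iter_bwd_le k x :
  ((iter k (bwd p) (fun=> 1%E) x) `^ (2 * n) <= iter k feynman_kac (fun=> 1%E) x)%E.
Proof.
have h1 : nnmf (fun _ : T => 1%E : \bar R) by exact: nnmf_cst.
elim: k x => [|k IH] x; first by rewrite poweR1r lexx.
apply: le_trans (bwd_le x (nnmf_iter_bwd p k h1)) _.
by apply: fk_le => //; [exact/nnmf_poweR/nnmf_iter_bwd|exact: nnmf_iter_fk].
Qed.

Hypothesis gw1 : (\int[lam]_x (g0 x * w x)%:E = 1)%E.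

(** Jensen's inequality for the initial law with exponent 2n divides the logarithm of the
    Feynman-Kac mean by 2n. A cost that is large but fixed becomes harmless for large n. *)
Lemma mass_le k : (\int[lam]_x (iter k (fwd p) e0 x * (w x)%:E) <=
  (\int[lam]_x (iter k feynman_kac (fun=> 1%E) x * (g0 x * w x)%:E)) `^ (2 * n)^-1)%E.
Proof.
have n0 : 0 < n by rewrite (lt_le_trans ltr01).
have n2 : 1 <= 2 * n by rewrite (le_trans n1)// ler_peMl ?ler1n// ltW.
have h1 : nnmf (fun _ : T => 1%E : \bar R) by exact: nnmf_cst.
have := iter_fwd_mass p k h1.
under eq_integral do rewrite mule1.
move=> ->; rewrite -[leLHS](@poweRK _ _ (2 * n)); last 2 first.
  by rewrite gt_eqF// mulr_gt0.
  have [_ B0] := nnmf_iter_bwd p k h1.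
  by apply: integral_ge0 => x _; rewrite !mule_ge0 ?lee_fin.
apply: lee_poweR; [by rewrite invr_ge0 mulr_ge0 ?ltW|exact: poweR_ge0|].
have [mA A0] := nnmf_iter_bwd p k h1.
under eq_integral do rewrite muleAC -EFinM muleC.
have mgw : measurable_fun [set: T] (fun x => g0 x * w x) by exact: measurable_funM.
have gw0 x : 0 <= g0 x * w x by rewrite mulr_ge0.
apply: le_trans (jensen_poweR mgw gw0 n2 gw1 mA A0) _.
have [mA2 A20] := nnmf_poweR (2 * n) (conj mA A0).
have [mF F0] := nnmf_iter_fk k h1.
apply: le_integral_nneg.
- by apply: emeasurable_funM => //; exact/measurable_EFinP.
- by apply: emeasurable_funM => //; exact/measurable_EFinP.
- by move=> x; rewrite mule_ge0 ?lee_fin.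
- by move=> x; rewrite lee_wpmul2r ?lee_fin ?iter_bwd_le.
Qed.

End comparison.

(** The power q of the interpolation bound is W^(1/2) (g^(2q - 1))^(1/2), and Cauchy-Schwarz
    applies. The order 2q - 1 originates here. *)
Lemma hoelder_densities f W g q : 1 < q -> nnmf f -> nnmf W -> nnmf g ->
  (forall x, f x <= W x `^ (2 * q)^-1 * g x `^ (1 - (2 * q)^-1))%E ->
  (\int[lam]_x (f x `^ q * (w x)%:E) <=
   (\int[lam]_x (W x * (w x)%:E)) `^ 2^-1 *
   (\int[lam]_x (g x `^ (2 * q - 1) * (w x)%:E)) `^ 2^-1)%E.
Proof.
move=> q1 hf hW hg fle; have q0 : 0 < q by rewrite (lt_trans ltr01).
have t01 := half01 R; have hg' := nnmf_poweR (2 * q - 1) hg.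
apply: (@le_trans _ _ (\int[lam]_x (W x `^ 2^-1 * (g x `^ (2 * q - 1)) `^ (1 - 2^-1) * (w x)%:E))%E).
  have [mf f0] := hf.
  apply: le_integral_nneg.
  - exact: (nnmfM (nnmf_poweR q hf) (nnmf_EFin mw w0)).1.
  - exact: (nnmfM (nnmfM (nnmf_poweR 2^-1 hW) (nnmf_poweR (1 - 2^-1) hg')) (nnmf_EFin mw w0)).1.
  - by move=> x; rewrite mule_ge0 ?poweR_ge0 ?lee_fin.
  - move=> x; rewrite lee_wpmul2r ?lee_fin//.
    apply: (@le_trans _ _ ((W x `^ (2 * q)^-1 * g x `^ (1 - (2 * q)^-1)) `^ q)%E).
      by apply: lee_poweR => //; exact: ltW.
    rewrite poweRM ?poweR_ge0// -!poweRrM le_eqVlt; apply/orP; left; apply/eqP.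
    by congr (_ `^ _ * _ `^ _)%E; field; rewrite gt_eqF.
have [mW W0] := hW; have [mg' g'0] := hg'.
by have := hoelder_weight lam mw w0 t01 mW mg' W0 g'0; rewrite onem_half.
Qed.

Lemma compare_chains (r : T -> T -> T -> R) (g0 ec : T -> R) (q n : R) k :
  measurable3 r -> (forall x y z, 0 <= r x y z) ->
  measurable_fun [set: T] g0 -> (forall x, 0 <= g0 x) ->
  measurable_fun [set: T] ec ->
  1 < q -> 1 <= n ->
  (forall x, (top lam Q S (fun x y z => (r x y z `^ (4 * q))%R) (fun=> 1) x <= (ec x)%:E)%E) ->
  (\int[lam]_x (g0 x * w x)%:E = 1)%E ->
  (\int[lam]_x ((iter k (top lam Q S (fun z y x => r x y z)) (fun x => (g0 x)%:E) x) `^ q * (w x)%:E) <=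
   (\int[lam]_x (iter k (feynman_kac ec n) (fun=> 1) x * (g0 x * w x)%:E)) `^ (4 * n)^-1 *
   (\int[lam]_x ((iter k prox (fun x => (g0 x)%:E) x) `^ (2 * q - 1) * (w x)%:E)) `^ 2^-1)%E.
Proof.
move=> mr r0 mg0 g00 mec q1 n1 rate gw1.
have q0 : 0 < q by rewrite (lt_trans ltr01).
have n0 : 0 < n by rewrite (lt_le_trans ltr01).
have p0 : 0 < 2 * q by rewrite mulr_gt0.
have p1 : 1 < 2 * q by rewrite (lt_trans q1)// ltr_pMl// ltr1n.
have r1E : (fun z y x => r x y z `^ 1) = (fun z y x => r x y z).
  by apply/funext => x; apply/funext => y; apply/funext => z; rewrite powRr1.
have hf := nnmf_iter_fwd mr mg0 g00 1 k; rewrite r1E in hf.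
have hW := nnmf_iter_fwd mr mg0 g00 (2 * q) k.
have hg := nnmf_iter_prox k (nnmf_EFin mg0 g00).
have fle x := iter_fwd_le mr mg0 g00 k x p1; rewrite r1E in fle.
apply: le_trans (hoelder_densities q1 hf hW hg fle) _.
rewrite lee_wpmul2r ?poweR_ge0//.
have -> : (4 * n)^-1 = (2 * n)^-1 * 2^-1 :> R by field; rewrite gt_eqF.
have [_ W0] := hW.
rewrite poweRrM; apply: lee_poweR; first by rewrite invr_ge0.
  by apply: integral_ge0 => x _; rewrite mule_ge0 ?lee_fin.
(* The interpolation uses p = 2q, and Cauchy-Schwarz doubles it once more, hence the moment of order
   4q. *)
have rate' x : (top lam Q S (fun x y z => (r x y z `^ (2 * (2 * q)))%R) (fun=> 1) x <= (ec x)%:E)%E.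
  by rewrite mulrA -natrM; exact: rate.
exact: (mass_le mr mg0 g00 mec n1 rate' gw1).
Qed.

(** A weighted L^2 bound passes through one Feynman-Kac step. Cauchy-Schwarz with an intermediate
    weight v1 bounds (Q v)^2 by Q(v^2 v1) Q(1/v1). The second factor is compensated by v2 and the
    potential; the first returns to u by duality and Jensen, at the price of Q v1 <= v0. *)
Lemma weighted_step u (e v0 v1 v2 : T -> R) : nnmf u ->
  measurable_fun [set: T] e -> (forall x, 0 <= e x) ->
  measurable_fun [set: T] v0 -> (forall x, 0 <= v0 x) ->
  measurable_fun [set: T] v1 -> (forall x, 0 < v1 x) ->
  measurable_fun [set: T] v2 -> (forall x, 0 <= v2 x) ->
  (forall x, kop lam Q (fun y => (v1 y)%:E) x <= (v0 x)%:E)%E ->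
  (forall x, (e x `^ 2 * v2 x)%:E * kop lam Q (fun y => (v1 y)^-1%:E) x <= 1)%E ->
  (\int[lam]_x (((e x)%:E * prox u x) `^ 2 * (v2 x * w x)%:E) <=
   \int[lam]_x (u x `^ 2 * (v0 x * w x)%:E))%E.
Proof.
move=> hu me e0 mv0 v00 mv1 v10 mv2 v20 H1 H2; have [mu u0] := hu.
have v1ge x : 0 <= v1 x by rewrite ltW.
have hSu := nnmf_kop lam mS S0 hu; set v := kop lam S u in hSu *.
have hv1 := nnmf_EFin mv1 v1ge.
have iv0 x : 0 <= (v1 x)^-1 by rewrite invr_ge0.
have hiv : nnmf (fun y => (v1 y)^-1%:E).
  by apply: nnmf_EFin => //; exact: measurable_funV.
have hvv := nnmfM (nnmf_poweR 2 hSu) hv1; set vv := (fun x => _ * _)%E in hvv.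
have hQ := nnmf_kop lam mQ Q0 hvv.
have H3 x : (kop lam Q v x `^ 2 <= kop lam Q vv x * kop lam Q (fun y => (v1 y)^-1%:E) x)%E.
  have [[mvv vv0] [miv iv0']] := (hvv, hiv).
  have := @kop_geo _ _ _ lam Q mQ Q0 vv (fun y => (v1 y)^-1%:E) 2^-1 x (half01 R) mvv miv vv0 iv0'.
  rewrite onem_half.
  have -> : (fun y => vv y `^ 2^-1 * (v1 y)^-1%:E `^ 2^-1)%E = v.
    have [_ v0'] := hSu.
    apply/funext => y; rewrite -poweRM ?lee_fin//.
    by rewrite /vv -muleA -EFinM mulfV ?gt_eqF// mule1 poweRK.
  have hQv := nnmf_kop lam mQ Q0 hSu.
  move=> /(lee_poweR (ler0n R 2) (hQv.2 x)); rewrite poweRM ?poweR_ge0//.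
  by rewrite !poweRVK//; [exact: (nnmf_kop lam mQ Q0 hiv).2|exact: hQ.2].
have hP := nnmf_prox hu.
have mvw2 : measurable_fun [set: T] (fun x => v2 x * w x) by exact: measurable_funM.
have vw20 x : 0 <= v2 x * w x by rewrite mulr_ge0.
have mvw0 : measurable_fun [set: T] (fun x => v0 x * w x) by exact: measurable_funM.
have vw00 x : 0 <= v0 x * w x by rewrite mulr_ge0.
have heP := nnmf_poweR 2 (nnmfM (nnmf_EFin me e0) hP).
apply: (@le_trans _ _ (\int[lam]_x (1 * kop lam Q vv x * (w x)%:E))%E).
  apply: le_integral_nneg.
  - exact: (nnmfM heP (nnmf_EFin mvw2 vw20)).1.
  - exact: (nnmfM (nnmfM (nnmf_cst _ lee01) hQ) (nnmf_EFin mw w0)).1.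
  - by move=> x; rewrite mule_ge0 ?poweR_ge0 ?lee_fin.
  - move=> x; rewrite EFinM muleA lee_wpmul2r ?lee_fin// mul1e.
    rewrite poweRM ?lee_fin//; last exact: hP.2.
    rewrite poweR_EFin muleAC -EFinM.
    apply: (@le_trans _ _ ((e x `^ 2 * v2 x)%:E * (kop lam Q vv x *
       kop lam Q (fun y => (v1 y)^-1%:E) x))%E).
      by rewrite lee_wpmul2l ?H3// lee_fin mulr_ge0 ?powR_ge0.
    rewrite muleCA -[leRHS]mule1; apply: lee_wpmul2l; first exact: hQ.2.
    exact: H2.
rewrite (kop_duality_QS (nnmf_cst _ lee01) hvv).
apply: (@le_trans _ _ (\int[lam]_y (kop lam S (fun x => u x `^ 2)%E y * (v1 y)%:E * (b y)%:E))%E).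
  have hS2 := nnmf_kop lam mS S0 (nnmf_poweR 2 hu).
  apply: le_integral_nneg.
  - have hS1 := nnmf_kop lam mS S0 (nnmf_cst _ lee01).
    exact: (nnmfM (nnmfM hS1 hvv) (nnmf_EFin mb b0)).1.
  - exact: (nnmfM (nnmfM hS2 hv1) (nnmf_EFin mb b0)).1.
  - move=> y; rewrite (kop_cst mS S0 S1)// mul1e mule_ge0 ?lee_fin//; exact: hvv.2.
  - move=> y; rewrite lee_wpmul2r ?lee_fin// (kop_cst mS S0 S1)// mul1e.
    rewrite lee_wpmul2r ?lee_fin//; apply: kop_jensen => //; by rewrite ler1n.
rewrite -(kop_duality_QS (nnmf_poweR 2 hu) hv1).
apply: le_integral_nneg.
- exact: (nnmfM (nnmfM (nnmf_poweR 2 hu) (nnmf_kop lam mQ Q0 hv1)) (nnmf_EFin mw w0)).1.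
- exact: (nnmfM (nnmf_poweR 2 hu) (nnmf_EFin mvw0 vw00)).1.
- by move=> x; rewrite !mule_ge0 ?poweR_ge0 ?lee_fin//; exact: (nnmf_kop lam mQ Q0 hv1).2.
- move=> x; rewrite [in leRHS]EFinM muleA lee_wpmul2r ?lee_fin//.
  by rewrite lee_wpmul2l ?poweR_ge0.
Qed.

Lemma weighted_iter (ec : T -> R) n (V M : nat -> T -> R) N :
  measurable_fun [set: T] ec ->
  (forall k, measurable_fun [set: T] (V k)) -> (forall k x, 0 <= V k x) ->
  (forall k, measurable_fun [set: T] (M k)) -> (forall k x, 0 < M k x) ->
  (forall k x, (k < N)%N -> kop lam Q (fun y => (M k y)%:E) x <= (V k x)%:E)%E ->
  (forall k x, (k < N)%N -> ((ec x `^ n) `^ 2 * V k.+1 x)%:E *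
     kop lam Q (fun y => (M k y)^-1%:E) x <= 1)%E ->
  (\int[lam]_x ((iter N (feynman_kac ec n) (fun=> 1%E) x) `^ 2 * (V N x * w x)%:E) <=
   \int[lam]_x (V 0%N x * w x)%:E)%E.
Proof.
move=> mec mV V0 mM M0; elim: N => [|N IH] H1 H2.
  by under eq_integral do rewrite poweR1r mul1e.
have h1 : nnmf (fun _ : T => 1%E : \bar R) by exact: nnmf_cst.
have hk := nnmf_iter_fk n mec N h1.
have mecn := measurableT_comp (measurable_powR n) mec.
apply: le_trans (weighted_step hk mecn (fun x => powR_ge0 _ _) (mV N) (V0 N) (mM N) (M0 N)
  (mV N.+1) (V0 N.+1) _ _) _.
- by move=> x; exact: H1.
- by move=> x; exact: H2.
- by apply: IH => k x kN; [apply: H1|apply: H2]; rewrite ltnS ltnW.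
Qed.

End two_stage_chain.

(** * Decay of moments along the proximal sampler *)

Section decay.
Context d (T : measurableType d) (R : realType)
  (lam : {sigma_finite_measure set T -> \bar R}).
Variables (Q S : T -> T -> R) (w b : T -> R).
Hypotheses (mQ : measurable_fun [set: T * T] (fun z => Q z.1 z.2))
  (mS : measurable_fun [set: T * T] (fun z => S z.1 z.2))
  (mw : measurable_fun [set: T] w) (mb : measurable_fun [set: T] b).
Hypotheses (Q0 : forall x y, 0 <= Q x y) (S0 : forall x y, 0 <= S x y)
  (w0 : forall x, 0 <= w x) (b0 : forall x, 0 <= b x).
Hypothesis (QS : forall x y, Q x y * w x = S y x * b y).
Hypotheses (Q1 : forall x, (\int[lam]_y (Q x y)%:E = 1)%E)
  (S1 : forall x, (\int[lam]_y (S x y)%:E = 1)%E)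
  (w1 : (\int[lam]_x (w x)%:E = 1)%E).
Implicit Types (u v f g W : T -> \bar R) (p n : R).

Lemma integral_kopQ v : nnmf v ->
  (\int[lam]_x (kop lam Q v x * (w x)%:E) = \int[lam]_y (v y * (b y)%:E))%E.
Proof.
move=> hv.
have := kop_duality_QS lam mQ mS mw mb Q0 S0 w0 b0 QS (nnmf_cst T lee01) hv.
under eq_integral do rewrite mul1e.
by move=> ->; apply: eq_integral => y _; rewrite (kop_cst mS S0 S1)// mul1e.
Qed.

Lemma integral_kopS u : nnmf u ->
  (\int[lam]_y (kop lam S u y * (b y)%:E) = \int[lam]_x (u x * (w x)%:E))%E.
Proof.
move=> hu.
have := kop_duality_QS lam mQ mS mw mb Q0 S0 w0 b0 QS hu (nnmf_cst T lee01).
under [RHS]eq_integral do rewrite mule1.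
by move=> <-; apply: eq_integral => y _; rewrite (kop_cst mQ Q0 Q1)// mule1.
Qed.

(** With f = v + e and v e = M e, the variances of f and v under the kernel differ by the variance
    of e plus 2 (M - Q v) Q e, which is nonnegative. The inequality is written with sums because the
    moments of f may be infinite. *)
Lemma kop_truncation_variance f (M : R) x : nnmf f -> 0 <= M ->
  forall v, v = (fun y => mine (f y) M%:E) ->
  (kop lam Q (fun y => v y * v y) x + kop lam Q f x * kop lam Q f x <=
   kop lam Q (fun y => f y * f y) x + kop lam Q v x * kop lam Q v x)%E.
Proof.
move=> hf M0 v vdef; have [mf f0] := hf.
have vE' y : v y = mine (f y) M%:E by rewrite vdef.
pose e y := (maxe (f y - M%:E) 0)%E.
have me : measurable_fun [set: T] e.
  by apply: measurable_maxe => //; apply: emeasurable_funB.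
have e0 y : (0 <= e y)%E by rewrite le_max lexx orbT.
have mv : measurable_fun [set: T] v by rewrite vdef; exact: measurable_mine.
have v0 y : (0 <= v y)%E by rewrite vE' le_min f0 lee_fin.
have vM y : (v y <= M%:E)%E by rewrite vE' ge_min lexx orbT.
have fE y : (f y = v y + e y)%E.
  rewrite vE' /e; case: (f y) (f0 y) => [r r0| |//].
  - have [rM|Mr] := leP r M.
      rewrite min_l ?lee_fin// max_r ?adde0//.
      by rewrite -EFinB lee_fin subr_le0.
    rewrite min_r ?lee_fin ?(ltW Mr)// max_l; first by rewrite -EFinB -EFinD addrC subrK.
    by rewrite -EFinB lee_fin subr_ge0 ltW.
  - by rewrite min_r ?leey// max_l.
(* The excess [e] is nonzero only where [v] equals [M]. *)
have veE y : (v y * e y = M%:E * e y)%E.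
  rewrite vE' /e; case: (f y) (f0 y) => [r r0| |//].
  - have [rM|Mr] := leP r M.
      rewrite [X in (_ * X)%E]max_r ?mule0//; last by rewrite -EFinB lee_fin subr_le0.
      by rewrite max_r ?mule0// -EFinB lee_fin subr_le0.
    by rewrite min_r ?lee_fin ?(ltW Mr).
  - by rewrite min_r ?leey.
have hv : nnmf v by split.
have he : nnmf e by split.
have mQx : measurable_fun [set: T] (EFin \o Q x).
  by apply/measurable_EFinP; exact: measurable_kernel1.
have kD u1 u2 : nnmf u1 -> nnmf u2 ->
    (kop lam Q (fun y => u1 y + u2 y) x = kop lam Q u1 x + kop lam Q u2 x)%E.
  move=> [m1 u10] [m2 u20]; rewrite /kop -ge0_integralD//.
  - by apply: eq_integral => y _; rewrite ge0_muleDl.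
  - by move=> y _; rewrite mule_ge0 ?lee_fin.
  - exact: emeasurable_funM.
  - by move=> y _; rewrite mule_ge0 ?lee_fin.
  - exact: emeasurable_funM.
have hvv := nnmfM hv hv; have hee := nnmfM he he.
have Qfe : kop lam Q f x = (kop lam Q v x + kop lam Q e x)%E.
  by rewrite -kD//; congr (kop _ _ _ x); apply/funext.
have M2 : (0 <= (2 * M)%:E)%E by rewrite lee_fin mulr_ge0.
have hMe : nnmf (fun y => (2 * M)%:E * e y)%E by exact: (nnmfM (nnmf_cst T M2) he).
have hMee : nnmf (fun y => (2 * M)%:E * e y + e y * e y)%E.
  split=> [|y]; first by apply: emeasurable_funD; [case: hMe|case: hee].
  by rewrite adde_ge0 ?mule_ge0.
have Qff : (kop lam Q (fun y => f y * f y) x =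
    kop lam Q (fun y => v y * v y) x + ((2 * M)%:E * kop lam Q e x + kop lam Q (fun y => e y * e y) x))%E.
  rewrite -(kopZ lam mQ Q0)// -kD// -kD//; congr (kop _ _ _ x); apply/funext => y.
  rewrite fE ge0_muleDl// !ge0_muleDr// (muleC (e y) (v y)) veE.
  by rewrite -addeA; congr (_ + _)%E; rewrite addeA; congr (_ + _)%E; rewrite EFinM -ge0_muleDl ?lee_fin// -EFinD; congr (_%:E * _)%E; ring.
have kv0 : (0 <= kop lam Q v x)%E by exact: kop_ge0.
have ke0 : (0 <= kop lam Q e x)%E by exact: kop_ge0.
have kee : (kop lam Q e x * kop lam Q e x <= kop lam Q (fun y => e y * e y) x)%E.
  have sq (z : \bar R) : (0 <= z -> z * z = z `^ 2)%E.
    case: z => [r r0| |]//=; last by rewrite ?(eqr_nat R 2 0)//= mulyy.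
    by rewrite -EFinM powR_mulrn.
  rewrite sq//; have := kop_jensen mQ Q0 Q1 x (ler1n R 2) me e0.
  by under eq_fun do rewrite -sq//.
have kvM : (kop lam Q v x <= M%:E)%E.
  rewrite -[leRHS](kop_cst mQ Q0 Q1 x (_ : 0 <= M%:E)%E) ?lee_fin//.
  by apply: le_kop => // y; rewrite lee_fin.
rewrite Qff Qfe -addeA leeD2l//.
move: kv0 ke0 kee kvM; set kv := kop lam Q v x; set ke := kop lam Q e x.
move=> kv0 ke0 kee kvM.
rewrite (ge0_muleDl _ kv0 ke0) (ge0_muleDr _ kv0 ke0) (ge0_muleDr ke kv0 ke0).
rewrite -addeA addeC leeD2r// addeA leeD//.
rewrite (muleC ke kv) -(ge0_muleDl _ kv0 kv0) lee_wpmul2r//.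
by rewrite mulr_natl mulr2n EFinD leeD.
Qed.

(** The loss F - F' dominates the mean variance of rho^(p/2) under Q, hence that of its truncation,
    a - c. The assumption on v bounds c - m^2, the variance of Q v, by this loss; m^2 is controlled
    by F because rho has mass 1, and truncation costs [tau]. *)
Lemma decay_step (rho : T -> \bar R) (p M tau B e F : R) :
  nnmf rho -> 2 < p -> 0 <= M -> 0 <= B ->
  (\int[lam]_y (rho y * (b y)%:E) = 1)%E ->
  (\int[lam]_y (rho y `^ p * (b y)%:E) = F%:E)%E ->
  (\int[lam]_y ((if rho y `^ (p / 2) <= M%:E then 0 else rho y `^ p) * (b y)%:E) <= tau%:E)%E ->
  (forall v : T -> R, measurable_fun [set: T] v -> (forall y, 0 <= v y <= M) ->
    exists a c m : R, [/\ (\int[lam]_y (v y ^+ 2 * b y)%:E = a%:E)%E,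
      (\int[lam]_x (kop lam Q (EFin \o v) x * kop lam Q (EFin \o v) x * (w x)%:E) = c%:E)%E,
      (\int[lam]_y (v y * b y)%:E = m%:E)%E & c - m ^+ 2 <= B * (a - c) + e]) ->
  exists2 F' : R, (\int[lam]_x (kop lam Q rho x `^ p * (w x)%:E) = F'%:E)%E &
    F' <= F /\ F - F `^ ((p - 2) / (p - 1)) - tau - e <= (1 + B) * (F - F').
Proof.
move=> hrho p2 M0 B0 rho1 FE tauE Hwpi.
have [mrho rho0] := hrho.
have p0 : 0 < p by rewrite (lt_trans _ p2).
have p21 : 1 <= p / 2 by rewrite ler_pdivlMr// mul1r ltW.
(* The power p/2 makes the moment of order p a second moment, to which a variance inequality
   applies; it is at least 1, so Jensen compares (Q rho)^p with (Q f)^2. *)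
pose f y := (rho y `^ (p / 2))%E.
have hf : nnmf f by exact: nnmf_poweR.
have [mf f0] := hf.
pose ve y := mine (f y) M%:E.
have ve0 y : (0 <= ve y)%E by rewrite le_min f0 lee_fin.
have veM y : (ve y <= M%:E)%E by rewrite ge_min lexx orbT.
pose v y := fine (ve y).
have vE y : (v y)%:E = ve y.
  by rewrite /v fineK// ge0_fin_numE// (le_lt_trans (veM y))// ltry.
have mve : measurable_fun [set: T] ve by exact: measurable_mine.
have mv : measurable_fun [set: T] v by exact: (measurableT_comp (fine_measurable measurableT)).
have v01 y : 0 <= v y <= M by rewrite -!lee_fin vE ve0 veM.
have [a [c [m [aE cE mE Hw]]]] := Hwpi v mv v01.
have sq (z : \bar R) : (0 <= z -> z * z = z `^ 2)%E.
  case: z => [r r0| |]//=; last by rewrite ?(eqr_nat R 2 0)//= mulyy.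
  by rewrite -EFinM powR_mulrn.
have ff y : (f y * f y = rho y `^ p)%E by rewrite sq// -poweRrM divfK.
have hve : nnmf ve by split.
have hQf := nnmf_kop lam mQ Q0 hf.
have hQr := nnmf_kop lam mQ Q0 hrho.
have hQv := nnmf_kop lam mQ Q0 hve.
have hw := nnmf_EFin mw w0.
have hb := nnmf_EFin mb b0.
have kff x : (kop lam Q rho x `^ p <= kop lam Q f x * kop lam Q f x)%E.
  rewrite sq; last exact: hQf.2.
  have -> : p = p / 2 * 2 by rewrite divfK.
  rewrite poweRrM; apply: lee_poweR => //; first exact: poweR_ge0.
  exact: kop_jensen.
have main : (a%:E + \int[lam]_x (kop lam Q rho x `^ p * (w x)%:E) <= F%:E + c%:E)%E.
  have -> : a%:E = (\int[lam]_x (kop lam Q (fun y => ve y * ve y) x * (w x)%:E))%E.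
    rewrite (integral_kopQ (nnmfM hve hve)) -aE; apply: eq_integral => y _.
    by rewrite -vE -!EFinM expr2.
  have -> : F%:E = (\int[lam]_x (kop lam Q (fun y => f y * f y) x * (w x)%:E))%E.
    rewrite (integral_kopQ (nnmfM hf hf)) -FE; apply: eq_integral => y _.
    by rewrite ff.
  rewrite -cE.
  have hQvv := nnmf_kop lam mQ Q0 (nnmfM hve hve).
  have hQff := nnmf_kop lam mQ Q0 (nnmfM hf hf).
  have veE : EFin \o v = ve by apply/funext => y; rewrite /= vE.
  rewrite veE -(ge0_integralD lam measurableT) -?(ge0_integralD lam measurableT); last 8 first.
  - by move=> x _; exact: (nnmfM hQff hw).2.
  - exact: (nnmfM hQff hw).1.
  - by move=> x _; exact: (nnmfM (nnmfM hQv hQv) hw).2.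
  - exact: (nnmfM (nnmfM hQv hQv) hw).1.
  - by move=> x _; exact: (nnmfM hQvv hw).2.
  - exact: (nnmfM hQvv hw).1.
  - by move=> x _; exact: (nnmfM (nnmf_poweR p hQr) hw).2.
  - exact: (nnmfM (nnmf_poweR p hQr) hw).1.
  apply: le_integral_nneg.
  - by apply: emeasurable_funD; [exact: (nnmfM hQvv hw).1|exact: (nnmfM (nnmf_poweR p hQr) hw).1].
  - by apply: emeasurable_funD; [exact: (nnmfM hQff hw).1|exact: (nnmfM (nnmfM hQv hQv) hw).1].
  - by move=> x; apply: adde_ge0; [exact: (nnmfM hQvv hw).2|exact: (nnmfM (nnmf_poweR p hQr) hw).2].
  - move=> x; rewrite -!ge0_muleDl ?poweR_ge0//; last 3 first.
    + exact: hQff.2.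
    + exact: (nnmfM hQv hQv).2.
    + exact: hQvv.2.
    rewrite lee_wpmul2r ?lee_fin//.
    by apply: le_trans (kop_truncation_variance x hf M0 erefl); rewrite leeD2l.
have F'0 : (0 <= \int[lam]_x (kop lam Q rho x `^ p * (w x)%:E))%E.
  by apply: integral_ge0 => x _; exact: (nnmfM (nnmf_poweR p hQr) hw).2.
have F'F : (\int[lam]_x (kop lam Q rho x `^ p * (w x)%:E) <= F%:E)%E.
  rewrite -FE -(integral_kopQ (nnmf_poweR p hrho)).
  have hQrp := nnmf_kop lam mQ Q0 (nnmf_poweR p hrho).
  apply: le_integral_nneg.
  - exact: (nnmfM (nnmf_poweR p hQr) hw).1.
  - exact: (nnmfM hQrp hw).1.
  - exact: (nnmfM (nnmf_poweR p hQr) hw).2.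
  - move=> x; rewrite lee_wpmul2r ?lee_fin//; apply: kop_jensen => //.
    by rewrite (le_trans _ (ltW p2))// ler1n.
have F'fin : (\int[lam]_x (kop lam Q rho x `^ p * (w x)%:E))%E \is a fin_num.
  by rewrite ge0_fin_numE// (le_lt_trans F'F)// ltry.
move: main F'F F'0 F'fin; set F'e := integral _ _ _; move=> main F'F F'0 F'fin.
exists (fine F'e); first by rewrite fineK.
rewrite -(fineK F'fin) in main F'F; rewrite -!EFinD !lee_fin in main F'F; split => //.
have aF : F - tau <= a.
  rewrite lerBlDr -lee_fin -FE.
  apply: (@le_trans _ _ (a%:E + \int[lam]_y ((if rho y `^ (p / 2) <= M%:E then 0 else rho y `^ p) * (b y)%:E))%E).
    have mt : measurable_fun [set: T] (fun y => ((if rho y `^ (p / 2) <= M%:E then 0 else rho y `^ p) * (b y)%:E)%E).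
      apply: emeasurable_funM; last exact: hb.1.
      apply: measurable_fun_ifT => //; last by case: (nnmf_poweR p hrho).
      by apply: measurable_fun_lee.
    have t0 y : (0 <= (if rho y `^ (p / 2) <= M%:E then 0 else rho y `^ p) * (b y)%:E)%E.
      by rewrite mule_ge0 ?lee_fin//; case: ifP => // _; exact: poweR_ge0.
    have mvb : measurable_fun [set: T] (fun y => (v y ^+ 2 * b y)%:E).
      by apply/measurable_EFinP; apply: measurable_funM => //; exact: measurable_funX.
    rewrite -aE -ge0_integralD//; last by move=> y _; rewrite lee_fin mulr_ge0 ?sqr_ge0.
    apply: le_integral_nneg.
    - exact: (nnmfM (nnmf_poweR p hrho) hb).1.
    - exact: emeasurable_funD.
    - exact: (nnmfM (nnmf_poweR p hrho) hb).2.
    - move=> y; rewrite EFinM; case: ifPn => [fM|fM].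
        by rewrite mul0e adde0 lee_wpmul2r ?lee_fin// expr2 EFinM vE /ve min_l// ff.
      by rewrite leeDr// mule_ge0 ?lee_fin ?sqr_ge0.
  by rewrite EFinD leeD2l.
have m0 : 0 <= m.
  rewrite -lee_fin -mE; apply: integral_ge0 => y _; rewrite lee_fin mulr_ge0//.
  by case/andP: (v01 y).
have F0 : 0 <= F.
  by rewrite -lee_fin -FE; apply: integral_ge0 => y _; exact: (nnmfM (nnmf_poweR p hrho) hb).2.
have vef y : (ve y <= f y)%E by rewrite /ve ge_min lexx.
have mF : m ^+ 2 <= F `^ ((p - 2) / (p - 1)).
  have p1 : 0 < p - 1 by rewrite subr_gt0 (lt_trans _ p2)// ltr1n.
  (* The weight in Hoelder's inequality between rho^p and rho, determined by p th + (1 - th) =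
     p/2. *)
  set th := (p - 2) / (2 * (p - 1)).
  have pp : 0 < 2 * (p - 1) by rewrite mulr_gt0.
  have th01 : 0 < th < 1.
    rewrite /th (divr_gt0 _ pp) ?subr_gt0//= (ltr_pdivrMr _ _ pp) mul1r; lra.
  have mle : m <= F `^ th.
    rewrite -lee_fin -poweR_EFin -FE -[leRHS]mule1 -(poweR1r (1 - th)) -rho1 -mE.
    have [mrp rp0] := nnmf_poweR p hrho.
    apply: le_trans (hoelder_weight lam mb b0 th01 mrp mrho rp0 rho0).
    apply: le_integral_nneg.
    - by apply/measurable_EFinP; exact: measurable_funM.
    - by apply: (nnmfM (nnmfM (nnmf_poweR th (nnmf_poweR p hrho)) (nnmf_poweR (1 - th) hrho)) hb).1.
    - by move=> y; exact: (mulr_ge0 (proj1 (andP (v01 y))) (b0 y)).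
    - move=> y; rewrite EFinM; apply: lee_wpmul2r; first exact: b0.
      rewrite vE.
      apply: (@le_trans _ _ (f y)); first exact: vef.
      rewrite -poweRrM -poweRD; last first.
        have /andP[th0 th1] := th01.
        by apply/implyP; rewrite gt_eqF// addr_gt0 ?subr_gt0// mulr_gt0.
      by rewrite le_eqVlt /f; apply/orP; left; apply/eqP; congr (_ `^ _)%E; rewrite /th; field; rewrite gt_eqF.
  have -> : (p - 2) / (p - 1) = th * 2 by rewrite /th; field; rewrite gt_eqF.
  rewrite powRrM -powR_mulrn ?powR_ge0//.
  by apply: ge0_ler_powR; rewrite ?nnegrE ?powR_ge0.
move: main F'F aF mF Hw; set F2 := F `^ _; set F1 := fine F'e => main F'F aF mF Hw.
have : B * (a - c) <= B * (F - F1) by apply: ler_wpM2l => //; lra.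
lra.
Qed.

End decay.

(** * Gaussian convolutions: smoothness and Bessel's inequality *)

Lemma expR_lipschitz (R : realType) (a b : R) :
  `|expR (- a) - expR (- b)| <= `|a - b| * (expR (- a) + expR (- b)).
Proof.
have H (u v : R) : expR (- u) - expR (- v) <= `|u - v| * expR (- u).
  have -> : expR (- u) - expR (- v) = (1 - expR (u - v)) * expR (- u).
    by rewrite mulrBl mul1r -expRD; congr (_ - expR _); lra.
  rewrite ler_wpM2r ?expR_ge0//; have := expR_ge1Dx (u - v).
  have := ler_norm (- (u - v)); rewrite normrN; lra.
have Ha := H a b; have Hb := H b a; rewrite (distrC b a) in Hb.
have ea := mulr_ge0 (normr_ge0 (a - b)) (expR_ge0 (- a)).
have eb := mulr_ge0 (normr_ge0 (a - b)) (expR_ge0 (- b)).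
rewrite ler_norml; apply/andP; split; rewrite mulrDr; lra.
Qed.

(** The topology is that of the sup norm; continuity of the polynomial |y - x|^2 links it to the
    Euclidean norm. *)
Lemma enorm_continuous_at (R : realType) n (f : 'rV[R]_n -> R) x :
  (forall e, 0 < e -> exists2 D, 0 < D &
     forall y, enorm (y - x) < D -> `|f y - f x| < e) ->
  {for x, continuous f}.
Proof.
move=> H; apply/(@cvgrPdist_lt _ R^o _ (nbhs x) (nbhs_filter x)) => e e0; have [D D0 HD] := H e e0.
have cd : continuous (fun y : 'rV[R]_n => dotv (y - x) (y - x)).
  have -> : (fun y : 'rV[R]_n => dotv (y - x) (y - x)) =
     (fun y => \sum_(i < n) (y ord0 i - x ord0 i) * (y ord0 i - x ord0 i)).
    by apply/funext => y; apply: eq_bigr => i _; rewrite !mxE.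
  elim: (index_enum _) => [|i r IH].
    by under eq_fun do rewrite big_nil; exact: cst_continuous.
  under eq_fun do rewrite big_cons.
  move=> z; have cy : {for z, continuous (fun y : 'rV[R]_n => y ord0 i - x ord0 i)}.
    by apply: continuousB; [exact: coord_continuous|exact: cst_continuous].
  exact: (continuousD (continuousM cy cy) (IH z)).
have : \forall y \near x, dotv (y - x) (y - x) < D ^+ 2.
  have HD2 : nbhs (dotv (x - x) (x - x)) [set t : R | t < D ^+ 2].
    by apply: lt_nbhsl; rewrite subrr dot0v exprn_gt0.
  exact: (cd x _ HD2).
apply: (filterS (F := nbhs x)) => y yD; rewrite distrC; apply: HD.
by rewrite -(ltr_pXn2r (n := 2))// ?nnegrE ?enorm_ge0 ?(ltW D0)// enorm_sqr.
Qed.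

Section gaussian_convolution.
Context (R : realType) (n : nat).
Implicit Types (x y z w : 'rV[R]_n) (h a c v : R) (psi phi f g : 'rV[R]_n -> R).
Local Notation lam := (lebesgue_rV R n).

(** Growth below every Gaussian. The class contains the bounded measurable functions and is stable
    under products with coordinates. Differentiating a Gaussian convolution multiplies the integrand
    by a coordinate, hence stays in the class. *)
Definition subgaussian_growth psi := measurable_fun [set: 'rV[R]_n] psi /\
  forall a, 0 < a -> exists C, forall y, `|psi y| <= C * expR (a * dotv y y).

Lemma subgaussian_growthM phi psi K : measurable_fun [set: 'rV[R]_n] phi ->
  (forall y, `|phi y| <= K * (1 + dotv y y)) -> subgaussian_growth psi ->
  subgaussian_growth (fun y => phi y * psi y).
Proof.
move=> mphi phiK [mpsi Hpsi]; split; first exact: measurable_funM.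
move=> a a0; have a20 : 0 < a / 2 by rewrite divr_gt0.
have [C HC] := Hpsi _ a20; exists (K * (1 + (a / 2)^-1) * C) => y.
have -> : a * dotv y y = a / 2 * dotv y y + a / 2 * dotv y y by field.
rewrite normrM expRD.
set e := expR _; have e1 : 1 <= e by rewrite -expR0 ler_expR mulr_ge0 ?dotv_ge0// ltW.
have K0 : 0 <= K.
  have := le_trans (normr_ge0 _) (phiK 0); rewrite dot0v; lra.
have es : dotv y y <= (a / 2)^-1 * e.
  rewrite ler_pdivlMl//; apply: le_trans (expR_ge1Dx _); lra.
apply: (@le_trans _ _ (K * ((1 + (a / 2)^-1) * e) * (C * e))); last first.
  by rewrite le_eqVlt; apply/orP; left; apply/eqP; ring.
  apply: (ler_pM (normr_ge0 _) (normr_ge0 _) _ (HC y)).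
apply: le_trans (phiK y) _; apply: ler_wpM2l => //; rewrite mulrDl mul1r; lra.
Qed.

Lemma bounded_subgaussian psi C : measurable_fun [set: 'rV[R]_n] psi ->
  (forall y, `|psi y| <= C) -> subgaussian_growth psi.
Proof.
move=> mpsi H; split=> // a a0; exists C => y; apply: le_trans (H y) _.
rewrite ler_peMr//; first exact: le_trans (normr_ge0 _) (H y).
by rewrite -expR0 ler_expR mulr_ge0 ?dotv_ge0// ltW.
Qed.

Lemma coord_sqr_le y i : y ord0 i ^+ 2 <= dotv y y.
Proof.
rewrite /dotv (bigD1 i)//= -expr2 lerDl sumr_ge0// => j _.
by rewrite -expr2 sqr_ge0.
Qed.

(** From |y|^2 <= 2 |y - x|^2 + 2 |x|^2. The bound is uniform for x in a ball, as domination near a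
    given point requires. *)
Lemma gausspdf_shift_le h x y (r : R) : 0 < h -> dotv x x <= r ->
  gausspdf h (y - x) <= normal_peak (Num.sqrt h) ^+ n * expR (r / (2 * h)) *
    expR (- (4 * h)^-1 * dotv y y).
Proof.
move=> h0 xr; rewrite gausspdfE// -mulrA ler_wpM2l ?exprn_ge0 ?normal_peak_ge0//.
rewrite -expRD ler_expR.
have -> : r / (2 * h) + - (4 * h)^-1 * dotv y y = (2 * r - dotv y y) / (4 * h).
  by field; exact: lt0r_neq0.
have -> : - dotv (y - x) (y - x) / (2 * h) = (- 2 * dotv (y - x) (y - x)) / (4 * h).
  by field; exact: lt0r_neq0.
rewrite ler_wpM2r ?invr_ge0 ?mulr_ge0 ?(ltW h0)//.
have := dotv_addC_le (y - x) x; rewrite subrK; lra.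
Qed.

Lemma measurable_expR_dotv c : measurable_fun [set: 'rV[R]_n] (fun y => expR (c * dotv y y)).
Proof.
apply: measurableT_comp => //; apply: measurable_funM => //.
by apply: measurable_dotv; exact: measurable_id.
Qed.

Lemma integrable_gauss c C : 0 < c ->
  lam.-integrable [set: 'rV[R]_n] (EFin \o (fun y => C * expR (- c * dotv y y))).
Proof.
move=> c0; have k0 : 0 < (2 * c)^-1 by rewrite invr_gt0 mulr_gt0.
have pk : normal_peak (Num.sqrt (2 * c)^-1) ^+ n != 0 :> R.
  by rewrite expf_neq0// gt_eqF// normal_peak_gt0// gt_eqF// sqrtr_gt0.
have E y : C * expR (- c * dotv y y) =
    (C / normal_peak (Num.sqrt (2 * c)^-1) ^+ n) * gausspdf (2 * c)^-1 y.
  rewrite gausspdfE// mulrA divfK//; congr (_ * expR _); field; exact: lt0r_neq0.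
rewrite (_ : EFin \o _ = (fun y => (C / normal_peak (Num.sqrt (2 * c)^-1) ^+ n)%:E * (gausspdf (2 * c)^-1 y)%:E)%E); last first.
  by apply/funext => y /=; rewrite E EFinM.
apply: integrableZl => //; apply/integrableP; split.
  by apply/measurable_EFinP; apply: measurable_gausspdf.
under eq_integral do rewrite gee0_abs ?lee_fin ?gausspdf_ge0//.
by rewrite integral_gausspdf// ltry.
Qed.

Lemma subgaussian_dominated h psi (r : R) : 0 < h -> subgaussian_growth psi ->
  exists D, forall x, dotv x x <= r -> forall y,
    `|psi y| * gausspdf h (y - x) <= D * expR (- (8 * h)^-1 * dotv y y).
Proof.
move=> h0 [mpsi Hpsi]; have a0 : 0 < (8 * h)^-1 by rewrite invr_gt0 mulr_gt0.
have [C HC] := Hpsi _ a0.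
exists (C * (normal_peak (Num.sqrt h) ^+ n * expR (r / (2 * h)))) => x xr y.
apply: (@le_trans _ _ ((C * expR ((8 * h)^-1 * dotv y y)) *
   (normal_peak (Num.sqrt h) ^+ n * expR (r / (2 * h)) *
    expR (- (4 * h)^-1 * dotv y y)))).
  apply: ler_pM => //; first exact: gausspdf_ge0.
  exact: gausspdf_shift_le.
rewrite mulrACA -expRD le_eqVlt; apply/orP; left; apply/eqP; congr (_ * expR _).
by field; exact: lt0r_neq0.
Qed.

Lemma subgaussian_integrable h psi x : 0 < h -> subgaussian_growth psi ->
  lam.-integrable [set: 'rV[R]_n] (EFin \o (fun y => psi y * gausspdf h (y - x))).
Proof.
move=> h0 gpsi; have [D HD] := subgaussian_dominated (dotv x x) h0 gpsi.
have a0 : 0 < (8 * h)^-1 by rewrite invr_gt0 mulr_gt0.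
apply: (le_integrable _ _ _ (integrable_gauss D a0)) => //.
  apply/measurable_EFinP; apply: measurable_funM; first exact: gpsi.1.
  exact: measurable_gausspdf_shift.
move=> y _; rewrite /= lee_fin normrM (ger0_norm (gausspdf_ge0 _ _)).
apply: le_trans (HD x (lexx _) y) (ler_norm _).
Qed.

Definition gaussconv h psi x : R := \int[lam]_y (psi y * gausspdf h (y - x)).

Lemma gaussconvD h psi phi x : 0 < h -> subgaussian_growth psi ->
  subgaussian_growth phi ->
  gaussconv h (fun y => psi y + phi y) x = gaussconv h psi x + gaussconv h phi x.
Proof.
move=> h0 g1 g2; rewrite /gaussconv -RintegralD//; try exact: subgaussian_integrable.
by apply: eq_Rintegral => y _; rewrite mulrDl.
Qed.

Lemma gaussconvZ h psi c x : 0 < h -> subgaussian_growth psi ->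
  gaussconv h (fun y => c * psi y) x = c * gaussconv h psi x.
Proof.
move=> h0 g1; rewrite /gaussconv -RintegralZl//; last exact: subgaussian_integrable.
by apply: eq_Rintegral => y _; rewrite mulrA.
Qed.

(** A local Lipschitz bound. By [expR_lipschitz] two shifted Gaussians differ by at most the
    distance of their centres times their sum and a factor linear in |z|, which is absorbed into the
    integrand [phi]. *)
Lemma gaussconv_continuous h psi : 0 < h -> subgaussian_growth psi ->
  continuous (gaussconv h psi).
Proof.
move=> h0 gpsi x; apply: enorm_continuous_at => e e0.
pose phi y := (enorm y + enorm x + 1) / h * `|psi y|.
have gn : subgaussian_growth (fun y => `|psi y|).
  split; first by apply: measurableT_comp => //; exact: gpsi.1.
  by move=> a a0; have [C HC] := gpsi.2 _ a0; exists C => y; rewrite normr_id.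
have gphi : subgaussian_growth phi.
  apply: (@subgaussian_growthM _ _ ((enorm x + 2) / h)) => //.
    apply: measurable_funM => //; apply: measurable_funD => //; apply: measurable_funD => //.
    by apply: measurable_enorm; exact: measurable_id.
  move=> y; rewrite ger0_norm ?divr_ge0 ?addr_ge0 ?enorm_ge0 ?(ltW h0)//.
  rewrite mulrAC ler_wpM2r ?invr_ge0 ?(ltW h0)//.
  have ey := enorm_ge0 y; have ex := enorm_ge0 x.
  rewrite -enorm_sqr; set Y := enorm y in ey *; set X := enorm x in ex *.
  have h1 := sqr_ge0 (Y - 1); have h2 := mulr_ge0 ex (sqr_ge0 Y).
  have -> : (X + 2) * (1 + Y ^+ 2) = X + 2 + X * Y ^+ 2 + 2 * Y ^+ 2 by ring.
  have h3 : (Y - 1) ^+ 2 = Y ^+ 2 - 2 * Y + 1 by ring.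
  have h4 := sqr_ge0 Y; lra.
have [D0 HD] := subgaussian_dominated (2 * dotv x x + 2) h0 gphi.
have a0 : 0 < (8 * h)^-1 by rewrite invr_gt0 mulr_gt0.
have iG := integrable_gauss (2 * D0) a0.
set I := \int[lam]_y (2 * D0 * expR (- (8 * h)^-1 * dotv y y)).
have main y : enorm (y - x) <= 1 ->
    `|gaussconv h psi y - gaussconv h psi x| <= enorm (y - x) * I.
  move=> yx; have [] := (subgaussian_integrable y h0 gpsi, subgaussian_integrable x h0 gpsi).
  move=> iy ix; rewrite /gaussconv -RintegralB//.
  apply: le_trans (le_normr_Rintegral _ _) _ => //.
    have := integrableB measurableT iy ix; apply: eq_integrable => // z _.
  rewrite -RintegralZl//; apply: le_Rintegral => //.
  - have := integrable_abse (integrableB measurableT iy ix).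
    apply: eq_integrable => // z _.
  - by have := integrableZl measurableT (enorm (y - x)) iG; apply: eq_integrable.
  move=> z _; rewrite -mulrBr normrM.
  have yb : dotv y y <= 2 * dotv x x + 2.
    have := dotv_addC_le (y - x) x; rewrite subrK -(enorm_sqr (y - x)).
    have : enorm (y - x) ^+ 2 <= 1 by rewrite exprn_ile1// enorm_ge0.
    lra.
  have xb : dotv x x <= 2 * dotv x x + 2 by have := dotv_ge0 x; lra.
  have Hy := HD y yb z; have Hx := HD x xb z.
  have key : `|gausspdf h (z - y) - gausspdf h (z - x)| <=
     enorm (y - x) * ((enorm z + enorm x + 1) / h) * (gausspdf h (z - y) + gausspdf h (z - x)).
    rewrite !gausspdfE// -mulrBr -mulrDr normrM ger0_norm ?exprn_ge0 ?normal_peak_ge0//.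
    rewrite [leRHS]mulrCA ler_wpM2l ?exprn_ge0 ?normal_peak_ge0//.
    rewrite !mulNr; apply: le_trans (expR_lipschitz _ _) _.
    rewrite ler_wpM2r ?addr_ge0 ?expR_ge0//.
    have -> : dotv (z - y) (z - y) / (2 * h) - dotv (z - x) (z - x) / (2 * h) =
       dotv (y - x) ((y - x) - 2 *: (z - x)) / (2 * h).
      rewrite !(dotvE, opprD, opprK) (dotvC z y) (dotvC z x) (dotvC x y); field; exact: lt0r_neq0.
    rewrite normrM (@ger0_norm _ (2 * h)^-1) ?invr_ge0 ?mulr_ge0 ?(ltW h0)//.
    have : `|dotv (y - x) ((y - x) - 2 *: (z - x))| <= enorm (y - x) * (2 * (enorm z + enorm x + 1)).
      apply: (@le_trans _ _ (enorm (y - x) * enorm ((y - x) - 2 *: (z - x)))).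
        rewrite ler_norml dotv_le_enorm andbT lerNl -dotvNr.
        by apply: le_trans (dotv_le_enorm _ _) _; rewrite enormN.
      rewrite ler_wpM2l ?enorm_ge0//; apply: le_trans (enormD _ _) _.
      rewrite enormN enormZ ger0_norm//; have := enormD z (- x); rewrite enormN; lra.
    move=> H; apply: le_trans (ler_wpM2r _ H) _; first by rewrite invr_ge0 mulr_ge0// ltW.
    rewrite le_eqVlt; apply/orP; left; apply/eqP; field; exact: lt0r_neq0.
  apply: le_trans (ler_wpM2l (normr_ge0 _) key) _.
  have np : `|phi z| = (enorm z + enorm x + 1) / h * `|psi z|.
    by rewrite ger0_norm// mulr_ge0// divr_ge0 ?addr_ge0 ?enorm_ge0 ?(ltW h0).
  rewrite np in Hy Hx.
  have -> : `|psi z| * (enorm (y - x) * ((enorm z + enorm x + 1) / h) * (gausspdf h (z - y) + gausspdf h (z - x))) =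
    enorm (y - x) * ((enorm z + enorm x + 1) / h * `|psi z| * gausspdf h (z - y) +
      (enorm z + enorm x + 1) / h * `|psi z| * gausspdf h (z - x)) by ring.
  rewrite ler_wpM2l ?enorm_ge0//; lra.
exists (Num.min 1 (e / (`|I| + 1))); first by rewrite lt_min ltr01 divr_gt0// ltr_wpDl.
move=> y; rewrite lt_min => /andP[y1 y2].
apply: le_lt_trans (main y (ltW y1)) _.
rewrite ltr_pdivlMr ?ltr_wpDl// in y2; apply: le_lt_trans y2.
rewrite ler_wpM2l ?enorm_ge0//; have := ler_norm I; lra.
Qed.

End gaussian_convolution.

(** Along a coordinate line a shifted Gaussian density is the exponential of a quadratic polynomial
    in t. *)
Lemma is_derive_expR_quad (R : realType) (K c0 c1 c2 t : R) :
  is_derive t (1 : R) (fun t => K * expR (c0 + c1 * t - c2 * t ^+ 2))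
    (K * (c1 - 2 * c2 * t) * expR (c0 + c1 * t - c2 * t ^+ 2)).
Proof.
have H : is_derive t (1 : R) (fun t => c0 + c1 * t - c2 * t ^+ 2) (c1 - 2 * c2 * t).
  apply: is_derive_eq; rewrite !scaler1 /GRing.scale/= ?mulr0 ?add0r ?addr0; ring.
have H2 := is_derive1_comp (is_derive_expR _) H.
have -> : K * (c1 - 2 * c2 * t) * expR (c0 + c1 * t - c2 * t ^+ 2) =
  K *: (expR (c0 + c1 * t - c2 * t ^+ 2) * (c1 - 2 * c2 * t)).
  by rewrite /GRing.scale/=; ring.
have H3 := is_deriveZ K H2; exact: H3.
Qed.

Section gaussian_convolution_smooth.
Context (R : realType) (n : nat).
Implicit Types (x y z w : 'rV[R]_n) (h a c v : R) (psi phi f g : 'rV[R]_n -> R).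
Local Notation lam := (lebesgue_rV R n).

Lemma subgaussian_coordM i c psi : subgaussian_growth psi ->
  subgaussian_growth (fun y => (y ord0 i * c) * psi y).
Proof.
move=> gpsi; apply: (@subgaussian_growthM _ _ (fun y => y ord0 i * c) _ `|c|) => //.
  by apply: measurable_funM => //; exact: measurable_coord.
move=> y; rewrite normrM mulrC ler_wpM2l//.
have := coord_sqr_le y i; have := sqr_ge0 (`|y ord0 i| - 1); have := normr_ge0 (y ord0 i).
rewrite -(real_normK (num_real (y ord0 i))) => h0.
have -> : (`|y ord0 i| - 1) ^+ 2 = `|y ord0 i| ^+ 2 - 2 * `|y ord0 i| + 1 by ring.
have := sqr_ge0 (`|y ord0 i|); lra.
Qed.

(** Differentiation under the integral. Restricting t to ]-1, 1[ keeps the shifts in a ball, so one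
    Gaussian dominates all derivatives. The limit is again expressed by Gaussian convolutions, which
    makes an induction on the order possible. *)
Lemma gaussconv_cvg h psi x i : 0 < h -> subgaussian_growth psi ->
  t^-1 *: (gaussconv h psi (t *: delta_mx ord0 i + x) - gaussconv h psi x) @[t --> 0^'] -->
   gaussconv h (fun y => (y ord0 i * h^-1) * psi y) x - x ord0 i / h * gaussconv h psi x.
Proof.
move=> h0 gpsi; set e := delta_mx ord0 i.
pose f (t : R) y := psi y * gausspdf h (y - (t *: e + x)).
have ee : dotv e e = 1 by rewrite dotv_delta mxE !eqxx.
have ei : e ord0 i = 1 by rewrite mxE !eqxx.
have de y : dotv y e = y ord0 i by exact: dotv_delta.
have fE y : (fun t => f t y) = (fun t => (psi y * normal_peak (Num.sqrt h) ^+ n) *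
   expR (- dotv (y - x) (y - x) / (2 * h) + ((y ord0 i - x ord0 i) / h) * t - (2 * h)^-1 * t ^+ 2)).
  apply/funext => t; rewrite /f gausspdfE// mulrA; congr (_ * expR _).
  rewrite !(dotvE, opprD) (dotvC e y) (dotvC e x) !de ei (dotvC x y); field; exact: lt0r_neq0.
have fd y t : is_derive t (1 : R) (fun t => f t y) ((y ord0 i - x ord0 i - t) / h * f t y).
  have -> : (y ord0 i - x ord0 i - t) / h * f t y = (psi y * normal_peak (Num.sqrt h) ^+ n) *
     ((y ord0 i - x ord0 i) / h - 2 * (2 * h)^-1 * t) * expR (- dotv (y - x) (y - x) / (2 * h) + ((y ord0 i - x ord0 i) / h) * t - (2 * h)^-1 * t ^+ 2).
    have := congr1 (fun F => F t) (fE y); rewrite /= => ->; field; exact: lt0r_neq0.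
  rewrite fE; exact: is_derive_expR_quad.
pose phi y := (`|y ord0 i| + (`|x ord0 i| + 1)) / h * psi y.
have gphi : subgaussian_growth phi.
  apply: (@subgaussian_growthM _ _ _ _ ((`|x ord0 i| + 2) / h)) => //.
    apply: measurable_funM => //; apply: measurable_funD => //.
    by apply: measurableT_comp => //; exact: measurable_coord.
  move=> y; rewrite ger0_norm ?divr_ge0 ?addr_ge0 ?(ltW h0)//.
  rewrite mulrAC ler_wpM2r ?invr_ge0 ?(ltW h0)//.
  have := coord_sqr_le y i; rewrite -(real_normK (num_real (y ord0 i))).
  have ey := normr_ge0 (y ord0 i); have ex := normr_ge0 (x ord0 i).
  set Y := `|y ord0 i| in ey *; set X := `|x ord0 i| in ex * => YD.
  have h1 := sqr_ge0 (Y - 1); have h2 := mulr_ge0 ex (le_trans (sqr_ge0 Y) YD).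
  have -> : (X + 2) * (1 + dotv y y) = X + 2 + X * dotv y y + 2 * dotv y y by ring.
  have h3 : (Y - 1) ^+ 2 = Y ^+ 2 - 2 * Y + 1 by ring.
  have h4 := sqr_ge0 Y; lra.
have [D0 HD] := subgaussian_dominated (2 * dotv x x + 2) h0 gphi.
have a0 : 0 < (8 * h)^-1 by rewrite invr_gt0 mulr_gt0.
have D00 : 0 <= D0.
  have xx : dotv x x <= 2 * dotv x x + 2 by have := dotv_ge0 x; lra.
  have := le_trans (mulr_ge0 (normr_ge0 _) (gausspdf_ge0 _ _)) (HD x xx 0).
  by rewrite pmulr_lge0 ?expR_gt0.
have iG := integrable_gauss n D0 a0.
have I0 : `](- 1 : R), (1 : R)[%classic (0 : R) by rewrite /= in_itv/= ltr01 oppr_lt0 ltr01.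
have If t : `](- 1 : R), (1 : R)[%classic t -> lam.-integrable [set: 'rV[R]_n] (EFin \o f t).
  by move=> _; exact: subgaussian_integrable.
have df t y : `](- 1 : R), (1 : R)[%classic t -> [set: 'rV[R]_n] y -> derivable (f ^~ y) t 1.
  by move=> _ _; exact: (@ex_derive _ _ _ _ _ _ _ (fd y t)).
have dfE t y : partial1of2 f t y = (y ord0 i - x ord0 i - t) / h * f t y.
  by rewrite partial1of2E; exact: (@derive_val _ _ _ _ _ _ _ (fd y t)).
have Gub t y : `](- 1 : R), (1 : R)[%classic t -> [set: 'rV[R]_n] y ->
    `|partial1of2 f t y| <= D0 * expR (- (8 * h)^-1 * dotv y y).
  rewrite /= in_itv/= => /andP[t1 t2] _; rewrite dfE.
  have tb : dotv (t *: e + x) (t *: e + x) <= 2 * dotv x x + 2.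
    apply: le_trans (dotv_addC_le _ _) _; rewrite !dotvE ee mulr1.
    have : t * t <= 1 by nra.
    lra.
  apply: le_trans (HD _ tb y); rewrite /f /phi !normrM mulrA (ger0_norm (gausspdf_ge0 _ _)).
  rewrite ler_wpM2r ?gausspdf_ge0// ler_wpM2r// ler_wpM2r// (@ger0_norm _ (_ + (_ + _))) ?addr_ge0//.
  apply: le_trans (ler_normB _ _) _; have := ler_normB (y ord0 i) (x ord0 i).
  have : `|t| <= 1 by rewrite ler_norml !ltW.
  lra.
have := cvg_differentiation_under_integral measurableT I0 If df
  (fun y => mulr_ge0 D00 (expR_ge0 _)) iG Gub.
have -> : \int[lam]_y partial1of2 f 0 y =
    gaussconv h (fun y => (y ord0 i * h^-1) * psi y) x - x ord0 i / h * gaussconv h psi x.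
  rewrite -(gaussconvZ _ _ h0 gpsi) /gaussconv -RintegralB//; last 2 first.
  - exact: (subgaussian_integrable x h0 (subgaussian_coordM i h^-1 gpsi)).
  - apply: (subgaussian_integrable x h0 (psi := fun y => x ord0 i / h * psi y)).
    apply: (@subgaussian_growthM _ _ (fun=> x ord0 i / h) _ `|x ord0 i / h|) => // y.
    by rewrite ler_peMr// lerDl dotv_ge0.
  apply: eq_Rintegral => y _; rewrite dfE /f scale0r add0r subr0; ring.
have f0E y : psi y * gausspdf h (y - x) = f 0 y by rewrite /f scale0r add0r.
apply: cvg_trans; apply: near_eq_cvg; apply: nearW => t /=.
have G0 : \int[lam]_y f 0 y = gaussconv h psi x by apply: eq_Rintegral => y _; rewrite -f0E.
have Gt : \int[lam]_y f t y = gaussconv h psi (t *: e + x) by rewrite /gaussconv; apply: eq_Rintegral => y _; rewrite /f /phi.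
by rewrite addr0; exact: (congr2 (fun a b => t^-1 *: (a - b)) Gt G0).
Qed.

Lemma gaussconv_derivable h psi x i : 0 < h -> subgaussian_growth psi ->
  derivable (gaussconv h psi) x (delta_mx ord0 i).
Proof. by move=> h0 gpsi; apply/cvg_ex; eexists; exact: gaussconv_cvg. Qed.

Lemma gaussconv_partial h psi x i : 0 < h -> subgaussian_growth psi ->
  partial i (gaussconv h psi) x =
  gaussconv h (fun y => (y ord0 i * h^-1) * psi y) x - x ord0 i / h * gaussconv h psi x.
Proof. by move=> h0 gpsi; apply: cvg_lim => //; exact: gaussconv_cvg. Qed.

Lemma CkW k f : Ck k.+1 f -> Ck k f.
Proof.
elim: k f => [|k IH] f /=; first by case.
by move=> [cf Hf]; split=> // i; have [df Cf] := Hf i; split=> //; exact: IH.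
Qed.

Lemma Ck_cst k c : Ck k (fun _ : 'rV[R]_n => c).
Proof.
elim: k c => [|k IH] c /=; first by split=> //; exact: cst_continuous.
split; first exact: cst_continuous.
move=> i; split=> [x|]; first exact: derivable_cst.
have -> : partial i (fun _ : 'rV[R]_n => c) = (fun=> 0) by apply/funext => x; exact: derive_cst.
exact: IH.
Qed.

Lemma CkD k f g : Ck k f -> Ck k g -> Ck k (fun x => f x + g x).
Proof.
elim: k f g => [|k IH] f g /= [cf Hf] [cg Hg].
  by split=> // x; exact: (continuousD (cf x) (cg x)).
split; first by move=> x; exact: (continuousD (cf x) (cg x)).
move=> i; have [df Cf] := Hf i; have [dg Cg] := Hg i; split=> [x|]; first exact: derivableD.
have -> : partial i (fun x => f x + g x) = (fun x => partial i f x + partial i g x).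
  by apply/funext => x; exact: deriveD.
exact: IH.
Qed.

Lemma CkM k f g : Ck k f -> Ck k g -> Ck k (fun x => f x * g x).
Proof.
elim: k f g => [|k IH] f g.
  by move=> /= [cf Hf] [cg Hg]; split=> // x; exact: (continuousM (cf x) (cg x)).
move=> Cf' Cg'; have Cfk := CkW Cf'; have Cgk := CkW Cg'.
move: Cf' Cg' => /= [cf Hf] [cg Hg]; split; first by move=> x; exact: (continuousM (cf x) (cg x)).
move=> i; have [df Cf] := Hf i; have [dg Cg] := Hg i; split=> [x|]; first exact: derivableM.
have -> : partial i (fun x => f x * g x) = (fun x => f x * partial i g x + g x * partial i f x).
  by apply/funext => x; exact: deriveM.
by apply: CkD; exact: IH.
Qed.

Lemma is_derive_coord i x (v : 'rV[R]_n) : is_derive x v (fun y : 'rV[R]_n => y ord0 i) (v ord0 i).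
Proof.
have H : t^-1 *: ((t *: v + x) ord0 i - x ord0 i) @[t --> (0 : R)^'] --> v ord0 i.
  apply: (@cvg_trans _ ((cst (v ord0 i) : R -> R) t @[t --> (0 : R)^'])); last exact: cvg_cst.
  apply: near_eq_cvg; near=> t.
  rewrite !mxE addrK /GRing.scale/= mulKf//; near: t; exact: nbhs_dnbhs_neq.
by split; [apply/cvg_ex; eexists; exact: H|apply: cvg_lim => //; exact: H].
Unshelve. all: by end_near. Qed.

Lemma Ck_coord k i : Ck k (fun x : 'rV[R]_n => x ord0 i).
Proof.
have cc : continuous (fun x : 'rV[R]_n => x ord0 i) by move=> x; exact: coord_continuous.
case: k => [|k] //=; split=> // j; split=> [x|].
  exact: (@ex_derive _ _ _ _ _ _ _ (is_derive_coord i x _)).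
have -> : partial j (fun x : 'rV[R]_n => x ord0 i) = (fun=> (delta_mx ord0 j : 'rV[R]_n) ord0 i).
  by apply/funext => x; exact: (@derive_val _ _ _ _ _ _ _ (is_derive_coord i x _)).
exact: Ck_cst.
Qed.

(** Induction on the order with [psi] general: a partial derivative is the convolution of another
    function of the class plus a linear function times the same convolution. *)
Lemma gaussconv_smooth h psi : 0 < h -> subgaussian_growth psi ->
  smooth (gaussconv h psi).
Proof.
move=> h0 gpsi k; elim: k psi gpsi => [|k IH] psi gpsi.
  by split=> //; exact: gaussconv_continuous.
split; first exact: gaussconv_continuous.
move=> i; split=> [x|]; first exact: gaussconv_derivable.
have -> : partial i (gaussconv h psi) = (fun x =>
    gaussconv h (fun y => (y ord0 i * h^-1) * psi y) x + (x ord0 i * (- h^-1)) * gaussconv h psi x).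
  by apply/funext => x; rewrite gaussconv_partial// mulrN mulNr.
apply: CkD; first by apply: IH; exact: subgaussian_coordM.
apply: CkM; last exact: IH.
by apply: CkM; [exact: Ck_coord|exact: Ck_cst].
Qed.

End gaussian_convolution_smooth.

Lemma expR_ge_quad (R : realType) (s : R) : 0 <= s -> 1 + s + s * s / 2 <= expR s.
Proof.
move=> s0; have -> : 1 + s + s * s / 2 = series (exp_coeff s) 3%N.
  by rewrite /series/= !big_nat_recl// big_geq// /exp_coeff/= expr0 expr1 expr2 !divr1 addr0 addrA.
apply: nondecreasing_cvgn_le; last exact: is_cvg_series_exp_coeff.
apply: nondecreasing_series => k _ _; exact: exp_coeff_ge0.
Qed.

(** The right-hand side is (2 sinh(u/2))^2, and sinh s >= s for s >= 0. It yields second Gaussian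
    moments from the moment generating function. *)
Lemma sqr_le_cosh (R : realType) (u : R) : u ^+ 2 <= expR u + expR (- u) - 2.
Proof.
have sinh (s : R) : 0 <= s -> 2 * s <= expR s - expR (- s).
  move=> s0; rewrite expRN.
  have E0 := expR_gt0 s; set E := expR s in E0 *.
  have h2 : 1 + s + s * s / 2 <= E.
    exact: expR_ge_quad.
  have : E^-1 <= (1 + s + s * s / 2)^-1.
    by rewrite lef_pV2// posrE; have := mulr_ge0 s0 s0; lra.
  have : (1 + s + s * s / 2)^-1 <= 1 - s + s * s / 2.
    have p : 0 < 1 + s + s * s / 2 by have := mulr_ge0 s0 s0; lra.
    rewrite -[leLHS]mul1r ler_pdivrMr//.
    have -> : (1 - s + s * s / 2) * (1 + s + s * s / 2) = 1 + (s * s) * (s * s) / 4 by field.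
    by rewrite lerDl divr_ge0// mulr_ge0 ?mulr_ge0.
  lra.
have E : expR u + expR (- u) - 2 = (expR (u / 2) - expR (- (u / 2))) ^+ 2.
  have h1 : expR u = expR (u / 2) * expR (u / 2) by rewrite -expRD; congr expR; field.
  have h2 : expR (- u) = expR (- (u / 2)) * expR (- (u / 2)) by rewrite -expRD; congr expR; field.
  have h3 : expR (u / 2) * expR (- (u / 2)) = 1 by rewrite -expRD subrr expR0.
  move: h1 h2 h3; set p := expR (u / 2); set q := expR (- (u / 2)) => -> -> h3.
  have -> : p * p + q * q - 2 = p * p + q * q - 2 * (p * q) by rewrite h3 mulr1.
  ring.
rewrite E; have [u0|u0] := leP 0 u.
  have u20 : 0 <= u / 2 by rewrite divr_ge0.
  have := sinh _ u20; have -> : 2 * (u / 2) = u by field.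
  by move=> h; rewrite ler_sqr ?nnegrE// (le_trans u0 h).
have u20 : 0 <= - u / 2 by rewrite divr_ge0// oppr_ge0 ltW.
have := sinh _ u20; have -> : 2 * (- u / 2) = - u by field.
rewrite mulNr opprK => h; rewrite -sqrrN -[leRHS]sqrrN opprB ler_sqr ?nnegrE//; first by rewrite oppr_ge0 ltW.
by rewrite (le_trans _ h)// oppr_ge0 ltW.
Qed.

Section bessel.
Context (R : realType) (n : nat).
Implicit Types (x y z w b : 'rV[R]_n) (h a c v : R) (psi phi f g : 'rV[R]_n -> R).
Local Notation lam := (lebesgue_rV R n).

Lemma subgaussianD psi phi : subgaussian_growth psi -> subgaussian_growth phi ->
  subgaussian_growth (fun y => psi y + phi y).
Proof.
move=> [m1 H1] [m2 H2]; split; first exact: measurable_funD.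
move=> a a0; have [C1 h1] := H1 _ a0; have [C2 h2] := H2 _ a0; exists (C1 + C2) => y.
by rewrite mulrDl; apply: le_trans (ler_normD _ _) _; exact: lerD.
Qed.

Lemma subgaussian_cst c : subgaussian_growth (fun _ : 'rV[R]_n => c).
Proof. by apply: (@bounded_subgaussian _ _ _ `|c|). Qed.

Lemma subgaussian_coord i : subgaussian_growth (fun y : 'rV[R]_n => y ord0 i).
Proof.
have := subgaussian_coordM i 1 (subgaussian_cst 1).
by under eq_fun do rewrite !mulr1.
Qed.

Lemma subgaussianM psi phi : subgaussian_growth psi -> subgaussian_growth phi ->
  subgaussian_growth (fun y => psi y * phi y).
Proof.
move=> [m1 H1] [m2 H2]; split; first exact: measurable_funM.
move=> a a0; have a20 : 0 < a / 2 by rewrite divr_gt0.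
have [C1 h1] := H1 _ a20; have [C2 h2] := H2 _ a20; exists (C1 * C2) => y.
have -> : a * dotv y y = a / 2 * dotv y y + a / 2 * dotv y y by field.
rewrite normrM expRD mulrACA; exact: ler_pM.
Qed.

Lemma subgaussian_dotv b c : subgaussian_growth (fun y => dotv b y + c).
Proof.
apply: subgaussianD (subgaussian_cst c); rewrite /dotv.
elim: (index_enum _) => [|i r IH].
  by under eq_fun do rewrite big_nil; exact: subgaussian_cst.
under eq_fun do rewrite big_cons; apply: subgaussianD => //.
by apply: subgaussianM; [exact: subgaussian_cst|exact: subgaussian_coord].
Qed.

Lemma subgaussian_expR b : subgaussian_growth (fun y => expR (dotv b y)).
Proof.
split; first by apply: measurableT_comp => //; exact: (subgaussian_dotv b 0).1 || (apply: measurable_dotv => //; exact: measurable_id).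
move=> a a0; exists (expR (dotv b b / (4 * a))) => y.
rewrite ger0_norm ?expR_ge0// -expRD ler_expR.
have := dotv_ge0 (b - (2 * a) *: y); rewrite !dotvE (dotvC y b) => h.
have -> : dotv b b / (4 * a) + a * dotv y y = (dotv b b + 4 * a ^+ 2 * dotv y y) / (4 * a).
  field; exact: lt0r_neq0.
rewrite ler_pdivlMr ?mulr_gt0//.
move: h; set B := dotv b b; set Y := dotv y y; set X := dotv b y.
have -> : B - 2 * a * X + (- (2 * a * X) - 2 * a * - (2 * a * Y)) = B + 4 * a ^+ 2 * Y - X * (4 * a) by ring.
by rewrite subr_ge0.
Qed.

Lemma gaussconvE h psi x : 0 < h -> subgaussian_growth psi ->
  ((gaussconv h psi x)%:E = \int[lam]_y (psi y * gausspdf h (y - x))%:E)%E.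
Proof.
move=> h0 gpsi; rewrite /gaussconv /Rintegral fineK//.
exact: (integrable_fin_num measurableT (subgaussian_integrable x h0 gpsi)).
Qed.

Lemma gaussconv_cst h c x : 0 < h -> gaussconv h (fun=> c) x = c.
Proof.
move=> h0; rewrite -[c in LHS]mulr1 (gaussconvZ _ _ h0 (subgaussian_cst 1)).
have : ((gaussconv h (fun=> 1) x)%:E = 1)%E.
  rewrite gaussconvE//; last exact: subgaussian_cst.
  by under eq_integral do rewrite mul1r; rewrite integral_gausspdf_shift1.
by case=> ->; rewrite mulr1.
Qed.

Lemma le_gaussconv h psi phi x : 0 < h -> subgaussian_growth psi ->
  subgaussian_growth phi -> (forall y, psi y <= phi y) ->
  gaussconv h psi x <= gaussconv h phi x.
Proof.
move=> h0 g1 g2 H; apply: le_Rintegral => //; try exact: subgaussian_integrable.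
by move=> y _; rewrite ler_wpM2r ?gausspdf_ge0.
Qed.

Lemma gaussconv_mgf h b x : 0 < h ->
  gaussconv h (fun y => expR (dotv b y)) x = expR (dotv b x + h / 2 * dotv b b).
Proof.
move=> h0; apply: EFin_inj; rewrite gaussconvE//; last exact: subgaussian_expR.
by rewrite -gauss_mgf//; apply: eq_integral => y _; rewrite mulrC.
Qed.

(** The exact value is h |b|^2; the factor 2 is the price of deducing the bound from exponential
    moments. *)
Lemma gaussconv_dotv_sqr h b x : 0 < h ->
  gaussconv h (fun y => (dotv b y - dotv b x) ^+ 2) x <= 2 * h * dotv b b.
Proof.
move=> h0; have gd := subgaussian_dotv b (- dotv b x).
have gs : subgaussian_growth (fun y => (dotv b y - dotv b x) ^+ 2).
  by under eq_fun do rewrite expr2; exact: subgaussianM.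
have [b0|b0] := eqVneq (dotv b b) 0.
  rewrite b0 mulr0 -(gaussconv_cst 0 x h0); apply: le_gaussconv => // [|y].
    exact: subgaussian_cst.
  by rewrite !(dotv_eq0 _ b0) subrr expr0n.
have bp : 0 < dotv b b by rewrite lt0r b0 dotv_ge0.
(* This scale gives t <b, y> variance 1; the exponential moments then lead to 2 e^(1/2) - 2 <= 2. *)
pose t2 := (h * dotv b b)^-1; have t20 : 0 < t2 by rewrite invr_gt0 mulr_gt0.
pose t := Num.sqrt t2; have tt : t ^+ 2 = t2 by rewrite sqr_sqrtr// ltW.
pose E1 y := expR (- dotv (t *: b) x) * expR (dotv (t *: b) y).
pose E2 y := expR (dotv (t *: b) x) * expR (dotv (- t *: b) y).
have gE1 : subgaussian_growth E1.
  by apply: subgaussianM; [exact: subgaussian_cst|exact: subgaussian_expR].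
have gE2 : subgaussian_growth E2.
  by apply: subgaussianM; [exact: subgaussian_cst|exact: subgaussian_expR].
have key y : t2 * (dotv b y - dotv b x) ^+ 2 <= E1 y + E2 y + (- 2).
  have := sqr_le_cosh (t * (dotv b y - dotv b x)); rewrite exprMn tt => /le_trans; apply.
  rewrite /E1 /E2 -!expRD !dotvE.
  have -> : - (t * dotv b x) + t * dotv b y = t * (dotv b y - dotv b x) by ring.
  by have -> : t * dotv b x + - t * dotv b y = - (t * (dotv b y - dotv b x)) by ring.
have gr : subgaussian_growth (fun y => E1 y + E2 y + (- 2)).
  by apply: subgaussianD (subgaussianD gE1 gE2) (subgaussian_cst _).
have gl : subgaussian_growth (fun y => t2 * (dotv b y - dotv b x) ^+ 2).
  by apply: subgaussianM gs; exact: subgaussian_cst.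
have := le_gaussconv x h0 gl gr key.
rewrite (gaussconvZ _ _ h0 gs) (gaussconvD _ h0 (subgaussianD gE1 gE2) (subgaussian_cst (- 2))).
rewrite (gaussconvD _ h0 gE1 gE2) gaussconv_cst// /E1 /E2.
rewrite !(gaussconvZ _ _ h0 (subgaussian_expR _)) !gaussconv_mgf// -!expRD.
rewrite !dotvE.
have q : h / 2 * (t * (t * dotv b b)) = 2^-1.
  have -> : h / 2 * (t * (t * dotv b b)) = t ^+ 2 * (h * dotv b b) / 2 by ring.
  rewrite tt /t2; field; by rewrite b0 gt_eqF.
have -> : - (t * dotv b x) + (t * dotv b x + h / 2 * (t * (t * dotv b b))) = 2^-1 by rewrite q; ring.
have -> : t * dotv b x + (- t * dotv b x + h / 2 * (- t * (- t * dotv b b))) = 2^-1.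
  by rewrite -[RHS]q; ring.
move=> H; have e2 : expR (2^-1 : R) <= 2.
  have := expR_ge1Dx (- 2^-1 : R); rewrite expRN => h2.
  have h3 : (2^-1 : R) <= (expR (2^-1 : R))^-1 by lra.
  by rewrite -[leRHS]invrK -[leLHS]invrK lef_pV2// ?posrE ?invr_gt0 ?expR_gt0.
have : t2 * gaussconv h (fun y => (dotv b y - dotv b x) ^+ 2) x <= 2 by lra.
by rewrite /t2 ler_pdivrMl ?mulr_gt0//; rewrite (mulrC _ 2) mulrA.
Qed.

(** Stein's identity: differentiating the Gaussian kernel produces the covariance of psi with a
    linear function. The proof runs over an arbitrary list of coordinates so that induction
    applies. *)
Lemma dotv_grad_gaussconv h psi b x : 0 < h -> subgaussian_growth psi ->
  h * dotv b (grad (gaussconv h psi) x) =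
  gaussconv h (fun y => (dotv b y - dotv b x) * psi y) x.
Proof.
move=> h0 gpsi; pose G := gaussconv h psi x.
have E (r : seq 'I_n) :
    h * (\sum_(i <- r) b ord0 i * (grad (gaussconv h psi) x) ord0 i) =
    gaussconv h (fun y => (\sum_(i <- r) b ord0 i * y ord0 i) * psi y) x -
    (\sum_(i <- r) b ord0 i * x ord0 i) * G /\
    subgaussian_growth (fun y => (\sum_(i <- r) b ord0 i * y ord0 i) * psi y).
  elim: r => [|i r [IH gr]].
    have E0 : (fun y : 'rV[R]_n => (\sum_(i <- [::]) b ord0 i * y ord0 i) * psi y) = (fun=> 0).
      by apply/funext => y; rewrite big_nil mul0r.
    by rewrite E0 gaussconv_cst// !big_nil mul0r mulr0 subr0; split=> //; exact: subgaussian_cst.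
  have gi : subgaussian_growth (fun y => (b ord0 i * h) * ((y ord0 i * h^-1) * psi y)).
    by apply: subgaussianM; [exact: subgaussian_cst|exact: subgaussian_coordM].
  have E0 : (fun y : 'rV[R]_n => (\sum_(i <- i :: r) b ord0 i * y ord0 i) * psi y) =
     (fun y => (b ord0 i * h) * ((y ord0 i * h^-1) * psi y) + (\sum_(i <- r) b ord0 i * y ord0 i) * psi y).
    by apply/funext => y; rewrite big_cons; field; exact: lt0r_neq0.
  rewrite E0; split; last exact: subgaussianD.
  rewrite gaussconvD// (gaussconvZ _ _ h0 (subgaussian_coordM i h^-1 gpsi)).
  rewrite !big_cons mulrDr IH mxE gaussconv_partial// -/G; field; exact: lt0r_neq0.
have [E1 E2] := E (index_enum _); rewrite /dotv E1.
have -> : (fun y : 'rV[R]_n => (\sum_(i < n) b ord0 i * y ord0 i - \sum_(i < n) b ord0 i * x ord0 i) * psi y) =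
  (fun y => (\sum_(i < n) b ord0 i * y ord0 i) * psi y + (- \sum_(i < n) b ord0 i * x ord0 i) * psi y).
  by apply/funext => y; rewrite mulrBl mulNr.
rewrite gaussconvD// ?(gaussconvZ _ _ h0 gpsi) ?mulNr//.
by apply: subgaussianM gpsi; exact: subgaussian_cst.
Qed.

(* Bessel's inequality for the linear functions in L^2 of the Gaussian kernel. *)
Lemma gaussconv_grad_le h psi x : 0 < h -> subgaussian_growth psi ->
  h * dotv (grad (gaussconv h psi) x) (grad (gaussconv h psi) x) <=
  2 * (gaussconv h (fun y => psi y ^+ 2) x - gaussconv h psi x ^+ 2).
Proof.
move=> h0 gpsi; set D := grad _ x; set c := gaussconv h psi x.
have gd := subgaussian_dotv D (- dotv D x).
have gc : subgaussian_growth (fun y => psi y + (- c)).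
  by apply: subgaussianD => //; exact: subgaussian_cst.
have g2 : subgaussian_growth (fun y => psi y ^+ 2).
  by under eq_fun do rewrite expr2; exact: subgaussianM.
have gd2 : subgaussian_growth (fun y => (dotv D y - dotv D x) ^+ 2).
  by under eq_fun do rewrite expr2; exact: subgaussianM.
have gc2 : subgaussian_growth (fun y => (psi y + (- c)) ^+ 2).
  by under eq_fun do rewrite expr2; exact: subgaussianM.
(* The direction is the gradient itself. Subtracting the mean c changes nothing, because the
   convolution of a constant has zero gradient. *)
have E1 : h * dotv D D = gaussconv h (fun y => (dotv D y - dotv D x) * (psi y + (- c))) x.
  have -> : (fun y => (dotv D y - dotv D x) * (psi y + (- c))) =
    (fun y => (dotv D y - dotv D x) * psi y + (- c) * ((dotv D y - dotv D x) * 1)).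
    by apply/funext => y; ring.
  rewrite gaussconvD// ?(gaussconvZ _ _ h0)//; last 3 first.
  - by apply: subgaussianM => //; exact: subgaussian_cst.
  - exact: subgaussianM.
  - by apply: subgaussianM; [exact: subgaussian_cst|apply: subgaussianM => //; exact: subgaussian_cst].
  rewrite -!dotv_grad_gaussconv//; last exact: subgaussian_cst.
  have -> : grad (gaussconv h (fun=> 1)) x = 0 :> 'rV[R]_n.
    apply/rowP => i; rewrite !mxE /partial.
    have -> : gaussconv h (fun=> 1) = cst 1 :> ('rV[R]_n -> R).
      by apply/funext => y; rewrite gaussconv_cst.
    exact: derive_cst.
  by rewrite (dotvC D 0) dot0v !mulr0 addr0.
have E2 : gaussconv h (fun y => (psi y + (- c)) ^+ 2) x = gaussconv h (fun y => psi y ^+ 2) x - c ^+ 2.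
  have -> : (fun y => (psi y + (- c)) ^+ 2) =
    (fun y => psi y ^+ 2 + ((- 2 * c) * psi y + c ^+ 2)) by apply/funext => y; ring.
  have gcp : subgaussian_growth (fun y => (- 2 * c) * psi y).
    by apply: subgaussianM gpsi; exact: subgaussian_cst.
  rewrite gaussconvD//; last by apply: subgaussianD gcp (subgaussian_cst _).
  rewrite (gaussconvD _ h0 gcp (subgaussian_cst _)) (gaussconvZ _ _ h0 gpsi) gaussconv_cst// -/c; ring.
(* The weight 1/4 combines with the variance bound 2 h |D|^2 and leaves half of h |D|^2 on the
   left. *)
have key y : (dotv D y - dotv D x) * (psi y + (- c)) <=
    4^-1 * (dotv D y - dotv D x) ^+ 2 + (psi y + (- c)) ^+ 2.
  set u := dotv D y - dotv D x; set v := psi y + _.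
  have := sqr_ge0 (2^-1 * u - v).
  have -> : (2^-1 * u - v) ^+ 2 = 4^-1 * u ^+ 2 + v ^+ 2 - u * v by field.
  by rewrite subr_ge0.
have gd4 : subgaussian_growth (fun y => 4^-1 * (dotv D y - dotv D x) ^+ 2).
  by apply: subgaussianM gd2; exact: subgaussian_cst.
have := le_gaussconv x h0 (subgaussianM gd gc) (subgaussianD gd4 gc2) key.
rewrite -E1 (gaussconvD _ h0 gd4 gc2) (gaussconvZ _ _ h0 gd2) E2.
have := gaussconv_dotv_sqr D x h0; lra.
Qed.

End bessel.

(** * The proximal kernels and the weak Poincare inequality for smoothed functions *)

Section proximal_kernels.
Context (R : realType) (n : nat).
Local Notation lam := (lebesgue_rV R n).
Local Notation rV := 'rV[R]_n.
Variables (h : R) (w : rV -> R).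

(* The two half steps of the proximal sampler for w: heatk adds Gaussian noise,
   backk resamples from the posterior, and heatdens is the intermediate density. *)
Definition heatk (x y : rV) : R := gausspdf h (y - x).
Definition heatdens (y : rV) : R := fine (\int[lam]_x (heatk x y * w x)%:E)%E.
Definition backk (y x : rV) : R := heatk x y * w x / heatdens y.

Hypotheses (h0 : 0 < h) (mw : measurable_fun [set: rV] w) (w0 : forall x, 0 <= w x)
  (w1 : (\int[lam]_x (w x)%:E = 1)%E).

Lemma measurable_heatk : measurable_fun [set: rV * rV] (fun z => heatk z.1 z.2).
Proof.
apply: measurable_gausspdf; apply: measurable_rVD; first exact: measurable_snd.
by apply: measurable_rVN; exact: measurable_fst.
Qed.

Lemma heatk_ge0 x y : 0 <= heatk x y. Proof. exact: gausspdf_ge0. Qed.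

Lemma heatk_gt0 x y : 0 < heatk x y. Proof. exact: gausspdf_gt0. Qed.

Lemma integral_heatk x : (\int[lam]_y (heatk x y)%:E = 1)%E.
Proof. exact: integral_gausspdf_shift1. Qed.

Let mhw : measurable_fun [set: rV * rV] (fun z => heatk z.1 z.2 * w z.1).
Proof.
apply: measurable_funM; first exact: measurable_heatk.
exact: (measurableT_comp mw measurable_fst).
Qed.

Let mhw1 y : measurable_fun [set: rV] (fun x => heatk x y * w x).
Proof. exact: (measurableT_comp mhw (pair2_measurable y)). Qed.

Let hw0 x y : 0 <= heatk x y * w x. Proof. by rewrite mulr_ge0// heatk_ge0. Qed.

Lemma heatdensE y : ((heatdens y)%:E = \int[lam]_x (heatk x y * w x)%:E)%E.
Proof.
rewrite /heatdens fineK// ge0_fin_numE; last first.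
  by apply: integral_ge0 => x _; rewrite lee_fin.
pose K := normal_peak (Num.sqrt h) ^+ n : R.
apply: (@le_lt_trans _ _ (\int[lam]_x (K%:E * (w x)%:E))%E).
  apply: le_integral_nneg.
  - exact/measurable_EFinP.
  - by apply: emeasurable_funM => //; exact/measurable_EFinP.
  - by move=> x; rewrite lee_fin.
  - by move=> x; rewrite -EFinM lee_fin ler_wpM2r// gausspdf_le.
rewrite ge0_integralZl//; first by rewrite w1 mule1 ltry.
- exact/measurable_EFinP.
- by move=> x _; rewrite lee_fin.
- by rewrite lee_fin exprn_ge0// normal_peak_ge0.
Qed.

(** The Gaussian kernel is positive, so a zero value would force [w] to vanish almost everywhere,
    against its total mass 1. *)
Lemma heatdens_gt0 y : 0 < heatdens y.
Proof.
rewrite lt_neqAle; apply/andP; split; last first.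
  by rewrite -lee_fin heatdensE integral_ge0// => x _; rewrite lee_fin.
apply/eqP => H; have := heatdensE y; rewrite -H => /esym I0.
have : (\int[lam]_x (w x)%:E = 0)%E.
  apply: ae_zero_of_integral I0.
  - exact/measurable_EFinP.
  - exact/measurable_EFinP.
  - by move=> x; rewrite lee_fin.
  - by move=> x; rewrite lee_fin.
  - by move=> x [] /eqP; rewrite mulf_eq0 gt_eqF ?heatk_gt0//= => /eqP ->.
by rewrite w1 => /eqP; rewrite onee_eq0.
Qed.

Lemma measurable_heatdens : measurable_fun [set: rV] heatdens.
Proof.
apply: (measurableT_comp (fine_measurable measurableT)).
apply: (@measurable_fun_fubini_tonelli_G _ _ _ _ _ lam
  (fun z : rV * rV => (heatk z.1 z.2 * w z.1)%:E)).
  exact/measurable_EFinP.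
by move=> z; rewrite lee_fin.
Qed.

Lemma measurable_backk : measurable_fun [set: rV * rV] (fun z => backk z.1 z.2).
Proof.
rewrite /backk; apply: measurable_funM.
  by apply: (measurableT_comp mhw (f := fun z => heatk z.1 z.2 * w z.1) (g := fun z : rV * rV => (z.2, z.1))); exact: measurable_swap.
apply: measurable_funV; first by move=> x; exact/ltW/heatdens_gt0.
exact: (measurableT_comp measurable_heatdens measurable_fst).
Qed.

Lemma backk_ge0 y x : 0 <= backk y x.
Proof. by rewrite divr_ge0// ltW// heatdens_gt0. Qed.

Lemma integral_backk y : (\int[lam]_x (backk y x)%:E = 1)%E.
Proof.
rewrite /backk; under eq_integral do rewrite mulrC EFinM.
rewrite ge0_integralZl//; last 3 first.
- exact/measurable_EFinP.
- by move=> x _; rewrite lee_fin.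
- by rewrite lee_fin invr_ge0 ltW// heatdens_gt0.
by rewrite -heatdensE -EFinM mulVf// gt_eqF// heatdens_gt0.
Qed.

Lemma heatk_backk x y : heatk x y * w x = backk y x * heatdens y.
Proof. by rewrite /backk divfK// gt_eqF// heatdens_gt0. Qed.

Lemma heatdens_ge0 y : 0 <= heatdens y. Proof. exact/ltW/heatdens_gt0. Qed.

Variables (pi : probability rV R) (beta : R -> R).
Hypotheses (piE : forall A, measurable A -> (pi A = \int[lam]_(x in A) (w x)%:E)%E)
  (Hpi : weak_poincare pi beta (fun f => (osc f ^+ 2)%E)).

Lemma kop_gaussconv (v : rV -> R) x : subgaussian_growth v ->
  kop lam heatk (EFin \o v) x = (gaussconv h v x)%:E.
Proof. by move=> gv; rewrite gaussconvE. Qed.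

(** The truncated density is only measurable, whereas the weak Poincare inequality needs a smooth
    test function; the Gaussian convolution of v is one. Bessel's inequality bounds its energy by
    (2/h)(a - c), and its oscillation is at most M. *)
Lemma wpi_smoothing (r M : R) (v : rV -> R) : 0 < r -> measurable_fun [set: rV] v ->
  (forall y, 0 <= v y <= M) ->
  exists a c m : R, [/\ (\int[lam]_y (v y ^+ 2 * heatdens y)%:E = a%:E)%E,
      (\int[lam]_x (kop lam heatk (EFin \o v) x * kop lam heatk (EFin \o v) x * (w x)%:E) = c%:E)%E,
      (\int[lam]_y (v y * heatdens y)%:E = m%:E)%E &
      c - m ^+ 2 <= (2 * beta r / h) * (a - c) + r * M ^+ 2].
Proof.
move=> r0 mv vM; have v0 y : 0 <= v y by case/andP: (vM y).
have v1 y : v y <= M by case/andP: (vM y).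
have M0 : 0 <= M := le_trans (v0 0) (v1 0).
have gv : subgaussian_growth v.
  by apply: (@bounded_subgaussian _ _ _ M) => // y; rewrite ger0_norm.
have gv2 : subgaussian_growth (fun y => v y ^+ 2).
  by under eq_fun do rewrite expr2; exact: subgaussianM.
pose f := gaussconv h v; pose f2 := gaussconv h (fun y => v y ^+ 2).
have f0 x : 0 <= f x.
  by rewrite -(@gaussconv_cst _ _ h 0 x h0) le_gaussconv//; exact: subgaussian_cst.
have fM x : f x <= M.
  by rewrite -(@gaussconv_cst _ _ h M x h0) le_gaussconv//; exact: subgaussian_cst.
have f20 x : 0 <= f2 x.
  by rewrite -(@gaussconv_cst _ _ h 0 x h0) le_gaussconv//; [exact: subgaussian_cst|move=> y; exact: sqr_ge0].
have f2M x : f2 x <= M ^+ 2.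
  rewrite -(@gaussconv_cst _ _ h (M ^+ 2) x h0) le_gaussconv//; first exact: subgaussian_cst.
  by move=> y; rewrite ler_sqr ?nnegrE.
have mf : measurable_fun [set: rV] f.
  by apply: measurable_fun_continuous_rV; exact: gaussconv_continuous.
have mf2 : measurable_fun [set: rV] f2.
  by apply: measurable_fun_continuous_rV; exact: gaussconv_continuous.
have Ipi (g : rV -> R) : measurable_fun [set: rV] g -> (forall x, 0 <= g x) ->
    (\int[lam]_x ((g x)%:E * (w x)%:E) = \int[pi]_x (g x)%:E)%E.
  move=> mg g0; rewrite (integral_density mw w0 piE)//; first exact/measurable_EFinP.
have bnd (g : rV -> R) (K : R) : measurable_fun [set: rV] g -> (forall x, 0 <= g x <= K) ->
    exists2 c, (\int[pi]_x (g x)%:E = c%:E)%E & 0 <= c.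
  move=> mg gK.
  have i0 : (0 <= \int[pi]_x (g x)%:E)%E.
    by apply: integral_ge0 => x _; rewrite lee_fin; case/andP: (gK x).
  have iK : (\int[pi]_x (g x)%:E <= K%:E)%E.
    rewrite -[leRHS]mule1 -(@probability_setT _ _ _ pi) -integral_cst//.
    apply: le_integral_nneg => //; first exact/measurable_EFinP.
    - by move=> x; rewrite lee_fin; case/andP: (gK x).
    - by move=> x; rewrite lee_fin; case/andP: (gK x).
  have fn : (\int[pi]_x (g x)%:E)%E \is a fin_num.
    by rewrite ge0_fin_numE// (le_lt_trans iK)// ltry.
  by exists (fine (\int[pi]_x (g x)%:E)%E); [rewrite fineK|rewrite fine_ge0].
have [c cE c0] : exists2 c, (\int[pi]_x (f x ^+ 2)%:E = c%:E)%E & 0 <= c.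
  apply: (bnd _ (M ^+ 2)); first exact: measurable_funX.
  by move=> x; rewrite sqr_ge0/= ler_sqr ?nnegrE.
have [a aE a0] : exists2 a, (\int[pi]_x (f2 x)%:E = a%:E)%E & 0 <= a.
  by apply: (bnd _ (M ^+ 2)) => // x; rewrite f20 f2M.
have [m mE m0] : exists2 m, (\int[pi]_x (f x)%:E = m%:E)%E & 0 <= m.
  by apply: (bnd _ M) => // x; rewrite f0 fM.
have kd (u : rV -> R) : subgaussian_growth u -> (forall y, 0 <= u y) ->
    measurable_fun [set: rV] (gaussconv h u) -> (forall x, 0 <= gaussconv h u x) ->
    (\int[lam]_y (u y * heatdens y)%:E = \int[pi]_x (gaussconv h u x)%:E)%E.
  move=> gu u0 mgu gu0; rewrite -Ipi//.
  have hu : nnmf (EFin \o u) by apply: nnmf_EFin => //; exact: gu.1.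
  have := integral_kopQ measurable_heatk measurable_backk mw measurable_heatdens
    heatk_ge0 backk_ge0 w0 heatdens_ge0 heatk_backk integral_backk hu.
  under [RHS]eq_integral do rewrite /= -EFinM.
  by move=> <-; apply: eq_integral => x _; rewrite kop_gaussconv.
have mg : measurable_fun [set: rV] (fun x => enorm (grad f x) ^+ 2).
  apply: measurable_funX; apply: measurable_enorm; apply: measurable_fun_rV => i.
  under eq_fun do rewrite mxE.
  have [_ /(_ i)[_ [ci _]]] := @gaussconv_smooth _ _ h v h0 gv 1%N.
  exact: measurable_fun_continuous_rV.
have Lf : (f : rV -> R) \in Lfun pi 2%:E.
  apply/andP; split; rewrite inE//= /finite_norm unlock /=; apply: poweR_lty.
  under eq_integral do rewrite /= ger0_norm// powR_mulrn//.
  by rewrite cE ltry.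
exists a, c, m; split.
- by rewrite -aE (kd (fun y => v y ^+ 2))// => y; exact: sqr_ge0.
- rewrite -cE -Ipi//; last by move=> x; exact: sqr_ge0.
    by apply: eq_integral => x _; rewrite kop_gaussconv// -EFinM expr2.
  exact: measurable_funX.
- by rewrite -mE kd.
have := wpi_inequality Hpi (@gaussconv_smooth _ _ h v h0 gv) r0.
rewrite -/f (varianceE Lf) !unlock.
have -> : (\int[pi]_x ((f ^+ 2)%R x)%:E = c%:E)%E.
  by rewrite -cE; apply: eq_integral => x _; rewrite fctE.
rewrite mE -EFin_expe -EFinB.
have b0 : 0 <= beta r := wpi_weight_ge0 Hpi r0.
have G1 : (\int[pi]_x (enorm (grad f x) ^+ 2)%:E <= (2 / h * (a - c))%:E)%E.
  (* Bessel's inequality integrated, in additive form, so that finiteness of the energy is a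
     consequence. *)
  have E : (c%:E + (h / 2)%:E * \int[pi]_x (enorm (grad f x) ^+ 2)%:E <= a%:E)%E.
    rewrite -cE -aE -ge0_integralZl//; last 3 first.
    - exact/measurable_EFinP.
    - by move=> x _; rewrite lee_fin sqr_ge0.
    - by rewrite lee_fin divr_ge0// ltW.
    rewrite -ge0_integralD//; last 4 first.
    - by move=> x _; rewrite lee_fin sqr_ge0.
    - by apply/measurable_EFinP; exact: measurable_funX.
    - by move=> x _; rewrite lee_fin mulr_ge0 ?sqr_ge0// divr_ge0// ltW.
    - by apply/measurable_EFinP; exact: measurable_funM.
    apply: le_integral_nneg.
    - apply/measurable_EFinP; apply: measurable_funD; first exact: measurable_funX.
      exact: measurable_funM.
    - exact/measurable_EFinP.
    - by move=> x; rewrite lee_fin addr_ge0 ?sqr_ge0// mulr_ge0 ?sqr_ge0// divr_ge0// ltW.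
    - move=> x; rewrite lee_fin enorm_sqr.
      have := gaussconv_grad_le x h0 gv; rewrite -/f -/f2; lra.
  have i0 : (0 <= \int[pi]_x (enorm (grad f x) ^+ 2)%:E)%E.
    by apply: integral_ge0 => x _; rewrite lee_fin sqr_ge0.
  move: E i0; case: (\int[pi]_x _)%E => [G| |//].
    rewrite -EFinM -EFinD !lee_fin => E G0.
    rewrite mulrAC ler_pdivlMr//; lra.
  by rewrite gt0_muley ?lte_fin ?divr_gt0// addey.
have osc1 : (osc f <= M%:E)%E.
  rewrite /osc; apply: (@le_trans _ _ (M%:E - 0%:E)%E); last by rewrite sube0.
  apply: leeB; first by apply: ge_ereal_sup => _ [x _ <-]; rewrite lee_fin.
  by apply: le_ereal_inf_tmp => _ [x _ <-]; rewrite lee_fin.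
have osc0 : (0 <= osc f)%E.
  rewrite /osc sube_ge0; last first.
    apply/orP; right.
    rewrite ge0_fin_numE//; last first.
      apply: le_trans (_ : (f 0)%:E <= _)%E; [by rewrite lee_fin|apply: ereal_sup_ubound; by exists 0].
    apply: le_lt_trans (ltry M); by apply: ge_ereal_sup => _ [x _ <-]; rewrite lee_fin.
  apply: (@le_trans _ _ (f 0)%:E); first by apply: ereal_inf_lbound; exists 0.
  by apply: ereal_sup_ubound; exists 0.
have O2 : (osc f ^+ 2 <= (M ^+ 2)%:E)%E.
  by rewrite EFin_expe lee_sqr.
move=> /le_trans H; rewrite -lee_fin; apply: H.
rewrite EFinD; apply: leeD; last first.
  by rewrite EFinM lee_wpmul2l// lee_fin ltW.
apply: le_trans (lee_wpmul2l _ G1) _; first by rewrite lee_fin.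
by rewrite -EFinM lee_fin le_eqVlt; apply/orP; left; apply/eqP; field; exact: lt0r_neq0.
Qed.

End proximal_kernels.

(** * The Maurey-Pisier inequality and the likelihood ratio of a step *)

Section derivative_along_curve.
Context (R : realType) (n : nat).
Implicit Types (x y v : 'rV[R]_n) (U : 'rV[R]_n -> R).

Lemma derive_dotv_grad U x v : differentiable U x -> 'D_v U x = dotv (grad U x) v.
Proof.
move=> dU; rewrite deriveE// {1}(row_sum_delta v) linear_sum.
rewrite /dotv; apply: eq_bigr => i _; rewrite linearZ /= mxE /partial deriveE//.
by rewrite mulrC.
Qed.

Lemma is_derive_scalel (k : R -> R) (dk t : R) v : is_derive t (1 : R) k dk ->
  is_derive t (1 : R) (fun z => k z *: v) (dk *: v).
Proof.
move=> Hk; have dkt : differentiable k t.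
  by apply/derivable1_diffP; exact: (@ex_derive _ _ _ _ _ _ _ Hk).
have dv := differentiableZl v dkt.
apply: DeriveDef; first exact/derivable1_diffP.
rewrite deriveE// diffZl//; congr (_ *: _).
by rewrite -deriveE//; exact: (@derive_val _ _ _ _ _ _ _ Hk).
Qed.

Lemma is_derive_along U (c : R -> 'rV[R]_n) (t : R) v : differentiable U (c t) ->
  is_derive t (1 : R) c v ->
  is_derive t (1 : R) (U \o c) (dotv (grad U (c t)) v).
Proof.
move=> dU dc; have dct : differentiable c t.
  by apply/derivable1_diffP; exact: (@ex_derive _ _ _ _ _ _ _ dc).
have dUc : differentiable (U \o c) t by exact: differentiable_comp.
apply: DeriveDef; first exact/derivable1_diffP.
rewrite deriveE// diff_comp//= -[X in 'd U _ X]deriveE//.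
have -> : 'D_1 c t = v by exact: (@derive_val _ _ _ _ _ _ _ dc).
by rewrite -deriveE// derive_dotv_grad.
Qed.

End derivative_along_curve.

Section rotation_invariance.
Context (R : realType) (n : nat).
Local Notation lam := (lebesgue_rV R n).
Local Notation rV := 'rV[R]_n.

Lemma measurable_lincomb d (T : measurableType d) (f g : T -> rV) (a b : R) :
  measurable_fun [set: T] f -> measurable_fun [set: T] g ->
  measurable_fun [set: T] (fun t => a *: f t + b *: g t).
Proof. by move=> mf mg; apply: measurable_rVD; exact: measurable_rVZ. Qed.

(** The orthogonal map is a composition of two affine substitutions: u = s x + c y at fixed x, then,
    with the integrals exchanged, x/c - (s/c) u at fixed u. The factors c^-n and c^n cancel. *)
Lemma lebesgue_rotation (F : rV * rV -> \bar R) (s c : R) : 0 < c ->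
  c ^+ 2 + s ^+ 2 = 1 -> measurable_fun [set: rV * rV] F -> (forall z, 0 <= F z)%E ->
  (\int[lam]_x \int[lam]_y F (s *: x + c *: y, c *: x - s *: y)%R =
   \int[lam]_x \int[lam]_y F (x, y))%E.
Proof.
move=> c0 cs mF F0; have cn : 0 < c ^+ n by rewrite exprn_gt0.
have mp (f g : rV * rV -> rV) : measurable_fun setT f -> measurable_fun setT g ->
    measurable_fun [set: rV * rV] (fun z => F (f z, g z)).
  by move=> mf mg; apply: (measurableT_comp mF); exact/measurable_fun_pairP.
have mG : measurable_fun [set: rV * rV] (fun z => F (z.2, c^-1 *: z.1 + (- (s / c)) *: z.2)%R).
  apply: mp; first exact: measurable_snd.
  by apply: measurable_lincomb; [exact: measurable_fst|exact: measurable_snd].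
transitivity (\int[lam]_x ((c ^- n)%:E * \int[lam]_u F (u, c^-1 *: x + (- (s / c)) *: u)%R))%E.
  apply: eq_integral => x _.
  have mf : measurable_fun [set: rV] (fun u => F (u, c^-1 *: x + (- (s / c)) *: u)%R).
    exact: (measurableT_comp mG (pair1_measurable x)).
  rewrite -(lebesgue_rV_affine (s *: x) c0 mf)//.
  apply: eq_integral => y _; congr F; congr pair; first by rewrite addrC.
  rewrite scalerDr !scalerA addrCA -scalerDl -[LHS]addrC; congr (_ + _).
    by rewrite -scaleNr; congr (_ *: _); rewrite mulNr divfK// gt_eqF.
  congr (_ *: _); have -> : c^-1 + - (s / c) * s = (1 - s ^+ 2) / c by field; exact: lt0r_neq0.
  by rewrite -cs addrK expr2 mulfK// gt_eqF.
have mGx : measurable_fun [set: rV] (fun x => \int[lam]_u F (u, c^-1 *: x + (- (s / c)) *: u)%R)%E.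
  exact: (@measurable_fun_fubini_tonelli_F _ _ _ _ _ lam _ mG).
rewrite ge0_integralZl//; last 2 first.
- by move=> x _; exact: integral_ge0.
- by rewrite lee_fin invr_ge0 ltW.
rewrite (@fubini_tonelli _ _ _ _ _ lam lam _ mG)//.
transitivity ((c ^- n)%:E * \int[lam]_u ((c ^+ n)%:E * \int[lam]_v F (u, v)))%E.
  congr (_ * _)%E; apply: eq_integral => u _.
  have mf : measurable_fun [set: rV] (fun v => F (u, v)).
    exact: (measurableT_comp mF (pair1_measurable u)).
  have c0' : 0 < c^-1 by rewrite invr_gt0.
  by rewrite -[X in (X%:E * _)%E](invrK (c ^+ n)) -exprVn -(lebesgue_rV_affine ((- (s / c)) *: u) c0' mf).
rewrite ge0_integralZl//; last 3 first.
- exact: (@measurable_fun_fubini_tonelli_F _ _ _ _ _ lam _ mF).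
- by move=> x _; exact: integral_ge0.
- by rewrite lee_fin ltW.
by rewrite muleA -EFinM mulVf ?mul1e// gt_eqF.
Qed.

Lemma gausspdf_rotation (s c : R) (x y : rV) : c ^+ 2 + s ^+ 2 = 1 ->
  gausspdf 1 x * gausspdf 1 y = gausspdf 1 (s *: x + c *: y) * gausspdf 1 (c *: x - s *: y).
Proof.
move=> cs; have [K gE] : exists K : R, forall v : rV, gausspdf 1 v = K * expR (- dotv v v / (2 * 1)).
  by exists (normal_peak (Num.sqrt 1) ^+ n) => v; rewrite gausspdfE.
rewrite !gE (mulrACA K) (mulrACA K _ K (expR (- dotv (c *: x - s *: y) _ / _))) -!expRD.
congr (_ * expR _); rewrite -!mulrDl -!opprD; congr (- _ / _); rewrite !dotvE (dotvC y x).
set X := dotv x x; set Y := dotv y y; set Z := dotv x y.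
rewrite -[LHS]mul1r -cs; ring.
Qed.

Lemma integral_gauss_pull (G : rV * rV -> \bar R) x : measurable_fun [set: rV * rV] G ->
  (forall z, 0 <= G z)%E ->
  ((\int[lam]_y (G (x, y) * (gausspdf 1 y)%:E)) * (gausspdf 1 x)%:E =
    \int[lam]_y (G (x, y) * (gausspdf 1 x * gausspdf 1 y)%:E))%E.
Proof.
move=> mG G0; rewrite muleC -ge0_integralZl//.
- by apply: eq_integral => y _; rewrite muleCA -EFinM.
- apply: emeasurable_funM; first exact: (measurableT_comp mG (pair1_measurable x)).
  by apply/measurable_EFinP; apply: measurable_gausspdf.
- by move=> y _; rewrite mule_ge0// lee_fin gausspdf_ge0.
- by rewrite lee_fin gausspdf_ge0.
Qed.

Lemma gaussian_rotation (F : rV * rV -> \bar R) (s c : R) : 0 < c ->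
  c ^+ 2 + s ^+ 2 = 1 -> measurable_fun [set: rV * rV] F -> (forall z, 0 <= F z)%E ->
  (\int[lam]_x ((\int[lam]_y (F (s *: x + c *: y, c *: x - s *: y)%R * (gausspdf 1 y)%:E)) * (gausspdf 1 x)%:E) =
   \int[lam]_x ((\int[lam]_y (F (x, y) * (gausspdf 1 y)%:E)) * (gausspdf 1 x)%:E))%E.
Proof.
move=> c0 cs mF F0.
have mg1 : measurable_fun [set: rV * rV] (fun z => gausspdf 1 z.1).
  by apply: measurable_gausspdf; exact: measurable_fst.
have mg2 : measurable_fun [set: rV * rV] (fun z => gausspdf 1 z.2).
  by apply: measurable_gausspdf; exact: measurable_snd.
pose H z := (F z * (gausspdf 1 z.1 * gausspdf 1 z.2)%:E)%E.
have mH : measurable_fun [set: rV * rV] H.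
  by apply: emeasurable_funM => //; apply/measurable_EFinP; exact: measurable_funM.
have H0 z : (0 <= H z)%E by rewrite mule_ge0// lee_fin mulr_ge0 ?gausspdf_ge0.
have := lebesgue_rotation c0 cs mH H0; rewrite /H /= => E.
transitivity (\int[lam]_x \int[lam]_y (F (x, y) * (gausspdf 1 x * gausspdf 1 y)%:E))%E; last first.
  by apply: eq_integral => x _; exact: esym (integral_gauss_pull x mF F0).
rewrite -E; apply: eq_integral => x _.
have mrot : measurable_fun [set: rV * rV] (fun z => F (s *: z.1 + c *: z.2, c *: z.1 - s *: z.2)%R).
  apply: (measurableT_comp mF); apply/measurable_fun_pairP; split => /=.
    by apply: measurable_lincomb; [exact: measurable_fst|exact: measurable_snd].
  under eq_fun do rewrite -scaleNr.
  by apply: measurable_lincomb; [exact: measurable_fst|exact: measurable_snd].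
rewrite (integral_gauss_pull x mrot (fun z => F0 _)).
apply: eq_integral => y _; congr (_ * _%:E)%E.
exact: gausspdf_rotation.
Qed.

End rotation_invariance.

Section maurey_pisier.
Context (R : realType) (n : nat).
Local Notation lam := (lebesgue_rV R n).
Local Notation rV := 'rV[R]_n.
Local Notation leb := (@lebesgue_measure R).
Variables (U : rV -> R) (h a : R) (m : rV).
Hypotheses (dU : forall x, differentiable U x)
  (cU : forall i, continuous (partial i U)) (h0 : 0 < h).

(** The arc joins the image of Y at t = 0 to that of X at t = pi/2. At every t the brackets in [arc]
    and [darc] form an orthogonal image of the pair (X, Y), so for independent standard Gaussians
    they are again independent and standard. *)
Let arc (X Y : rV) (t : R) : rV := Num.sqrt h *: (sin t *: X + cos t *: Y) + m.
Let darc (X Y : rV) (t : R) : rV := Num.sqrt h *: (cos t *: X - sin t *: Y).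

Let is_derive_arc X Y t : is_derive t (1 : R) (arc X Y) (darc X Y t).
Proof.
have -> : arc X Y = (fun t => (Num.sqrt h * sin t) *: X + (Num.sqrt h * cos t) *: Y + cst m t).
  by apply/funext => z; rewrite /arc scalerDr !scalerA.
have -> : darc X Y t = (Num.sqrt h * cos t) *: X + (Num.sqrt h * (- sin t)) *: Y + 0.
  by rewrite /darc addr0 scalerDr -scaleNr !scalerA.
have H1 : is_derive t (1 : R) (fun t => Num.sqrt h * sin t) (Num.sqrt h * cos t).
  exact: (is_deriveZ (Num.sqrt h) (is_derive_sin t)).
have H2 : is_derive t (1 : R) (fun t => Num.sqrt h * cos t) (Num.sqrt h * - sin t).
  exact: (is_deriveZ (Num.sqrt h) (is_derive_cos t)).
apply: is_deriveD (is_derive_cst _ _ _); apply: is_deriveD; exact: is_derive_scalel.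
Qed.

Let continuous_arc X Y : continuous (arc X Y).
Proof.
move=> t; apply/differentiable_continuous/derivable1_diffP.
exact: (@ex_derive _ _ _ _ _ _ _ (is_derive_arc X Y t)).
Qed.

Let slope X Y t : R := a * (pi / 2) * dotv (grad U (arc X Y t)) (darc X Y t).

Let continuous_slope X Y : continuous (slope X Y).
Proof.
suff cd : continuous (fun t => dotv (grad U (arc X Y t)) (darc X Y t)).
  move=> t; have cc : {for t, continuous (cst (a * (pi / 2)) : R -> R)} by exact: cst_continuous.
  exact: (continuousM cc (cd t)).
rewrite /dotv; elim: (index_enum _) => [|i r IH].
  by under eq_fun do rewrite big_nil; exact: cst_continuous.
under eq_fun do rewrite big_cons.
move=> t.
have c1 : {for t, continuous (fun t => grad U (arc X Y t) ord0 i)}.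
  have -> : (fun t => grad U (arc X Y t) ord0 i) = partial i U \o arc X Y.
    by apply/funext => z; rewrite mxE.
  by apply: continuous_comp; [exact: continuous_arc|exact: cU].
have c2 : {for t, continuous (fun t => darc X Y t ord0 i)}.
  have -> : (fun t => darc X Y t ord0 i) = (fun t => Num.sqrt h * (cos t * X ord0 i - sin t * Y ord0 i)).
    by apply/funext => z; rewrite !mxE.
  apply: continuousM; first exact: cst_continuous.
  apply: continuousB; apply: continuousM; try exact: cst_continuous.
    exact: continuous_cos.
  exact: continuous_sin.
exact: (continuousD (continuousM c1 c2) (IH t)).
Qed.

Let pih : 0 < pi / 2 :> R. Proof. by rewrite divr_gt0// pi_gt0. Qed.

(** Jensen's inequality on [0, pi/2]: exp lies above its tangent at [c0], and [c0] is the average of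
    the slope along the arc by the fundamental theorem of calculus. [F] is the primitive of the
    tangent expression. *)
Let jensen_arc X Y :
  ((pi / 2 * expR (a * (U (Num.sqrt h *: X + m) - U (Num.sqrt h *: Y + m))))%R%:E <=
   \int[leb]_(t in `[0%R, (pi / 2)%R]) (expR (slope X Y t))%:E)%E.
Proof.
set c0 := a * _.
pose f t := expR c0 * (1 + slope X Y t - c0).
pose F t := expR c0 * ((1 - c0) * t + (pi / 2 * a) * (U \o arc X Y) t).
have cf : continuous f.
  move=> t; have k (c : R) : {for t, continuous (cst c : R -> R)} by exact: cst_continuous.
  have H := continuousM (k (expR c0)) (continuousB (continuousD (k 1) (@continuous_slope X Y t)) (k c0)).
  exact H.
have dF t : is_derive t (1 : R) F (f t).
  have H1 := is_derive_along (dU (arc X Y t)) (is_derive_arc X Y t).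
  have H2 := is_deriveD (is_deriveZ (1 - c0) (is_derive_id t (1 : R))) (is_deriveZ (pi / 2 * a) H1).
  have H3 := is_deriveZ (expR c0) H2.
  have -> : f t = expR c0 *: ((1 - c0) *: 1 + (pi / 2 * a) *: dotv (grad U (arc X Y t)) (darc X Y t)).
    by rewrite /GRing.scale/= /f /slope; ring.
  exact: H3.
have cF : continuous F.
  move=> t; apply/differentiable_continuous/derivable1_diffP.
  exact: (@ex_derive _ _ _ _ _ _ _ (dF t)).
have := @continuous_FTC2 R f F 0 (pi / 2) pih (continuous_subspaceT cf).
have dFc : derivable_oo_LRcontinuous F 0 (pi / 2).
  split; last 2 first.
  + exact: cvg_at_right_filter (cF 0).
  + exact: cvg_at_left_filter (cF (pi / 2)).
  + by move=> t _; exact: (@ex_derive _ _ _ _ _ _ _ (dF t)).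
have dFE : {in `]0, pi / 2[, F^`()%classic =1 f}.
  by move=> t _; rewrite derive1E; exact: (@derive_val _ _ _ _ _ _ _ (dF t)).
move=> /(_ dFc dFE).
move=> E; have FE : F (pi / 2) - F 0 = pi / 2 * expR c0.
  rewrite /F /= /arc sin_pihalf cos_pihalf sin0 cos0 !scale1r !scale0r addr0 add0r.
  have -> : (1 - c0) * (pi / 2) + pi / 2 * a * U (Num.sqrt h *: X + m) =
    pi / 2 * (1 - c0 + a * U (Num.sqrt h *: X + m)) by ring.
  rewrite -mulrBr mulr0 add0r; have : c0 = a * U (Num.sqrt h *: X + m) - a * U (Num.sqrt h *: Y + m).
    by rewrite /c0 mulrBr.
  move=> Ec; have -> : pi / 2 * (1 - c0 + a * U (Num.sqrt h *: X + m)) - pi / 2 * a * U (Num.sqrt h *: Y + m)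
    = pi / 2 * (1 - c0 + (a * U (Num.sqrt h *: X + m) - a * U (Num.sqrt h *: Y + m))) by ring.
  by rewrite -Ec; ring.
rewrite -FE EFinB -E; apply: le_integral => //.
- by apply: continuous_compact_integrable; [exact: segment_compact|exact: continuous_subspaceT].
- apply: continuous_compact_integrable; first exact: segment_compact.
  apply: continuous_subspaceT => t; apply: continuous_comp; first exact: continuous_slope.
  exact: continuous_expR.
- move=> t _; rewrite lee_fin /f.
  have -> : expR (slope X Y t) = expR c0 * expR (slope X Y t - c0).
    by rewrite -expRD; congr expR; ring.
  by rewrite ler_wpM2l ?expR_ge0// -addrA expR_ge1Dx.
Qed.

Let mgrad d (T : measurableType d) (f : T -> rV) : measurable_fun [set: T] f ->
  measurable_fun [set: T] (fun t => grad U (f t)).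
Proof.
move=> mf; apply: measurable_fun_rV => i; under eq_fun do rewrite mxE.
by apply: (measurableT_comp _ mf); exact: measurable_fun_continuous_rV.
Qed.

Let mU : measurable_fun [set: rV] U.
Proof. by apply: measurable_fun_continuous_rV => x; exact: differentiable_continuous. Qed.

(** The arc bound is averaged over X and Y, the integrals are exchanged and the pair is rotated. For
    each t the slope becomes a Gaussian linear form independent of the base point; its exponential
    moment has exponent (1/2) (a pi/2)^2 h |grad U|^2, the origin of pi^2/8. *)
Lemma maurey_pisier :
  (\int[lam]_x ((\int[lam]_y ((expR (a * (U (Num.sqrt h *: x + m)%R - U (Num.sqrt h *: y + m)%R)))%:E
      * (gausspdf 1 y)%:E)) * (gausspdf 1 x)%:E) <=
   \int[lam]_x ((expR ((pi : R) ^+ 2 / 8 * a ^+ 2 * h *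
      dotv (grad U (Num.sqrt h *: x + m)%R) (grad U (Num.sqrt h *: x + m)%R)))%:E * (gausspdf 1 x)%:E))%E.
Proof.
(* The end point pi/2 is left out because the rotation lemma needs cos t > 0; it is a null set. *)
pose D : set (measurableTypeR R) := `[0, (pi / 2 : R)[%classic.
pose G (t : R) (x y : rV) : R := expR (slope x y t) * \1_D t.
have G0 t x y : 0 <= G t x y by rewrite mulr_ge0 ?expR_ge0.
have mG : measurable_fun [set: measurableTypeR R * (rV * rV)] (fun z => G z.1 z.2.1 z.2.2).
  have mx : measurable_fun [set: measurableTypeR R * (rV * rV)] (fun z => z.2.1).
    exact: (measurableT_comp measurable_fst measurable_snd).
  have my : measurable_fun [set: measurableTypeR R * (rV * rV)] (fun z => z.2.2).
    exact: (measurableT_comp measurable_snd measurable_snd).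
  have mt : measurable_fun [set: measurableTypeR R * (rV * rV)] fst by exact: measurable_fst.
  have msin : measurable_fun [set: measurableTypeR R * (rV * rV)] (fun z => sin z.1).
    exact: (measurableT_comp (continuous_measurable_fun (@continuous_sin R)) mt).
  have mcos : measurable_fun [set: measurableTypeR R * (rV * rV)] (fun z => cos z.1).
    exact: (measurableT_comp (continuous_measurable_fun (@continuous_cos R)) mt).
  have msc (k : measurableTypeR R * (rV * rV) -> R) (f : measurableTypeR R * (rV * rV) -> rV) :
     measurable_fun setT k -> measurable_fun setT f -> measurable_fun setT (fun z => k z *: f z).
    move=> mk mf; apply: measurable_fun_rV => i; under eq_fun do rewrite mxE.
    by apply: measurable_funM => //; exact: (measurableT_comp (@measurable_coord R n i) mf).
  apply: measurable_funM; last first.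
    have mD : measurable_fun [set: measurableTypeR R] (\1_D : measurableTypeR R -> R).
    by apply: measurable_indic; exact: measurable_itv.
  exact: (measurableT_comp mD mt).
  apply: measurableT_comp => //; apply: measurable_funM => //; apply: measurable_dotv.
    apply: mgrad; apply: measurable_rVD => //; apply: measurable_rVZ.
    by apply: measurable_rVD; exact: msc.
  apply: measurable_rVZ; apply: measurable_rVD; first exact: msc.
  by apply: measurable_rVN; exact: msc.
have mGt x y : measurable_fun [set: measurableTypeR R] (fun t => G t x y).
  exact: (measurableT_comp mG (pair2_measurable (x, y))).
pose J z : \bar R := (\int[leb]_t (G t z.1 z.2)%:E)%E.
have mJ : measurable_fun [set: rV * rV] J.
  apply: (@measurable_fun_fubini_tonelli_G _ _ _ _ _ leb (fun z => (G z.1 z.2.1 z.2.2)%:E)).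
    exact/measurable_EFinP.
  by move=> z; rewrite lee_fin.
have J0 z : (0 <= J z)%E by apply: integral_ge0 => t _; rewrite lee_fin.
pose E z := expR (a * (U (Num.sqrt h *: z.1 + m)%R - U (Num.sqrt h *: z.2 + m)%R)).
have maff d (T : measurableType d) (f : T -> rV) : measurable_fun setT f ->
    measurable_fun [set: T] (fun t => U (Num.sqrt h *: f t + m)).
  by move=> mf; apply: (measurableT_comp mU); apply: measurable_rVD => //; exact: measurable_rVZ.
have mE : measurable_fun [set: rV * rV] E.
  apply: measurableT_comp => //; apply: measurable_funM => //.
  by apply: measurable_funB; apply: maff; [exact: measurable_fst|exact: measurable_snd].
have EJ z : ((pi / 2)%R%:E * (E z)%:E <= J z)%E.
  rewrite -EFinM; apply: le_trans (jensen_arc z.1 z.2) _.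
  have mexp : measurable_fun [set: measurableTypeR R] (fun t => expR (slope z.1 z.2 t)).
    apply: measurableT_comp => //; apply: (continuous_measurable_fun (@continuous_slope z.1 z.2)).
  rewrite -(@integral_itv_bndo_bndc _ _ _ (fun t => (expR (slope z.1 z.2 t))%:E)); last first.
    by apply: measurable_funTS; exact/measurable_EFinP.
  rewrite integral_mkcond /J le_eqVlt; apply/orP; left; apply/eqP; apply: eq_integral => t _.
  by rewrite patchE /G indicE -/D; case: (t \in D); rewrite ?mulr1 ?mulr0.
have mg1 : measurable_fun [set: rV] (fun x : rV => gausspdf 1 x) by exact: measurable_gausspdf.
pose B := (\int[lam]_x ((expR ((pi : R) ^+ 2 / 8 * a ^+ 2 * h *
      dotv (grad U (Num.sqrt h *: x + m)%R) (grad U (Num.sqrt h *: x + m)%R)))%:E * (gausspdf 1 x)%:E))%E.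
have step4 (t : R) : D t ->
   (\int[lam]_x ((\int[lam]_y ((G t x y)%:E * (gausspdf 1 y)%:E)) * (gausspdf 1 x)%:E) = B)%E.
  move=> Dt; have Dt' := Dt; move: Dt; rewrite /D /= in_itv/= => /andP[t0 t1].
  have ct : 0 < cos t by rewrite cos_gt0_pihalf// t1 (lt_le_trans _ t0)// oppr_lt0.
  pose F z : \bar R := (expR (a * (pi / 2) * dotv (grad U (Num.sqrt h *: z.1 + m)) (Num.sqrt h *: z.2)))%:E.
  have mF : measurable_fun [set: rV * rV] F.
    apply/measurable_EFinP; apply: measurableT_comp => //; apply: measurable_funM => //.
    apply: measurable_dotv; last by apply: measurable_rVZ; exact: measurable_snd.
    by apply: mgrad; apply: measurable_rVD => //; apply: measurable_rVZ; exact: measurable_fst.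
  have F0 z : (0 <= F z)%E by rewrite lee_fin expR_ge0.
  have Erot := gaussian_rotation ct (cos2Dsin2 t) mF F0.
  have RB : (\int[lam]_x ((\int[lam]_y (F (x, y) * (gausspdf 1 y)%:E)) * (gausspdf 1 x)%:E) = B)%E.
    apply: eq_integral => x _; congr (_ * _)%E.
    have := gauss_mgf 0 ((a * (pi / 2)) *: (Num.sqrt h *: grad U (Num.sqrt h *: x + m))) (@ltr01 R).
    rewrite (dotvC _ 0) dot0v add0r.
    set g := grad U _.
    have -> : 1 / 2 * dotv ((a * (pi / 2)) *: (Num.sqrt h *: g)) ((a * (pi / 2)) *: (Num.sqrt h *: g)) =
        pi ^+ 2 / 8 * a ^+ 2 * h * dotv g g.
      by rewrite !dotvE -[in RHS](sqr_sqrtr (ltW h0)); field.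
    move=> <-; apply: eq_integral => y _; rewrite subr0 -EFinM mulrC; congr (_ * expR _)%:E.
    by rewrite /= !dotvE /g; ring.
  apply: (etrans _ RB); apply: (etrans _ Erot).
  apply: eq_integral => x _; congr (_ * _)%E; apply: eq_integral => y _.
  have tD : (t \in D) = true by exact: mem_set.
  have GE : G t x y = expR (slope x y t) by rewrite /G indicE tD; exact: (mulr1 (expR _)).
  have FE : F (sin t *: x + cos t *: y, cos t *: x - sin t *: y)%R = (expR (slope x y t))%:E by [].
  by rewrite GE FE.
pose Phi (z : measurableTypeR R * (rV * rV)) : \bar R :=
  ((G z.1 z.2.1 z.2.2)%:E * (gausspdf 1 z.2.1 * gausspdf 1 z.2.2)%:E)%E.
have mPhi : measurable_fun setT Phi.
  apply: emeasurable_funM; first exact/measurable_EFinP.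
  apply/measurable_EFinP; apply: measurable_funM; apply: measurable_gausspdf.
    exact: (measurableT_comp measurable_fst measurable_snd).
  exact: (measurableT_comp measurable_snd measurable_snd).
have Phi0 z : (0 <= Phi z)%E by rewrite mule_ge0 ?lee_fin ?mulr_ge0 ?gausspdf_ge0.
have gg0 x y : 0 <= gausspdf 1 x * gausspdf 1 y :> R by rewrite mulr_ge0 ?gausspdf_ge0.
have LJ : (\int[lam]_x ((\int[lam]_y (J (x, y) * (gausspdf 1 y)%:E)) * (gausspdf 1 x)%:E) =
    \int[lam]_x \int[lam]_y \int[leb]_t Phi (t, (x, y)))%E.
  apply: eq_integral => x _; rewrite integral_gauss_pull//; apply: eq_integral => y _.
  rewrite /J /= muleC -ge0_integralZl//.
  - by apply: eq_integral => t _; rewrite muleC.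
  - exact/measurable_EFinP.
  - by move=> t _; rewrite lee_fin.
  - by rewrite lee_fin.
have swap1 : (\int[lam]_x \int[lam]_y \int[leb]_t Phi (t, (x, y)) =
    \int[lam]_x \int[leb]_t \int[lam]_y Phi (t, (x, y)))%E.
  apply: eq_integral => x _.
  have mP : measurable_fun [set: rV * measurableTypeR R] (fun z => Phi (z.2, (x, z.1))).
    have mi : measurable_fun [set: rV * measurableTypeR R] (fun z => (x, z.1)).
      by apply/measurable_fun_pairP; split; [exact: measurable_cst|exact: measurable_fst].
    apply: (measurableT_comp mPhi); apply/measurable_fun_pairP; split; first exact: measurable_snd.
    exact: mi.
  exact: (@fubini_tonelli _ _ _ _ _ lam leb _ mP).
have swap2 : (\int[lam]_x \int[leb]_t \int[lam]_y Phi (t, (x, y)) =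
    \int[leb]_t \int[lam]_x \int[lam]_y Phi (t, (x, y)))%E.
  have mP : measurable_fun [set: rV * measurableTypeR R] (fun z => \int[lam]_y Phi (z.2, (z.1, y)))%E.
    apply: (@measurable_fun_fubini_tonelli_F _ _ _ _ _ lam (fun z : (rV * measurableTypeR R) * rV => Phi (z.1.2, (z.1.1, z.2)))) => //.
    have mi : measurable_fun [set: (rV * measurableTypeR R) * rV] (fun z => (z.1.1, z.2)).
      apply/measurable_fun_pairP; split; last exact: measurable_snd.
      exact: (measurableT_comp measurable_fst measurable_fst).
    apply: (measurableT_comp mPhi); apply/measurable_fun_pairP; split; last exact: mi.
    exact: (measurableT_comp measurable_snd measurable_fst).
  rewrite (@fubini_tonelli _ _ _ _ _ lam leb _ mP)// => z; exact: integral_ge0.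
have B0 : (0 <= B)%E.
  by apply: integral_ge0 => x _; rewrite mule_ge0 ?lee_fin ?expR_ge0 ?gausspdf_ge0.
have Bt : (\int[leb]_t \int[lam]_x \int[lam]_y Phi (t, (x, y)) = (pi / 2)%R%:E * B)%E.
  transitivity (\int[leb]_(t in D) (cst B t))%E.
    rewrite [RHS]integral_mkcond; apply: eq_integral => t _; rewrite patchE.
    case: ifPn => tD.
      rewrite -(step4 t (set_mem tD)); apply: eq_integral => x _.
      have mGx : measurable_fun [set: rV * rV] (fun z => (G t z.1 z.2)%:E).
        by apply/measurable_EFinP; exact: (measurableT_comp mG (pair1_measurable t)).
      have GE0 (z : rV * rV) : (0 <= (G t z.1 z.2)%:E)%E by rewrite lee_fin.
      exact: esym (integral_gauss_pull x mGx GE0).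
    have -> : (point : \bar R) = 0%E by [].
    apply: integral0_eq => x _; apply: integral0_eq => y _.
    by rewrite /Phi /G indicE (negbTE tD) mulr0 mul0e.
  have mD : measurable D by exact: measurable_itv.
  rewrite integral_cst// [LHS]muleC; congr (_ * _)%E.
  apply: (etrans (lebesgue_measure_itv _)) => /=.
  by rewrite lte_fin pih -EFinB subr0.
have mEg x : measurable_fun [set: rV] (fun y => (E (x, y))%:E * (gausspdf 1 y)%:E)%E.
  apply: emeasurable_funM; apply/measurable_EFinP => //.
  exact: (measurableT_comp mE (pair1_measurable x)).
have mJg x : measurable_fun [set: rV] (fun y => J (x, y) * (gausspdf 1 y)%:E)%E.
  apply: emeasurable_funM; last exact/measurable_EFinP.
  exact: (measurableT_comp mJ (pair1_measurable x)).
have mIE : measurable_fun [set: rV] (fun x => (\int[lam]_y ((E (x, y))%:E * (gausspdf 1 y)%:E)) * (gausspdf 1 x)%:E)%E.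
  apply: emeasurable_funM; last exact/measurable_EFinP.
  apply: (@measurable_fun_fubini_tonelli_F _ _ _ _ _ lam (fun z => (E z)%:E * (gausspdf 1 z.2)%:E)%E).
    apply: emeasurable_funM; apply/measurable_EFinP => //.
    by apply: measurable_gausspdf; exact: measurable_snd.
  by move=> z; rewrite mule_ge0 ?lee_fin ?expR_ge0 ?gausspdf_ge0.
have mIJ : measurable_fun [set: rV] (fun x => (\int[lam]_y (J (x, y) * (gausspdf 1 y)%:E)) * (gausspdf 1 x)%:E)%E.
  apply: emeasurable_funM; last exact/measurable_EFinP.
  apply: (@measurable_fun_fubini_tonelli_F _ _ _ _ _ lam (fun z => J z * (gausspdf 1 z.2)%:E)%E).
    apply: emeasurable_funM => //; apply/measurable_EFinP => //.
    by apply: measurable_gausspdf; exact: measurable_snd.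
  by move=> z; rewrite mule_ge0 ?lee_fin ?gausspdf_ge0.
have Eg0 x y : (0 <= (E (x, y))%:E * (gausspdf 1 y)%:E)%E by rewrite mule_ge0 ?lee_fin ?expR_ge0 ?gausspdf_ge0.
have Jg0 x y : (0 <= J (x, y) * (gausspdf 1 y)%:E)%E by rewrite mule_ge0 ?lee_fin ?gausspdf_ge0.
have p0 : (0 <= (pi / 2 : R)%R%:E)%E by rewrite lee_fin ltW.
rewrite -(@lee_pmul2l _ (pi / 2 : R)%R%:E) ?lte_fin//.
apply: (@le_trans _ _ (\int[lam]_x ((\int[lam]_y (J (x, y) * (gausspdf 1 y)%:E)) * (gausspdf 1 x)%:E))%E); last first.
  by rewrite LJ swap1 swap2 Bt.
have IE0 x : (0 <= (\int[lam]_y ((E (x, y))%:E * (gausspdf 1 y)%:E)) * (gausspdf 1 x)%:E)%E.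
  apply: mule_ge0; last by rewrite lee_fin gausspdf_ge0.
  by apply: integral_ge0 => y _; exact: Eg0.
rewrite -(ge0_integralZl lam measurableT mIE (fun x _ => IE0 x) p0).
apply: le_integral_nneg => //.
- exact: (measurable_funeM _ mIE).
- by move=> x; apply: mule_ge0 => //; exact: IE0.
- move=> x; rewrite muleA; apply: lee_wpmul2r; first by rewrite lee_fin gausspdf_ge0.
  rewrite -(ge0_integralZl lam measurableT (mEg x) (fun y _ => Eg0 x y) p0).
  apply: le_integral_nneg => //.
  + exact: (measurable_funeM _ (mEg x)).
  + by move=> y; apply: mule_ge0 => //; exact: Eg0.
  + by move=> y; rewrite muleA; apply: lee_wpmul2r; [rewrite lee_fin gausspdf_ge0|exact: EJ].
Qed.

End maurey_pisier.

(** Replacing a power s <= 1 by an affine function at a chosen scale l turns Hoelder bounds into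
    quadratic exponents, which Gaussian integrals can handle. *)
Lemma powR_le_affine (R : realType) (t l s : R) : 0 <= t -> 0 < l -> 0 <= s <= 1 ->
  t `^ s <= l `^ s + l `^ (s - 1) * t.
Proof.
move=> t0 l0 /andP[s0 s1]; have [tl|lt] := leP t l.
  apply: (@le_trans _ _ (l `^ s)); first by apply: ge0_ler_powR => //; rewrite nnegrE// ltW.
  by rewrite lerDl mulr_ge0// powR_ge0.
have tp : 0 < t by rewrite (lt_trans l0).
apply: (@le_trans _ _ (l `^ (s - 1) * t)); last by rewrite lerDr powR_ge0.
have -> : t `^ s = t `^ (s - 1) * t.
  by rewrite -[X in _ = _ * X](powRr1 t0) -powRD ?subrK// (gt_eqF tp) implybT.
rewrite ler_wpM2r//.
have e (x : R) : x `^ (s - 1) = (x `^ (1 - s))^-1 by rewrite -powRN opprB.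
rewrite !e lef_pV2 ?posrE ?powR_gt0//.
by apply: ge0_ler_powR; rewrite ?subr_ge0 ?nnegrE// ltW.
Qed.

Lemma powR_addr_le (R : realType) (t1 t2 s : R) : 0 <= t1 -> 0 <= t2 -> 0 <= s <= 1 ->
  (t1 + t2) `^ s <= 2 * (t1 `^ s + t2 `^ s).
Proof.
have H (a b : R) : 0 <= a -> a <= b -> 0 <= s <= 1 -> (a + b) `^ s <= 2 * (a `^ s + b `^ s).
  move=> a0 ab /andP[s0 s1]; have b0 := le_trans a0 ab.
  apply: (@le_trans _ _ ((2 * b) `^ s)).
    apply: ge0_ler_powR; rewrite ?nnegrE ?addr_ge0 ?mulr_ge0//; lra.
  rewrite powRM//; apply: ler_pM; rewrite ?powR_ge0//.
    by rewrite -[leRHS]powRr1//; apply: ler_powR => //; rewrite ler1n.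
  by rewrite lerDr powR_ge0.
move=> t10 t20 s01; have [le12|/ltW le21] := leP t1 t2; first exact: H.
by rewrite addrC [X in 2 * X]addrC; exact: H.
Qed.

Lemma inv_onem_le (R : realType) (u : R) : 0 <= u -> u <= 2^-1 -> (1 - u)^-1 <= expR (2 * u).
Proof.
move=> u0 u1; rewrite -[leRHS]invrK -expRN lef_pV2 ?posrE ?expR_gt0//; last by lra.
have h := expR_ge1Dx (2 * u).
rewrite expRN -[leRHS]mul1r -[leLHS]mul1r ler_pdivrMr ?expR_gt0// mul1r.
have : (1 - u) * (1 + 2 * u) <= (1 - u) * expR (2 * u) by rewrite ler_wpM2l//; lra.
have -> : (1 - u) * (1 + 2 * u) = 1 + u * (1 - 2 * u) by ring.
have : 0 <= u * (1 - 2 * u) by rewrite mulr_ge0//; lra.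
lra.
Qed.

Section holder_potential.
Context (R : realType) (n : nat).
Local Notation rV := 'rV[R]_n.
Variables (V : rV -> R) (L s : R).
Hypotheses (dV : forall x, differentiable V x) (hV : holder_grad V L s)
  (L0 : 0 < L) (s0 : 0 < s).

Lemma continuous_potential : continuous V.
Proof. by move=> x; exact: differentiable_continuous. Qed.

Lemma continuous_partial_potential i : continuous (partial i V).
Proof.
move=> x; apply: enorm_continuous_at => e e0.
have eL : 0 < e / L by rewrite divr_gt0.
exists ((e / L) `^ s^-1); first by rewrite powR_gt0.
move=> y yx; apply: (@le_lt_trans _ _ (L * enorm (y - x) `^ s)).
  apply: le_trans (hV y x).
  rewrite -(ler_pXn2r (n := 2))// ?nnegrE ?enorm_ge0// enorm_sqr real_normK ?num_real//.
  have := coord_sqr_le (grad V y - grad V x) i; by rewrite !mxE.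
rewrite mulrC -ltr_pdivlMr//.
apply: (@lt_le_trans _ _ (((e / L) `^ s^-1) `^ s)).
  by apply: gt0_ltr_powR => //; rewrite nnegrE ?enorm_ge0 ?powR_ge0.
by rewrite -powRrM mulVf ?gt_eqF// powRr1// ltW.
Qed.

Lemma measurable_grad_potential d (T : measurableType d) (f : T -> rV) :
  measurable_fun [set: T] f -> measurable_fun [set: T] (fun t => grad V (f t)).
Proof.
move=> mf; apply: measurable_fun_rV => i; under eq_fun do rewrite mxE.
apply: (measurableT_comp _ mf); apply: measurable_fun_continuous_rV.
exact: continuous_partial_potential.
Qed.

(** Used with v the gradient at the starting point: the Maurey-Pisier inequality for the tilted
    potential then sees only gradient differences, which Hoelder continuity controls. *)
Lemma grad_tilt v x : grad (fun z => V z - dotv v z) x = grad V x - v.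
Proof.
apply/rowP => i; rewrite !mxE /partial.
have dl : is_derive x (delta_mx ord0 i) (fun z : rV => dotv v z) (v ord0 i).
  have H : t^-1 *: (dotv v (t *: delta_mx ord0 i + x) - dotv v x) @[t --> (0 : R)^'] --> v ord0 i.
    apply: (@cvg_trans _ ((cst (v ord0 i) : R -> R) t @[t --> (0 : R)^'])); last exact: cvg_cst.
    apply: near_eq_cvg; near=> t.
    rewrite !dotvE addrK dotv_delta /GRing.scale/= mulKf//; near: t; exact: nbhs_dnbhs_neq.
  by split; [apply/cvg_ex; eexists; exact: H|apply: cvg_lim => //; exact: H].
have dVi : derivable V x (delta_mx ord0 i) by exact: diff_derivable.
have := @deriveB _ _ _ V (fun z => dotv v z) x (delta_mx ord0 i) dVi (@ex_derive _ _ _ _ _ _ _ dl).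
by move=> ->; congr (_ - _); exact: (@derive_val _ _ _ _ _ _ _ dl).
Unshelve. all: by end_near. Qed.

Lemma differentiable_dotv v x : differentiable (fun z : rV => dotv v z) x.
Proof.
rewrite /dotv; elim: (index_enum _) => [|i r IH].
  by under eq_fun do rewrite big_nil; exact: differentiable_cst.
under eq_fun do rewrite big_cons.
apply: (differentiableD _ IH); apply: differentiableM; first exact: differentiable_cst.
exact: differentiable_coord.
Qed.

Lemma differentiable_tilt v x : differentiable (fun z => V z - dotv v z) x.
Proof. by apply: differentiableB => //; exact: differentiable_dotv. Qed.

Lemma continuous_partial_tilt v i : continuous (partial i (fun z => V z - dotv v z)).
Proof.
have -> : partial i (fun z => V z - dotv v z) = (fun x => partial i V x - v ord0 i).
  by apply/funext => x; have := congr1 (fun M : rV => M ord0 i) (grad_tilt v x); rewrite !mxE.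
move=> x; have cc : {for x, continuous (cst (v ord0 i) : rV -> R)} by exact: cst_continuous.
exact: (continuousB (continuous_partial_potential (x := x)) cc).
Qed.

End holder_potential.

Section lmc_ratio.
Context (R : realType) (n : nat).
Local Notation rV := 'rV[R]_n.
Local Notation lam := (lebesgue_rV R n).
Variables (V : rV -> R) (L s h Z : R).
Hypotheses (dV : forall x, differentiable V x) (hV : holder_grad V L s)
  (L0 : 0 < L) (s0 : 0 < s) (h0 : 0 < h) (Z0 : 0 < Z).

Definition gibbsdens x : R := expR (- V x) / Z.
Hypothesis w1 : (\int[lam]_x (gibbsdens x)%:E = 1)%E.

Lemma gibbsdens_gt0 x : 0 < gibbsdens x.
Proof. by rewrite divr_gt0 ?expR_gt0. Qed.

Lemma gibbsdens_ge0 x : 0 <= gibbsdens x. Proof. exact/ltW/gibbsdens_gt0. Qed.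

Lemma measurable_gibbsdens : measurable_fun [set: rV] gibbsdens.
Proof.
apply: measurable_funM => //; apply: measurableT_comp => //; apply: measurableT_comp => //.
by apply: measurable_fun_continuous_rV; exact: continuous_potential.
Qed.

Local Notation w := gibbsdens.
Local Notation hk := (@heatk R n h).
Local Notation bk := (backk h w).
Let mw := measurable_gibbsdens.
Let w0 := gibbsdens_ge0.
Let mbk := measurable_backk h0 mw w0 w1.

(* An LMC step is a heat step x -> y followed by the step driftk x y; lmc_ratio is
   its likelihood ratio with respect to a proximal step. *)
Definition driftk x y z : R := gausspdf h (z - (y - h *: grad V x)).
Definition lmc_ratio x y z : R := driftk x y z / bk y z.

Lemma backk_gt0 y z : 0 < bk y z.
Proof. by rewrite divr_gt0 ?heatdens_gt0// mulr_gt0 ?heatk_gt0 ?gibbsdens_gt0. Qed.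

Lemma lmc_ratioK x y z : lmc_ratio x y z * bk y z = driftk x y z.
Proof. by rewrite divfK// gt_eqF// backk_gt0. Qed.

Lemma driftk_gt0 x y z : 0 < driftk x y z. Proof. exact: gausspdf_gt0. Qed.

Lemma lmc_ratio_gt0 x y z : 0 < lmc_ratio x y z.
Proof. by rewrite divr_gt0 ?driftk_gt0 ?backk_gt0. Qed.

Lemma measurable_driftk : measurable3 driftk.
Proof.
apply: measurable_gausspdf; apply: measurable_rVD; first exact: measurable_snd.
apply: measurable_rVN; apply: measurable_rVD.
  exact: (measurableT_comp measurable_snd measurable_fst).
apply: measurable_rVN; apply: measurable_rVZ; apply: (measurable_grad_potential hV L0 s0).
exact: (measurableT_comp measurable_fst measurable_fst).
Qed.

Lemma measurable_lmc_ratio : measurable3 lmc_ratio.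
Proof.
apply: measurable_funM; first exact: measurable_driftk.
apply: measurable_funV; first by move=> x; exact/ltW/backk_gt0.
have mi : measurable_fun [set: (rV * rV) * rV] (fun t => (t.1.2, t.2)).
  apply/measurable_fun_pairP; split; last exact: measurable_snd.
  exact: (measurableT_comp measurable_snd measurable_fst).
exact: (measurableT_comp mbk mi).
Qed.

Let U x z := V z - dotv (grad V x) z.

Let mU x : measurable_fun [set: rV] (U x).
Proof.
apply: measurable_fun_continuous_rV => z; apply: differentiable_continuous.
exact: differentiable_tilt.
Qed.

Let mdrift1 x y : measurable_fun [set: rV] (driftk x y).
Proof. by apply: measurable_gausspdf; apply: measurable_rVD => //; exact: measurable_id. Qed.

Lemma integral_driftk x y : (\int[lam]_z (driftk x y z)%:E = 1)%E.
Proof. exact: integral_gausspdf_shift1. Qed.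

(** Up to constants, the drift density is the heat kernel tilted by exp(- <v, z>) with v the
    gradient at x, and the posterior is the heat kernel tilted by exp(- V). In the ratio all
    normalising constants cancel, which leaves exp(U z) times the mean of exp(- U) under the drift
    density, for U = V - <v, .>. *)
Lemma lmc_ratioE x y z : ((lmc_ratio x y z)%:E =
  (expR (V z - dotv (grad V x) z))%:E *
  \int[lam]_t ((expR (- (V t - dotv (grad V x) t)))%:E * (driftk x y t)%:E))%E.
Proof.
set v := grad V x; pose k := dotv y v - h / 2 * dotv v v.
have dE t : driftk x y t = hk t y * expR (k - dotv v t).
  rewrite /driftk /heatk -/v !gausspdfE// -mulrA -expRD; congr (_ * expR _).
  rewrite /k !(dotvE, opprD, opprK) (dotvC t y) (dotvC v y) (dotvC v t); field; exact: lt0r_neq0.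
have -> : (\int[lam]_t ((expR (- (V t - dotv v t)))%:E * (driftk x y t)%:E) =
    (Z * expR k * heatdens h w y)%:E)%E.
  rewrite EFinM heatdensE// -ge0_integralZl//; last 3 first.
  - apply/measurable_EFinP; apply: measurable_funM => //.
    exact: (measurable_kernel2 (@measurable_heatk R n h) y).
  - by move=> t _; rewrite lee_fin mulr_ge0// heatk_ge0.
  - by rewrite lee_fin mulr_ge0 ?expR_ge0// ltW.
  apply: eq_integral => t _; rewrite -!EFinM; congr EFin.
  rewrite dE /gibbsdens.
  have -> : - (V t - dotv v t) = - V t + dotv v t by ring.
  rewrite !expRD !expRN; have e0 := expR_gt0 (dotv v t); have e1 := expR_gt0 (V t); field; rewrite ?gt_eqF ?expR_gt0//.
rewrite -EFinM; congr EFin; rewrite /lmc_ratio /backk dE.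
have b0 := heatdens_gt0 h0 mw w0 w1 y; have k0 := heatk_gt0 h0 z y.
rewrite [gibbsdens z]/gibbsdens !expRD !expRN.
have e0 := expR_gt0 (dotv v z); have e1 := expR_gt0 (V z).
move: b0 k0 e0 e1; set H := heatdens h w y; set K := hk z y; set A := expR (dotv v z).
set B := expR (V z); set D := expR (dotv y v) / _ => b0 k0 e0 e1.
by field; rewrite !gt_eqF.
Qed.

(** Jensen's inequality moves the power p inside the mean of exp(- U). What remains is the
    exponential of p (U z - U t) for two independent draws from one Gaussian, the situation of
    Maurey-Pisier. *)
Lemma lmc_ratio_moment (p : R) x y : 1 <= p ->
  (\int[lam]_z ((lmc_ratio x y z `^ p)%:E * (driftk x y z)%:E) <=
   \int[lam]_z ((expR (pi ^+ 2 / 8 * p ^+ 2 * h *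
      dotv (grad V z - grad V x) (grad V z - grad V x)))%R%:E * (driftk x y z)%:E))%E.
Proof.
move=> p1; have p0 : 0 <= p by rewrite (le_trans ler01).
pose m := y - h *: grad V x.
have meU a : measurable_fun [set: rV] (fun z => expR (a * U x z)).
  by apply: measurableT_comp => //; apply: measurable_funM.
have meU2 : measurable_fun [set: rV * rV] (fun z => expR (p * (U x z.1 - U x z.2))).
  apply: measurableT_comp => //; apply: measurable_funM => //; apply: measurable_funB.
    exact: (measurableT_comp (mU x) measurable_fst).
  exact: (measurableT_comp (mU x) measurable_snd).
have md1 : measurable_fun [set: rV] (EFin \o driftk x y) by exact/measurable_EFinP.
have md2 : measurable_fun [set: rV * rV] (fun z => (driftk x y z.2)%:E).
  exact: (measurableT_comp md1 measurable_snd).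
pose I z := (\int[lam]_t ((expR (p * (U x z - U x t)))%:E * (driftk x y t)%:E))%E.
have mI : measurable_fun [set: rV] I.
  apply: (@measurable_fun_fubini_tonelli_F _ _ _ _ _ lam (fun z => (expR (p * (U x z.1 - U x z.2)))%:E * (driftk x y z.2)%:E)%E).
    by apply: emeasurable_funM => //; exact/measurable_EFinP.
  by move=> z; rewrite mule_ge0 ?lee_fin ?expR_ge0// ltW// driftk_gt0.
have I0 z : (0 <= I z)%E.
  by apply: integral_ge0 => t _; rewrite mule_ge0 ?lee_fin ?expR_ge0// ltW// driftk_gt0.
have d0 t : 0 <= driftk x y t by exact/ltW/driftk_gt0.
have key z : ((lmc_ratio x y z `^ p)%:E <= I z)%E.
  rewrite -poweR_EFin lmc_ratioE poweRM ?lee_fin ?expR_ge0//; last first.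
    by apply: integral_ge0 => t _; rewrite mule_ge0 ?lee_fin ?expR_ge0.
  apply: (@le_trans _ _ ((expR (V z - dotv (grad V x) z))%:E `^ p *
     (\int[lam]_t ((expR (- U x t))%:E `^ p * (driftk x y t)%:E)))%E).
    apply: lee_wpmul2l; first exact: poweR_ge0.
    apply: jensen_poweR => //.
    - exact: integral_driftk.
    - by apply/measurable_EFinP; under eq_fun do rewrite -mulN1r; exact: meU.
  rewrite -ge0_integralZl//; last 3 first.
  - apply: emeasurable_funM => //; apply: measurable_poweR_fun.
    by apply/measurable_EFinP; under eq_fun do rewrite -mulN1r; exact: meU.
  - by move=> t _; rewrite mule_ge0 ?poweR_ge0 ?lee_fin.
  - exact: poweR_ge0.
  rewrite le_eqVlt; apply/orP; left; apply/eqP; apply: eq_integral => t _.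
  rewrite !poweR_EFin -!EFinM; congr EFin; rewrite mulrA; congr (_ * _).
  by rewrite -!expRM -expRD /U; congr expR; ring.
apply: (@le_trans _ _ (\int[lam]_z (I z * (driftk x y z)%:E))%E).
  apply: le_integral_nneg.
  - apply: emeasurable_funM => //; apply/measurable_EFinP.
    apply: (measurableT_comp (measurable_powR p)).
    exact: (measurableT_comp measurable_lmc_ratio (pair1_measurable (x, y))).
  - exact: emeasurable_funM.
  - by move=> z; rewrite mule_ge0 ?lee_fin ?powR_ge0.
  - by move=> z; rewrite lee_wpmul2r ?lee_fin.
have IE z : I z = (\int[lam]_t ((expR (p * (U x z - U x (Num.sqrt h *: t + m)%R)))%:E * (gausspdf 1 t)%:E))%E.
  rewrite /I /driftk -/m (@integral_gausspdf_shift R n h m ( fun t => (expR (p * (U x z - U x t)))%:E))//.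
  by apply/measurable_EFinP; exact: (measurableT_comp meU2 (pair1_measurable z)).
have eqle (a b : \bar R) : a = b -> (a <= b)%E by move=> ->.
have E1 := @integral_gausspdf_shift R n h m I h0 mI I0.
apply: (le_trans (eqle _ _ E1)).
have E2 := @maurey_pisier R n (U x) h p m (differentiable_tilt dV (grad V x))
  (continuous_partial_tilt dV hV L0 s0 (v := grad V x)) h0.
apply: (@le_trans _ _ _ _ _ (le_trans (eqle _ _ _) E2)).
  by apply: eq_integral => z _; rewrite -IE.
pose G z := expR (pi ^+ 2 / 8 * p ^+ 2 * h * dotv (grad V z - grad V x) (grad V z - grad V x)).
have mG : measurable_fun [set: rV] (EFin \o G).
  have mgz : measurable_fun [set: rV] (fun z => grad V z - grad V x).
    apply: measurable_rVD; last exact: measurable_cst.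
    by apply: (measurable_grad_potential hV L0 s0); exact: measurable_id.
  apply/measurable_EFinP.
  exact: (measurableT_comp (@measurable_expR R) (measurable_funM (measurable_cst _) (measurable_dotv mgz mgz))).
have G0 z : (0 <= (EFin \o G) z)%E by rewrite lee_fin expR_ge0.
have E4 := @integral_gausspdf_shift R n h m (EFin \o G) h0 mG G0.
apply: (le_trans _ (eqle _ _ (esym E4))); apply: eqle; apply: eq_integral => z _.
by congr (_ * _)%E; rewrite /G /U /= grad_tilt.
Qed.

End lmc_ratio.

(** The determinant factor (1 - u)^(- n/2) with u = 2 a h <= 1/2 is at most exp(n u); this is where
    the dimension enters the exponent. *)
Lemma gauss_quad_centered (R : realType) n (h a : R) (m : 'rV[R]_n) : 0 < h -> 0 <= a ->
  2 * a * h <= 2^-1 ->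
  (\int[lebesgue_rV R n]_z ((expR (a * dotv (z - m) (z - m)))%:E * (gausspdf h (z - m))%:E) <=
   (expR (n%:R * (2 * a * h)))%:E)%E.
Proof.
move=> h0 a0 ah; set u := 2 * a * h in ah *.
have u0 : 0 <= u by rewrite /u mulr_ge0 ?mulr_ge0// ltW.
have mm : measurable_fun [set: 'rV[R]_n] (fun z => z - m).
  by apply: measurable_rVD => //; exact: measurable_cst.
have mq : measurable_fun [set: 'rV[R]_n] (fun z => (expR (a * dotv (z - m) (z - m)))%:E).
  apply/measurable_EFinP.
  exact: (measurableT_comp (@measurable_expR R) (measurable_funM (measurable_cst _) (measurable_dotv mm mm))).
rewrite (@integral_gausspdf_shift R n h m (fun z => (expR (a * dotv (z - m) (z - m)))%:E) h0 mq); last first.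
  by move=> z; rewrite lee_fin expR_ge0.
have u1 : 2 * (a * h) * 1 < 1 by rewrite mulr1 mulrA -/u; lra.
have H := gauss_quad (0 : 'rV[R]_n) (@ltr01 R) u1; rewrite dot0v mulr0 expR0 mulr1 in H.
have -> : (\int[lebesgue_rV R n]_z ((expR (a * dotv (Num.sqrt h *: z + m - m) (Num.sqrt h *: z + m - m)))%:E *
    (gausspdf 1 z)%:E) = (Num.sqrt (1 - 2 * (a * h) * 1) ^- n)%:E)%E.
  rewrite -H; apply: eq_integral => z _; rewrite -EFinM addrK subr0 mulrC !dotvE.
  congr (_ * expR _)%:E; rewrite -[X in _ = a * X * _](sqr_sqrtr (ltW h0)); ring.
rewrite lee_fin mulr1 mulrA -/u mulrC expRM_natr -exprVn; apply: lerXn2r; rewrite ?nnegrE ?invr_ge0 ?sqrtr_ge0 ?expR_ge0//.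
rewrite -(ler_pXn2r (n := 2))// ?nnegrE ?invr_ge0 ?sqrtr_ge0 ?expR_ge0//.
rewrite exprVn sqr_sqrtr; last by lra.
by rewrite expr2 -expRD -mulr2n -(mulr_natl u); exact: inv_onem_le.
Qed.

Section rate.
Context (R : realType) (n : nat).
Local Notation rV := 'rV[R]_n.
Local Notation lam := (lebesgue_rV R n).
Variables (V : rV -> R) (L s h Z q B : R).
Hypotheses (dV : forall x, differentiable V x) (hV : holder_grad V L s) (V0 : grad V 0 = 0)
  (L0 : 0 < L) (s0 : 0 < s) (s1 : s <= 1) (h0 : 0 < h) (Z0 : 0 < Z) (n0 : (0 < n)%N)
  (q1 : 1 <= q) (B0 : 0 < B).
Local Notation w := (gibbsdens V Z).
Hypothesis w1 : (\int[lam]_x (w x)%:E = 1)%E.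
Local Notation l := (n%:R * h).
Local Notation K := (32 * q ^+ 2 * h * L ^+ 2).
Hypothesis small : 32 * K * h * l `^ (s - 1) <= 1.

(** [rate_cst] and [rate_quad] are the coefficients c0 and c1 in the bound on the moment of order 4q
    of the ratio. [B] is the scale at which |x|^(2 s^2) is linearised; it stays free until the step
    size is chosen. *)
Definition rate_cst : R := K * (26 * l `^ s + 8 * (h * L) `^ (2 * s) * B `^ (s ^+ 2)).
Definition rate_quad : R := K * (8 * (h * L) `^ (2 * s) * B `^ (s ^+ 2 - 1)).

Let l0 : 0 < l. Proof. by rewrite mulr_gt0// ltr0n. Qed.

Let s01 : 0 <= s <= 1. Proof. by rewrite ltW. Qed.

Lemma sqr_enorm_powR (x : rV) : (enorm x `^ s) ^+ 2 = dotv x x `^ s.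
Proof.
rewrite -(powR_mulrn 2 (powR_ge0 _ _)) -enorm_sqr -(powR_mulrn 2 (enorm_ge0 x)).
by rewrite -!powRrM mulrC.
Qed.

Lemma holder_grad_sqr x y :
  dotv (grad V x - grad V y) (grad V x - grad V y) <= L ^+ 2 * dotv (x - y) (x - y) `^ s.
Proof.
have H := ler_pM (enorm_ge0 _) (enorm_ge0 _) (hV x y) (hV x y).
by rewrite -!expr2 enorm_sqr exprMn sqr_enorm_powR in H.
Qed.

(** Since the gradient vanishes at 0, it is at most L |x|^s in norm. The power s of the squared
    drift has order 2 s^2 <= 2 in |x| and is linearised at the scale [B]. *)
Lemma drift_powR_le x : (h ^+ 2 * dotv (grad V x) (grad V x)) `^ s <=
  (h * L) `^ (2 * s) * (B `^ (s ^+ 2) + B `^ (s ^+ 2 - 1) * dotv x x).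
Proof.
have vx : dotv (grad V x) (grad V x) <= L ^+ 2 * dotv x x `^ s.
  by have := holder_grad_sqr x 0; rewrite V0 !subr0.
apply: (@le_trans _ _ (((h * L) ^+ 2 * dotv x x `^ s) `^ s)).
  apply: ge0_ler_powR; first exact: ltW.
  - by rewrite nnegrE mulr_ge0 ?dotv_ge0// sqr_ge0.
  - by rewrite nnegrE mulr_ge0 ?powR_ge0// sqr_ge0.
  - have := ler_wpM2l (sqr_ge0 h) vx; by rewrite mulrA -exprMn.
have hL0 : 0 <= h * L by rewrite ltW// mulr_gt0.
rewrite powRM ?powR_ge0 ?sqr_ge0// -powR_mulrn// -!powRrM ler_wpM2l ?powR_ge0//.
rewrite -expr2; apply: powR_le_affine => //; first exact: dotv_ge0.
by rewrite sqr_ge0/= exprn_ile1// ltW.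
Qed.

(** The displacement consists of two Gaussian increments and the drift. The increments are
    linearised at l = n h, the order of their squared norm, and become quadratic; the drift depends
    on x alone and goes into the potential. *)
Lemma displacement_le x y z :
  dotv (z - x) (z - x) `^ s <=
  2 * (l `^ s + l `^ (s - 1) * (2 * dotv (z - (y - h *: grad V x)) (z - (y - h *: grad V x)) + 4 * dotv (y - x) (y - x))
   + 4 * ((h * L) `^ (2 * s) * (B `^ (s ^+ 2) + B `^ (s ^+ 2 - 1) * dotv x x))).
Proof.
set v := grad V x; set a := z - (y - h *: v); set b := y - x.
have zx : dotv (z - x) (z - x) <= (2 * dotv a a + 4 * dotv b b) + 4 * (h ^+ 2 * dotv v v).
  have -> : z - x = a + (b - h *: v).
    by rewrite /a /b opprB addrA addrA addrC; apply/rowP => i; rewrite !mxE; ring.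
  have h1 := dotv_addC_le a (b - h *: v); have h2 := dotv_addC_le b (- (h *: v)).
  have h3 : dotv (- (h *: v)) (- (h *: v)) = h ^+ 2 * dotv v v by rewrite !dotvE; ring.
  rewrite h3 in h2; move: h1 h2; lra.
have t10 : 0 <= 2 * dotv a a + 4 * dotv b b by rewrite addr_ge0 ?mulr_ge0 ?dotv_ge0.
have t20 : 0 <= h ^+ 2 * dotv v v by rewrite mulr_ge0 ?sqr_ge0 ?dotv_ge0.
have t21 : 0 <= 4 * (h ^+ 2 * dotv v v) by rewrite mulr_ge0.
apply: (@le_trans _ _ ((2 * dotv a a + 4 * dotv b b + 4 * (h ^+ 2 * dotv v v)) `^ s)).
  apply: (ge0_ler_powR (ltW s0) _ _ zx); rewrite nnegrE; first exact: dotv_ge0.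
  exact: (addr_ge0 t10 t21).
apply: le_trans (powR_addr_le t10 t21 s01) _; rewrite ler_wpM2l//.
apply: lerD; first exact: powR_le_affine.
rewrite powRM//; apply: ler_pM; rewrite ?powR_ge0//; last exact: drift_powR_le.
by rewrite -[leRHS]powRr1//; apply: ler_powR => //; rewrite ler1n.
Qed.

Lemma pi_sqr_le (p : R) : 0 <= p -> p <= 4 * q -> pi ^+ 2 / 8 * p ^+ 2 * h <= 32 * q ^+ 2 * h.
Proof.
move=> p0 pq; rewrite ler_wpM2r ?(ltW h0)//.
have pi4 : (pi : R) <= 4 by have := pihalf_lt2 R; rewrite ltr_pdivrMr//; lra.
have pi0 := pi_ge0 R.
have : pi ^+ 2 <= 4 ^+ 2 :> R by rewrite ler_pXn2r ?nnegrE.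
have : p ^+ 2 <= (4 * q) ^+ 2 by rewrite ler_pXn2r ?nnegrE// mulr_ge0// (le_trans ler01).
rewrite exprMn => h1 h2; have p20 := sqr_ge0 p; have p2 := sqr_ge0 (pi : R).
apply: (@le_trans _ _ (4 ^+ 2 / 8 * (4 ^+ 2 * q ^+ 2))); last first.
  by rewrite le_eqVlt; apply/orP; left; apply/eqP; field.
by apply: ler_pM => //; [rewrite divr_ge0|rewrite ler_wpM2r].
Qed.

Local Notation hk := (@heatk R n h).
Local Notation bk := (backk h w).
Local Notation ratio := (lmc_ratio V h Z).

Lemma rate_bound x :
  (top lam hk bk (fun x y z => (ratio x y z `^ (4 * q))%R) (fun=> 1%E) x <=
   (expR (rate_cst + rate_quad * dotv x x))%:E)%E.
Proof.
(* One factor of the ratio converts the posterior into the drift density, so order 4q under [bk] is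
   order 4q - 1 under the drift density. *)
pose p := 4 * q - 1; have p1 : 1 <= p by have := q1; rewrite /p; lra.
have mw : measurable_fun [set: rV] w by exact: measurable_gibbsdens.
have w0 := gibbsdens_ge0 V Z0.
pose C0 := K * (2 * l `^ s + 8 * ((h * L) `^ (2 * s) * (B `^ (s ^+ 2) + B `^ (s ^+ 2 - 1) * dotv x x))).
(* Coefficients of the two squared increments. Their Gaussian integrals add 8 and 16 times K l^s to
   the exponent, which with the 2 in [C0] make the 26 of [rate_cst]. *)
pose a1 := K * 4 * l `^ (s - 1); pose a2 := K * 8 * l `^ (s - 1).
have q0 : 0 <= q by rewrite (le_trans ler01).
have hh0 := ltW h0; have LL0 := ltW L0; have p0 : 0 <= p by rewrite (le_trans ler01).
have K0 : 0 <= K.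
  by apply: mulr_ge0 (sqr_ge0 L); apply: mulr_ge0 hh0; apply: mulr_ge0 (sqr_ge0 q).
have a10 : 0 <= a1 by apply: mulr_ge0 (powR_ge0 _ _); apply: mulr_ge0.
have a20 : 0 <= a2 by apply: mulr_ge0 (powR_ge0 _ _); apply: mulr_ge0.
have sm : K * l `^ (s - 1) * h <= 32^-1.
  rewrite -(ler_pM2l (_ : 0 < 32 :> R))// mulfV//.
  by have -> : 32 * (K * l `^ (s - 1) * h) = 32 * K * h * l `^ (s - 1) by ring.
have a1h : 2 * a1 * h <= 2^-1.
  have -> : 2 * a1 * h = 8 * (K * l `^ (s - 1) * h) by rewrite /a1; ring.
  lra.
have a2h : 2 * a2 * h <= 2^-1.
  have -> : 2 * a2 * h = 16 * (K * l `^ (s - 1) * h) by rewrite /a2; ring.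
  lra.
have expo y z : pi ^+ 2 / 8 * p ^+ 2 * h * dotv (grad V z - grad V x) (grad V z - grad V x) <=
    (C0 + a2 * dotv (y - x) (y - x)) + a1 * dotv (z - (y - h *: grad V x)) (z - (y - h *: grad V x)).
  apply: (@le_trans _ _ (32 * q ^+ 2 * h * (L ^+ 2 * dotv (z - x) (z - x) `^ s))).
    apply: ler_pM.
    - apply: mulr_ge0 hh0; apply: mulr_ge0 (sqr_ge0 p); apply: mulr_ge0 (sqr_ge0 _) _.
      by rewrite invr_ge0.
    - exact: dotv_ge0.
    - by apply: pi_sqr_le; have := q1; rewrite /p; lra.
    - exact: holder_grad_sqr.
  rewrite mulrA; apply: le_trans (ler_wpM2l K0 (displacement_le x y z)) _.
  by rewrite /C0 /a1 /a2 le_eqVlt; apply/orP; left; apply/eqP; ring.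
have mratio := measurable_lmc_ratio dV hV L0 s0 h0 Z0 w1.
have mdk := measurable_driftk h hV L0 s0.
have d0 y z : 0 <= driftk V h x y z by exact/ltW/driftk_gt0.
have md1 y : measurable_fun [set: rV] (EFin \o driftk V h x y).
  by apply/measurable_EFinP; exact: (measurableT_comp mdk (pair1_measurable (x, y))).
have inner y : (tin lam bk (fun x y z => (ratio x y z `^ (4 * q))%R) (fun=> 1%E) x y <=
    (expR (C0 + n%:R * (2 * a1 * h) + a2 * dotv (y - x) (y - x)))%:E)%E.
  apply: (@le_trans _ _ (\int[lam]_z ((ratio x y z `^ p)%:E * (driftk V h x y z)%:E))%E).
    rewrite le_eqVlt; apply/orP; left; apply/eqP; apply: eq_integral => z _.
    have r0 := lmc_ratio_gt0 dV h0 Z0 w1 x y z.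
    have E : ratio x y z `^ (4 * q) = ratio x y z `^ p * ratio x y z.
      rewrite -[X in _ = _ * X](powRr1 (ltW r0)) -powRD; last by rewrite (gt_eqF r0) implybT.
      by congr (_ `^ _); rewrite /p; ring.
    by rewrite mul1e -EFinM E -mulrA (lmc_ratioK dV h0 Z0 w1).
  apply: le_trans (lmc_ratio_moment dV hV L0 s0 h0 Z0 w1 x y p1) _.
  pose m := y - h *: grad V x.
  have mm : measurable_fun [set: rV] (fun z => z - m).
    by apply: measurable_rVD => //; exact: measurable_cst.
  have mg z0 : measurable_fun [set: rV] (fun z => grad V z - z0).
    apply: measurable_rVD; last exact: measurable_cst.
    by apply: (measurable_grad_potential hV L0 s0); exact: measurable_id.
  have me : measurable_fun [set: rV] (fun z => (expR (a1 * dotv (z - m) (z - m)))%:E).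
    apply/measurable_EFinP.
    exact: (measurableT_comp (@measurable_expR R) (measurable_funM (measurable_cst _) (measurable_dotv mm mm))).
  apply: (@le_trans _ _ (\int[lam]_z ((expR (C0 + a2 * dotv (y - x) (y - x)))%:E *
      ((expR (a1 * dotv (z - m) (z - m)))%:E * (gausspdf h (z - m))%:E)))%E).
    apply: le_integral_nneg.
    - apply: emeasurable_funM; last exact: md1.
      apply/measurable_EFinP.
      exact: (measurableT_comp (@measurable_expR R) (measurable_funM (measurable_cst _) (measurable_dotv (mg _) (mg _)))).
    - apply: measurable_funeM; apply: emeasurable_funM => //; exact: (md1 y).
    - by move=> z; rewrite mule_ge0 ?lee_fin ?expR_ge0.
    - move=> z; rewrite -!EFinM lee_fin mulrA -expRD; apply: ler_wpM2r; first exact: gausspdf_ge0.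
      by rewrite ler_expR; exact: expo.
  rewrite ge0_integralZl//; last 2 first.
  - apply: emeasurable_funM => //; exact: (md1 y).
  - by move=> z _; rewrite mule_ge0 ?lee_fin ?expR_ge0//; exact: d0.
  apply: le_trans (lee_wpmul2l _ (gauss_quad_centered m h0 a10 a1h)) _; first by rewrite lee_fin expR_ge0.
  by rewrite -EFinM -expRD lee_fin ler_expR; lra.
have mb : measurable_fun [set: rV * rV] (fun z => bk z.1 z.2) by exact: measurable_backk.
have mrp : measurable3 (fun x y z => (ratio x y z `^ (4 * q))%R) by exact: measurable3_powR.
have b0 y z : 0 <= bk y z by exact/ltW/(backk_gt0 dV h0 Z0 w1).
have mt : measurable_fun [set: rV] (tin lam bk (fun x y z => (ratio x y z `^ (4 * q))%R) (fun=> 1%E) x).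
  apply: measurable_tin1 => //; by move=> *; exact: powR_ge0.
have t0 y : (0 <= tin lam bk (fun x y z => (ratio x y z `^ (4 * q))%R) (fun=> 1%E) x y)%E.
  by apply: tin_ge0 => //; move=> *; exact: powR_ge0.
have mmx : measurable_fun [set: rV] (fun z => z - x).
  by apply: measurable_rVD => //; exact: measurable_cst.
have me : measurable_fun [set: rV] (fun z => (expR (a2 * dotv (z - x) (z - x)))%:E).
  apply/measurable_EFinP.
  exact: (measurableT_comp (@measurable_expR R) (measurable_funM (measurable_cst _) (measurable_dotv mmx mmx))).
have mh1 : measurable_fun [set: rV] (fun y => (gausspdf h (y - x))%:E).
  by apply/measurable_EFinP; apply: measurable_gausspdf.
apply: (@le_trans _ _ (\int[lam]_y ((expR (C0 + n%:R * (2 * a1 * h)))%:E *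
    ((expR (a2 * dotv (y - x) (y - x)))%:E * (gausspdf h (y - x))%:E)))%E).
  apply: le_integral_nneg.
  - by apply: emeasurable_funM => //; exact: mh1.
  - by apply: measurable_funeM; exact: emeasurable_funM.
  - by move=> y; rewrite mule_ge0// lee_fin heatk_ge0.
  - move=> y; rewrite [leRHS]muleA; apply: lee_wpmul2r; first by rewrite lee_fin heatk_ge0.
    by apply: le_trans (inner y) _; rewrite -EFinM -expRD.
rewrite ge0_integralZl//; last 2 first.
- exact: emeasurable_funM.
- by move=> y _; rewrite mule_ge0 ?lee_fin ?expR_ge0// gausspdf_ge0.
apply: le_trans (lee_wpmul2l _ (gauss_quad_centered x h0 a20 a2h)) _; first by rewrite lee_fin expR_ge0.
rewrite -EFinM -expRD lee_fin ler_expR /C0 /a1 /a2 /rate_cst /rate_quad.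
have ll : l * l `^ (s - 1) = l `^ s.
  rewrite -[X in X * _ = _](powRr1 (ltW l0)) -powRD; last by rewrite (gt_eqF l0) implybT.
  by congr (_ `^ _); ring.
move: ll; set P := l `^ (s - 1); set P2 := l `^ s => ll; rewrite -ll.
by rewrite le_eqVlt; apply/orP; left; apply/eqP; ring.
Qed.

End rate.

(** * The Feynman-Kac functional and the tilted target *)

Section gaussian_weights.
Context (R : realType) (n : nat).
Local Notation rV := 'rV[R]_n.
Local Notation lam := (lebesgue_rV R n).
Variables (h al : R).
Hypotheses (h0 : 0 < h) (al0 : 0 <= al) (alh : 8 * al * h <= 1).

(** The coefficient a/(1 - 2 a h) is the one that a heat step takes back to a; the determinant
    factor is at most 1. *)
Lemma heat_neg_quad (a b : R) x : 0 <= a <= al ->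
  (kop lam (@heatk R n h) (fun y => (expR (- b - a / (1 - 2 * a * h) * dotv y y))%:E) x <=
   (expR (- b - a * dotv x x))%:E)%E.
Proof.
move=> /andP[a0 aal]; have alh1 := alh; set a' := a / _.
have ah0 : 0 <= a * h by rewrite mulr_ge0// ltW.
have ah : a * h <= 8^-1.
  have := ler_wpM2r (ltW h0) aal; lra.
have den : 0 < 1 - 2 * a * h by rewrite -mulrA; lra.
have a'0 : 0 <= a' by rewrite divr_ge0// ltW.
have a'h : 0 <= a' * h by rewrite mulr_ge0// ltW.
have H1 : 2 * - a' * h < 1 by rewrite mulrN mulNr -mulrA; lra.
have := gauss_quad x h0 H1.
have -> : 1 - 2 * - a' * h = (1 - 2 * a * h)^-1.
  rewrite /a'; field; exact: lt0r_neq0.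
have -> : - a' / (1 - 2 * a * h)^-1 = - a by rewrite invrK /a' mulNr divfK// lt0r_neq0.
move=> E.
have -> : kop lam (@heatk R n h) (fun y => (expR (- b - a' * dotv y y))%:E) x =
   ((expR (- b))%:E * \int[lam]_y (gausspdf h (y - x) * expR (- a' * dotv y y))%:E)%E.
  rewrite -ge0_integralZl//.
  - apply: eq_integral => y _; rewrite -!EFinM; congr EFin.
    by rewrite expRD -mulNr /heatk; ring.
  - apply/measurable_EFinP; apply: measurable_funM; first exact: measurable_gausspdf_shift.
    apply: (measurableT_comp (@measurable_expR R)); apply: measurable_funM => //.
    by apply: measurable_dotv; exact: measurable_id.
  - by move=> y _; rewrite lee_fin mulr_ge0 ?gausspdf_ge0 ?expR_ge0.
rewrite E -EFinM lee_fin expRD ler_wpM2l ?expR_ge0//.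
rewrite mulNr ler_piMl ?expR_ge0// invf_le1 ?exprn_gt0 ?sqrtr_gt0 ?invr_gt0//.
have d1 : 1 <= (1 - 2 * a * h)^-1 by rewrite -[leLHS]invr1 lef_pV2 ?posrE// -mulrA; lra.
by apply: exprn_ege1; have := ler_wsqrtr d1; rewrite sqrtr1.
Qed.

(** For the inverse weight a heat step leads from a/(1 - 2 a h) to a/(1 - 4 a h), which exceeds a by
    at most 8 al^2 h: the price per step of a Gaussian weight. *)
Lemma heat_pos_quad (a b : R) x : 0 <= a <= al ->
  (kop lam (@heatk R n h) (fun y => ((expR (- b - a / (1 - 2 * a * h) * dotv y y))^-1)%:E) x <=
   (expR (b + 4 * al * h * n%:R + (a + 8 * al ^+ 2 * h) * dotv x x))%:E)%E.
Proof.
move=> /andP[a0 aal]; have alh1 := alh; set a' := a / _.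
have ah0 : 0 <= a * h by rewrite mulr_ge0// ltW.
have alh0 : 0 <= al * h by rewrite mulr_ge0// ltW.
have aalh := ler_wpM2r (ltW h0) aal.
have ah : a * h <= 8^-1 by lra.
have den : 0 < 1 - 2 * a * h by rewrite -mulrA; lra.
have den4 : 0 < 1 - 4 * a * h by rewrite -mulrA; lra.
have a'0 : 0 <= a' by rewrite divr_ge0// ltW.
have a'h : 2 * a' * h = 2 * a * h / (1 - 2 * a * h) by rewrite /a'; ring.
have H1 : 2 * a' * h < 1.
  by rewrite a'h ltr_pdivrMr// mul1r -mulrA; lra.
have := gauss_quad x h0 H1.
have u0 : 0 <= 2 * a' * h by apply: mulr_ge0 (ltW h0); exact: mulr_ge0.
have u1 : 2 * a' * h <= 4 * (al * h).
  rewrite a'h ler_pdivrMr// -!mulrA.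
  have h1 : 0 <= (al * h) * (1 - 4 * (a * h)) by rewrite mulr_ge0//; lra.
  have -> : 4 * (al * (h * (1 - 2 * (a * h)))) = 2 * (al * h) + 2 * ((al * h) * (1 - 4 * (a * h))) by ring.
  lra.
have -> : a' / (1 - 2 * a' * h) = a / (1 - 4 * a * h).
  have n1 : 1 - 2 * a * h != 0 by exact: lt0r_neq0.
  have n2 : 1 - 4 * a * h != 0 by exact: lt0r_neq0.
  by rewrite /a'; field; rewrite n1 n2.
move=> E.
have -> : kop lam (@heatk R n h) (fun y => ((expR (- b - a' * dotv y y))^-1)%:E) x =
   ((expR b)%:E * \int[lam]_y (gausspdf h (y - x) * expR (a' * dotv y y))%:E)%E.
  rewrite -ge0_integralZl//.
  - apply: eq_integral => y _; rewrite -!EFinM; congr EFin.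
    rewrite -expRN opprB opprK expRD; rewrite /heatk; ring.
  - apply/measurable_EFinP; apply: measurable_funM; first exact: measurable_gausspdf_shift.
    apply: (measurableT_comp (@measurable_expR R)); apply: measurable_funM => //.
    by apply: measurable_dotv; exact: measurable_id.
  - by move=> y _; rewrite lee_fin mulr_ge0 ?gausspdf_ge0 ?expR_ge0.
rewrite E -EFinM lee_fin 2!expRD -[leRHS]mulrA ler_wpM2l ?expR_ge0//.
apply: ler_pM; rewrite ?invr_ge0 ?exprn_ge0 ?sqrtr_ge0 ?expR_ge0//.
  set u := 2 * a' * h in u0 u1 *.
  have u2 : u <= 2^-1 by lra.
  rewrite -exprVn (_ : 4 * al * h * n%:R = (4 * (al * h)) * n%:R); last by ring.
  rewrite expRM_natr; apply: lerXn2r; rewrite ?nnegrE ?invr_ge0 ?sqrtr_ge0 ?expR_ge0//.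
  rewrite -(ler_pXn2r (n := 2))// ?nnegrE ?invr_ge0 ?sqrtr_ge0 ?expR_ge0//.
  rewrite exprVn sqr_sqrtr; last by lra.
  rewrite expr2 -expRD; apply: le_trans (inv_onem_le u0 u2) _; rewrite ler_expR; lra.
rewrite ler_expR ler_wpM2r ?dotv_ge0// ler_pdivrMr//.
have -> : (a + 8 * al ^+ 2 * h) * (1 - 4 * a * h) =
  a + (8 * al ^+ 2 * h - 4 * a ^+ 2 * h) - 32 * (al ^+ 2 * h) * (a * h) by ring.
have q1 : a ^+ 2 <= al ^+ 2 by rewrite ler_pXn2r ?nnegrE.
have q2 : a ^+ 2 * h <= al ^+ 2 * h by rewrite ler_wpM2r// ltW.
have q3 : 0 <= al ^+ 2 * h by rewrite mulr_ge0 ?sqr_ge0// ltW.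
have q4 : (al ^+ 2 * h) * (a * h) <= (al ^+ 2 * h) * 8^-1 by rewrite ler_wpM2l.
lra.
Qed.

Variables (S : rV -> rV -> R) (w bb : rV -> R) (nn c0 c1 : R) (N : nat).
Hypotheses (mS : measurable_fun [set: rV * rV] (fun z => S z.1 z.2))
  (mw : measurable_fun [set: rV] w) (mb : measurable_fun [set: rV] bb).
Hypotheses (S0 : forall x y, 0 <= S x y)
  (w0 : forall x, 0 <= w x) (b0 : forall x, 0 <= bb x).
Hypothesis (QS : forall x y, heatk h x y * w x = S y x * bb y).
Hypotheses (S1 : forall x, (\int[lam]_y (S x y)%:E = 1)%E)
  (w1 : (\int[lam]_x (w x)%:E = 1)%E).
Hypotheses (nn1 : 1 <= nn) (c00 : 0 <= c0) (c10 : 0 <= c1)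
  (Nal : N%:R * (8 * al ^+ 2 * h + 2 * nn * c1) <= al).
Local Notation ec := (fun x : rV => expR (c0 + c1 * dotv x x)).

(** The weight after k steps has coefficient k da, starting from the weight 1. Each increment da
    absorbs the growth 8 al^2 h of the inverse weight and the quadratic potential 2 nn c1; [Nal]
    keeps the coefficient below [al], and the constants db accumulate in the exponent. *)
Lemma feynman_kac_sqr_bound :
  (\int[lam]_x ((iter N (feynman_kac lam (@heatk R n h) S ec nn) (fun=> 1%E) x) `^ 2 *
      (expR (- al * dotv x x) * w x)%:E) <=
   (expR (N%:R * (2 * nn * c0 + 4 * al * h * n%:R)))%:E)%E.
Proof.
pose da := 8 * al ^+ 2 * h + 2 * nn * c1; pose db := 2 * nn * c0 + 4 * al * h * n%:R.
have nn0 : 0 <= nn by rewrite (le_trans ler01).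
have da0 : 0 <= da.
  by apply: addr_ge0; [rewrite mulr_ge0 ?mulr_ge0 ?sqr_ge0// ltW|rewrite !mulr_ge0].
pose aa (k : nat) : R := k%:R * da; pose ab (k : nat) : R := k%:R * db.
have aab k : (k <= N)%N -> 0 <= aa k <= al.
  move=> kN; rewrite mulr_ge0//=; apply: le_trans Nal; rewrite ler_wpM2r//.
  by rewrite ler_nat.
pose W (k : nat) (x : rV) := expR (- ab k - aa k * dotv x x).
pose M (k : nat) (y : rV) := expR (- ab k - aa k / (1 - 2 * aa k * h) * dotv y y).
have mexp (k1 k2 : R) : measurable_fun [set: rV] (fun x => expR (k1 - k2 * dotv x x)).
  apply: (measurableT_comp (@measurable_expR R)); apply: measurable_funB => //.
  apply: measurable_funM => //; by apply: measurable_dotv; exact: measurable_id.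
have mec : measurable_fun [set: rV] ec.
  have := mexp c0 (- c1); by under eq_fun do rewrite mulNr opprK.
have mQ := @measurable_heatk R n h.
have Q0 := @heatk_ge0 R n h.
have := weighted_iter mQ mS mw mb Q0 S0 w0 b0 QS S1 (ec := ec) (n := nn) (V := W) (M := M) (N := N)
  mec (fun k => mexp _ _) (fun k x => expR_ge0 _) (fun k => mexp _ _) (fun k x => expR_gt0 _).
have H1 k x : (k < N)%N -> (kop lam (@heatk R n h) (fun y => (M k y)%:E) x <= (W k x)%:E)%E.
  by move=> kN; apply: heat_neg_quad; apply: aab; exact: ltnW.
have H2 k x : (k < N)%N -> (((ec x `^ nn) `^ 2 * W k.+1 x)%:E *
     kop lam (@heatk R n h) (fun y => (M k y)^-1%:E) x <= 1)%E.
  move=> kN; have := heat_pos_quad (ab k) x (aab k (ltnW kN)).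
  move=> /(lee_wpmul2l (_ : 0 <= ((ec x `^ nn) `^ 2 * W k.+1 x)%:E)%E) H.
  apply: le_trans (H _) _; first by rewrite lee_fin mulr_ge0 ?powR_ge0 ?expR_ge0.
  rewrite -EFinM lee_fin -powRrM -expRM /W -!expRD -[leRHS]expR0 ler_expR.
  have -> : ab k.+1 = ab k + db by rewrite /ab -natr1 mulrDl mul1r.
  have -> : aa k.+1 = aa k + da by rewrite /aa -natr1 mulrDl mul1r.
  rewrite le_eqVlt; apply/orP; left; apply/eqP; rewrite /da /db; ring.
move=> /(_ H1 H2) H.
have W0 : (\int[lam]_x (W 0%N x * w x)%:E = 1)%E.
  rewrite -[RHS]w1; apply: eq_integral => x _.
  by rewrite /W /ab /aa !mul0r oppr0 addr0 expR0 mul1r.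
rewrite W0 in H.
have hk : nnmf (iter N (feynman_kac lam (@heatk R n h) S ec nn) (fun=> 1%E)).
  by apply: nnmf_iter_fk => //; exact: nnmf_cst.
have hw := nnmf_EFin mw w0.
have m1 : measurable_fun [set: rV] (fun x => (expR (- al * dotv x x) * w x)%:E).
  apply/measurable_EFinP; apply: measurable_funM => //.
  have := mexp 0 al; by under eq_fun do rewrite add0r -mulNr.
have m2 : measurable_fun [set: rV] (fun x => (W N x * w x)%:E).
  by apply/measurable_EFinP; apply: measurable_funM => //; exact: mexp.
have hk2 := nnmf_poweR 2 hk.
apply: (@le_trans _ _ (\int[lam]_x ((expR (ab N))%:E * ((iter N (feynman_kac lam (@heatk R n h) S ec nn) (fun=> 1%E) x) `^ 2 *
      (W N x * w x)%:E)))%E).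
  apply: le_integral_nneg.
  - by apply: emeasurable_funM => //; exact: hk2.1.
  - by apply: measurable_funeM; apply: emeasurable_funM => //; exact: hk2.1.
  - by move=> x; rewrite mule_ge0 ?poweR_ge0 ?lee_fin ?mulr_ge0 ?expR_ge0.
  - move=> x; rewrite muleCA; apply: lee_wpmul2l; first exact: poweR_ge0.
    rewrite -EFinM lee_fin mulrA ler_wpM2r// /W -expRD ler_expR.
    have /andP[_ le1] := aab N (leqnn N).
    have := ler_wpM2r (dotv_ge0 x) le1; lra.
rewrite ge0_integralZl//; last 2 first.
- by apply: emeasurable_funM => //; exact: hk2.1.
- by move=> x _; rewrite mule_ge0 ?poweR_ge0 ?lee_fin ?mulr_ge0 ?expR_ge0.
by rewrite -[leRHS]mule1; apply: lee_wpmul2l H; rewrite lee_fin expR_ge0.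
Qed.

End gaussian_weights.

(** * Renyi divergences through densities, and the tilted target *)

Lemma dominates_of_density d (T : measurableType d) (R : realType)
    (rho pi : {measure set T -> \bar R}) (f : T -> \bar R) :
  measurable_fun [set: T] f -> (forall x, 0 <= f x)%E ->
  (forall A, measurable A -> rho A = \int[pi]_(x in A) f x)%E -> rho `<< pi.
Proof.
move=> mf f0 rhoE; apply/null_content_dominatesP => A mA piA.
rewrite rhoE//; apply: null_set_integral => //; exact: measurable_funTS.
Qed.

Section renyi_density.
Context d (T : measurableType d) (R : realType) (rho pi : probability T R).

Lemma exists_density : rho `<< pi -> exists f : T -> R,
  [/\ measurable_fun [set: T] f, forall x, 0 <= f x &
      forall A, measurable A -> (rho A = \int[pi]_(x in A) (f x)%:E)%E].
Proof.
move=> rp; pose g := Radon_Nikodym_SigmaFinite.f rho pi.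
exists (fine \o g); split.
- apply: (measurableT_comp (fine_measurable measurableT)).
  exact: measurable_int (Radon_Nikodym_SigmaFinite.f_integrable rp).
- by move=> x; apply: fine_ge0; exact: Radon_Nikodym_SigmaFinite.f_ge0.
- move=> A mA; rewrite (Radon_Nikodym_SigmaFinite.f_integral rp mA).
  apply: eq_integral => x _; rewrite /= fineK//.
  exact: Radon_Nikodym_SigmaFinite.f_fin_num.
Qed.

Variable f : T -> \bar R.
Hypotheses (mf : measurable_fun [set: T] f) (f0 : forall x, (0 <= f x)%E)
  (rhoE : forall A, measurable A -> (rho A = \int[pi]_(x in A) f x)%E).

Lemma ae_eq_Radon_Nikodym_density :
  ae_eq pi [set: T] f (Radon_Nikodym (charge_of_finite_measure rho) pi).
Proof.
have rp : rho `<< pi := dominates_of_density mf f0 rhoE.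
have f1 : pi.-integrable [set: T] f.
  apply/integrableP; split => //; under eq_integral do rewrite gee0_abs//.
  by rewrite -rhoE// probability_setT ltry.
have rp' : charge_of_finite_measure rho `<< pi by [].
have mg : measurable_fun [set: T] (Radon_Nikodym (charge_of_finite_measure rho) pi).
  exact: measurable_int (Radon_Nikodym_integrable rp').
apply: (integral_ae_eq measurableT f1 mg) => E _ mE; rewrite -rhoE// -(Radon_Nikodym_integral rp' mE).
by [].
Qed.

Lemma renyi_fin_density (q : R) : 1 < q ->
  renyi q%:E rho pi = (((q - 1)^-1)%:E * lne (\int[pi]_x f x `^ q))%E.
Proof.
move=> q1; have rp : rho `<< pi := dominates_of_density mf f0 rhoE.
have rp' : charge_of_finite_measure rho `<< pi by [].
have q0 : q != 0 by rewrite gt_eqF// (lt_trans ltr01).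
rewrite /renyi asboolT//= poweR_Lnorm//; congr (_ * lne _)%E.
have mg : measurable_fun [set: T] (Radon_Nikodym (charge_of_finite_measure rho) pi).
  exact: measurable_int (Radon_Nikodym_integrable rp').
apply: ae_eq_integral => //.
- by apply: measurable_poweR_fun; exact: measurableT_comp.
- exact: measurable_poweR_fun.
- apply: filterS ae_eq_Radon_Nikodym_density => x /(_ I) <- _; by rewrite gee0_abs.
Qed.

Lemma renyi_pinfty_density : (renyi +oo%E rho pi < +oo)%E ->
  {ae pi, forall x, (f x <= (expR (fine (renyi +oo%E rho pi)))%:E)%E}.
Proof.
have rp : rho `<< pi := dominates_of_density mf f0 rhoE.
rewrite /renyi asboolT//= unlock.
have -> : (0 < pi [set: T])%E by rewrite probability_setT lte01.
set E := ess_sup_inf.ess_sup _ _ => Eoo.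
have fE : {ae pi, forall x, (f x <= E)%E}.
  have h := ess_sup_inf.ess_sup_ge pi (abse \o Radon_Nikodym (charge_of_finite_measure rho) pi).
  apply: filterS2 h ae_eq_Radon_Nikodym_density => x /= h1 /(_ I) h2.
  by rewrite -h2 gee0_abs// in h1.
apply: filterS fE => x /le_trans; apply.
move: Eoo; case: E => [e| |]//= ; last by rewrite leNye.
(* A nonpositive essential supremum has logarithm -oo, whose [fine] is 0, and expR 0 = 1 is still an
   upper bound. *)
by case: ifPn => [e0 _|e0 _]; rewrite /= ?expR0 lee_fin ?(le_trans e0)// lnK// posrE ltNge.
Qed.

End renyi_density.

Section renyi_moments.
Context d (T : measurableType d) (R : realType) (rho pi : probability T R).
Variable f : T -> R.
Hypotheses (mf : measurable_fun [set: T] f) (f0 : forall x, 0 <= f x)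
  (rhoE : forall A, measurable A -> (rho A = \int[pi]_(x in A) (f x)%:E)%E).

Let meF : measurable_fun [set: T] (EFin \o f). Proof. exact/measurable_EFinP. Qed.
Let eF0 x : (0 <= (EFin \o f) x)%E. Proof. by rewrite lee_fin. Qed.

Let int1 : (\int[pi]_x (f x)%:E = 1)%E.
Proof. by rewrite -rhoE// probability_setT. Qed.

Lemma moment_ge1 (p : R) : 1 <= p -> (1 <= \int[pi]_x (f x)%:E `^ p)%E.
Proof.
move=> p1; have h : (\int[pi]_x (1 : R)%:E = 1)%E by rewrite -[RHS](@probability_setT _ _ _ pi) -[RHS]mul1e -integral_cst.
have mc : measurable_fun [set: T] (fun _ : T => (1 : R)) by exact: measurable_cst.
have := jensen_poweR mc (fun=> ler01) p1 h meF eF0.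
under eq_integral do rewrite mule1; under [leRHS]eq_integral do rewrite mule1.
by rewrite int1 poweR1r.
Qed.

(** The moment is at least 1 by Jensen, so a divergence below +oo is a nonnegative real and [fine]
    loses nothing. *)
Lemma renyi_moment (p : R) : 1 < p -> (renyi p%:E rho pi < +oo)%E ->
  (\int[pi]_x (f x)%:E `^ p = (expR ((p - 1) * fine (renyi p%:E rho pi)))%:E)%E /\
  0 <= fine (renyi p%:E rho pi).
Proof.
move=> p1; rewrite (renyi_fin_density meF eF0 rhoE p1).
have p0 : 0 < p - 1 by rewrite subr_gt0.
have := moment_ge1 (ltW p1); case: (\int[pi]_x _)%E => [X| |]//=; last first.
  by move=> _; rewrite gt0_muley// lte_fin invr_gt0.
rewrite lee_fin => X1 _; have X0 : 0 < X by rewrite (lt_le_trans ltr01).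
rewrite leNgt X0/= mulrA mulfV ?gt_eqF// mul1r lnK ?posrE//; split => //.
by rewrite mulr_ge0 ?invr_ge0 ?ln_ge0// ltW.
Qed.

(** Log-convexity of the moments between order 1, where the moment is 1, and order r. *)
Lemma moment_le (p r E : R) : 1 < p -> p < r ->
  (\int[pi]_x (f x)%:E `^ r <= E%:E)%E ->
  (\int[pi]_x (f x)%:E `^ p <= (E `^ ((p - 1) / (r - 1)))%:E)%E.
Proof.
move=> p1 pr HE; have r1 : 1 < r by rewrite (lt_trans p1).
set t := (p - 1) / (r - 1).
have t01 : 0 < t < 1.
  have r10 : 0 < r - 1 by rewrite subr_gt0.
  by rewrite divr_gt0 ?subr_gt0//= ltr_pdivrMr// mul1r ltrD2r.
have mr : measurable_fun [set: T] (fun x => (f x)%:E `^ r)%E by exact: measurable_poweR_fun.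
have r0 x : (0 <= (f x)%:E `^ r)%E by exact: poweR_ge0.
have := hoelder_geo pi t01 mr meF r0 eF0; rewrite int1 poweR1r mule1.
have -> : (\int[pi]_x (((f x)%:E `^ r) `^ t * (EFin \o f) x `^ (1 - t)) = \int[pi]_x (f x)%:E `^ p)%E.
  apply: eq_integral => x _; rewrite -[(EFin \o f) x]/((f x)%:E) !poweR_EFin -EFinM; congr EFin.
  rewrite -powRrM -powRD; last first.
    rewrite gt_eqF//; have /andP[t0 t1] := t01.
    have rt : 0 < r * t by rewrite mulr_gt0// (lt_trans ltr01).
    lra.
  by congr (_ `^ _); rewrite /t; field; rewrite gt_eqF// subr_gt0.
move=> /le_trans; apply; rewrite -poweR_EFin; apply: lee_poweR => //.
- by case/andP: t01 => /ltW.
- by apply: integral_ge0 => x _; exact: poweR_ge0.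
Qed.

(** An almost everywhere bound becomes a bound at every point, which the kernel operators
    preserve. *)
Lemma truncated_density (c : R) : {ae pi, forall x, ((f x)%:E <= c%:E)%E} -> 0 <= c ->
  exists g : T -> R, [/\ measurable_fun [set: T] g, forall x, 0 <= g x <= c &
      forall A, measurable A -> (rho A = \int[pi]_(x in A) (g x)%:E)%E].
Proof.
move=> fc c0; exists (fun x => Num.min (f x) c).
have mg : measurable_fun [set: T] (fun x => Num.min (f x) c) by exact: measurable_minr.
split => //; first by move=> x; rewrite le_min f0 c0 ge_min lexx orbT.
move=> A mA; rewrite rhoE//; apply: ae_eq_integral => //.
- exact: measurable_funTS.
- by apply: measurable_funTS; exact/measurable_EFinP.
- apply: filterS fc => x; rewrite lee_fin => xc _; by rewrite min_l.
Qed.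

End renyi_moments.

Section tilted_target.
Context (R : realType) (n : nat).
Local Notation rV := 'rV[R]_n.
Local Notation lam := (lebesgue_rV R n).
Variables (V : rV -> R) (pi : probability rV R) (Z Zh T gam : R).
Local Notation m := (half_median_radius pi).
Local Notation W := (tilted_potential V m T).
Local Notation w := (gibbsdens V Z).
Local Notation wh := (gibbsdens W Zh).
Hypotheses (dV : forall x, differentiable V x) (Z0 : 0 < Z) (Zh0 : 0 < Zh) (gam0 : 0 < gam) (m1 : 1 <= m).
Hypotheses (piE : forall A, measurable A -> (pi A = \int[lam]_(x in A) (w x)%:E)%E)
  (wh1 : (\int[lam]_x (wh x)%:E = 1)%E).

(* 6144 is a unary numeral, hence the abstract name for this constant. *)
Hypothesis gamE : (6144 * T)^-1 = gam.

Lemma tilted_potentialE : W = (fun x => V x + gam * Num.max (enorm x - 2 * m) 0 ^+ 2).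
Proof. by apply/funext => x; rewrite /tilted_potential gamE. Qed.

Lemma measurable_tilt : measurable_fun [set: rV] W.
Proof.
rewrite tilted_potentialE.
apply: measurable_funD; first by apply: measurable_fun_continuous_rV; exact: continuous_potential.
apply: measurable_funM => //; apply: measurable_funX; apply: measurable_maxr => //.
by apply: measurable_funB => //; apply: measurable_enorm; exact: measurable_id.
Qed.

Lemma measurable_tilted_dens : measurable_fun [set: rV] wh.
Proof.
apply: measurable_funM => //; apply: measurableT_comp => //; apply: measurableT_comp => //.
exact: measurable_tilt.
Qed.

Let mnorm : measurable_fun [set: rV] (fun x : rV => enorm x).
Proof. by apply: measurable_enorm; exact: measurable_id. Qed.

Let mball (r : R) : measurable [set x : rV | r <= enorm x].
Proof.
rewrite (_ : [set x : rV | r <= enorm x] = [set: rV] `&` (fun x : rV => enorm x) @^-1` `[r, +oo[%classic).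
  by apply: mnorm => //; exact: measurable_itv.
by apply/seteqP; split => x /=; rewrite in_itv/= andbT; [split|case].
Qed.

(** The infimum that defines 2 m need not be attained; a radius below 2 m + 1 is enough. *)
Lemma ball_median : exists2 r, r < 2 * m + 1 & (pi [set x | r <= enorm x]%R <= (2^-1)%:E)%E.
Proof.
pose S := [set r : R | (pi [set x | r <= enorm x]%R <= (2^-1)%:E)%E].
have mE : 2 * m = inf S by rewrite /half_median_radius mulrA mulfV// mul1r.
have S0 : S !=set0.
  (* The infimum of the empty set is 0 by convention, which m >= 1 excludes. *)
  apply/set0P/negP => /eqP SE; move: mE; rewrite SE inf0 => h.
  by have := m1; lra.
have Slb : has_lbound S.
  exists 0 => r; rewrite /S/= => Hr; rewrite leNgt; apply/negP => r0.
  move: Hr; have -> : [set x : rV | r <= enorm x] = [set: rV].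
    by apply/seteqP; split => x //= _; rewrite (le_trans (ltW r0))// enorm_ge0.
  by rewrite probability_setT lee_fin; apply/negP; rewrite -ltNge invf_lt1// ltr1n.
have [r Sr rlt] := inf_adherent (@ltr01 R) (conj S0 Slb).
by exists r => //; rewrite mE.
Qed.

(** On a ball of radius below 2 m + 1 and probability at least 1/2 the penalty is at most [gam].
    Tilting therefore reduces the normalising constant at most by the factor exp(- gam)/2. *)
Lemma normalization_ratio_ge : expR (- gam) / 2 <= Zh / Z.
Proof.
have [r rlt Hr] := ball_median.
pose B := [set x : rV | r <= enorm x]; pose C := ~` B.
have mC : measurable C by apply: measurableC; exact: mball.
have piC : ((2^-1)%:E <= pi C)%E.
  rewrite /C probability_setC; last exact: mball.
  have : (pi B <= (2^-1)%:E)%E by [].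
  have : (0 <= pi B)%E by [].
  case: (pi B) => [b| |]//; rewrite !lee_fin => b0 b1.
  lra.
have m0 : 0 <= 2 * m by have := m1; lra.
have key : ((expR (- gam) / Zh)%:E * (Z%:E * pi C) <= 1)%E.
  rewrite piE// -wh1 -ge0_integralZl//; last 3 first.
  - by apply/measurable_EFinP; apply: measurable_funTS; exact: measurable_gibbsdens.
  - by move=> x _; rewrite lee_fin gibbsdens_ge0.
  - by rewrite lee_fin ltW.
  rewrite -ge0_integralZl//; last 3 first.
  - apply: measurable_funeM; apply/measurable_EFinP; apply: measurable_funTS; exact: measurable_gibbsdens.
  - by move=> x _; rewrite mule_ge0 ?lee_fin ?gibbsdens_ge0 ?(ltW Z0).
  - by rewrite lee_fin divr_ge0 ?expR_ge0// ltW.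
  apply: (@le_trans _ _ (\int[lam]_(x in C) (wh x)%:E)%E); last first.
    apply: ge0_subset_integral => //.
    - by apply/measurable_EFinP; exact: measurable_tilted_dens.
    - by move=> x _; rewrite lee_fin gibbsdens_ge0.
  apply: ge0_le_integral => //.
  - by move=> x _; rewrite !mule_ge0 ?lee_fin ?gibbsdens_ge0 ?(ltW Z0)// divr_ge0 ?expR_ge0// ltW.
  - apply: measurable_funeM; apply: measurable_funeM; apply/measurable_EFinP; apply: measurable_funTS; exact: measurable_gibbsdens.
  - by apply/measurable_EFinP; apply: measurable_funTS; exact: measurable_tilted_dens.
  move=> x Cx; rewrite -!EFinM lee_fin /gibbsdens tilted_potentialE.
  have -> : expR (- gam) / Zh * (Z * (expR (- V x) / Z)) = expR (- gam) * expR (- V x) / Zh.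
    by field; rewrite !gt_eqF.
  rewrite ler_wpM2r ?invr_ge0 ?(ltW Zh0)// -expRD ler_expR.
  rewrite opprD addrC lerD2l lerN2 -[leRHS]mulr1 ler_wpM2l ?(ltW gam0)//.
  rewrite exprn_ile1// ?le_max ?lexx ?orbT// ge_max ler01 andbT.
  have : enorm x < r by move: Cx; rewrite /C /B /= => /negP; rewrite -ltNge.
  lra.
have H : ((expR (- gam) / Zh)%:E * (Z%:E * (2^-1)%:E) <= 1)%E.
  apply: le_trans key; apply: lee_wpmul2l; first by rewrite lee_fin divr_ge0 ?expR_ge0// ltW.
  by apply: lee_wpmul2l => //; rewrite lee_fin ltW.
rewrite -!EFinM lee_fin in H.
rewrite ler_pdivlMr// -(ler_pM2r (_ : 0 < Zh^-1)) ?invr_gt0// mulfV ?gt_eqF//.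
by apply: le_trans H; rewrite le_eqVlt; apply/orP; left; apply/eqP; field; rewrite gt_eqF.
Qed.

(** With M = max(|x| - 2m, 0), the bound |x| <= 2m + M gives |x|^2 <= 8 m^2 + 2 M^2, so the penalty
    gam M^2 pays for gam |x|^2 / 2 up to a constant. *)
Lemma gaussian_weight_le_tilt x : expR (gam / 2 * dotv x x) <=
  2 * expR (gam + 4 * gam * m ^+ 2) * (w x / wh x).
Proof.
have -> : w x / wh x = Zh / Z * expR (gam * Num.max (enorm x - 2 * m) 0 ^+ 2).
  rewrite /gibbsdens tilted_potentialE opprD expRD !expRN.
  have e1 := expR_gt0 (V x); set E := expR (gam * _); have e2 : 0 < E by exact: expR_gt0.
  by field; rewrite !gt_eqF.
set M := Num.max _ _; have M0 : 0 <= M by rewrite /M le_max lexx orbT.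
have xM : enorm x <= 2 * m + M by have : enorm x - 2 * m <= M by [rewrite /M le_max lexx]; lra.
have m0 : 0 <= m by rewrite (le_trans ler01).
have xx : dotv x x <= 8 * m ^+ 2 + 2 * M ^+ 2.
  rewrite -enorm_sqr; apply: (@le_trans _ _ ((2 * m + M) ^+ 2)).
    by rewrite ler_pXn2r ?nnegrE ?enorm_ge0// addr_ge0// mulr_ge0.
  have := sqr_ge0 (2 * m - M).
  have -> : (2 * m - M) ^+ 2 = 4 * m ^+ 2 - 4 * m * M + M ^+ 2 by ring.
  have -> : (2 * m + M) ^+ 2 = 4 * m ^+ 2 + 4 * m * M + M ^+ 2 by ring.
  lra.
apply: (@le_trans _ _ (expR (4 * gam * m ^+ 2) * expR (gam * M ^+ 2))).
  rewrite -expRD ler_expR.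
  have -> : 4 * gam * m ^+ 2 + gam * M ^+ 2 = gam / 2 * (8 * m ^+ 2 + 2 * M ^+ 2) by field.
  by apply: ler_wpM2l xx; rewrite divr_ge0// ltW.
rewrite expRD.
have -> : 2 * (expR gam * expR (4 * gam * m ^+ 2)) * (Zh / Z * expR (gam * M ^+ 2)) =
  (2 * expR gam * (Zh / Z)) * (expR (4 * gam * m ^+ 2) * expR (gam * M ^+ 2)) by ring.
rewrite ler_peMl ?mulr_ge0 ?expR_ge0//.
have := normalization_ratio_ge; rewrite expRN => h.
have e0 := expR_gt0 gam.
have p0 : 0 <= 2 * expR gam by rewrite mulr_ge0 ?expR_ge0.
have := ler_wpM2l p0 h.
by have -> : 2 * expR gam * ((expR gam)^-1 / 2) = 1 by field; rewrite gt_eqF.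
Qed.

Variables (pih mu0 : probability rV R) (g0 : rV -> R) (u : rV -> \bar R).
Hypotheses (pihE : forall A, measurable A -> (pih A = \int[lam]_(x in A) (wh x)%:E)%E)
  (mg0 : measurable_fun [set: rV] g0) (g00 : forall x, 0 <= g0 x)
  (mu0E : forall A, measurable A -> (mu0 A = \int[pi]_(x in A) (g0 x)%:E)%E)
  (r2fin : (renyi 2%:E mu0 pih < +oo)%E) (hu : nnmf u).

(** Cauchy-Schwarz in L^2(pi), with the Gaussian weight on u and its inverse on g0. The inverse
    weight is paid for by w/wh, which turns the second factor into the second moment of the density
    of mu0 relative to the tilted target. *)
Lemma integral_mu0_le :
  (\int[lam]_x (u x * (g0 x * w x)%:E) <=
   (\int[lam]_x (u x `^ 2 * (expR (- (gam / 2) * dotv x x) * w x)%:E)) `^ 2^-1 *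
   (expR (2^-1 * (1 + gam + 4 * gam * m ^+ 2 + fine (renyi 2%:E mu0 pih))))%:E)%E.
Proof.
have wh0 x : 0 < wh x by exact: gibbsdens_gt0.
have w0 x : 0 < w x by exact: gibbsdens_gt0.
have mw : measurable_fun [set: rV] w by exact: measurable_gibbsdens.
have mwh := measurable_tilted_dens.
pose k x := g0 x * w x / wh x.
have mk : measurable_fun [set: rV] k.
  apply: measurable_funM; first exact: measurable_funM.
  by apply: measurable_funV => // x; exact: ltW.
have k0 x : 0 <= k x by apply: divr_ge0; [exact: (mulr_ge0 (g00 x) (ltW (w0 x)))|exact: ltW].
have kE A : measurable A -> (mu0 A = \int[pih]_(x in A) (k x)%:E)%E.
  move=> mA; rewrite mu0E// integral_mkcond [RHS]integral_mkcond.
  have mpt (f : rV -> R) : measurable_fun [set: rV] f -> measurable_fun [set: rV] ((EFin \o f) \_ A).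
    move=> mf; apply/(measurable_restrictT _ mA); apply: measurable_funTS; exact/measurable_EFinP.
  have p0 (f : rV -> R) x : (forall x, 0 <= f x) -> (0 <= ((EFin \o f) \_ A) x)%E.
    by move=> f0; rewrite patchE; case: ifP => // _; rewrite lee_fin.
  rewrite (integral_density mw (fun x => ltW (w0 x)) piE (mpt _ mg0) (fun x => p0 _ x g00)).
  rewrite (integral_density mwh (fun x => ltW (wh0 x)) pihE (mpt _ mk) (fun x => p0 _ x k0)).
  apply: eq_integral => x _; rewrite !patchE; case: ifP => _; last by rewrite !mul0e.
  by rewrite -!EFinM /k divfK// gt_eqF.
have [k2 _] := renyi_moment mk k0 kE (ltr1n R 2) r2fin.
set r2 := fine _ in k2 *; set ga := gam / 2.
have mexp (c : R) : measurable_fun [set: rV] (fun x : rV => expR (c * dotv x x)).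
  by apply: measurable_expR_dotv.
have [mu_ u0] := hu.
pose a x := (u x `^ 2 * (expR (- ga * dotv x x))%:E)%E.
pose b x := (g0 x ^+ 2 * expR (ga * dotv x x))%:E.
have ha : nnmf a.
  by apply: nnmfM; [exact: nnmf_poweR|apply: nnmf_EFin => // x; exact: expR_ge0].
have hb : nnmf b.
  apply: nnmf_EFin; first by apply: measurable_funM => //; exact: measurable_funX.
  by move=> x; rewrite mulr_ge0 ?sqr_ge0 ?expR_ge0.
have H := hoelder_weight lam mw (fun x => ltW (w0 x)) (half01 R) ha.1 hb.1 ha.2 hb.2.
rewrite onem_half in H.
have E1 x : (u x * (g0 x * w x)%:E = a x `^ 2^-1 * b x `^ 2^-1 * (w x)%:E)%E.
  rewrite EFinM muleA; congr (_ * _)%E; rewrite /a /b.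
  rewrite poweRM ?poweR_ge0 ?lee_fin ?expR_ge0// poweRK// !poweR_EFin -muleA -EFinM; congr (_ * _%:E)%E.
  rewrite powRM ?sqr_ge0 ?expR_ge0// -powR_mulrn// -powRrM mulfV// powRr1//.
  rewrite -!expRM mulrCA -expRD.
  have -> : - ga * dotv x x * 2^-1 + ga * dotv x x * 2^-1 = 0 by ring.
  by rewrite expR0 mulr1.
under eq_integral do rewrite E1.
apply: le_trans H _.
have -> : (\int[lam]_x (a x * (w x)%:E) = \int[lam]_x (u x `^ 2 * (expR (- ga * dotv x x) * w x)%:E))%E.
  by apply: eq_integral => x _; rewrite /a -muleA -EFinM.
apply: lee_wpmul2l; first exact: poweR_ge0.
pose C := 2 * expR (gam + 4 * gam * m ^+ 2).
have C0 : 0 <= C by rewrite mulr_ge0 ?expR_ge0.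
have bB : (\int[lam]_x (b x * (w x)%:E) <= (C * expR r2)%:E)%E.
  have -> : ((C * expR r2)%:E = \int[lam]_x (C%:E * ((k x)%:E `^ 2 * (wh x)%:E)))%E.
    rewrite ge0_integralZl//; last 2 first.
    - apply: emeasurable_funM; last exact/measurable_EFinP.
      by apply: measurable_poweR_fun; exact/measurable_EFinP.
    - by move=> x _; rewrite mule_ge0 ?poweR_ge0// lee_fin ltW.
    rewrite EFinM; congr (_ * _)%E.
    rewrite -(integral_density mwh (fun x => ltW (wh0 x)) pihE); last 2 first.
    - by apply: measurable_poweR_fun; exact/measurable_EFinP.
    - by move=> x; exact: poweR_ge0.
    by rewrite k2 /r2; congr (expR _)%:E; ring.
  apply: le_integral_nneg.
  - by apply: emeasurable_funM; [exact: hb.1|exact/measurable_EFinP].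
  - apply: measurable_funeM; apply: emeasurable_funM; last exact/measurable_EFinP.
    by apply: measurable_poweR_fun; exact/measurable_EFinP.
  - by move=> x; apply: mule_ge0; [exact: hb.2|rewrite lee_fin ltW].
  - move=> x; rewrite poweR_EFin -!EFinM lee_fin powR_mulrn//.
    have -> : C * (k x ^+ 2 * wh x) = (g0 x ^+ 2 * w x) * (C * (w x / wh x)).
      by rewrite /k; field; rewrite gt_eqF.
    rewrite mulrAC; apply: ler_wpM2l (gaussian_weight_le_tilt x).
    exact: mulr_ge0 (sqr_ge0 _) (ltW (w0 x)).
have b0 : (0 <= \int[lam]_x (b x * (w x)%:E))%E.
  by apply: integral_ge0 => x _; apply: mule_ge0; [exact: hb.2|rewrite lee_fin ltW].
apply: le_trans (lee_poweR _ b0 bB) _; first by rewrite invr_ge0.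
rewrite poweR_EFin lee_fin (mulrC 2^-1 (_ + r2)) expRM; apply: ge0_ler_powR; rewrite ?nnegrE ?invr_ge0 ?mulr_ge0 ?expR_ge0//.
rewrite /C -mulrA -expRD.
have -> : 1 + gam + 4 * gam * m ^+ 2 + r2 = 1 + (gam + 4 * gam * m ^+ 2 + r2) by ring.
(* The factor 2 from the normalising constants is absorbed through 2 <= e; this is the 1 in the
   exponent. *)
rewrite [leRHS]expRD ler_wpM2r ?expR_ge0//; have := expR_ge1Dx (1 : R); lra.
Qed.

End tilted_target.

(** * Lower bound on the weak Poincare weight *)

Section trigonometric_tests.
Context (R : realType) (n : nat).
Local Notation rV := 'rV[R]_n.
Implicit Types (x v : rV).

Lemma is_derive_coord_comp (phi : R -> R) (dphi : R) (i : 'I_n) x v :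
  is_derive (x ord0 i) (1 : R) phi dphi ->
  is_derive x v (fun y : rV => phi (y ord0 i)) (v ord0 i * dphi).
Proof.
move=> H; have dp : differentiable phi (x ord0 i).
  by apply/derivable1_diffP; exact: (@ex_derive _ _ _ _ _ _ _ H).
have dc : differentiable (fun y : rV => y ord0 i) x by exact: differentiable_coord.
have dpc : differentiable (phi \o (fun y : rV => y ord0 i)) x by exact: differentiable_comp.
have Hc := is_derive_coord i x v.
apply: DeriveDef; first exact: diff_derivable.
rewrite deriveE// diff_comp//= -[X in 'd phi _ X]deriveE//.
have -> : 'D_v (fun y : rV => y ord0 i) x = v ord0 i by exact: (@derive_val _ _ _ _ _ _ _ Hc).
have E : 'd phi (x ord0 i) (v ord0 i *: (1 : R)) = v ord0 i *: 'd phi (x ord0 i) 1 by rewrite linearZ.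
rewrite -[X in 'd phi _ X](mulr1 (v ord0 i)); apply: (etrans E).
rewrite -deriveE//; congr (_ * _).
exact: (@derive_val _ _ _ _ _ _ _ H).
Qed.

Variables (a : R) (i : 'I_n).

(** Sine and cosine are kept in one family because it is closed under partial derivatives, so
    smoothness follows by induction. *)
Definition trig (A B : R) x : R := A * cos (a * x ord0 i) + B * sin (a * x ord0 i).

Lemma is_derive_trig A B x v :
  is_derive x v (trig A B) (v ord0 i * (- (A * a) * sin (a * x ord0 i) + (B * a) * cos (a * x ord0 i))).
Proof.
have ad (t : R) : is_derive t (1 : R) (fun t => a * t) a.
  by apply: is_derive_eq; rewrite /GRing.scale/= mulr1.
apply: (@is_derive_coord_comp (fun t => A * cos (a * t) + B * sin (a * t))).
have hc := is_deriveZ A (is_derive1_comp (is_derive_cos _) (ad (x ord0 i))).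
have hs := is_deriveZ B (is_derive1_comp (is_derive_sin _) (ad (x ord0 i))).
have := is_deriveD hc hs.
have -> : A *: (- sin (a * x ord0 i) * a) + B *: (cos (a * x ord0 i) * a) =
  - (A * a) * sin (a * x ord0 i) + (B * a) * cos (a * x ord0 i).
  by rewrite /GRing.scale/=; ring.
by [].
Qed.

Lemma trig_continuous A B : continuous (trig A B).
Proof.
move=> x; rewrite /trig.
have ci : {for x, continuous (fun x : rV => a * x ord0 i)}.
  have k : {for x, continuous (cst a : rV -> R)} by exact: cst_continuous.
  have c : {for x, continuous (fun x : rV => x ord0 i)} by exact: coord_continuous.
  exact: (continuousM k c).
have kA : {for x, continuous (cst A : rV -> R)} by exact: cst_continuous.
have kB : {for x, continuous (cst B : rV -> R)} by exact: cst_continuous.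
have cc : {for x, continuous (fun x : rV => cos (a * x ord0 i))}.
  by apply: (continuous_comp ci); exact: continuous_cos.
have cs : {for x, continuous (fun x : rV => sin (a * x ord0 i))}.
  by apply: (continuous_comp ci); exact: continuous_sin.
exact: (continuousD (continuousM kA cc) (continuousM kB cs)).
Qed.

Lemma trig_partial A B j :
  partial j (trig A B) = trig ((delta_mx ord0 j : rV) ord0 i * (B * a)) ((delta_mx ord0 j : rV) ord0 i * - (A * a)).
Proof.
apply/funext => x; rewrite /partial (@derive_val _ _ _ _ _ _ _ (is_derive_trig A B x _)) /trig; ring.
Qed.

Lemma trig_smooth A B : smooth (trig A B).
Proof.
move=> k; elim: k A B => [|k IH] A B; first by split=> //; exact: trig_continuous.
split; first exact: trig_continuous.
move=> j; split=> [x|]; first exact: (@ex_derive _ _ _ _ _ _ _ (is_derive_trig A B x _)).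
rewrite trig_partial; exact: IH.
Qed.

Lemma grad_trig_sqr A B x : enorm (grad (trig A B) x) ^+ 2 =
  a ^+ 2 * (B * cos (a * x ord0 i) - A * sin (a * x ord0 i)) ^+ 2.
Proof.
rewrite enorm_sqr /dotv (bigD1 i)//= big1 ?addr0; last first.
  by move=> j ji; rewrite mxE trig_partial /trig mxE eqxx/= eq_sym (negbTE ji) !mul0r addr0 mul0r.
rewrite mxE trig_partial /trig mxE !eqxx !mul1r; ring.
Qed.

End trigonometric_tests.

Section weight_lower_bound.
Context (R : realType) (n : nat).
Local Notation rV := 'rV[R]_n.
Local Notation lam := (lebesgue_rV R n).
Variables (V : rV -> R) (L s h Z : R) (pi0 : probability rV R) (beta : R -> R).
Hypotheses (dV : forall x, differentiable V x) (hV : holder_grad V L s)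
  (L0 : 0 < L) (s0 : 0 < s) (s1 : s <= 1) (h0 : 0 < h) (Z0 : 0 < Z) (n0 : (0 < n)%N).
Local Notation w := (gibbsdens V Z).
Hypothesis (piE : forall A, measurable A -> (pi0 A = \int[lam]_(x in A) (w x)%:E)%E)
  (Hpi : weak_poincare pi0 beta (fun f => (osc f ^+ 2)%E))
  (small : L * (8 * Num.sqrt h) `^ (1 + s) <= 3^-1).

(** The mean value theorem for the even function t -> V(x + t v) + V(x - t v), whose derivative is a
    gradient difference and thus bounded by Hoelder continuity. *)
Lemma midpoint_le x v : V (x + v) + V (x - v) <= 2 * V x + 2 * (L * enorm v `^ (1 + s)).
Proof.
pose g (t : R) := V (x + t *: v) + V (x + (- t) *: v).
have dline (k t : R) : is_derive t (1 : R) (fun t => x + (k * t) *: v) (k *: v).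
  have Hk : is_derive t (1 : R) (fun t => k * t) k.
    by apply: is_derive_eq; rewrite /GRing.scale/= mulr1.
  have := is_deriveD (is_derive_cst x t 1) (is_derive_scalel v Hk).
  by rewrite add0r.
have dg (t : R) : is_derive t (1 : R) g (dotv (grad V (x + t *: v) - grad V (x - t *: v)) v).
  have h1 := is_derive_along (dV _) (dline 1 t).
  have h2 := is_derive_along (dV _) (dline (-1) t).
  have H := is_deriveD h1 h2.
  have gE : g = (V \o (fun t => x + (1 * t) *: v)) + (V \o (fun t => x + (-1 * t) *: v)).
    by apply/funext => z; rewrite /g fctE /= mul1r mulN1r.
  rewrite gE; apply: is_derive_eq H _.
  by rewrite mul1r mulN1r scale1r scaleN1r dotvNr dotvDl dotvNl scaleNr.
have cg : {within `[0, (1 : R)], continuous g}.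
  apply: continuous_subspaceT => t; apply/differentiable_continuous/derivable1_diffP.
  exact: (@ex_derive _ _ _ _ _ _ _ (dg t)).
have [t] := @MVT R g (fun t => dotv (grad V (x + t *: v) - grad V (x - t *: v)) v) 0 1 ltr01
   (fun t _ => dg t) cg.
rewrite in_itv/= subr0 mulr1 => /andP[t0 t1] E.
have -> : V (x + v) + V (x - v) = g 1 by rewrite /g scale1r scaleN1r.
have -> : g 1 = g 0 + dotv (grad V (x + t *: v) - grad V (x - t *: v)) v by rewrite -E; ring.
have -> : g 0 = 2 * V x by rewrite /g oppr0 !scale0r !addr0; ring.
rewrite lerD2l; apply: le_trans (dotv_le_enorm _ _) _.
apply: le_trans (ler_wpM2r (enorm_ge0 _) (hV _ _)) _.
have e0 := enorm_ge0 v.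
have xx : enorm (x + t *: v - (x - t *: v)) <= 2 * enorm v.
  have -> : x + t *: v - (x - t *: v) = (2 * t) *: v.
    by apply/rowP => j; rewrite !mxE; ring.
  rewrite enormZ ger0_norm ?mulr_ge0 ?(ltW t0)// ler_wpM2r//; lra.
have ps : enorm (x + t *: v - (x - t *: v)) `^ s <= 2 * enorm v `^ s.
  apply: (@le_trans _ _ ((2 * enorm v) `^ s)).
    by apply: ge0_ler_powR; rewrite ?nnegrE ?enorm_ge0 ?mulr_ge0 ?(ltW s0).
  rewrite powRM// ler_wpM2r ?powR_ge0//.
  by rewrite -[leRHS]powRr1//; apply: ler_powR => //; rewrite ler1n.
rewrite powRD; last by rewrite gt_eqF// addr_gt0.
rewrite powRr1//; have -> : 2 * (L * (enorm v * enorm v `^ s)) = (L * (2 * enorm v `^ s)) * enorm v by ring.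
by apply: (ler_wpM2r e0); apply: ler_wpM2l ps; exact: ltW.
Qed.

(** By the midpoint bound and the inequality of arithmetic and geometric means, the density at x is
    at most a constant times the average of its values at x + v and x - v. Translating the two
    integrals replaces F by G. *)
Lemma shift_average_le (F G : rV -> R) v : measurable_fun [set: rV] F -> (forall x, 0 <= F x) ->
  measurable_fun [set: rV] G -> (forall x, 0 <= G x) ->
  (forall x, F (x + v) = G x) -> (forall x, F (x - v) = G x) ->
  (\int[pi0]_x (F x)%:E <= (expR (L * enorm v `^ (1 + s)))%:E * \int[pi0]_x (G x)%:E)%E.
Proof.
move=> mF F0 mG G0 Fp Fm; set e := expR _; have e0 : 0 <= e by exact: expR_ge0.
have mw : measurable_fun [set: rV] w by exact: measurable_gibbsdens.
have w0 := gibbsdens_ge0 V Z0.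
rewrite !(integral_density mw w0 piE); try (by apply/measurable_EFinP); try (by move=> x; rewrite lee_fin).
have mws u : measurable_fun [set: rV] (fun x => w (x + u)).
  by apply: (measurableT_comp mw); apply: measurable_rVD => //; exact: measurable_cst.
have wle x : w x <= e / 2 * w (x + v) + e / 2 * w (x - v).
  rewrite /gibbsdens -mulrDr -mulrDl mulrA ler_wpM2r ?invr_ge0 ?(ltW Z0)//.
  have H := midpoint_le x v; rewrite -/(L * _) in H.
  set A := V (x + v) in H *; set B := V (x - v) in H *.
  apply: (@le_trans _ _ (e * expR (- ((A + B) / 2)))).
    rewrite -expRD ler_expR; lra.
  rewrite -mulrA ler_wpM2l//.
  have -> : expR (- ((A + B) / 2)) = expR (- A / 2) * expR (- B / 2) by rewrite -expRD; congr expR; field.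
  have -> : expR (- A) = expR (- A / 2) * expR (- A / 2) by rewrite -expRD; congr expR; field.
  have -> : expR (- B) = expR (- B / 2) * expR (- B / 2) by rewrite -expRD; congr expR; field.
  set p := expR (- A / 2); set q := expR (- B / 2).
  have := sqr_ge0 (p - q); have -> : (p - q) ^+ 2 = p * p + q * q - 2 * (p * q) by ring.
  lra.
have shift (u : rV) (H : rV -> R) : measurable_fun [set: rV] H -> (forall x, 0 <= H x) ->
   (\int[lam]_x (H (x + u))%:E = \int[lam]_x (H x)%:E)%E.
  move=> mH H0; have := @lebesgue_rV_affine R n 1 u (EFin \o H) ltr01.
  rewrite expr1n invr1 mul1e => <-.
  - by apply: eq_integral => x _; rewrite /= scale1r.
  - exact/measurable_EFinP.
  - by move=> x; rewrite lee_fin.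
have e20 : 0 <= e / 2 by rewrite divr_ge0.
apply: (@le_trans _ _ (\int[lam]_x ((e / 2)%:E * (F x * w (x + v))%:E + (e / 2)%:E * (F x * w (x - v))%:E))%E).
  apply: le_integral_nneg.
  - by apply: emeasurable_funM; exact/measurable_EFinP.
  - by apply: emeasurable_funD; apply: measurable_funeM; apply/measurable_EFinP; apply: measurable_funM.
  - by move=> x; rewrite mule_ge0 ?lee_fin.
  - move=> x; rewrite -!EFinM -EFinD lee_fin.
    have -> : e / 2 * (F x * w (x + v)) + e / 2 * (F x * w (x - v)) = F x * (e / 2 * w (x + v) + e / 2 * w (x - v)) by ring.
    exact: ler_wpM2l.
rewrite ge0_integralD//; last 4 first.
- by move=> x _; rewrite mule_ge0// lee_fin mulr_ge0.
- by apply: measurable_funeM; apply/measurable_EFinP; exact: measurable_funM.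
- by move=> x _; rewrite mule_ge0// lee_fin mulr_ge0.
- by apply: measurable_funeM; apply/measurable_EFinP; exact: measurable_funM.
have part (u : rV) : (forall x, F (x - u) = G x) ->
    (\int[lam]_x ((e / 2)%:E * (F x * w (x + u))%:E) = (e / 2)%:E * \int[lam]_x ((G x)%:E * (w x)%:E))%E.
  move=> Fu.
  have mFw : measurable_fun [set: rV] (fun x => (F x * w (x + u))%:E).
    by apply/measurable_EFinP; exact: measurable_funM.
  have Fw0 x : [set: rV] x -> (0 <= (F x * w (x + u))%:E)%E by move=> _; rewrite lee_fin mulr_ge0.
  have e2 : (0 <= (e / 2)%:E)%E by rewrite lee_fin.
  rewrite (ge0_integralZl lam measurableT mFw Fw0 e2); apply: (congr1 (fun t => (e / 2)%:E * t)%E).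
  rewrite -(shift (- u) (fun x => F x * w (x + u))); last 2 first.
  - exact: measurable_funM.
  - by move=> x; rewrite mulr_ge0.
  by apply: eq_integral => x _; rewrite Fu subrK EFinM.
have pm : (\int[lam]_x ((e / 2)%:E * (F x * w (x - v))%:E) = (e / 2)%:E * \int[lam]_x ((G x)%:E * (w x)%:E))%E.
  by apply: (part (- v)) => x; rewrite opprK.
rewrite pm (part v)// -ge0_muleDl ?lee_fin// -EFinD.
by have -> : e / 2 + e / 2 = e by field.
Qed.

Let i0 : 'I_n := Ordinal n0.
(** Half a period is pi/a = 2 pi sqrt h, at most the length 8 sqrt h in [small]. *)
Let a : R := (2 * Num.sqrt h)^-1.
Local Notation trg := (trig a i0).

Let sh0 : 0 < Num.sqrt h. Proof. by rewrite sqrtr_gt0. Qed.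

Let a0 : 0 < a. Proof. by rewrite invr_gt0 mulr_gt0. Qed.

Let int1 : (\int[pi0]_x (1 : R)%:E = 1)%E.
Proof. by rewrite -[RHS](@probability_setT _ _ _ pi0) -[RHS]mul1e -integral_cst. Qed.

Let trg_bound A B x : A ^+ 2 + B ^+ 2 = 1 -> -1 <= trg A B x <= 1.
Proof.
move=> AB; rewrite -ler_norml -(ler_pXn2r (n := 2))// ?nnegrE// expr1n real_normK ?num_real// /trig.
have := cos2Dsin2 (a * x ord0 i0); set c := cos _; set t := sin _ => ct.
have h1 := sqr_ge0 (A * t - B * c).
have h2 : (A * c + B * t) ^+ 2 + (A * t - B * c) ^+ 2 = 1.
  by rewrite -[RHS]mulr1 -{1}AB -ct; ring.
lra.
Qed.

(** Translation by half a period in either direction changes the sign of the test function and costs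
    a factor at most 3/2. Comparing the means of 1 + trg and 1 - trg gives |c| <= 1/5. *)
Let trg_mean A B : A ^+ 2 + B ^+ 2 = 1 ->
  exists2 c, (\int[pi0]_x (trg A B x)%:E = c%:E)%E & -4^-1 <= c <= 4^-1.
Proof.
move=> AB; pose v : rV := (pi / a) *: delta_mx ord0 i0.
have mt C D : measurable_fun [set: rV] (trg C D).
  by apply: measurable_fun_continuous_rV; exact: trig_continuous.
have bnd := trg_bound _ AB.
have aa : a * (pi / a) = pi by rewrite mulrC divfK// gt_eqF.
have vi : v ord0 i0 = pi / a by rewrite !mxE !eqxx mulr1.
have tp x : trg A B (x + v) = - trg A B x.
  by rewrite /trig mxE vi mulrDr aa cosDpi sinDpi; ring.
have tm x : trg A B (x - v) = - trg A B x.
  by rewrite -[x in RHS](subrK v) tp opprK.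
have it : pi0.-integrable [set: rV] (EFin \o trg A B).
  apply: (@le_integrable _ _ _ _ _ measurableT _ (EFin \o cst 1)).
  - exact/measurable_EFinP.
  - by move=> x _; rewrite /= lee_fin normr1 ler_norml bnd.
  - exact: finite_measure_integrable_cst.
have fin := integrable_fin_num measurableT it.
exists (fine (\int[pi0]_x (trg A B x)%:E)); first by rewrite fineK.
set c := fine _; have cE : (\int[pi0]_x (trg A B x)%:E = c%:E)%E by rewrite fineK.
have I1 (e : R) : (\int[pi0]_x (1 + e * trg A B x)%:E = (1 + e * c)%:E)%E.
  transitivity (\int[pi0]_x ((cst 1 x)%:E + e%:E * (trg A B x)%:E))%E; first by [].
  have ic : pi0.-integrable [set: rV] (EFin \o cst (1 : R)) by exact: finite_measure_integrable_cst.
  rewrite (integralD measurableT ic (integrableZl measurableT e it)) integralZl// cE.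
  have -> : (\int[pi0]_x (EFin \o cst (1%R : R)) x = 1)%E := int1.
  by [].
have nv : enorm v <= 8 * Num.sqrt h.
  rewrite /v enormZ ger0_norm ?divr_ge0 ?pi_ge0 ?(ltW a0)//.
  have -> : enorm (delta_mx ord0 i0 : rV) = 1.
    by rewrite enormE dotv_delta mxE !eqxx sqrtr1.
  rewrite mulr1 /a invrK; have := pihalf_lt2 R; rewrite ltr_pdivrMr// => p4.
  have -> : 8 * Num.sqrt h = 4 * (2 * Num.sqrt h) by ring.
  by rewrite ler_wpM2r ?mulr_ge0 ?(ltW sh0)//; lra.
have e32 : expR (L * enorm v `^ (1 + s)) <= 3 / 2.
  have le3 : L * enorm v `^ (1 + s) <= 3^-1.
    apply: le_trans small; apply: ler_wpM2l; first exact: ltW.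
    by apply: ge0_ler_powR; rewrite ?nnegrE ?enorm_ge0 ?mulr_ge0 ?(ltW sh0) ?addr_ge0 ?(ltW s0).
  apply: (@le_trans _ _ (expR 3^-1)); first by rewrite ler_expR.
  have := expR_ge1Dx (- 3^-1 : R); rewrite expRN => h2.
  have h3 : (2 / 3 : R) <= (expR (3^-1 : R))^-1 by lra.
  rewrite -[leRHS]invrK -[leLHS]invrK lef_pV2 ?posrE ?invr_gt0 ?expR_gt0//.
  by rewrite invf_div.
have side (e : R) : e = 1 \/ e = -1 -> 1 + e * c <= 3 / 2 * (1 - e * c).
  move=> e1.
  have ge x : 0 <= 1 + e * trg A B x by have /andP[] := bnd x; case: e1 => ->; lra.
  have ge' x : 0 <= 1 + (- e) * trg A B x by have /andP[] := bnd x; case: e1 => ->; lra.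
  have mg e' : measurable_fun [set: rV] (fun x => 1 + e' * trg A B x).
    by apply: measurable_funD => //; apply: measurable_funM.
  have := @shift_average_le _ _ v (mg e) ge (mg (- e)) ge'.
  rewrite !I1 -EFinM lee_fin mulNr => H.
  have c1 : 0 <= 1 - e * c.
    rewrite -lee_fin -mulNr -I1; apply: integral_ge0 => x _; rewrite lee_fin; exact: ge'.
  apply: le_trans (H _ _) _.
  - by move=> x; rewrite tp mulrN mulNr.
  - by move=> x; rewrite tm mulrN mulNr.
  - exact: ler_wpM2r.
have := side 1 (or_introl erefl); have := side (-1) (or_intror erefl); lra.
Qed.

(** Cosine and sine have squares summing to 1, squared means at most 1/16 and squared oscillations
    at most 4. Adding their two inequalities gives 7/8 <= beta a^2 + 8 r, and with r <= 1/16 and a^2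
    = 1/(4h) the weight is at least 3h/2. *)
Lemma wpi_weight_ge (r : R) : 0 < r -> r <= 16^-1 -> h <= beta r.
Proof.
move=> r0 r16.
have mt A B : measurable_fun [set: rV] (trg A B).
  by apply: measurable_fun_continuous_rV; exact: trig_continuous.
have oscB A B : A ^+ 2 + B ^+ 2 = 1 -> (osc (trg A B) <= 2%:E)%E /\ (0 <= osc (trg A B))%E.
  move=> AB; have bnd := trg_bound _ AB; split.
    have -> : (2%:E = 1%:E - (-1)%:E :> \bar R)%E by rewrite -EFinB; congr EFin; ring.
    apply: leeB; first by apply: ge_ereal_sup => _ [x _ <-]; rewrite lee_fin; case/andP: (bnd x).
    by apply: le_ereal_inf_tmp => _ [x _ <-]; rewrite lee_fin; case/andP: (bnd x).
  rewrite /osc sube_ge0.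
    apply: (@le_trans _ _ (trg A B 0)%:E); first by apply: ereal_inf_lbound; exists 0.
    by apply: ereal_sup_ubound; exists 0.
  apply/orP; right; rewrite fin_numE; apply/andP; split.
    apply/eqP => E; have : ((trg A B 0)%:E <= ereal_sup (range (EFin \o trg A B)))%E by apply: ereal_sup_ubound; exists 0.
    by rewrite E leeNy_eq.
  apply/eqP => E; have : (ereal_sup (range (EFin \o trg A B)) <= 1%:E)%E.
    by apply: ge_ereal_sup => _ [x _ <-]; rewrite lee_fin; case/andP: (bnd x).
  by rewrite E leye_eq.
have b0 : 0 <= beta r := wpi_weight_ge0 Hpi r0.
have E A B : A ^+ 2 + B ^+ 2 = 1 -> exists S2 G : R,
    [/\ (\int[pi0]_x (trg A B x ^+ 2)%:E = S2%:E)%E,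
     (\int[pi0]_x ((B * cos (a * x ord0 i0) - A * sin (a * x ord0 i0)) ^+ 2)%:E = G%:E)%E,
     S2 + G = 1 & S2 - 16^-1 <= beta r * (a ^+ 2 * G) + r * 4].
  move=> AB; have bnd := trg_bound _ AB.
  have mG : measurable_fun [set: rV] (fun x : rV => (B * cos (a * x ord0 i0) - A * sin (a * x ord0 i0)) ^+ 2).
    have := measurable_funX 2 (mt B (- A)).
    by rewrite /trig; under eq_fun do rewrite mulNr.
  have mS : measurable_fun [set: rV] (fun x => trg A B x ^+ 2) by exact: measurable_funX.
  have sum1 x : trg A B x ^+ 2 + (B * cos (a * x ord0 i0) - A * sin (a * x ord0 i0)) ^+ 2 = 1.
    by rewrite /trig -[RHS]mulr1 -{1}AB -(cos2Dsin2 (a * x ord0 i0)); ring.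
  have I1 : (\int[pi0]_x (trg A B x ^+ 2)%:E + \int[pi0]_x ((B * cos (a * x ord0 i0) - A * sin (a * x ord0 i0)) ^+ 2)%:E = 1)%E.
    rewrite -ge0_integralD//; last 4 first.
    - by move=> x _; rewrite lee_fin sqr_ge0.
    - exact/measurable_EFinP.
    - by move=> x _; rewrite lee_fin sqr_ge0.
    - exact/measurable_EFinP.
    under eq_integral do rewrite -EFinD sum1.
    exact: int1.
  have S0 : (0 <= \int[pi0]_x (trg A B x ^+ 2)%:E)%E by apply: integral_ge0 => x _; rewrite lee_fin sqr_ge0.
  have G0 : (0 <= \int[pi0]_x ((B * cos (a * x ord0 i0) - A * sin (a * x ord0 i0)) ^+ 2)%:E)%E.
    by apply: integral_ge0 => x _; rewrite lee_fin sqr_ge0.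
  have Lf : (trg A B : rV -> R) \in Lfun pi0 2%:E.
    apply/andP; split; rewrite inE//= /finite_norm unlock /=; apply: poweR_lty.
    under eq_integral do rewrite /= powR_mulrn ?normr_ge0// real_normK ?num_real//.
    apply: (@le_lt_trans _ _ (1%E : \bar R)); last exact: ltry.
    by rewrite -I1 leeDl.
  have [c cE c4] := trg_mean AB.
  have := wpi_inequality Hpi (trig_smooth a i0 A B) r0.
  rewrite (varianceE Lf) !expectation.unlock.
  have -> : (\int[pi0]_x (((trg A B) ^+ 2)%R x)%:E = \int[pi0]_x (trg A B x ^+ 2)%:E)%E.
    by apply: eq_integral => x _; rewrite fctE.
  rewrite cE -EFin_expe.
  have -> : (\int[pi0]_x (enorm (grad (trg A B) x) ^+ 2)%:E = (a ^+ 2)%:E * \int[pi0]_x ((B * cos (a * x ord0 i0) - A * sin (a * x ord0 i0)) ^+ 2)%:E)%E.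
    rewrite -ge0_integralZl//.
    - by apply: eq_integral => x _; rewrite grad_trig_sqr EFinM.
    - exact/measurable_EFinP.
    - by move=> x _; rewrite lee_fin sqr_ge0.
    - by rewrite lee_fin sqr_ge0.
  move: S0 G0 I1; case ES: (\int[pi0]_x (trg A B x ^+ 2)%:E)%E => [S2| |]//; case EG: (\int[pi0]_x ((B * cos (a * x ord0 i0) - A * sin (a * x ord0 i0)) ^+ 2)%:E)%E => [G| |]//.
  rewrite -EFinD -EFinB -!EFinM => _ _ [SG] H.
  exists S2, G; split; [exact: erefl|exact: erefl|exact: SG|].
  have [hi lo] := oscB _ _ AB.
  have O4 : (osc (trg A B) ^+ 2 <= 4%:E)%E.
    have -> : 4%:E = (2%:E ^+ 2)%E :> \bar R by rewrite -EFin_expe; congr EFin; ring.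
    by rewrite lee_sqr ?lee_fin.
  have H2 : ((S2 - c ^+ 2)%:E <= (beta r * (a ^+ 2 * G) + r * 4)%:E)%E.
    apply: le_trans H _; rewrite EFinD; apply: leeD => //.
    by rewrite EFinM; apply: lee_wpmul2l => //; rewrite lee_fin ltW.
  rewrite lee_fin in H2; apply: le_trans H2; rewrite lerD2l lerN2.
  have /andP[c1 c2] := c4; nra.
have [S1 [G1 [_ G1E SG1 W1]]] := E 1 0 (ltac:(ring)).
have [S2 [G2 [S2E _ SG2 W2]]] := E 0 1 (ltac:(ring)).
have SG : S2 = G1.
  apply: EFin_inj; rewrite -S2E -G1E; apply: eq_integral => x _; congr EFin.
  by rewrite /trig; ring.
have aa : a ^+ 2 = (4 * h)^-1.
  by rewrite /a exprVn exprMn sqr_sqrtr ?(ltW h0)//; congr (_^-1); ring.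
have W : 7 / 8 <= beta r * a ^+ 2 + 8 * r.
  have -> : beta r * a ^+ 2 = beta r * (a ^+ 2 * G1) + beta r * (a ^+ 2 * G2).
    have G2E : G2 = 1 - G1 by rewrite -SG -SG2; ring.
    by rewrite G2E; ring.
  lra.
have : 3 / 8 <= beta r * a ^+ 2 by lra.
rewrite aa ler_pdivlMr ?mulr_gt0// => H3.
have hh := h0; lra.
Qed.

End weight_lower_bound.

(** * Convergence of the proximal sampler *)

Section entropy_recursion.
Context (R : realType).
Implicit Types (p B sigma E F x y : R).

Lemma onem_expRN_ge x : 0 <= x <= 1 -> x / 2 <= 1 - expR (- x).
Proof.
move=> /andP[x0 x1]; have e1 := expR_ge1Dx x.
have x10 : 0 < 1 + x by lra.
have : expR (- x) <= (1 + x)^-1.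
  by rewrite expRN lef_pV2 ?posrE ?expR_gt0.
have : x / 2 <= 1 - (1 + x)^-1.
  have -> : 1 - (1 + x)^-1 = x / (1 + x) by field; rewrite gt_eqF.
  by rewrite ler_wpM2l// lef_pV2 ?posrE//; lra.
lra.
Qed.

Lemma expR1_ge2 : (2 : R) <= expR 1.
Proof. by have := expR_ge1Dx (1 : R); lra. Qed.

(** With x = ln F / (p - 1), the divergence, F^((p - 2)/(p - 1)) equals F exp(- x), so the recursion
    for moments becomes a decrease of x through ln(1 - t) <= - t. Since F >= 1, the error sigma may
    be taken relative to F. *)
Lemma entropy_step p B sigma E' F : 2 < p -> 0 <= B -> 1 <= E' -> E' <= F ->
  F - F `^ ((p - 2) / (p - 1)) - sigma <= (1 + B) * (F - E') ->
  let x := ln F / (p - 1) in 0 <= sigma -> sigma <= 1 - expR (- x) ->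
  ln E' / (p - 1) <= x - (1 - expR (- x) - sigma) / ((1 + B) * (p - 1)).
Proof.
move=> p2 B0 E1 EF H x s0 sx.
have p10 : 0 < p - 1 by lra.
have F1 : 1 <= F := le_trans E1 EF.
have F0 : 0 < F by lra.
have E0 : 0 < E' by lra.
have FE : F `^ ((p - 2) / (p - 1)) = F * expR (- x).
  rewrite /powR gt_eqF// -{2}(lnK F0) -expRD; congr expR.
  by rewrite /x; field; rewrite gt_eqF.
have B1 : 0 < 1 + B by lra.
set t := (1 - expR (- x) - sigma) / (1 + B).
have t0 : 0 <= t by rewrite divr_ge0 ?(ltW B1)//; lra.
have EFt : E' <= F * (1 - t).
  have : F * (1 - expR (- x) - sigma) <= (1 + B) * (F - E').
    apply: le_trans H; rewrite FE.
    have : 0 <= sigma * (F - 1) by rewrite mulr_ge0//; lra.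
    lra.
  rewrite -subr_ge0 => H2; rewrite -subr_ge0.
  have -> : F * (1 - t) - E' = ((1 + B) * (F - E') - F * (1 - expR (- x) - sigma)) / (1 + B).
    by rewrite /t; field; rewrite gt_eqF.
  by rewrite divr_ge0// ltW.
have : ln E' <= ln F - t.
  rewrite -(expRK (ln F - t)) ler_ln ?posrE ?expR_gt0// expRD (lnK F0).
  apply: (le_trans EFt); apply: ler_wpM2l; first exact: ltW.
  exact: expR_ge1Dx.
have -> : x - (1 - expR (- x) - sigma) / ((1 + B) * (p - 1)) = (ln F - t) / (p - 1).
  by rewrite /x /t; field; rewrite ?gt_eqF.
by move=> H2; rewrite ler_pM2r ?invr_gt0.
Qed.

Lemma affine_phase (y : nat -> R) (c : R) : 0 <= c ->
  (forall k, y k.+1 <= Num.max 1 (y k - c)) ->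
  forall k, y k <= Num.max 1 (y 0%N - k%:R * c).
Proof.
move=> c0 H; elim=> [|k IH]; first by rewrite mul0r subr0 le_max lexx orbT.
apply: le_trans (H k) _; rewrite ge_max le_max lexx/=.
move: IH; rewrite !le_max => /orP[y1|y2]; apply/orP; [left; lra|right].
by rewrite -natr1 mulrDl mul1r; lra.
Qed.

Lemma geometric_phase (y : nat -> R) (e t : R) : 0 <= t <= 1 -> 0 <= e <= 1 ->
  (forall k, y k <= 1 -> y k.+1 <= Num.max e (y k * t)) -> y 0%N <= 1 ->
  forall k, y k <= Num.max e (t ^+ k).
Proof.
move=> /andP[t0 t1] /andP[e0 e1] H y0; elim=> [|k IH].
  by rewrite expr0 le_max y0 orbT.
have y1 : y k <= 1 by apply: le_trans IH _; rewrite ge_max e1 exprn_ile1.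
apply: le_trans (H k y1) _; rewrite ge_max le_max lexx/=.
move: IH; rewrite !le_max => /orP[ye|yt]; apply/orP; [left|right].
  by apply: (@le_trans _ _ (e * t)); [exact: ler_wpM2r|exact: ler_piMr].
by rewrite exprSr; exact: ler_wpM2r.
Qed.

(** Above 1 the factor 1 - exp(- x) is at least 1/2 and the decrease is linear in time; below 1 it
    is at least x/2 and the decrease is geometric. The errors 1/4 and eps/8 are half of the
    guaranteed gain in each regime. [X] measures the length of the first phase, which exists only
    for an initial divergence above 1. *)
Lemma entropy_decay (E : nat -> R) (p B1 B2 eps X : R) (N : nat) :
  2 < p -> 0 < eps -> eps <= 1 -> 0 <= B1 -> 0 <= B2 -> 0 <= X ->
  (forall k, 1 <= E k) ->
  (forall k, exists2 F, E k.+1 <= F <= E k &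
     F - F `^ ((p - 2) / (p - 1)) - 4^-1 <= (1 + B1) * (F - E k.+1)) ->
  (forall k, exists2 F, E k.+1 <= F <= E k &
     F - F `^ ((p - 2) / (p - 1)) - eps / 8 <= (1 + B2) * (F - E k.+1)) ->
  (1 < ln (E 0%N) / (p - 1) -> (1 + B1) * (ln (E 0%N) / (p - 1)) <= X) ->
  4 * (p - 1) * (X + (1 + B2) * ln (2 / eps)) + 2 <= N%:R ->
  E N <= expR ((p - 1) * (eps / 2)).
Proof.
move=> p2 e0 e1 B10 B20 X0 E1 H1 H2 HX HN.
have p10 : 0 < p - 1 by lra.
pose y k := ln (E k) / (p - 1).
have Ek0 k : 0 < E k by rewrite (lt_le_trans _ (E1 k)).
have y0 k : 0 <= y k by rewrite divr_ge0 ?ln_ge0// ltW.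
suff : y N <= eps / 2.
  by rewrite /y ler_pdivrMr// => yN; rewrite -(lnK (Ek0 N)) ler_expR mulrC.
have xle k F : E k.+1 <= F <= E k -> y k.+1 <= ln F / (p - 1) /\ ln F / (p - 1) <= y k.
  move=> /andP[F1 F2]; have F0 : 0 < F := lt_le_trans (Ek0 k.+1) F1.
  by rewrite !ler_pM2r ?invr_gt0// !ler_ln ?posrE.
pose C1 := (1 + B1) * (p - 1); pose C2 := (1 + B2) * (p - 1).
have C10 : 1 <= C1 by rewrite /C1; nra.
have C20 : 1 <= C2 by rewrite /C2; nra.
have S1 k : y k.+1 <= Num.max 1 (y k - (4 * C1)^-1).
  have [F F12 HF] := H1 k; have [x1 x2] := xle k F F12; have /andP[F1 F2] := F12.
  rewrite le_max; have [//|y1] := leP (y k.+1) 1; apply/orP; right.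
  set x := ln F / (p - 1) in x1 x2.
  have ex : expR (- x) <= 2^-1.
    rewrite expRN lef_pV2 ?posrE ?expR_gt0//; apply: (le_trans expR1_ge2).
    by rewrite ler_expR; lra.
  have s1 : (4^-1 : R) <= 1 - expR (- x) by lra.
  have s0 : (0 : R) <= 4^-1 by [].
  have := entropy_step p2 B10 (E1 k.+1) F1 HF s0 s1.
  rewrite -/x -/(y _) -/C1 => H; apply: (le_trans H).
  have : (4 * C1)^-1 <= (1 - expR (- x) - 4^-1) / C1.
    by rewrite invfM ler_wpM2r ?invr_ge0//; lra.
  lra.
have S2 k : y k <= 1 -> y k.+1 <= Num.max (eps / 2) (y k * (1 - (4 * C2)^-1)).
  move=> yk1.
  have [F F12 HF] := H2 k; have [x1 x2] := xle k F F12; have /andP[F1 F2] := F12.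
  rewrite le_max; have [//|y1] := leP (y k.+1) (eps / 2); apply/orP; right.
  set x := ln F / (p - 1) in x1 x2.
  have x01 : 0 <= x <= 1 by apply/andP; lra.
  have ex := onem_expRN_ge x01.
  have s1 : eps / 8 <= 1 - expR (- x) by lra.
  have s0 : 0 <= eps / 8 by lra.
  have := entropy_step p2 B20 (E1 k.+1) F1 HF s0 s1.
  rewrite -/x -/(y _) -/C2 => H; apply: (le_trans H).
  have C2i : (4 * C2)^-1 = 4^-1 * C2^-1 by rewrite invfM.
  have C2p : 0 <= C2^-1 by rewrite invr_ge0; lra.
  have C2q : C2^-1 <= 1 by rewrite invf_le1//; lra.
  have : x / 4 * C2^-1 <= (1 - expR (- x) - eps / 8) / C2.
    by rewrite ler_wpM2r//; lra.
  have : x * (1 - (4 * C2)^-1) <= y k * (1 - (4 * C2)^-1) by rewrite ler_wpM2r//; lra.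
  rewrite C2i; lra.
have lnge : 0 <= ln (2 / eps).
  by apply: ln_ge0; rewrite ler_pdivlMr//; lra.
have [N1 yN1 N1le] : exists2 N1 : nat, y N1 <= 1 & N1%:R <= 4 * (p - 1) * X + 1.
  have [y01|y01] := leP (y 0%N) 1.
    exists 0%N => //; have : 0 <= 4 * (p - 1) * X by rewrite !mulr_ge0// ltW.
    lra.
  pose N1 := (Num.truncn (4 * C1 * y 0%N)).+1.
  have t0 : 0 <= 4 * C1 * y 0%N by apply: mulr_ge0; [lra|exact: y0].
  have /andP[tl tg] := truncn_itv t0.
  exists N1.
    apply: le_trans (affine_phase _ S1 N1) _; first by rewrite invr_ge0 mulr_ge0//; lra.
    rewrite ge_max lexx/=; have : y 0%N <= N1%:R * (4 * C1)^-1.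
      by rewrite ler_pdivlMr; [rewrite mulrC ltW|lra].
    lra.
  rewrite /N1 -natr1 lerD2r; apply: (le_trans tl).
  have := HX y01; rewrite -/(y 0%N) => HX'.
  have -> : 4 * C1 * y 0%N = 4 * (p - 1) * ((1 + B1) * y 0%N) by rewrite /C1; ring.
  by apply: ler_wpM2l => //; rewrite mulr_ge0// ltW.
have N1N : (N1 <= N)%N.
  rewrite -(ler_nat R); apply: (le_trans N1le); apply: le_trans HN.
  have : 0 <= 4 * (p - 1) * ((1 + B2) * ln (2 / eps)) by rewrite !mulr_ge0//; lra.
  lra.
have C2i : (4 * C2)^-1 = 4^-1 * C2^-1 by rewrite invfM.
have C2p : 0 <= C2^-1 by rewrite invr_ge0; lra.
have C2q : C2^-1 <= 1 by rewrite invf_le1//; lra.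
have t01 : 0 <= 1 - (4 * C2)^-1 <= 1 by apply/andP; rewrite C2i; lra.
have e01 : 0 <= eps / 2 <= 1 by apply/andP; lra.
have := geometric_phase (y := fun k => y (N1 + k)%N) t01 e01.
rewrite addn0 => /(_ _ yN1 (N - N1)%N); rewrite subnKC// => H.
apply: (le_trans (H _)).
  by move=> k yk; rewrite addnS; exact: S2.
rewrite ge_max lexx/=.
have : (1 - (4 * C2)^-1) ^+ (N - N1) <= expR (- (4 * C2)^-1) ^+ (N - N1).
  apply: lerXn2r; rewrite ?nnegrE ?expR_ge0//; first by case/andP: t01.
  exact: expR_ge1Dx.
move=> /le_trans; apply; rewrite -expRM_natr.
have -> : eps / 2 = expR (- ln (2 / eps)).
  by rewrite expRN lnK ?posrE ?divr_gt0// invf_div.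
rewrite ler_expR mulNr lerN2 [leRHS]mulrC ler_pdivlMr; last lra.
rewrite natrB//; have : 4 * (p - 1) * (X + (1 + B2) * ln (2 / eps)) = 4 * (p - 1) * X + ln (2 / eps) * (4 * C2) by rewrite /C2; ring.
lra.
Qed.

End entropy_recursion.

Lemma ln_ge1 (R : realType) (x : R) : 4 <= x -> 1 <= ln x.
Proof.
have e4 : expR 1 <= (4 : R).
  have := expR_ge1Dx (- 2^-1 : R) => h2.
  have h3 : expR (2^-1 : R) <= 2.
    rewrite -[leRHS]invrK -[leLHS]invrK -expRN lef_pV2 ?posrE ?invr_gt0 ?expR_gt0//; lra.
  have -> : (1 : R) = 2^-1 + 2^-1 by field.
  by rewrite expRD; have := expR_ge0 (2^-1 : R); nra.
move=> x4; rewrite -[leLHS]expRK ler_ln ?posrE ?expR_gt0//; first exact: le_trans x4.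
by rewrite (lt_le_trans _ x4).
Qed.

(** The logarithmic factor of [rate] is at least 1, so for finite q' the rate dominates [beta] at
    the modified argument. *)
Lemma ln_max_powR_ge1 (R : realType) (r a : R) : 0 < r -> r <= 4^-1 -> 1 <= a ->
  1 <= ln (Num.max ((5 / r) `^ a) 1).
Proof.
move=> r0 r4 a1.
have r54 : 4 <= 5 / r by rewrite ler_pdivlMr//; lra.
have r5p : 0 < 5 / r by rewrite divr_gt0.
have ln1 := ln_ge1 r54.
apply: (@le_trans _ _ (ln ((5 / r) `^ a))); first by rewrite ln_powR; nra.
by rewrite ler_ln ?posrE ?lt_max ?powR_gt0// le_max lexx.
Qed.

Section proximal_decay.
Context (R : realType) (n : nat).
Local Notation lam := (lebesgue_rV R n).
Local Notation rV := 'rV[R]_n.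
Variables (h : R) (w : rV -> R).
Hypotheses (h0 : 0 < h) (mw : measurable_fun [set: rV] w) (w0 : forall x, 0 <= w x)
  (w1 : (\int[lam]_x (w x)%:E = 1)%E).
Local Notation Q := (heatk h).
Local Notation S := (backk h w).
Local Notation b := (heatdens h w).

Definition prox (u : rV -> \bar R) : rV -> \bar R := kop lam Q (kop lam S u).

Let mQ := @measurable_heatk R n h.
Let mS := measurable_backk h0 mw w0 w1.
Let mb := measurable_heatdens h mw w0.
Let Q0 := @heatk_ge0 R n h.
Let S0 := backk_ge0 h0 mw w0 w1.
Let b0 := heatdens_ge0 h0 mw w0 w1.
Let QS := heatk_backk h0 mw w0 w1.
Let Q1 := @integral_heatk R n h h0.
Let S1 := integral_backk h0 mw w0 w1.

Let nnmfS u : nnmf u -> nnmf (kop lam S u).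
Proof. by move=> hu; exact: nnmf_kop. Qed.

Lemma nnmf_proximal u : nnmf u -> nnmf (prox u).
Proof. by move=> hu; apply: nnmf_kop => //; exact: nnmfS. Qed.

Lemma nnmf_iter_proximal u k : nnmf u -> nnmf (iter k prox u).
Proof. by move=> hu; elim: k => // k; exact: nnmf_proximal. Qed.

Let massS u : nnmf u ->
  (\int[lam]_y (kop lam S u y * (b y)%:E) = \int[lam]_x (u x * (w x)%:E))%E.
Proof. exact: (integral_kopS mQ mS mw mb Q0 S0 w0 b0 QS Q1). Qed.

Let massQ v : nnmf v ->
  (\int[lam]_x (kop lam Q v x * (w x)%:E) = \int[lam]_y (v y * (b y)%:E))%E.
Proof. exact: (integral_kopQ mQ mS mw mb Q0 S0 w0 b0 QS S1). Qed.

Lemma integral_iter_prox u k : nnmf u ->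
  (\int[lam]_x (iter k prox u x * (w x)%:E) = \int[lam]_x (u x * (w x)%:E))%E.
Proof.
move=> hu; elim: k => // k IH; have hk := nnmf_iter_proximal k hu.
by rewrite iterS /prox massQ ?massS//; exact: nnmfS.
Qed.

Lemma moment_kopS u p : 1 <= p -> nnmf u ->
  (\int[lam]_y (kop lam S u y `^ p * (b y)%:E) <= \int[lam]_x (u x `^ p * (w x)%:E))%E.
Proof.
move=> p1 hu; have hup := nnmf_poweR p hu; rewrite -(massS hup).
apply: le_integral_nneg.
- by apply: emeasurable_funM; [exact: (nnmf_poweR p (nnmfS hu)).1|exact/measurable_EFinP].
- by apply: emeasurable_funM; [exact: (nnmfS hup).1|exact/measurable_EFinP].
- by move=> y; rewrite mule_ge0 ?poweR_ge0 ?lee_fin.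
- move=> y; apply: lee_wpmul2r; first by rewrite lee_fin.
  exact: (kop_jensen mS S0 S1 _ p1 hu.1 hu.2).
Qed.

Lemma moment_prox u p : 1 <= p -> nnmf u ->
  (\int[lam]_x (prox u x `^ p * (w x)%:E) <= \int[lam]_x (u x `^ p * (w x)%:E))%E.
Proof.
move=> p1 hu; apply: le_trans (moment_kopS p1 hu).
have hv := nnmfS hu; have hvp := nnmf_poweR p hv; rewrite -(massQ hvp).
apply: le_integral_nneg.
- by apply: emeasurable_funM; [exact: (nnmf_poweR p (nnmf_proximal hu)).1|exact/measurable_EFinP].
- by apply: emeasurable_funM; [exact: (nnmf_kop lam mQ Q0 hvp).1|exact/measurable_EFinP].
- by move=> y; rewrite mule_ge0 ?poweR_ge0 ?lee_fin.
- move=> y; apply: lee_wpmul2r; first by rewrite lee_fin.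
  exact: (kop_jensen mQ Q0 Q1 _ p1 hv.1 hv.2).
Qed.

Lemma moment_iter_prox u p k : 1 <= p -> nnmf u ->
  (\int[lam]_x (iter k prox u x `^ p * (w x)%:E) <= \int[lam]_x (u x `^ p * (w x)%:E))%E.
Proof.
move=> p1 hu; elim: k => // k; apply: le_trans.
by rewrite iterS; exact: moment_prox (nnmf_iter_proximal k hu).
Qed.

Lemma kopS_le u (c : R) : 0 <= c -> nnmf u -> (forall x, u x <= c%:E)%E ->
  forall y, (kop lam S u y <= c%:E)%E.
Proof.
move=> c0 hu uc y; rewrite -(kop_cst mS S0 S1 (c := c%:E) y) ?lee_fin//.
apply: le_integral_nneg.
- by apply: emeasurable_funM; [exact: hu.1|apply/measurable_EFinP; exact: measurable_kernel1].
- by apply: measurable_funeM; apply/measurable_EFinP; exact: measurable_kernel1.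
- by move=> x; rewrite mule_ge0 ?lee_fin ?hu.2.
- by move=> x; apply: lee_wpmul2r; rewrite ?lee_fin.
Qed.

Lemma proximal_le u (c : R) : 0 <= c -> nnmf u -> (forall x, u x <= c%:E)%E ->
  forall x, (prox u x <= c%:E)%E.
Proof.
move=> c0 hu uc x; have hv := nnmfS hu.
rewrite -(kop_cst mQ Q0 Q1 (c := c%:E) x) ?lee_fin//.
apply: le_integral_nneg.
- by apply: emeasurable_funM; [exact: hv.1|apply/measurable_EFinP; exact: measurable_kernel1].
- by apply: measurable_funeM; apply/measurable_EFinP; exact: measurable_kernel1.
- by move=> y; rewrite mule_ge0 ?lee_fin ?hv.2.
- by move=> y; apply: lee_wpmul2r; rewrite ?lee_fin//; exact: kopS_le.
Qed.

Lemma iter_prox_le u (c : R) k : 0 <= c -> nnmf u -> (forall x, u x <= c%:E)%E ->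
  forall x, (iter k prox u x <= c%:E)%E.
Proof.
move=> c0 hu uc; elim: k => // k IH x; rewrite iterS.
by apply: proximal_le => //; exact: nnmf_iter_proximal.
Qed.

(** The part of the moment of order p above the truncation of v^(p/2) at M: the quantity bounded by
    [tau] in [decay_step]. *)
Definition tail (p M : R) (v : rV -> \bar R) : \bar R :=
  (\int[lam]_y ((if v y `^ (p / 2) <= M%:E then 0 else v y `^ p) * (b y)%:E))%E.

Lemma tail_bounded u (p c : R) : 0 <= p -> 0 <= c -> nnmf u -> (forall x, u x <= c%:E)%E ->
  tail p (c `^ (p / 2)) (kop lam S u) = 0%E.
Proof.
move=> p0 c0 hu uc; have le y : (kop lam S u y `^ (p / 2) <= (c `^ (p / 2))%:E)%E.
  rewrite -poweR_EFin; apply: lee_poweR.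
  - by rewrite divr_ge0.
  - exact: (nnmfS hu).2.
  - exact: kopS_le.
by rewrite /tail; under eq_integral do rewrite le mul0e; exact: integral0.
Qed.

(** Chebyshev's argument: where v^(p/2) exceeds M, the factor v^(p - P) = (v^(p/2))^(- 2 (P/p - 1))
    is at most the same power of M. *)
Lemma tail_moment u (p P M Lam : R) : 1 <= p -> p < P -> 0 < M -> nnmf u ->
  (\int[lam]_x (u x `^ P * (w x)%:E) <= Lam%:E)%E ->
  (tail p M (kop lam S u) <= (Lam * M `^ (- (2 * (P / p - 1))))%:E)%E.
Proof.
move=> p1 pP M0 hu uL; have p0 : 0 < p by rewrite (lt_le_trans ltr01).
have hv := nnmfS hu; set v := kop lam S u in hv *.
have P1 : 0 < P by rewrite (lt_trans p0).
have hvP := nnmf_poweR P hv.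
have mtail : measurable_fun [set: rV] (fun y => if (v y `^ (p / 2) <= M%:E)%E then 0%E else (v y `^ p)%E).
  apply: measurable_fun_if => //.
  - apply: (measurable_fun_lee (f := fun y => (v y `^ (p / 2))%E) (g := cst M%:E)) => //.
    exact: (nnmf_poweR _ hv).1.
  - by apply: measurable_funTS; exact: (nnmf_poweR _ hv).1.
set t := - (2 * (P / p - 1)).
have Lam0 : (0 <= Lam%:E)%E.
  by apply: le_trans uL; apply: integral_ge0 => x _; rewrite mule_ge0 ?poweR_ge0 ?lee_fin.
apply: (@le_trans _ _ ((M `^ t)%:E * \int[lam]_y (v y `^ P * (b y)%:E))%E); last first.
  rewrite EFinM muleC; apply: lee_wpmul2r; first by rewrite lee_fin powR_ge0.
  apply: le_trans uL; by apply: moment_kopS => //; rewrite (le_trans p1)// ltW.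
rewrite -ge0_integralZl//; last 3 first.
- by apply: emeasurable_funM; [exact: hvP.1|exact/measurable_EFinP].
- by move=> y _; rewrite mule_ge0 ?poweR_ge0 ?lee_fin.
- by rewrite lee_fin powR_ge0.
apply: le_integral_nneg.
- by apply: emeasurable_funM => //; exact/measurable_EFinP.
- by apply: measurable_funeM; apply: emeasurable_funM; [exact: hvP.1|exact/measurable_EFinP].
- by move=> y; rewrite mule_ge0 ?lee_fin//; case: ifP => // _; exact: poweR_ge0.
- move=> y; rewrite muleA; apply: lee_wpmul2r; first by rewrite lee_fin.
  case: ifPn => [_|]; first by rewrite mule_ge0 ?poweR_ge0// lee_fin powR_ge0.
  rewrite -ltNge; have := hv.2 y; case: (v y) => [z| |]//; last first.
    move=> _ _; rewrite !poweRyr ?gt_eqF// gt0_muley// lte_fin powR_gt0//.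
  rewrite lee_fin !poweR_EFin lte_fin -EFinM lee_fin => z0 Mz.
  have zp : 0 < z.
    rewrite lt_neqAle z0 andbT; apply/eqP => z00; move: Mz.
    by rewrite -z00 powR0 ?gt_eqF ?divr_gt0// ltNge (ltW M0).
  have zt : z `^ (p - P) <= M `^ t.
    have -> : z `^ (p - P) = (z `^ (p / 2)) `^ t.
      by rewrite -powRrM; congr powR; rewrite /t; field; rewrite gt_eqF.
    have zp2 : 0 < z `^ (p / 2) by rewrite powR_gt0.
    rewrite /t !powRN lef_pV2 ?posrE ?(powR_gt0 _ zp2) ?(powR_gt0 _ M0)//.
    apply: ge0_ler_powR; rewrite ?nnegrE ?powR_ge0 ?(ltW M0) ?(ltW Mz)//.
    by rewrite mulr_ge0// subr_ge0 ler_pdivlMr// mul1r ltW.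
  have -> : z `^ p = z `^ (p - P) * z `^ P.
    by rewrite -powRD ?subrK// (gt_eqF zp) implybT.
  by apply: ler_wpM2r => //; rewrite powR_ge0.
Qed.

Variables (pi : probability rV R) (beta : R -> R).
Hypotheses (piE : forall A, measurable A -> pi A = (\int[lam]_(x in A) (w x)%:E)%E)
  (Hpi : weak_poincare pi beta (fun f => (osc f ^+ 2)%E)).

(** [F] is the moment between the two half steps: applying [S] does not increase the moment, and
    [decay_step] handles the application of [Q]. *)
Lemma prox_step u (p M tau r E : R) : nnmf u -> 2 < p -> 0 <= M -> 0 < r ->
  (\int[lam]_x (u x * (w x)%:E) = 1)%E ->
  (\int[lam]_x (u x `^ p * (w x)%:E) = E%:E)%E ->
  (tail p M (kop lam S u) <= tau%:E)%E ->
  exists E' F : R, [/\ (\int[lam]_x (prox u x `^ p * (w x)%:E) = E'%:E)%E,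
    E' <= F <= E &
    F - F `^ ((p - 2) / (p - 1)) - (tau + r * M ^+ 2) <= (1 + 2 * beta r / h) * (F - E')].
Proof.
move=> hu p2 M0 r0 u1 uE utau; have hv := nnmfS hu.
have p1 : 1 <= p by lra.
have := moment_kopS p1 hu; rewrite uE.
have : (0 <= \int[lam]_y (kop lam S u y `^ p * (b y)%:E))%E.
  by apply: integral_ge0 => y _; rewrite mule_ge0 ?poweR_ge0 ?lee_fin.
case FE : (\int[lam]_y (kop lam S u y `^ p * (b y)%:E))%E => [F| |]// _; rewrite lee_fin => FE'.
have B0 : 0 <= 2 * beta r / h.
  by rewrite divr_ge0 ?(ltW h0)// mulr_ge0// (wpi_weight_ge0 Hpi).
have Sw : (\int[lam]_y (kop lam S u y * (b y)%:E) = 1)%E by rewrite massS.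
have := decay_step mQ mS mw mb Q0 S0 w0 b0 QS Q1 S1 hv p2 M0 B0 Sw FE utau.
move=> /(_ (r * M ^+ 2)) [|E' E'E [E'F H]].
  by move=> v mv vM; exact: (wpi_smoothing h0 mw w0 w1 piE Hpi r0 mv vM).
exists E', F; split; [exact: E'E|by rewrite E'F FE'|].
by apply: le_trans H; lra.
Qed.


Lemma moment_le_of_bound u p (c : R) : 1 <= p -> 0 <= c -> nnmf u -> (forall x, u x <= c%:E)%E ->
  (\int[lam]_x (u x `^ p * (w x)%:E) <= (c `^ (p - 1))%:E * \int[lam]_x (u x * (w x)%:E))%E.
Proof.
move=> p1 c0 hu uc.
have mu1 : measurable_fun [set: rV] (fun x => u x * (w x)%:E)%E.
  by apply: emeasurable_funM; [exact: hu.1|exact/measurable_EFinP].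
rewrite -ge0_integralZl//; last 2 first.
- by move=> x _; rewrite mule_ge0 ?lee_fin ?hu.2.
- by rewrite lee_fin powR_ge0.
apply: le_integral_nneg.
- by apply: emeasurable_funM; [exact: (nnmf_poweR p hu).1|exact/measurable_EFinP].
- exact: measurable_funeM.
- by move=> x; rewrite mule_ge0 ?poweR_ge0 ?lee_fin.
- move=> x; rewrite muleA; apply: lee_wpmul2r; first by rewrite lee_fin.
  have := uc x; have := hu.2 x; case: (u x) => [z| |]//; rewrite !lee_fin => z0 zc.
  rewrite ?poweR_EFin -?EFinM ?lee_fin.
  have [->|zn] := eqVneq z 0; first by rewrite powR0 ?mulr0// gt_eqF// (lt_le_trans ltr01).
  rewrite -{1}(subrK 1 p) powRD ?zn ?implybT// powRr1//.
  by apply: ler_wpM2r => //; apply: ge0_ler_powR; rewrite ?nnegrE ?subr_ge0.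
Qed.

Lemma moment_ge1_kernel u p : 1 <= p -> nnmf u ->
  (\int[lam]_x (u x * (w x)%:E) = 1)%E -> (1 <= \int[lam]_x (u x `^ p * (w x)%:E))%E.
Proof.
by move=> p1 hu u1; have := jensen_poweR mw w0 p1 w1 hu.1 hu.2; rewrite u1 poweR1r.
Qed.

Variables (q eps R0 Rinf : R) (q' : \bar R) (g0 : rV -> R).
Hypotheses (q2 : 2 <= q) (eps0 : 0 < eps) (eps2 : eps <= 2^-1)
  (Rinf0 : 0 <= Rinf) (R00 : 0 <= R0).
Hypotheses (mg0 : measurable_fun [set: rV] g0) (g00 : forall x, 0 <= g0 x)
  (g01 : (\int[lam]_x (g0 x * w x)%:E = 1)%E).
Let p : R := 2 * q - 1.
Hypothesis (g0p : (\int[lam]_x ((g0 x)%:E `^ p * (w x)%:E) = (expR ((p - 1) * R0))%:E)%E).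
Hypothesis (g0q' : match q' with
  | +oo%E => forall x, g0 x <= expR Rinf
  | P%:E => p < P /\
      (\int[lam]_x ((g0 x)%:E `^ P * (w x)%:E) = (expR ((P - 1) * Rinf))%:E)%E
  | -oo%E => False end).
Hypothesis (beta_ge : forall r, 0 < r -> r <= 16^-1 -> h <= beta r).

Let delta0 : R := expR (p * Rinf).
Let u0 : rV -> \bar R := EFin \o g0.

Let hu0 : nnmf u0.
Proof. by split => [|x]; [exact/measurable_EFinP|rewrite /u0 /= lee_fin]. Qed.

Let p3 : 3 <= p. Proof. by rewrite /p; have := q2; lra. Qed.
Let delta1 : 1 <= delta0.
Proof. by rewrite -expR0 ler_expR mulr_ge0//; have := p3; lra. Qed.

(** For q' = +oo the densities stay below exp(Rinf), the tail vanishes and M is fixed by r M^2 =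
    sigma. For q' = P finite, M makes the tail bound equal to r M^2: with the exponent P/(P - p)
    both are (1/5) (sigma/delta0) Lam^(p/P), at most sigma/5. This explains the exponent in
    [rate]. *)
Let truncation_level sigma : 0 < sigma -> sigma <= 4^-1 ->
  exists M tau r : R, [/\ 0 <= M, 0 < r,
    beta r <= rate beta q q' (sigma / delta0) /\
      (r <= 16^-1 \/ (q' = +oo%E /\ r = sigma / delta0)),
    tau + r * M ^+ 2 <= sigma &
    forall k, (tail p M (kop lam S (iter k prox u0)) <= tau%:E)%E].
Proof.
move=> s0 s4; have half (z : R) : 0 <= z -> z <= sigma -> z / 5 + z / 5 <= sigma by lra.
have d0 : 0 < delta0 by rewrite expR_gt0.
have sd : sigma / delta0 <= 4^-1.
  by rewrite ler_pdivrMr//; have := delta1; nra.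
have sd0 : 0 < sigma / delta0 by rewrite divr_gt0.
have p1 : 1 <= p by have := p3; lra.
have p0 : 0 < p by rewrite (lt_le_trans ltr01).
move: g0q'; case: q' => [P| |]//.
- move=> [pP LE].
  set r := sigma / delta0 in sd sd0 *.
  have P0 : 0 < P by rewrite (lt_trans p0).
  pose a := P / (P - p).
  have Pp0 : 0 < P - p by rewrite subr_gt0.
  have a1 : 1 <= a by rewrite ler_pdivlMr// mul1r; have := p0; lra.
  pose rt := (r / 5) `^ a.
  have r5 : 0 < r / 5 by rewrite divr_gt0.
  have rt0 : 0 < rt by rewrite powR_gt0.
  have rt20 : rt <= 20^-1.
    apply: (@le_trans _ _ (r / 5)); last lra.
    rewrite /rt -{1}(subrK 1 a) powRD ?(gt_eqF r5) ?implybT// powRr1 ?(ltW r5)//.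
    apply: ler_piMl; first exact: ltW.
    apply: (@le_trans _ _ (1 `^ (a - 1))); last by rewrite powR1.
    apply: ge0_ler_powR; rewrite ?nnegrE ?subr_ge0 ?(ltW r5)//; lra.
  have rt16 : rt <= 16^-1 by apply: (le_trans rt20); rewrite lef_pV2 ?posrE// ler_nat.
  pose Lam := expR ((P - 1) * Rinf).
  have Lam0 : 0 < Lam by rewrite expR_gt0.
  pose t := p / P.
  have LR : 0 < Lam / rt by rewrite divr_gt0.
  have LRE z : (Lam / rt) `^ z = Lam `^ z * rt `^ (- z).
    rewrite powRM ?invr_ge0 ?(ltW Lam0) ?(ltW rt0)//; congr (_ * _).
    by rewrite -(powR_inv1 (ltW rt0)) -powRrM mulN1r.
  have rt1 : rt `^ (1 - t) = r / 5.
    rewrite /rt -powRrM -[RHS]powRr1 ?(ltW r5)//; congr powR.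
    by rewrite /a /t; field; rewrite !gt_eqF.
  pose M := (Lam / rt) `^ (t / 2).
  have M0 : 0 < M by rewrite powR_gt0.
  pose Z := Lam `^ t.
  have Zd : Z <= delta0.
    rewrite /Z /Lam -expRM ler_expR mulrAC; apply: ler_wpM2r => //.
    have -> : (P - 1) * t = p - t by rewrite /t; field; rewrite gt_eqF.
    by rewrite gerBl divr_ge0// ltW.
  have E1 : rt * M ^+ 2 = r / 5 * Z.
    rewrite -powR_mulrn ?(ltW M0)// /M -powRrM.
    have -> : t / 2 * 2%:R = t by field.
    rewrite LRE -rt1 mulrCA mulrC; congr (_ * _).
    by rewrite -{1}(powRr1 (ltW rt0)) -powRD// (gt_eqF rt0) implybT.
  have E2 : Lam * M `^ (- (2 * (P / p - 1))) = r / 5 * Z.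
    rewrite /M -powRrM.
    have -> : t / 2 * - (2 * (P / p - 1)) = t - 1 by rewrite /t; field; rewrite !gt_eqF.
    rewrite LRE opprB rt1 mulrA mulrC; congr (_ * _).
    by rewrite -{1}(powRr1 (ltW Lam0)) -powRD ?subrKC// (gt_eqF Lam0) implybT.
  exists M, (r / 5 * Z), rt; split.
  - exact: ltW.
  - exact: rt0.
  - split; last by left; exact: rt16.
    rewrite /rate -/p -/a -/rt; apply: ler_peMr; first exact: (wpi_weight_ge0 Hpi).
    exact: ln_max_powR_ge1.
  - rewrite E1.
    have : r * Z <= sigma.
      by rewrite /r mulrAC ler_pdivrMr// ler_wpM2l// ltW.
    have : 0 <= r * Z by rewrite mulr_ge0 ?(ltW sd0)// powR_ge0.
    have -> : r / 5 * Z = (r * Z) / 5 by ring.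
    exact: half.
  - move=> k; rewrite -E2; apply: tail_moment => //.
    + exact: nnmf_iter_proximal.
    + rewrite -LE; by apply: moment_iter_prox => //; rewrite (le_trans p1)// ltW.
- move=> g0le.
  exists (expR Rinf `^ (p / 2)), 0, (sigma / delta0); split.
  - exact: powR_ge0.
  - exact: sd0.
  - by split; [rewrite /rate|right].
  - rewrite add0r -powR_mulrn ?powR_ge0// -powRrM.
    have -> : p / 2 * 2%:R = p by field.
    by rewrite -expRM (mulrC Rinf) -/delta0 divfK// gt_eqF.
  - move=> k.
    have hk : nnmf (iter k prox u0) := nnmf_iter_proximal k hu0.
    have bk : forall x, (iter k prox u0 x <= (expR Rinf)%:E)%E.
      exact: iter_prox_le.
    by rewrite (tail_bounded (ltW p0) (expR_ge0 Rinf) hk bk).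
Qed.

(** The weight dominates h at the relevant arguments, so 1 + 2 beta/h <= 3 b/h. With the 4 of
    [entropy_decay] this gives the 12. *)
Lemma prox_decay N :
  12 / h * (p * (rate beta q q' (4^-1 / delta0) * R0 +
                 rate beta q q' (eps / 8 / delta0) * ln (2 / eps))) + 2 <= N%:R ->
  exists2 E : R, (\int[lam]_x (iter N prox (EFin \o g0) x `^ p * (w x)%:E) = E%:E)%E &
    E <= expR ((p - 1) * (eps / 2)).
Proof.
move=> HN; have p3' := p3; have p2 : 2 < p by lra. have p1 : 1 <= p by lra.
have e0' := eps0; have e2' := eps2.
have mass k : (\int[lam]_x (iter k prox u0 x * (w x)%:E) = 1)%E.
  by rewrite integral_iter_prox// -g01; apply: eq_integral => x _; rewrite EFinM.
have fin k : exists2 E : R, (\int[lam]_x (iter k prox u0 x `^ p * (w x)%:E) = E%:E)%E & 1 <= E.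
  have := moment_iter_prox k p1 hu0; rewrite g0p.
  have := moment_ge1_kernel p1 (nnmf_iter_proximal k hu0) (mass k).
  by case: (\int[lam]_x _)%E => [E| |]//; rewrite lee_fin => E1 _; exists E.
pose E k := fine (\int[lam]_x (iter k prox u0 x `^ p * (w x)%:E))%E.
have EE k : (\int[lam]_x (iter k prox u0 x `^ p * (w x)%:E) = (E k)%:E)%E.
  by rewrite /E; have [e -> _] := fin k.
have E1 k : 1 <= E k by rewrite /E; have [e -> ] := fin k.
exists (E N); first exact: EE.
have E0 : E 0%N = expR ((p - 1) * R0) by rewrite /E /= g0p.
have y0 : ln (E 0%N) / (p - 1) = R0 by rewrite E0 expRK mulrC mulKf// gt_eqF//; lra.
have s2 : 0 < eps / 8 by lra.
have s24 : eps / 8 <= 4^-1 by lra.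
have [M1 [t1 [r1 [M10 r10 [br1 rr1] s1 tl1]]]] := truncation_level (sigma := 4^-1) (ltac:(by [])) (lexx _).
have [M2 [t2 [r2 [M20 r20 [br2 rr2] s2' tl2]]]] := truncation_level s2 s24.
have step k M tau r sigma : 0 <= M -> 0 < r -> tau + r * M ^+ 2 <= sigma ->
    (tail p M (kop lam S (iter k prox u0)) <= tau%:E)%E ->
    exists2 F, E k.+1 <= F <= E k &
      F - F `^ ((p - 2) / (p - 1)) - sigma <= (1 + 2 * beta r / h) * (F - E k.+1).
  move=> M0 r0 sg tl.
  have [E' [F [E'E EF H]]] := prox_step (nnmf_iter_proximal k hu0) p2 M0 r0 (mass k) (EE k) tl.
  have E'k : E' = E k.+1 by rewrite /E iterS E'E.
  rewrite E'k in EF H; exists F => //; apply: le_trans H; lra.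
have d0 : 0 < delta0 by rewrite expR_gt0.
have b10 : 0 <= beta r1 := wpi_weight_ge0 Hpi r10.
have b20 : 0 <= beta r2 := wpi_weight_ge0 Hpi r20.
set b1 := rate beta q q' (4^-1 / delta0) in br1 HN.
set b2 := rate beta q q' (eps / 8 / delta0) in br2 HN.
(* The lower bound on the weight needs an argument at most 1/16. For q' = +oo the argument is 1/(4
   delta0), and R0 > 1 forces delta0 >= 4; for R0 <= 1 the first phase is empty. *)
have b1g : 1 < R0 -> h <= b1.
  move=> R01; apply: le_trans br1; apply: beta_ge => //; case: rr1 => // -[q'E ->].
  have RR : R0 <= Rinf.
    move: g0q'; rewrite q'E => g0le.
    have := moment_le_of_bound p1 (expR_ge0 Rinf) hu0 (fun x => g0le x).
    rewrite g0p (mass 0%N) mule1 lee_fin -expRM ler_expR mulrC ler_pM2r//; lra.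
  have d4 : 4 <= delta0.
    have := expR_ge1Dx (3 : R) => e3; apply: (@le_trans _ _ (expR 3)); first lra.
    by rewrite ler_expR; nra.
  by rewrite ler_pdivrMr//; lra.
(* Here eps <= 1/2 and delta0 >= 1 already make the argument at most 1/16. *)
have b2g : h <= b2.
  apply: le_trans br2; apply: beta_ge => //; case: rr2 => // -[q'E ->].
  by rewrite ler_pdivrMr//; have := delta1; lra.
have h0' := h0.
have lnge : 0 <= ln (2 / eps) by apply: ln_ge0; rewrite ler_pdivlMr//; lra.
have le3 b r : h <= b -> beta r <= b -> 1 + 2 * beta r / h <= 3 * b / h.
  move=> hb rb; rewrite ler_pdivlMr// mulrDl divfK ?gt_eqF//; lra.
apply: (entropy_decay (B1 := 2 * beta r1 / h) (B2 := 2 * beta r2 / h) (X := 3 * b1 / h * R0) p2 eps0) => //.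
- lra.
- by rewrite divr_ge0 ?mulr_ge0// ltW.
- by rewrite divr_ge0 ?mulr_ge0// ltW.
- by rewrite mulr_ge0// divr_ge0 ?mulr_ge0 ?(ltW h0)//; exact: le_trans br1.
- by move=> k; exact: step (tl1 k).
- by move=> k; exact: step (tl2 k).
- by rewrite y0 => R01; apply: ler_wpM2r => //; exact: le3 (b1g R01) br1.
- apply: le_trans HN; rewrite lerD2r.
  have b1p : 0 <= b1 by exact: le_trans br1.
  apply: (@le_trans _ _ (4 * (p - 1) * (3 * b1 / h * R0 + 3 * b2 / h * ln (2 / eps)))).
    apply: ler_wpM2l; first lra.
    by rewrite lerD2l; apply: ler_wpM2r => //; exact: le3.
  have -> : 4 * (p - 1) * (3 * b1 / h * R0 + 3 * b2 / h * ln (2 / eps)) =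
    12 / h * ((p - 1) * (b1 * R0 + b2 * ln (2 / eps))) by ring.
  apply: ler_wpM2l; first by rewrite divr_ge0// ltW.
  apply: ler_wpM2r; last lra.
  by rewrite addr_ge0// mulr_ge0//; exact: le_trans br2.
Qed.

End proximal_decay.

(** * The law of the iterates *)

Section independent_chain.
Context (R : realType) d (Omega : measurableType d) (P : probability Omega R)
  d' (T : measurableType d').
Variables (X xi : nat -> {RV P >-> T}) (phi : T * T -> T).
Hypothesis mphi : measurable_fun [set: T * T] phi.
Hypothesis Xphi : forall k o, X k.+1 o = phi (X k o, xi k o).
Hypothesis indep : mutually_independent (fun k => if k is k'.+1 then xi k' else X 0%N).

(** Index 0 is the initial state and index k + 1 the noise of step k, so [X k] depends only on the
    indices up to k. *)
Let Y k : {RV P >-> T} := if k is k'.+1 then xi k' else X 0%N.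

Let Yev (J : seq nat) (A : nat -> set T) : set Omega := [set o | forall j, j \in J -> A j (Y j o)].

Let Yev_prob (J : seq nat) (A : nat -> set T) : (forall j, measurable (A j)) -> uniq J ->
  P (Yev J A) = (\prod_(j <- J) P (Y j @^-1` A j))%E.
Proof.
move=> mA uJ; have iY : mutually_independent Y := indep.
have := iY [fset j in J]%fset A mA.
have -> : \bigcap_(i in [set` [fset j in J]%fset]) (Y i @^-1` A i) = Yev J A.
  apply/seteqP; split => o /= H j jJ.
    by apply: (H j); rewrite /= inE.
  by apply: H; move: jJ; rewrite /= inE.
move=> ->; apply: perm_big; apply: uniq_perm; [exact: fset_uniq|exact: uJ|].
by move=> j; rewrite inE.
Qed.

Let measurable_Yev J A : (forall j, measurable (A j)) -> measurable (Yev J A).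
Proof.
move=> mA; rewrite (_ : Yev J A = \bigcap_(i in [set` J]) (Y i @^-1` A i)); last first.
  by apply/seteqP; split => o H j; exact: H.
apply: bigcap_measurableType => j _.
by rewrite -[_ @^-1` _]setTI; exact: (@measurable_funPT _ _ _ _ (Y j)).
Qed.

(** The factorisation is known on rectangles. Divided by P E, the joint law restricted to E agrees
    there with the product measure, hence everywhere; P E = 0 is trivial. *)
Lemma product_law (k : nat) (E : set Omega) : measurable E ->
  (forall A B, measurable A -> measurable B ->
    P (X k @^-1` A `&` (xi k @^-1` B `&` E)) = (P (X k @^-1` A) * P (xi k @^-1` B) * P E)%E) ->
  forall C, measurable C ->
  P ((fun o => (X k o, xi k o)) @^-1` C `&` E) =
    ((distribution P (X k) \x distribution P (xi k)) C * P E)%E.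
Proof.
move=> mE H C mC.
have mp : measurable_fun [set: Omega] (fun o => (X k o, xi k o)).
  by apply/measurable_fun_pairP; split; exact: measurable_funPT.
have mpC D : measurable D -> measurable ((fun o => (X k o, xi k o)) @^-1` D).
  by move=> mD; rewrite -[_ @^-1` _]setTI; exact: mp.
have Pfin : P E \is a fin_num by exact: fin_num_measure.
have [PE0|PE0] := eqVneq (P E) 0%E.
  rewrite PE0 mule0; apply/eqP; rewrite -measure_le0 -PE0.
  apply: le_measure; [rewrite inE|by rewrite inE|exact: subIsetr].
  by apply: measurableI => //; exact: mpC.
have PE1 : 0 < fine (P E) by rewrite fine_gt0// lt0e PE0 measure_ge0 -ge0_fin_numE ?measure_ge0.
have [c c0 cE] : exists2 c : R, 0 <= c & (c%:E * P E = 1)%E.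
  exists (fine (P E))^-1; first by rewrite invr_ge0 ltW.
  by rewrite -{2}(fineK Pfin) -EFinM mulVf ?gt_eqF.
pose m0 : {measure set (T * T) -> \bar R} :=
  measure_function_pushforward__canonical__measure_function_Measure (mrestr P mE) mp.
pose m' : {measure set (T * T) -> \bar R} := mscale (NngNum c0) m0.
have m'E0 D : m' D = (c%:E * P ((fun o => (X k o, xi k o)) @^-1` D `&` E))%E by [].
have m'E D : (m' D * P E = P ((fun o => (X k o, xi k o)) @^-1` D `&` E))%E.
  by rewrite m'E0 muleAC cE mul1e.
rewrite -m'E; congr (_ * _)%E; symmetry; apply: product_measure_unique => // A B mA mB.
rewrite m'E0.
have -> : (fun o => (X k o, xi k o)) @^-1` (A `*` B) `&` E = X k @^-1` A `&` (xi k @^-1` B `&` E).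
  by apply/seteqP; split => o /=; rewrite /setX /=; tauto.
by rewrite H// muleCA cE mule1.
Qed.


Let Yev_cons (j : nat) (J : seq nat) (A : set T) (B : nat -> set T) : j \notin J ->
  Yev (j :: J) (fun i => if i == j then A else B i) = Y j @^-1` A `&` Yev J B.
Proof.
move=> jJ; apply/seteqP; split => o /=.
  move=> H; split; first by have := H j; rewrite mem_head eqxx; apply.
  move=> i iJ; have := H i; rewrite inE iJ orbT => /(_ erefl).
  by case: eqP => // ij; move: jJ; rewrite -ij iJ.
move=> [XA H] i; rewrite inE => /orP[/eqP ->|iJ]; first by rewrite eqxx.
by case: eqP => [ij|_]; [move: jJ; rewrite -ij iJ|exact: H].
Qed.

Let Yev_cons_prob (j : nat) (J : seq nat) (A : set T) (B : nat -> set T) : j \notin J ->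
  measurable A -> (forall i, measurable (B i)) -> uniq J ->
  P (Y j @^-1` A `&` Yev J B) = (P (Y j @^-1` A) * P (Yev J B))%E.
Proof.
move=> jJ mA mB uJ; rewrite -Yev_cons// Yev_prob; first last.
- by rewrite /= jJ uJ.
- by move=> i; case: ifP.
rewrite big_cons eqxx; congr (_ * _)%E; rewrite (Yev_prob mB uJ); apply: eq_big_seq => i iJ.
by case: eqP => // ij; move: jJ; rewrite -ij iJ.
Qed.

(** Induction on k: X k.+1 is a function of X k and xi k, whose joint law remains a product on
    events about later noises. To see this, the induction hypothesis is used with the index k + 1
    added to [J]. *)
Lemma chain_independent_noise (k : nat) (A : set T) (J : seq nat) (B : nat -> set T) :
  measurable A -> (forall j, measurable (B j)) -> uniq J -> (forall j, j \in J -> (k < j)%N) ->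
  P (X k @^-1` A `&` Yev J B) = (P (X k @^-1` A) * P (Yev J B))%E.
Proof.
elim: k A J B => [|k IH] A J B mA mB uJ Jk.
  have J0 : 0%N \notin J by apply/negP => /Jk.
  exact: (Yev_cons_prob J0 mA mB uJ).
have rect (J0 : seq nat) : uniq J0 -> (forall j, j \in J0 -> (k.+1 < j)%N) ->
    forall A1 B1, measurable A1 -> measurable B1 ->
    P (X k @^-1` A1 `&` (xi k @^-1` B1 `&` Yev J0 B)) =
    (P (X k @^-1` A1) * P (xi k @^-1` B1) * P (Yev J0 B))%E.
  move=> uJ0 J0k A1 B1 mA1 mB1.
  have kJ : k.+1 \notin J0 by apply/negP => /J0k; rewrite ltnn.
  have := Yev_cons_prob kJ mB1 mB uJ0; rewrite /Y => YE.
  rewrite -[RHS]muleA -YE -(Yev_cons _ _ kJ) IH//.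
  - by move=> j; case: ifP.
  - by rewrite /= kJ uJ0.
  - by move=> j; rewrite inE => /orP[/eqP ->//|/J0k /ltnW].
have set0E : Yev [::] B = setT by apply/seteqP; split.
have mE : measurable (Yev J B) by exact: measurable_Yev.
have mphiA : measurable (phi @^-1` A) by rewrite -[_ @^-1` _]setTI; exact: mphi.
have e : X k.+1 @^-1` A = (fun o => (X k o, xi k o)) @^-1` (phi @^-1` A).
  by apply/seteqP; split => o /=; rewrite Xphi.
rewrite e (product_law mE (rect _ uJ Jk) mphiA).
have := product_law measurableT _ mphiA => /(_ k).
have := rect [::] erefl; rewrite set0E => r0 /(_ (r0 _)).
by rewrite setIT probability_setT mule1 => ->.
Qed.

Lemma chain_law (k : nat) (A : set T) : measurable A ->
  P (X k.+1 @^-1` A) = (distribution P (X k) \x distribution P (xi k))%E (phi @^-1` A).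
Proof.
move=> mA.
have mphiA : measurable (phi @^-1` A) by rewrite -[_ @^-1` _]setTI; exact: mphi.
have e : X k.+1 @^-1` A = (fun o => (X k o, xi k o)) @^-1` (phi @^-1` A).
  by apply/seteqP; split => o /=; rewrite Xphi.
have := @product_law k setT measurableT _ _ mphiA; rewrite setIT probability_setT mule1 e; apply.
move=> A1 B1 mA1 mB1; rewrite setIT mule1.
have := @chain_independent_noise k A1 [:: k.+1] (fun=> B1) mA1 (fun=> mB1) erefl.
have -> : Yev [:: k.+1] (fun=> B1) = xi k @^-1` B1.
  apply/seteqP; split => o /= H; first by apply: (H k.+1); rewrite inE.
  by move=> j; rewrite inE => /eqP ->.
by apply=> j; rewrite inE => /eqP ->.
Qed.

End independent_chain.

(** Iterated densities may be +oo on a null set; there [fine] changes the value to 0, which reduces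
    the claim to real densities. *)
Lemma integral_ereal_density d (T : measurableType d) (R : realType)
    (mu : {measure set T -> \bar R}) (nu : probability T R) (g f : T -> \bar R) :
  measurable_fun [set: T] g -> (forall x, 0 <= g x)%E ->
  (forall A, measurable A -> nu A = \int[mu]_(x in A) g x)%E ->
  measurable_fun [set: T] f -> (forall x, 0 <= f x)%E ->
  (\int[nu]_x f x = \int[mu]_x (f x * g x))%E.
Proof.
move=> mg g0 nuE mf f0.
have ig : mu.-integrable [set: T] g.
  apply/integrableP; split => //; under eq_integral do rewrite gee0_abs//.
  by rewrite -nuE// probability_setT ltry.
have gfin : {ae mu, forall x, [set: T] x -> g x \is a fin_num} := integrable_ae measurableT ig.
have mfg : measurable_fun [set: T] (fine \o g).
  exact: (measurableT_comp (fine_measurable measurableT)).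
have fg0 x : 0 <= (fine \o g) x by exact: fine_ge0.
rewrite (@integral_density _ _ _ mu nu (fine \o g) f mfg fg0 _ mf f0); last first.
  move=> A mA; transitivity (\int[mu]_(x in A) g x)%E; first exact: nuE.
  apply: ae_eq_integral => //.
  - exact: measurable_funTS.
  - by apply: measurable_funTS; exact/measurable_EFinP.
  - by apply: filterS gfin => x /= h _; rewrite fineK// h.
apply: ae_eq_integral => //.
- by apply: emeasurable_funM => //; exact/measurable_EFinP.
- exact: emeasurable_funM.
- by apply: filterS gfin => x /= h _; rewrite fineK// h.
Qed.

Section lmc_law.
Context (R : realType) (n : nat).
Local Notation rV := 'rV[R]_n.
Local Notation lam := (lebesgue_rV R n).
Variables (V : rV -> R) (L s h Z : R).
Hypotheses (dV : forall x, differentiable V x) (hV : holder_grad V L s)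
  (L0 : 0 < L) (s0 : 0 < s) (h0 : 0 < h) (Z0 : 0 < Z).
Local Notation w := (gibbsdens V Z).
Hypothesis w1 : (\int[lam]_x (w x)%:E = 1)%E.
Local Notation hk := (@heatk R n h).
Local Notation bk := (backk h w).
Let mw := measurable_gibbsdens Z dV.
Let w0 := gibbsdens_ge0 V Z0.
Let phi (z : rV * rV) : rV := z.1 - h *: grad V z.1 + Num.sqrt (2 * h) *: z.2.

Let measurable_phi : measurable_fun [set: rV * rV] phi.
Proof.
apply: measurable_rVD.
  apply: measurable_rVD; first exact: measurable_fst.
  apply: measurable_rVN; apply: measurable_rVZ.
  by apply: (measurable_grad_potential hV L0 s0); exact: measurable_fst.
by apply: measurable_rVZ; exact: measurable_snd.
Qed.

(** A rotation by pi/4 merges two Gaussian increments of variance h into one of variance 2h. The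
    shift g is fixed by the starting point, so the two half steps compose exactly to an LMC step
    although the drift acts in the second. *)
Lemma gaussian_convolution (F : rV -> \bar R) (x g : rV) :
  measurable_fun [set: rV] F -> (forall z, 0 <= F z)%E ->
  (\int[lam]_y ((\int[lam]_z (F z * (gausspdf h (z - (y - g)))%:E)) * (gausspdf h (y - x))%:E) =
   \int[lam]_e (F (x - g + Num.sqrt (2 * h) *: e)%R * (gausspdf 1 e)%:E))%E.
Proof.
move=> mF F0; set r := Num.sqrt h.
have sr : Num.sqrt (2 * h) = Num.sqrt 2 * r by rewrite sqrtrM.
have s2 : Num.sqrt 2 * Num.sqrt 2 = 2 :> R by rewrite -expr2 sqr_sqrtr.
have s20 : 0 < Num.sqrt 2 :> R by rewrite sqrtr_gt0.
pose c : R := (Num.sqrt 2)^-1.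
have c0 : 0 < c by rewrite invr_gt0.
have cs : c ^+ 2 + c ^+ 2 = 1 by rewrite /c exprVn sqr_sqrtr//; field.
pose G (z : rV * rV) : \bar R := F (x - g + Num.sqrt (2 * h) *: z.1)%R.
have mG : measurable_fun [set: rV * rV] G.
  apply: (measurableT_comp mF); apply: measurable_rVD => //.
  by apply: measurable_rVZ; exact: measurable_fst.
have G0 z : (0 <= G z)%E by exact: F0.
transitivity (\int[lam]_e1 ((\int[lam]_e2 (G (c *: e1 + c *: e2, c *: e1 - c *: e2)%R * (gausspdf 1 e2)%:E)) * (gausspdf 1 e1)%:E))%E.
  have mI : measurable_fun [set: rV] (fun y => \int[lam]_z (F z * (gausspdf h (z - (y - g)))%:E))%E.
    apply: (@measurable_fun_fubini_tonelli_F _ _ _ _ _ lam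
      (fun t : rV * rV => F t.2 * (gausspdf h (t.2 - (t.1 - g)))%:E)%E).
      apply: emeasurable_funM; first exact: (measurableT_comp mF measurable_snd).
      apply/measurable_EFinP; apply: measurable_gausspdf; apply: measurable_rVD; first exact: measurable_snd.
      by apply: measurable_rVN; apply: measurable_rVD => //; exact: measurable_fst.
    by move=> t; rewrite mule_ge0// lee_fin gausspdf_ge0.
  rewrite (integral_gausspdf_shift x h0 mI); last first.
    by move=> y; apply: integral_ge0 => z _; rewrite mule_ge0// lee_fin gausspdf_ge0.
  apply: eq_integral => e1 _; apply: (congr1 (fun t => t * (gausspdf 1 e1)%:E)%E).
  rewrite (integral_gausspdf_shift _ h0 mF F0); apply: eq_integral => e2 _.
  apply: (congr1 (fun t => F t * (gausspdf 1 e2)%:E)%E).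
  rewrite /= sr -scalerDr scalerA.
  have -> : Num.sqrt 2 * r * c = r by rewrite /c mulrAC mulfV ?mul1r// gt_eqF.
  rewrite scalerDr -/r; apply/rowP => i; rewrite !mxE; ring.
rewrite gaussian_rotation//.
apply: eq_integral => e1 _; rewrite /G /=.
have mg1 : measurable_fun [set: rV] (fun y : rV => (gausspdf 1 y)%:E).
  by apply/measurable_EFinP; apply: measurable_gausspdf.
have g1 (y : rV) : (0 <= (gausspdf 1 y)%:E)%E by rewrite lee_fin gausspdf_ge0.
rewrite (ge0_integralZl lam measurableT mg1 (fun y _ => g1 y) (F0 _)).
by rewrite integral_gausspdf// mule1.
Qed.

Lemma lmc_kernel (v : rV -> \bar R) (x : rV) : nnmf v ->
  (top lam hk bk (lmc_ratio V h Z) v x =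
   \int[lam]_e (v (phi (x, e)) * (gausspdf 1 e)%:E))%E.
Proof.
move=> [mv v0]; rewrite /phi /= -(gaussian_convolution x (h *: grad V x) mv v0).
apply: eq_integral => y _; apply: (congr1 (fun t => t * (gausspdf h (y - x))%:E)%E).
apply: eq_integral => z _; by rewrite (lmc_ratioK dV h0 Z0 w1).
Qed.

Local Notation lop := (top lam hk bk (fun z y x => lmc_ratio V h Z x y z)).

(** Duality against the indicator of A: the operator on densities is the adjoint of the LMC
    transition operator. *)
Lemma lmc_density_step (f : rV -> \bar R) (A : set rV) : nnmf f -> measurable A ->
  (\int[lam]_(z in A) (lop f z * (w z)%:E) =
   \int[lam]_x ((\int[lam]_e ((\1_A (phi (x, e)))%:E * (gausspdf 1 e)%:E)) * (f x * (w x)%:E)))%E.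
Proof.
move=> [mf f0] mA.
have m1 : measurable_fun [set: rV] (fun z : rV => (\1_A z : R)%:E) by exact/measurable_EFinP.
have h1 : nnmf (fun z : rV => (\1_A z : R)%:E) by split => // z; rewrite lee_fin.
rewrite integral_mkcond.
transitivity (\int[lam]_z ((\1_A z)%:E * lop f z * (w z)%:E))%E.
  apply: eq_integral => z _; rewrite patchE indicE -muleA; case: ifP => _; first by rewrite mul1e.
  by rewrite mul0e.
rewrite -(top_duality lam (b := heatdens h w) (@measurable_heatk R n h) (measurable_backk h0 mw w0 w1) mw
  (@heatk_ge0 R n h) (backk_ge0 h0 mw w0 w1) w0 (heatdens_ge0 h0 mw w0 w1)
  (heatk_backk h0 mw w0 w1) (measurable_lmc_ratio dV hV L0 s0 h0 Z0 w1)
  (fun x y z => ltW (lmc_ratio_gt0 dV h0 Z0 w1 x y z)) mf m1 f0 h1.2).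
apply: eq_integral => x _; rewrite (lmc_kernel x h1).
by rewrite (muleC (f x)) -muleA.
Qed.

Variables (mu0 : probability rV R) (g0 : rV -> R).
Hypotheses (mg0 : measurable_fun [set: rV] g0) (g00 : forall x, 0 <= g0 x)
  (mu0E : forall A, measurable A -> mu0 A = (\int[lam]_(x in A) (g0 x * w x)%:E)%E).

Lemma nnmf_iter_lop k : nnmf (iter k lop (EFin \o g0)).
Proof.
elim: k => [|k [mk k0]]; first by split => [|x]; [exact/measurable_EFinP|rewrite /= lee_fin].
have mr : measurable3 (fun z y x => lmc_ratio V h Z x y z).
  apply: (measurableT_comp (measurable_lmc_ratio dV hV L0 s0 h0 Z0 w1) (g := fun t : rV * rV * rV => ((t.2, t.1.2), t.1.1))).
  apply: measurable_fun_pair; last exact: (measurableT_comp measurable_fst measurable_fst).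
  by apply: measurable_fun_pair; [exact: measurable_snd|exact: (measurableT_comp measurable_snd measurable_fst)].
have r0 x y z : 0 <= (fun z y x => lmc_ratio V h Z x y z) x y z.
  by apply: ltW; exact: (lmc_ratio_gt0 dV h0 Z0 w1).
rewrite iterS; split.
  apply: measurable_top => //; [exact: measurable_heatk|exact: (measurable_backk h0 mw w0 w1)|
    exact: heatk_ge0|exact: (backk_ge0 h0 mw w0 w1)].
by move=> x; apply: top_ge0 => //; [exact: heatk_ge0|exact: (backk_ge0 h0 mw w0 w1)].
Qed.

Lemma lmc_law d (Omega : measurableType d) (P : probability Omega R)
    (x xi : nat -> {RV P >-> 'rV[R]_n}) (k : nat) (A : set rV) :
  LMC V h mu0 x xi -> measurable A ->
  distribution P (x k) A = (\int[lam]_(z in A) (iter k lop (EFin \o g0) z * (w z)%:E))%E.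
Proof.
move=> lmc; elim: k A => [|k IH] A mA.
  rewrite (LMC_init lmc mA) mu0E//.
have stepE j o : x j.+1 o = phi (x j o, xi j o) := LMC_step lmc j o.
have -> : distribution P (x k.+1) A = P (x k.+1 @^-1` A) by [].
rewrite (chain_law measurable_phi stepE (LMC_independent lmc))//.
have hf := nnmf_iter_lop k; set f := iter k lop _ in IH hf *.
rewrite iterS lmc_density_step//.
have mpA : measurable (phi @^-1` A) by rewrite -[_ @^-1` _]setTI; exact: measurable_phi.
transitivity (\int[distribution P (x k)]_y (\int[lam]_e ((\1_A (phi (y, e)))%:E * (gausspdf 1 e)%:E)))%E.
  apply: eq_integral => y _.
  transitivity (distribution P (xi k) (xsection (phi @^-1` A) y)) => //.
  have ms : measurable (xsection (phi @^-1` A) y) by exact: measurable_xsection.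
  rewrite (LMC_noise lmc k ms) /gaussian_law integral_mkcond; apply: eq_integral => e _.
  rewrite patchE indicE; case: ifPn => eA.
    have -> : phi (y, e) \in A by move: eA; rewrite mem_xsection inE.
    by rewrite mul1e /gausspdf.
  have -> : (phi (y, e) \in A) = false by apply/negbTE; move: eA; rewrite mem_xsection.
  by rewrite mul0e.
have mD : measurable_fun [set: rV] (fun z => f z * (w z)%:E)%E.
  by apply: emeasurable_funM; [exact: hf.1|exact/measurable_EFinP].
apply: (@integral_ereal_density _ _ _ lam (distribution P (x k)) (fun z => f z * (w z)%:E)%E) => //.
- by move=> z; rewrite mule_ge0 ?hf.2 ?lee_fin.
- apply: (@measurable_fun_fubini_tonelli_F _ _ _ _ _ lam
    (fun t : rV * rV => ((\1_A (phi t))%:E * (gausspdf 1 t.2)%:E)%E)).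
    apply: emeasurable_funM; apply/measurable_EFinP.
      exact: (measurableT_comp (measurable_indic mA) measurable_phi).
    by apply: measurable_gausspdf; exact: measurable_snd.
  by move=> t; rewrite mule_ge0// lee_fin ?gausspdf_ge0.
- by move=> y; apply: integral_ge0 => e _; rewrite mule_ge0// lee_fin ?gausspdf_ge0.
Qed.

End lmc_law.

(** * Choice of the step size *)

Section step_size.
Context (R : realType).

Lemma iteration_bound_ge (n : nat) (s q L m T eps r2 : R)
    (base := T `^ (1 + 1 / s) * n%:R * q `^ (1 / s) * L `^ (2 / s) / eps `^ (1 / s)) :
  let A := iteration_bound n s q L m T eps r2 in
  [/\ base <= A,
   base * (eps `^ (1 / (2 * s)) * m `^ s / (L `^ (1 / s - 1) * T `^ (1 / (2 * s)) * n%:R)) <= A &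
   base * (eps `^ (1 / (2 * s)) * r2 `^ (s / 2) /
       (L `^ (1 / s - 1) * T `^ ((1 - s ^+ 2) / (2 * s)) * n%:R) *
     ln (q * T * L * r2 / eps) `^ (s / 2)) <= A].
Proof.
have b0 : 0 <= base by rewrite !mulr_ge0 ?invr_ge0 ?powR_ge0.
rewrite /= /iteration_bound -/base; split; last 2 first.
- by apply: ler_wpM2l => //; rewrite !le_max lexx !orbT.
- by apply: ler_wpM2l => //; rewrite !le_max lexx !orbT.
- by apply: ler_peMr => //; rewrite le_max lexx.
Qed.

Lemma exists_expR (x : R) : 1 <= x -> exists2 l : R, x = expR l & 0 <= l.
Proof.
by move=> x1; exists (ln x); rewrite ?ln_ge0// lnK// posrE (lt_le_trans ltr01).
Qed.

(** Three uses of [powR_addr_le] give the factors 8, 8, 4 and 2, whose sum is 22. *)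
Lemma mul_powR_sum4_le (Q a b c e t X : R) : 0 <= Q ->
  0 <= a -> 0 <= b -> 0 <= c -> 0 <= e -> 0 <= t <= 1 ->
  Q * a `^ t <= X -> Q * b `^ t <= X -> Q * c `^ t <= X -> Q * e `^ t <= X ->
  Q * (a + b + c + e) `^ t <= 22 * X.
Proof.
move=> Q0 a0 b0 c0 e0 t01 P1 P2 P3 P4.
have H1 := powR_addr_le a0 b0 t01.
have H2 := powR_addr_le (addr_ge0 a0 b0) c0 t01.
have H3 := powR_addr_le (addr_ge0 (addr_ge0 a0 b0) c0) e0 t01.
apply: (@le_trans _ _ (Q * (8 * a `^ t + 8 * b `^ t + 4 * c `^ t + 2 * e `^ t))).
  by apply: ler_wpM2l => //; lra.
lra.
Qed.

(** Parameters other than h and delta, or their inverses, are at least 1. Written as exponentials,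
    they turn the products of powers into linear inequalities between logarithms. The first term of
    the maximum in [A] handles the noise and the summands T and T n, the second handles m^2, the
    third T r2. *)
Lemma step_size_conditions (n : nat) (s q L m T eps r2 h delta : R)
    (A := iteration_bound n s q L m T eps r2) :
  0 < s -> s <= 1 -> 2 <= q -> 0 < eps -> eps <= q^-1 -> 1 <= m -> 1 <= L -> 1 <= T ->
  1 <= r2 -> (0 < n)%N -> 0 < delta -> 0 < h -> h * A <= delta `^ (1 / s) * T ->
  [/\ T <= A, q * L ^+ 2 * T * (n%:R * h) `^ s <= delta * eps &
    q * L ^+ 2 * T * (h * L) `^ (2 * s) * (T + m ^+ 2 + T * n%:R + T * r2) `^ (s ^+ 2) <=
      22 * delta ^+ 2 * eps].
Proof.
move=> s0 s1 q2 eps0 epsq m1 L1 T1 r1 n0 d0 h0 hA.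
have q1 : 1 <= q by lra.
have e1 : eps <= 1 by apply: (le_trans epsq); rewrite invf_le1//; lra.
have e41 : 1 <= eps^-1 by rewrite invf_ge1.
have n1 : 1 <= (n%:R : R) by rewrite ler1n.
have ln1 : 1 <= ln (q * T * L * r2 / eps).
  apply: ln_ge1; rewrite ler_pdivlMr//.
  have qe : q * eps <= 1 by rewrite -(mulVf (_ : q != 0)) ?gt_eqF ?ler_pM2r//; [rewrite mulrC ler_pM2r//; lra|lra].
  have qTL : q <= q * T * L * r2.
    rewrite -!mulrA; apply: ler_peMr; first lra.
    by rewrite mulr_ege1// mulr_ege1.
  have : 4 * eps <= q; last lra.
  have : eps <= 2^-1 by apply: (le_trans epsq); rewrite lef_pV2 ?posrE//; lra.
  lra.
have := iteration_bound_ge n s q L m T eps r2; rewrite /= -/A.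
set lg := ln _ in ln1 *.
have [lq qE lq0] := exists_expR q1; have [lL LE lL0] := exists_expR L1.
have [lT TE lT0] := exists_expR T1; have [lm mE lm0] := exists_expR m1.
have [lr rE lr0] := exists_expR r1; have [ld nE ld0] := exists_expR n1.
have [le eE le0] := exists_expR e41; have [ll lgE ll0] := exists_expR ln1.
have epsE : eps = expR (- le) by rewrite expRN -eE invrK.
have dE : delta = expR (ln delta) by rewrite lnK.
have hE : h = expR (ln h) by rewrite lnK.
set ldel := ln delta in dE; set eta := ln h in hE.
have sn : s != 0 by rewrite gt_eqF.
have e2 (x : R) : expR x ^+ 2 = expR (2 * x) by rewrite mulrC -expRM_natr.
rewrite qE LE TE mE rE nE epsE lgE -!expRM -!expRD -!expRN -!expRD => -[A1 A2 A3].
have AT : expR lT <= A.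
  apply: le_trans A1; rewrite ler_expR.
  have i0 : 0 <= s^-1 by rewrite invr_ge0 ltW.
  have := mulr_ge0 i0 lT0; have := mulr_ge0 i0 lq0; have := mulr_ge0 i0 lL0; have := mulr_ge0 i0 le0.
  by rewrite !mul1r; lra.
(* Taking logarithms and multiplying by s clears the exponents 1/s. *)
have key a : expR a <= A -> s * eta <= ldel + s * lT - s * a.
  move=> aA; have : h * expR a <= delta `^ (1 / s) * T.
    by apply: le_trans hA; rewrite ler_pM2l.
  rewrite hE dE TE -expRM -!expRD ler_expR => H.
  have : s * (eta + a) <= s * (ldel * (1 / s) + lT) by rewrite ler_pM2l.
  have -> : s * (ldel * (1 / s) + lT) = ldel + s * lT by field.
  lra.
have s20 : 0 <= s ^+ 2 by exact: sqr_ge0.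
have ss : s ^+ 2 <= s by rewrite expr2 ler_piMl// ltW.
have K1 := key _ A1; have K2 := key _ A2; have K3 := key _ A3; clear key hA A1 A2 A3.
have E1 : s * (lT * (1 + 1 / s) + ld + lq * (1 / s) + lL * (2 / s) - - le * (1 / s)) =
  (s + 1) * lT + s * ld + lq + 2 * lL + le by field.
have E2 : s * (- le * (1 / (2 * s)) + lm * s - (lL * (1 / s - 1) + lT * (1 / (2 * s)) + ld)) =
  - (le / 2) + s ^+ 2 * lm - (1 - s) * lL - lT / 2 - s * ld by field.
have E3 : s * (- le * (1 / (2 * s)) + lr * (s / 2) -
    (lL * (1 / s - 1) + lT * ((1 - s ^+ 2) / (2 * s)) + ld) + ll * (s / 2)) =
  - (le / 2) + s ^+ 2 * (lr / 2) - (1 - s) * lL - (1 - s ^+ 2) * lT / 2 - s * ld + s ^+ 2 * (ll / 2).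
  by field.
rewrite E1 in K1; rewrite mulrDr E1 E2 in K2; rewrite mulrDr E1 E3 in K3; clear E1 E2 E3.
have ss1 : 0 <= 1 - s ^+ 2 by clear -ss s1; lra.
have p1 : 0 <= (1 - s ^+ 2) * lT by exact: mulr_ge0.
have p2 : 0 <= (2 * s - s ^+ 2) * ld by rewrite mulr_ge0//; clear -ss s0; lra.
have p3 : 0 <= (1 - s) * lL by rewrite mulr_ge0// subr_ge0.
have p4 : 0 <= s ^+ 2 * ll by rewrite mulr_ge0.
have p5 : 0 <= s ^+ 2 * ld by rewrite mulr_ge0.
have dE2 : delta ^+ 2 = expR (2 * ldel) by rewrite dE e2.
split; first exact: AT.
  rewrite hE dE -expRD e2 -expRM -!expRD ler_expR; clear -K1; lra.
set Q := expR lq * expR lL ^+ 2 * expR lT * (h * expR lL) `^ (2 * s).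
have QE : Q = expR (lq + 2 * lL + lT + (eta + lL) * (2 * s)).
  by rewrite /Q hE -expRD e2 -expRM -!expRD.
have Q0 : 0 <= Q by rewrite QE expR_ge0.
have s2 : 0 <= s ^+ 2 <= 1 by apply/andP; split => //; clear -ss1; lra.
have part x : lq + 2 * lL + lT + (eta + lL) * (2 * s) + x * s ^+ 2 <= 2 * ldel - le ->
    Q * expR x `^ (s ^+ 2) <= delta ^+ 2 * expR (- le).
  by move=> H; rewrite QE dE2 -expRM -!expRD ler_expR.
have P1 : Q * expR lT `^ (s ^+ 2) <= delta ^+ 2 * expR (- le).
  by apply: part; clear -K1 p1 p2 p3 p5 lq0 le0; lra.
have P2 : Q * (expR lm ^+ 2) `^ (s ^+ 2) <= delta ^+ 2 * expR (- le).
  by rewrite e2; apply: part; clear -K2 lq0; lra.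
have P3 : Q * expR (lT + ld) `^ (s ^+ 2) <= delta ^+ 2 * expR (- le).
  by apply: part; clear -K1 p1 p2 p3 lq0 le0; lra.
have P4 : Q * expR (lT + lr) `^ (s ^+ 2) <= delta ^+ 2 * expR (- le).
  by apply: part; clear -K3 p4 lq0; lra.
rewrite -mulrA.
exact: (mul_powR_sum4_le Q0 (expR_ge0 _) (sqr_ge0 _) (expR_ge0 _) (expR_ge0 _) s2 P1 P2 P3 P4).
Qed.

End step_size.

Section rate_conditions.
Context (R : realType).

(* Powers of ten are products because numerals are unary. *)
Lemma rate_conditions (n N : nat) (s q L m T eps r2 h gam delta : R)
    (S := 1 + m ^+ 2 / T + n%:R + r2) (nn := S / (q * eps)) (B := T * S) :
  0 < s -> s <= 1 -> 2 <= q -> 0 < eps -> eps <= q^-1 -> 1 <= L -> 1 <= T ->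
  1 <= r2 -> (0 < n)%N -> 0 < h -> h <= 1 -> N%:R * h = 14 * T ->
  0 < delta -> 10 * (10 * (10 * (10 * (10 * delta)))) = 1 ->
  10 * (10 * (10 * (gam * T))) <= 1 -> 1 <= 10 * (10 * (10 * (10 * (gam * T)))) ->
  q * L ^+ 2 * T * (n%:R * h) `^ s <= delta * eps ->
  q * L ^+ 2 * T * (h * L) `^ (2 * s) * (T + m ^+ 2 + T * n%:R + T * r2) `^ (s ^+ 2) <=
    22 * delta ^+ 2 * eps ->
  [/\ [/\ 1 <= nn, 0 < B, 8 * (gam / 2) * h <= 1 & 0 <= rate_quad L s h q B],
   32 * (32 * q ^+ 2 * h * L ^+ 2) * h * (n%:R * h) `^ (s - 1) <= 1,
   N%:R * (8 * (gam / 2) ^+ 2 * h + 2 * nn * rate_quad L s h q B) <= gam / 2,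
   N%:R * (2 * nn * rate_cst n L s h q B + 4 * (gam / 2) * h * n%:R) +
     (1 + gam + 4 * gam * m ^+ 2 + r2) <= 4 * nn * (q - 1) * eps &
   L * (8 * Num.sqrt h) `^ (1 + s) <= 3^-1].
Proof.
move=> s0 s1 q2 eps0 epsq L1 T1 r1 n0 h0 h1 Nh d0 dE gT1 gT2 C1 C2.
have n1 : 1 <= (n%:R : R) by rewrite ler1n.
have T0 : 0 < T by lra.
have q0 : 0 < q by lra.
have L0 : 0 < L by lra.
have qe0 : 0 < q * eps by rewrite mulr_gt0.
have qe : q * eps <= 1 by rewrite mulrC -ler_pdivlMr// div1r.
have mT : 0 <= m ^+ 2 / T by rewrite divr_ge0 ?sqr_ge0// ltW.
have S1 : 1 <= S by rewrite /S; lra.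
have S0 : 0 < S by lra.
have B0 : 0 < B by rewrite mulr_gt0.
have BE : T + m ^+ 2 + T * n%:R + T * r2 = B by rewrite /B /S; field; rewrite gt_eqF.
rewrite BE in C2.
have g0 : 0 < gam by rewrite -(pmulr_lgt0 _ T0); lra.
have gT : gam <= gam * T by rewrite ler_peMr// ltW.
have nh0 : 0 < n%:R * h by rewrite mulr_gt0//; lra.
have Bs : B `^ (s ^+ 2 - 1) = B `^ (s ^+ 2) / B.
  by rewrite powRD ?(gt_eqF B0) ?implybT// powR_inv1// ltW.
have ns : (n%:R * h) `^ (s - 1) = (n%:R * h) `^ s / (n%:R * h).
  by rewrite powRD ?(gt_eqF nh0) ?implybT// powR_inv1// ltW.
rewrite /rate_quad /rate_cst Bs ns.
set X := (n%:R * h) `^ s in C1 *; set Y := (h * L) `^ (2 * s) in C2 *.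
set W := B `^ (s ^+ 2) in C2 *.
have X0 : 0 <= X by exact: powR_ge0.
have Y0 : 0 <= Y by exact: powR_ge0.
have W0 : 0 <= W by exact: powR_ge0.
have hsX : h `^ s <= X.
  apply: ge0_ler_powR; rewrite ?nnegrE ?(ltW h0) ?(ltW nh0) ?(ltW s0)//.
  by rewrite ler_peMl// ltW.
have SE : S = 1 + m ^+ 2 / T + n%:R + r2 by [].
have BT : B = T * S by [].
have nnE : nn = S / (q * eps) by [].
clearbody X Y W; clearbody nn; clearbody B; clearbody S.
(* [u] and [v] are the noise and drift contributions relative to eps. The moment conditions become
   linear in them, with u at most delta and v at most 22 delta^2. *)
pose u := q * L ^+ 2 * T * X / eps; pose v := q * L ^+ 2 * T * Y * W / eps.
have qL0 : 0 <= q * L ^+ 2 * T by apply: mulr_ge0; [apply: mulr_ge0; [exact: ltW|exact: sqr_ge0]|exact: ltW].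
have u0 : 0 <= u by apply: divr_ge0; [exact: mulr_ge0|exact: ltW].
have v0 : 0 <= v by apply: divr_ge0; [apply: mulr_ge0 => //; exact: mulr_ge0|exact: ltW].
have ud : u <= delta by rewrite ler_pdivrMr.
have vd : v <= 22 * delta ^+ 2 by rewrite ler_pdivrMr.
have dx x : x * (10 * (10 * (10 * (10 * (10 * delta))))) = x by rewrite dE mulr1.
have d2 : 10 * (10 * (10 * (10 * (10 * delta ^+ 2)))) = delta by rewrite -[RHS]dx; ring.
(* Prepares the last condition, the one behind the lower bound on the weight. *)
have Lh : L ^+ 2 * h `^ s <= delta.
  have e1 : eps <= 1 by apply: (le_trans epsq); rewrite invf_le1//; clear -q2; lra.
  have H1 : L ^+ 2 * h `^ s <= L ^+ 2 * X by rewrite ler_wpM2l// sqr_ge0.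
  have qT : 1 <= q * T by rewrite mulr_ege1//; clear -q2; lra.
  have H2 : L ^+ 2 * X <= q * L ^+ 2 * T * X.
    have -> : q * L ^+ 2 * T * X = (q * T) * (L ^+ 2 * X) by ring.
    by rewrite ler_peMl// mulr_ge0 ?sqr_ge0.
  have H3 : delta * eps <= delta by rewrite ler_piMr// ltW.
  clear -C1 H1 H2 H3; lra.
clear C1 C2.
have en0 : eps != 0 by rewrite gt_eqF.
have qn0 : q != 0 by rewrite gt_eqF.
have Tn0 : T != 0 by rewrite gt_eqF.
have Sn0 : S != 0 by rewrite gt_eqF.
have nn0 : (n%:R : R) != 0 by rewrite gt_eqF//; clear -n1; lra.
have hn0 : h != 0 by rewrite gt_eqF.
split; first split.
- by rewrite nnE ler_pdivlMr// mul1r; clear -S1 qe; lra.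
- exact: B0.
- have : gam * h <= gam * 1 by rewrite ler_pM2l.
  clear -g0 gT gT1; lra.
- apply: mulr_ge0; first by rewrite !mulr_ge0 ?sqr_ge0// ltW.
  by apply: mulr_ge0; [rewrite mulr_ge0|rewrite divr_ge0// ltW].
- have -> : 32 * (32 * q ^+ 2 * h * L ^+ 2) * h * (X / (n%:R * h)) = 32 * 32 * u * (q * eps) * h / (n%:R * T).
    by rewrite /u; field; rewrite en0 Tn0 nn0 hn0.
  have nT : 1 <= n%:R * T by rewrite mulr_ege1.
  rewrite ler_pdivrMr; last by clear -nT; lra.
  rewrite mul1r; apply: le_trans nT.
  have a1 : u * (q * eps) <= u * 1 by rewrite ler_wpM2l.
  have a2 : u * (q * eps) * h <= u * (q * eps) * 1 by rewrite ler_wpM2l// mulr_ge0// ltW.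
  clear -a1 a2 ud dE; lra.
(* The choice B = T S makes the quadratic rate, times N and nn, a multiple of v/T, which is small
   compared with gam because gam T is bounded below. *)
- have -> : N%:R * (8 * (gam / 2) ^+ 2 * h + 2 * nn * (32 * q ^+ 2 * h * L ^+ 2 * (8 * Y * (W / B)))) =
     (N%:R * h) * (2 * gam ^+ 2 + 512 * (q * L ^+ 2 * Y * W / (T * eps))).
    by rewrite nnE BT; field; rewrite en0 Sn0 Tn0 qn0.
  rewrite Nh.
  have -> : 14 * T * (2 * gam ^+ 2 + 512 * (q * L ^+ 2 * Y * W / (T * eps))) = 28 * (gam * (gam * T)) + 14 * 512 * (v / T).
    by rewrite /v; field; rewrite en0 Tn0.
  have a1 : gam * (10 * (10 * (10 * (gam * T)))) <= gam * 1 by rewrite ler_pM2l.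
  have a2 : v / T <= gam * (10 * (10 * (10 * (10 * v)))).
    rewrite ler_pdivrMr//.
    have : v * 1 <= v * (10 * (10 * (10 * (10 * (gam * T))))) by rewrite ler_wpM2l.
    clear -T0; lra.
  have a3 : gam * (10 * (10 * (10 * (10 * v)))) <= gam * (10 * (10 * (10 * (10 * (22 * delta ^+ 2))))).
    by rewrite ler_pM2l//; clear -vd; lra.
  have a4 : gam * (10 * (10 * (10 * (10 * (22 * delta ^+ 2))))) = gam * (22 / 10 * delta).
    by congr (_ * _); clear -d2; lra.
  have a5 : gam * (22 / 10 * delta) * (10 * (10 * (10 * (10 * 10)))) = gam * (22 / 10).
    by rewrite -[RHS]dx; ring.
  clear -a1 a2 a3 a4 a5 g0; lra.
(* With nn = S/(q eps) the right-hand side is 4 S (1 - 1/q) >= 2 S. The four summands of S dominate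
   the cost of the change of law and of the dimension. *)
- have -> : N%:R * (2 * nn * (32 * q ^+ 2 * h * L ^+ 2 * (26 * X + 8 * Y * W)) + 4 * (gam / 2) * h * n%:R) =
     (N%:R * h) * (64 * S * (q * L ^+ 2 * (26 * X + 8 * Y * W)) / eps + 2 * gam * n%:R).
    by rewrite nnE; field; rewrite en0 qn0.
  rewrite Nh.
  have -> : 14 * T * (64 * S * (q * L ^+ 2 * (26 * X + 8 * Y * W)) / eps + 2 * gam * n%:R) =
     14 * 64 * (S * (26 * u + 8 * v)) + 28 * (gam * T * n%:R).
    by rewrite /u /v; field.
  have -> : 4 * nn * (q - 1) * eps = 4 * S * (1 - q^-1) by rewrite nnE; field; rewrite en0 qn0.
  have qi : q^-1 <= 2^-1 by rewrite lef_pV2 ?posrE.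
  have b1 : S * (26 * u + 8 * v) <= S * (27 * delta) by rewrite ler_pM2l//; clear -ud vd d2 d0; lra.
  have b2 : S * (27 * delta) * (10 * (10 * (10 * (10 * 10)))) = S * 27 by rewrite -[RHS]dx; ring.
  have b3 : 10 * (10 * (10 * (gam * T))) * n%:R <= 1 * n%:R by rewrite ler_wpM2r.
  have b4 : 10 * (10 * (10 * (gam * T))) * (m ^+ 2 / T) <= 1 * (m ^+ 2 / T) by rewrite ler_wpM2r.
  have b5 : gam * m ^+ 2 = gam * T * (m ^+ 2 / T) by field.
  have b6 : S * (1 - 2^-1) <= S * (1 - q^-1) by rewrite ler_pM2l//; clear -qi; lra.
  have e3 : S * (26 * u + 8 * v) * (10 * (10 * (10 * (10 * 10)))) <= S * 27 by clear -b1 b2; lra.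
  have e4 : 14 * 64 * (S * (26 * u + 8 * v)) <= S / 4.
    by clear -e3 S0; lra.
  have e5 : 28 * (gam * T * n%:R) <= n%:R / 10 by clear -b3 n1; lra.
  have e6 : 4 * gam * m ^+ 2 <= (m ^+ 2 / T) / 10 by rewrite -mulrA b5; clear -b4 mT; lra.
  have e7 : gam <= 10^-1 by clear -gT gT1 g0; lra.
  move: (m ^+ 2 / T) SE mT e6 => P SE P0 e6.
  have e8 : 4 * S * (1 - q^-1) = 4 * (S * (1 - q^-1)) by ring.
  rewrite e8; move: (S * (1 - q^-1)) b6 => Q b6.
  rewrite -/(4 * gam * m ^+ 2).
  move: (S * (26 * u + 8 * v)) (gam * T * n%:R) (4 * gam * m ^+ 2) e4 e5 e6 => z1 z2 z3 e4 e5 e6.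
  clear -e4 e5 e6 e7 b6 SE P0 S0 r1 n1; lra.
(* It suffices that 8^(1 + s) <= 64 and that L^2 h^(1 + s) <= delta, which lies below 192^-2. *)
- have e1 : (8 * Num.sqrt h) `^ (1 + s) = 8 `^ (1 + s) * h `^ ((1 + s) / 2).
    by rewrite powRM ?sqrtr_ge0// -(powR12_sqrt (ltW h0)) -powRrM; congr (_ * powR _ _); field.
  have e2 : (8 : R) `^ (1 + s) <= 64.
    apply: (@le_trans _ _ ((8 : R) `^ 2%:R)).
      by apply: ler_powR; clear -s0 s1; lra.
    by rewrite powR_mulrn// expr2; clear; lra.
  rewrite e1; set z := h `^ ((1 + s) / 2).
  have z0 : 0 <= z by exact: powR_ge0.
  have z2 : (L * z) ^+ 2 <= delta.
    rewrite exprMn -(powR_mulrn 2 z0) -powRrM.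
    have -> : (1 + s) / 2 * 2%:R = 1 + s by field.
    rewrite powRD ?(gt_eqF h0) ?implybT// powRr1 ?(ltW h0)//.
    rewrite mulrCA; apply: le_trans Lh; rewrite ler_piMl// mulr_ge0 ?sqr_ge0 ?powR_ge0//.
  have z1 : L * z <= 192^-1.
    rewrite -(ler_pXn2r (n := 2))// ?nnegrE ?mulr_ge0 ?(ltW L0)//.
    apply: (le_trans z2); rewrite expr2; clear -dE d0; lra.
  have : L * (8 `^ (1 + s) * z) <= 64 * (L * z).
    by rewrite mulrCA ler_wpM2r// mulr_ge0// ltW.
  clear -z1; lra.
Qed.

End rate_conditions.

(** * The initial density, the bound for a given step size, and the choice of constants *)

Lemma integral_density_in d (T : measurableType d) (R : realType)
    (mu nu : {measure set T -> \bar R}) (g : T -> R) (f : T -> \bar R) (A : set T) :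
  measurable_fun [set: T] g -> (forall x, 0 <= g x) ->
  (forall A, measurable A -> nu A = \int[mu]_(x in A) (g x)%:E)%E ->
  measurable_fun [set: T] f -> (forall x, 0 <= f x)%E -> measurable A ->
  (\int[nu]_(x in A) f x = \int[mu]_(x in A) (f x * (g x)%:E))%E.
Proof.
move=> mg g0 nuE mf f0 mA; rewrite integral_mkcond [RHS]integral_mkcond.
rewrite (integral_density mg g0 nuE).
- apply: eq_integral => x _; rewrite !patchE; case: ifP => // _; exact: mul0e.
- by apply/measurable_restrict => //; rewrite setTI; exact: measurable_funTS.
- by move=> x; rewrite patchE; case: ifP.
Qed.

Section initial_density.
Context d (T : measurableType d) (R : realType) (rho pi : probability T R).

Lemma renyi_lty_dominates (q : \bar R) : (renyi q rho pi < +oo)%E -> rho `<< pi.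
Proof.
by rewrite /renyi; case: ifP => [/asboolP//|_]; rewrite ltxx.
Qed.

Lemma moment_renyi_lty (f : T -> R) (p E : R) : measurable_fun [set: T] f ->
  (forall x, 0 <= f x) ->
  (forall A, measurable A -> (rho A = \int[pi]_(x in A) (f x)%:E)%E) ->
  1 < p -> (\int[pi]_x (f x)%:E `^ p <= E%:E)%E -> (renyi p%:E rho pi < +oo)%E.
Proof.
move=> mf f0 rhoE p1 H.
have mef : measurable_fun [set: T] (EFin \o f) by exact/measurable_EFinP.
have ef0 x : (0 <= (EFin \o f) x)%E by rewrite /= lee_fin.
rewrite (renyi_fin_density mef ef0 rhoE p1).
have := moment_ge1 mf f0 rhoE (ltW p1); move: H => /=.
case: (\int[pi]_x _)%E => [X| |]//= _; rewrite lee_fin => X1.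
by rewrite leNgt (lt_le_trans _ X1)//= ltry.
Qed.

(** One density serves for both orders. For q' = +oo it is truncated so that its bound holds at
    every point. *)
Lemma initial_density (p : R) (q' : \bar R) : 1 < p -> (p%:E < q')%E ->
  (renyi q' rho pi < +oo)%E ->
  exists g : T -> R, [/\ measurable_fun [set: T] g, forall x, 0 <= g x,
    forall A, measurable A -> (rho A = \int[pi]_(x in A) (g x)%:E)%E,
    0 <= fine (renyi q' rho pi) /\ (renyi p%:E rho pi < +oo)%E &
    match q' with
    | +oo%E => forall x, g x <= expR (fine (renyi q' rho pi))
    | P%:E => p < P /\
      (\int[pi]_x (g x)%:E `^ P = (expR ((P - 1) * fine (renyi q' rho pi)))%:E)%E
    | -oo%E => False
    end].
Proof.
move=> p1 pq rq; have [f [mf f0 rhoE]] := exists_density (renyi_lty_dominates rq).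
have mef : measurable_fun [set: T] (EFin \o f) by exact/measurable_EFinP.
have ef0 x : (0 <= (EFin \o f) x)%E by rewrite /= lee_fin.
case: q' pq rq => [P| |]// pq rq.
  rewrite lte_fin in pq; have P1 : 1 < P by rewrite (lt_trans p1).
  have [fP RP] := renyi_moment mf f0 rhoE P1 rq.
  exists f; split => //; split => //.
  have fPle : (\int[pi]_x (f x)%:E `^ P <= (expR ((P - 1) * fine (renyi P%:E rho pi)))%:E)%E by rewrite fP.
  exact: (moment_renyi_lty mf f0 rhoE p1 (moment_le mf f0 rhoE p1 pq fPle)).
set r := fine _.
have fr := renyi_pinfty_density mef ef0 rhoE rq; rewrite -/r in fr.
have [g [mg g01 gE]] := truncated_density mf f0 rhoE fr (expR_ge0 r).
have g0 x : 0 <= g x by case/andP: (g01 x).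
have g1 x : g x <= expR r by case/andP: (g01 x).
have cst1 (c : R) : (\int[pi]_x c%:E = c%:E)%E.
  by rewrite -[RHS]mule1 -(@probability_setT _ _ _ pi) -integral_cst.
exists g; split => //; split.
  have : (\int[pi]_x (g x)%:E <= \int[pi]_x (expR r)%:E)%E.
    by apply: le_integral_nneg; [exact/measurable_EFinP|exact: measurable_cst|
      move=> x; rewrite lee_fin|move=> x; rewrite lee_fin].
  by rewrite -gE// probability_setT cst1 lee_fin -{1}expR0 ler_expR.
apply: (moment_renyi_lty mg g0 gE p1 (E := expR r `^ p)).
rewrite -cst1; apply: le_integral_nneg => //.
- by apply: measurable_poweR_fun; exact/measurable_EFinP.
- by move=> x; exact: poweR_ge0.
- move=> x; rewrite poweR_EFin lee_fin; apply: ge0_ler_powR; rewrite ?nnegrE ?expR_ge0//.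
  by rewrite ltW// (lt_trans ltr01).
Qed.

End initial_density.

(** The constant 6144 enters only through 10^3 <= 6144 <= 10^4, which places gam T between powers of
    ten. *)
Lemma tilt_cst (R : realType) (T : R) : 1 <= T -> exists gam : R,
  [/\ (6144 * T)^-1 = gam, 0 < gam,
    10 * (10 * (10 * (gam * T))) <= 1 & 1 <= 10 * (10 * (10 * (10 * (gam * T))))].
Proof.
move=> T1; have T0 : 0 < T by rewrite (lt_le_trans ltr01).
have [c [cE c0 c1 c2]] : exists c : R, [/\ 6144 = c, 0 < c, 10 * (10 * 10) <= c & c <= 10 * (10 * (10 * 10))].
  by exists 6144; rewrite ltr0n -!natrM !ler_nat; split.
rewrite cE; exists (c * T)^-1; split => //; first by rewrite invr_gt0 mulr_gt0.
  by rewrite invfM -[_ / T * T]mulrA mulVf ?gt_eqF// mulr1 !mulrA ler_pdivrMr// mul1r -!mulrA.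
by rewrite invfM -[_ / T * T]mulrA mulVf ?gt_eqF// mulr1 !mulrA ler_pdivlMr// mul1r -!mulrA.
Qed.

Section lmc_convergence.
Context (R : realType) (n : nat).
Local Notation rV := 'rV[R]_n.
Local Notation lam := (lebesgue_rV R n).
Variables (V : rV -> R) (pi : probability rV R) (beta : R -> R) (L s q : R) (q' : \bar R)
  (mu0 : probability rV R) (eps : R) (pihat : probability rV R) (h delta : R) (N : nat).
Let m := half_median_radius pi.
Let T := mixing_time beta q q' eps mu0 pi.
Let r2 := fine (renyi 2%:E mu0 pihat).

Lemma lmc_renyi_le : 0 < s -> s <= 1 -> (0 < n)%N -> gibbs V pi ->
  weak_poincare pi beta (fun f => (osc f ^+ 2)%E) ->
  (forall x, differentiable V x) -> holder_grad V L s -> grad V 0 = 0 ->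
  2 <= q -> ((2 * q - 1)%:E < q')%E -> (renyi q' mu0 pi < +oo)%E ->
  0 < eps -> eps <= q^-1 -> gibbs (tilted_potential V m T) pihat ->
  1 <= m -> 1 <= L -> 1 <= T -> 1 <= r2 -> (renyi 2%:E mu0 pihat < +oo)%E ->
  0 < h -> h <= 1 -> N%:R * h = 14 * T -> (14 <= N)%N ->
  0 < delta -> 10 * (10 * (10 * (10 * (10 * delta)))) = 1 ->
  q * L ^+ 2 * T * (n%:R * h) `^ s <= delta * eps ->
  q * L ^+ 2 * T * (h * L) `^ (2 * s) * (T + m ^+ 2 + T * n%:R + T * r2) `^ (s ^+ 2) <=
    22 * delta ^+ 2 * eps ->
  forall (disp : measure_display) (Omega : measurableType disp)
    (P : probability Omega R) (x xi : nat -> {RV P >-> rV}),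
  LMC V h mu0 x xi -> (renyi q%:E (distribution P (x N)) pi <= eps%:E)%E.
Proof.
have aux (k : R) : 14 <= k -> 12 / 14 * k + 2 <= k by move=> ?; lra.
move=> s0 s1 n0 [Z Z0 piE] Hpi dV hV V0 q2 qq' rq' eps0 epsq [Zh Zh0 pihE] m1 L1 T1 r21 r2fin
  h0 h1 NhT N14 d0 dE C1 C2 disp Omega P x xi lmc.
pose w := gibbsdens V Z.
have mw : measurable_fun [set: rV] w := measurable_gibbsdens Z dV.
have w0 : forall x, 0 <= w x := gibbsdens_ge0 V Z0.
have w1 : (\int[lam]_x (w x)%:E = 1)%E by rewrite -piE// probability_setT.
have wh1 : (\int[lam]_x (gibbsdens (tilted_potential V m T) Zh x)%:E = 1)%E.
  by rewrite -pihE// probability_setT.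
have L0 : 0 < L by rewrite (lt_le_trans ltr01).
have q1 : 1 < q by lra.
have p1 : 1 < 2 * q - 1 by lra.
have e2 : eps <= 2^-1 by apply: (le_trans epsq); rewrite lef_pV2 ?posrE//; lra.
have [g0 [mg0 g00 g0E [Rinf0 rp] g0q']] := initial_density p1 qq' rq'.
have [g0p R00] := renyi_moment mg0 g00 g0E p1 rp.
have toLam (u : rV -> \bar R) : nnmf u -> (\int[pi]_x u x = \int[lam]_x (u x * (w x)%:E))%E.
  by move=> [mu u0]; exact: integral_density.
have hg0 : nnmf (EFin \o g0) by split => [|y]; [exact/measurable_EFinP|rewrite /= lee_fin].
have mu0E A : measurable A -> mu0 A = (\int[lam]_(y in A) (g0 y * w y)%:E)%E.
  move=> mA; rewrite g0E// (integral_density_in mw w0 piE hg0.1 hg0.2 mA).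
  by apply: eq_integral => y _; rewrite EFinM.
have g01 : (\int[lam]_x (g0 x * w x)%:E = 1)%E by rewrite -mu0E// probability_setT.
have [gam [gamE gam0 gT1 gT2]] := tilt_cst T1.
have [[nn1 B0 alh quad0] small1 small2 small3 small4] :=
  rate_conditions s0 s1 q2 eps0 epsq L1 T1 r21 n0 h0 h1 NhT d0 dE gT1 gT2 C1 C2.
move: nn1 B0 alh quad0 small1 small2 small3.
set S := 1 + m ^+ 2 / T + n%:R + r2; set nn := S / (q * eps); set B := T * S.
move=> nn1 B0 alh quad0 small1 small2 small3.
have bge := wpi_weight_ge dV hV L0 s0 s1 h0 Z0 n0 piE Hpi small4.
(* From N h = 14 T: the proximal sampler needs 12 T/h + 2 steps, and 2 <= 2 N/14 because N >= 14. *)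
have HN : 12 / h * T + 2 <= N%:R.
  have -> : T = N%:R * h / 14 by rewrite NhT mulrC mulrA mulVf ?mul1r.
  have -> : 12 / h * (N%:R * h / 14) = 12 / 14 * N%:R by field; rewrite gt_eqF.
  have : (14 : R) <= N%:R by rewrite (ler_nat R 14 N).
  exact: aux.
have [E EE Ele] : exists2 E : R,
    (\int[lam]_x (iter N (prox h w) (EFin \o g0) x `^ (2 * q - 1) * (w x)%:E) = E%:E)%E &
    E <= expR ((2 * q - 1 - 1) * (eps / 2)).
  apply: (prox_decay (q' := q') h0 mw w0 w1 piE Hpi q2 eps0 e2 Rinf0 R00 mg0 g00 g01) => //.
  - by rewrite -g0p toLam//; exact: (nnmf_poweR _ hg0).
  - move: (fine (renyi q' mu0 pi)) g0q' => Rinf; case: q' => [Q| |]// [pQ g0Q]; split => //.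
    by rewrite -g0Q toLam//; exact: (nnmf_poweR _ hg0).
  - apply: le_trans HN; rewrite lerD2r le_eqVlt; apply/orP; left; apply/eqP.
    rewrite /T /mixing_time; congr (_ * (_ * (rate _ _ _ _ * _ + rate _ _ _ _ * _))).
    + by rewrite invfM mulrA mul1r.
    + by rewrite invfM mulrA.
have mS := measurable_backk h0 mw w0 w1.
have S0 := backk_ge0 h0 mw w0 w1.
have b0 := heatdens_ge0 h0 mw w0 w1.
have mb := measurable_heatdens h mw w0.
have QS := heatk_backk h0 mw w0 w1.
have S1 := integral_backk h0 mw w0 w1.
pose ec (y : rV) := expR (rate_cst n L s h q B + rate_quad L s h q B * dotv y y).
have mec : measurable_fun [set: rV] ec.
  apply: measurableT_comp => //; apply: measurable_funD => //; apply: measurable_funM => //.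
  by apply: measurable_dotv; exact: measurable_id.
have rb := rate_bound dV hV V0 L0 s0 s1 h0 Z0 n0 (ltW q1) B0 w1 small1.
have r0 a b c : 0 <= lmc_ratio V h Z a b c := ltW (lmc_ratio_gt0 dV h0 Z0 w1 a b c).
have mr := measurable_lmc_ratio dV hV L0 s0 h0 Z0 w1.
have cmp := compare_chains (@measurable_heatk R n h) mS mw (@heatk_ge0 R n h) S0 w0 b0 QS
  (@integral_heatk R n h h0) S1 N mr r0 mg0 g00 mec q1 nn1 rb g01.
have mprox : (\int[lam]_x (iter N (fun u => kop lam (@heatk R n h) (kop lam (backk h w) u))
    (fun x => (g0 x)%:E) x `^ (2 * q - 1) * (w x)%:E) = E%:E)%E := EE.
rewrite mprox in cmp.
set u := iter N (feynman_kac _ _ _ _ _) _ in cmp.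
have hu : nnmf u.
  by rewrite /u; apply: nnmf_iter_fk => //; [exact: measurable_heatk|exact: heatk_ge0].
have g2 : 0 <= gam / 2 by rewrite divr_ge0// ltW.
have FK := feynman_kac_sqr_bound h0 g2 alh (rate_cst n L s h q B) mS mw mb S0 w0 b0 QS S1 w1 nn1 quad0 small2.
rewrite -/ec -/u in FK.
have IM := integral_mu0_le dV Z0 Zh0 gam0 m1 piE wh1 gamE pihE mg0 g00 g0E r2fin hu.
set D1 := N%:R * _ in FK small3.
rewrite -/m -/r2 in IM.
set D2 := 1 + gam + 4 * gam * m ^+ 2 + r2 in IM small3.
have IM2 : (\int[lam]_x (u x * (g0 x * w x)%:E) <= (expR (2^-1 * (D1 + D2)))%:E)%E.
  apply: (le_trans IM); clear IM cmp.
  have -> : expR (2^-1 * (D1 + D2)) = expR (2^-1 * D1) * expR (2^-1 * D2) by rewrite -expRD -mulrDr.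
  rewrite [leRHS]EFinM; apply: lee_wpmul2r.
    by rewrite lee_fin expR_ge0.
  have -> : (expR (2^-1 * D1))%:E = ((expR D1)%:E `^ 2^-1)%E :> \bar R.
    by rewrite poweR_EFin -expRM mulrC.
  apply: lee_poweR => //.
  by apply: integral_ge0 => y _; rewrite mule_ge0 ?poweR_ge0// lee_fin mulr_ge0 ?expR_ge0.
have nn0 : 0 < nn by rewrite (lt_le_trans ltr01).
have hf := nnmf_iter_lop dV hV L0 s0 h0 Z0 w1 mg0 g00 N.
set f := iter N (top _ _ _ _) _ in hf cmp.
(* The Feynman-Kac factor and the proximal factor each contribute at most (q - 1) eps / 2 to the
   exponent. *)
have fq : (\int[lam]_x (f x `^ q * (w x)%:E) <= (expR ((q - 1) * eps))%:E)%E.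
  apply: (le_trans cmp).
  apply: (@le_trans _ _ ((expR (2^-1 * (D1 + D2)))%:E `^ (4 * nn)^-1 *
      (expR ((2 * q - 1 - 1) * (eps / 2)))%:E `^ 2^-1)%E).
    apply: lee_pmul; rewrite ?poweR_ge0//.
      apply: lee_poweR IM2; first by rewrite invr_ge0 mulr_ge0// ltW.
      by apply: integral_ge0 => y _; rewrite mule_ge0 ?hu.2// lee_fin mulr_ge0.
    apply: lee_poweR; rewrite ?lee_fin//.
    rewrite -lee_fin -mprox; apply: integral_ge0 => y _.
    by rewrite mule_ge0 ?poweR_ge0 ?lee_fin.
  rewrite !poweR_EFin -EFinM lee_fin -!expRM -expRD ler_expR.
  have -> : 2^-1 * (D1 + D2) / (4 * nn) = (D1 + D2) / (8 * nn).
    by field; rewrite gt_eqF.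
  have : (D1 + D2) / (8 * nn) <= (q - 1) * eps / 2.
    have n8 : 0 < 8 * nn by rewrite pmulr_rgt0.
    rewrite ler_pdivrMr//; apply: le_trans small3 _.
    have -> : (q - 1) * eps / 2 * (8 * nn) = 4 * nn * (q - 1) * eps by field.
    exact: lexx.
  have -> : (2 * q - 1 - 1) * (eps / 2) * 2^-1 = (q - 1) * eps / 2 by field.
  by move: ((D1 + D2) / _) => z hz; rewrite [leRHS]splitr lerD2r.
have mf := hf.1; have f0 := hf.2.
have fE A : measurable A -> distribution P (x N) A = (\int[pi]_(y in A) f y)%E.
  move=> mA; rewrite (integral_density_in mw w0 piE mf f0 mA).
  exact: (lmc_law dV hV L0 s0 h0 Z0 w1 mg0 g00 mu0E N lmc mA).
rewrite (renyi_fin_density mf f0 fE q1) (toLam _ (nnmf_poweR q hf)).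
have -> : eps%:E = (((q - 1)^-1)%:E * ((q - 1) * eps)%:E)%E.
  by rewrite -EFinM mulKf// gt_eqF// subr_gt0.
apply: lee_wpmul2l; first by rewrite lee_fin invr_ge0 subr_ge0 ltW.
rewrite -[leRHS]expeRK lee_lne//.
- by rewrite in_itv/= leey integral_ge0// => y _; rewrite mule_ge0 ?poweR_ge0 ?lee_fin.
- by rewrite in_itv/= leey lee_fin expR_ge0.
Qed.

End lmc_convergence.

(** Rounding C A up to an integer costs at most a factor 2, and h is then fixed by the total
    time. *)
Lemma step_count (R : realType) (A C T : R) : 1 <= A -> 1 <= C -> 1 <= T ->
  exists (N : nat) (h : R), [/\ (0 < N)%N, C * A <= N%:R, N%:R <= 2 * C * A, N%:R * h = T & 0 < h].
Proof.
move=> A1 C1 T1; have CA : 1 <= C * A by exact: mulr_ege1.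
have CA0 : 0 <= C * A by exact: le_trans CA.
have /andP[tl tg] := truncn_itv CA0.
set N := (Num.truncn (C * A)).+1 in tg; have N0 : 0 < N%:R :> R by rewrite ltr0n.
exists N, (T / N%:R); split => //.
- exact: ltW.
- by rewrite /N -natr1; lra.
- by rewrite mulrC divfK// gt_eqF.
- by rewrite divr_gt0//; lra.
Qed.

Theorem theorem4 (R : realType) (s : R) (s_gt0 : 0 < s) (s_le1 : s <= 1) :
  exists c C : R, [/\ 0 < c, c <= C &
    forall (d : nat) (V : 'rV[R]_d -> R) (pi : probability 'rV[R]_d R)
      (betaWPI : R -> R) (L q : R) (q' : \bar R)
      (mu0 : probability 'rV[R]_d R) (eps : R)
      (pihat : probability 'rV[R]_d R),
    (0 < d)%N ->
    gibbs V pi ->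
    weak_poincare pi betaWPI (fun f => (osc f ^+ 2)%E) ->
    (forall x, differentiable V x) ->
    holder_grad V L s ->
    grad V 0 = 0 ->
    smooth_core V pi ->
    2 <= q ->
    ((2 * q - 1)%:E < q')%E ->
    mu0 `<< lebesgue_rV R d ->
    (renyi q' mu0 pi < +oo)%E ->
    0 < eps -> eps <= q^-1 ->
    let m := half_median_radius pi in
    let T := mixing_time betaWPI q q' eps mu0 pi in
    gibbs (tilted_potential V m T) pihat ->
    1 <= eps^-1 -> 1 <= m -> 1 <= L -> 1 <= T ->
    (1 <= renyi 2%:E mu0 pihat)%E -> (renyi 2%:E mu0 pihat < +oo)%E ->
    let A := iteration_bound d s q L m T eps (fine (renyi 2%:E mu0 pihat)) in
    exists (h : R) (N : nat),
      [/\ 0 < h, c * A <= N%:R, N%:R <= C * A &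
        forall (disp : measure_display) (Omega : measurableType disp)
          (P : probability Omega R) (x xi : nat -> {RV P >-> 'rV[R]_d}),
        LMC V h mu0 x xi ->
        (renyi q%:E (distribution P (x N)) pi <= eps%:E)%E]].

Proof.
(* The smallness constant for which [rate_conditions] closes; it is the same for all s. *)
pose delta : R := 10^-1 ^+ 5.
have d0 : 0 < delta by rewrite exprn_gt0// invr_gt0.
have dE : 10 * (10 * (10 * (10 * (10 * delta)))) = 1.
  by rewrite /delta; field.
have d1 : delta <= 1 by lra.
clearbody delta.
(* The step size condition reads h A <= e T. With the total time N h = 14 T it asks for N >= (14/e)
   A, hence the constant [C]; the interval up to 2 C A leaves room for rounding. *)
pose e := delta `^ (1 / s).
have e0 : 0 < e by rewrite powR_gt0.
have e1 : e <= 1.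
  apply: (@le_trans _ _ (1 `^ (1 / s))); last by rewrite powR1.
  by apply: ge0_ler_powR; rewrite ?nnegrE ?(ltW d0)// divr_ge0// ltW.
pose C := 14 / e.
have C14 : 14 <= C by rewrite ler_pdivlMr// ler_piMr.
have C0 : 0 < C by lra.
exists C, (2 * C); split => //; first by lra.
move=> n V pi beta L q q' mu0 eps pihat n0 Hgibbs Hpi dV hV V0 _ q2 qq' _ rq' eps0 epsq m T
  Hgibbs' _ m1 L1 T1 r21 r2fin A.
have r2r : 1 <= fine (renyi 2%:E mu0 pihat).
  by move: r21 r2fin; case: (renyi _ _ _) => [r| |].
have T14 : 1 <= 14 * T by lra.
have cond h := @step_size_conditions R n s q L m T eps _ h delta s_gt0 s_le1 q2 eps0 epsq m1 L1 T1 r2r n0 d0.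
(* T <= A follows from any admissible step size. As A > 0 is not yet known, dividing by max(A, 1)
   provides one. *)
have AT : T <= A.
  have M0 : 0 < Num.max A 1 by rewrite lt_max ltr01 orbT.
  have Mn : Num.max A 1 != 0 by rewrite gt_eqF.
  have hM : 0 < e * T / Num.max A 1 by rewrite divr_gt0// mulr_gt0//; lra.
  have [] // := cond _ hM.
  rewrite -[leRHS](divfK Mn).
  by apply: ler_wpM2l; [exact: ltW|rewrite le_max lexx].
have A1 : 1 <= A := le_trans T1 AT.
have C1 : 1 <= C by lra.
have [N [h [N0 CN NC NhT h0]]] := step_count A1 C1 T14.
exists h, N; split => //.
have hA : h * A <= e * T.
  have : h * (C * A) <= h * N%:R by rewrite ler_pM2l.
  rewrite [h * N%:R]mulrC NhT => H.
  have -> : e * T = 14 * T / C by rewrite /C; field; rewrite gt_eqF.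
  by rewrite ler_pdivlMr// mulrAC -mulrA.
have [_ c1 c2] := cond h h0 hA.
have NR : 14 <= N%:R :> R by apply: le_trans CN; nra.
have N14 : (14 <= N)%N by rewrite -(ler_nat R).
have h1 : h <= 1.
  have TN : 14 * T <= N%:R by apply: le_trans CN; apply: ler_pM => //; lra.
  by rewrite -(ler_pM2l (_ : 0 < N%:R :> R)) ?ltr0n// NhT mulr1.
move=> disp Omega P x xi lmc.
exact: (lmc_renyi_le s_gt0 s_le1 n0 Hgibbs Hpi dV hV V0 q2 qq' rq' eps0 epsq Hgibbs' m1 L1 T1 r2r r2fin
  h0 h1 NhT N14 d0 dE c1 c2 lmc).
Qed.
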